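(* Fix a Hilbert space $H$. If $P$ is a property of C*-algebras such that both $P$ and its negation are axiomatizable, then the C*-subalgebras of $B(H)$ satisfying $P$ form a $d_{KK}$-clopen set (in the space of all C*-subalgebras of $B(H)$). In particular, the algebras satisfying each of the following form a $d_{KK}$-clopen set: (1) abelian C*-algebras; (2) $n$-subhomogeneous C*-algebras, for any given $n$; (3) unital, projectionless C*-algebras; (4) algebras containing a unital copy of $M_n(\mathbb C)$, for any given $n$; (5) simple, purely infinite C*-algebras; (6) finite C*-algebras; (7) C*-algebras with real rank zero; (8) C*-algebras with stable rank one.
   Context: The Kadison--Kastler distance between C*-subalgebras $A,B$ of $B(H)$ is the Hausdorff distance between their unit balls $A_1$, $B_1$: $d_{KK}(A,B)=\max\bigl(\sup_{x\in A_1}\inf_{y\in B_1}\|x-y\|,\ \sup_{y\in B_1}\inf_{x\in A_1}\|x-y\|\bigr)$. Continuous logic for C*-algebras. A C*-algebra $A$ is viewed as a metric structure whose sorts are the balls $B_n(A)=\{a:\|a\|\le n\}$, $n\in\mathbb N$, with metric $\|x-y\|$, and whose functions are the restrictions to these balls of $+,\cdot,{}^*$, scalar multiplication by each $\lambda\in\mathbb C$, the constant $0$ (and $1$ in the unital case) and the inclusions $B_m\to B_n$. Terms are *-polynomials, atomic formulas are distances between terms, and formulas are obtained from atomic ones by applying continuous functions $f:\mathbb R^n\to\mathbb R$ and the quantifiers $\sup_x,\inf_x$ over a sort. A property (class) of C*-algebras is axiomatizable if there is a set $T$ of sentences (formulas without free variables) such that $A$ has the property iff $\varphi^A=0$ for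 all $\varphi\in T$, where $\varphi^A$ is the value of $\varphi$ in $A$. Definitions. $A$ is $n$-subhomogeneous if each of its irreducible representations has dimension at most $n$. Unital projectionless: unital with no projections other than $0,1$. Containing a unital copy of $M_n(\mathbb C)$: $A$ is unital and has a subalgebra isomorphic to $M_n(\mathbb C)$ containing $1_A$. Purely infinite and simple: $\dim A>1$ and for all nonzero positive $a,b$ there are $x_n$ with $\|x_nax_n^*-b\|\to0$. Infinite: has nonzero orthogonal projections $p,q$ with $p+q$ Murray--von Neumann equivalent to $p$; finite: not infinite. Real rank zero: invertible self-adjoint elements are dense among self-adjoint elements; stable rank one: invertible elements are dense (in the unitization, if $A$ is not unital). *)

(* Defs.v *)
From HB Require Import structures.
From mathcomp Require Import all_boot all_order all_algebra.
From mathcomp Require Import boolp classical_sets functions.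
From mathcomp Require Import reals topology normedtype sequences.
From mathcomp Require Import ring lra.
From mathcomp Require Import complex.
Set Implicit Arguments. 
Unset Strict Implicit. 
Unset Printing Implicit Defensive.
Import Order.TTheory GRing.Theory Num.Theory.
Import numFieldNormedType.Exports.
Local Open Scope classical_set_scope.
Local Open Scope ring_scope.

(* The norm of a complex normed space takes its values in the nonnegative
   elements of R[i]; rnorm is the same norm with values in R. *)
Section RealNorm.
Variables (R : realType) (V : normedModType R[i]).
Implicit Types x y : V.

Definition rnorm x : R := complex.Re `|x|.

Lemma normE x : `|x| = (rnorm x)%:C%C.
Proof. by rewrite /rnorm RRe_real // ger0_real. Qed.

Lemma rnorm_ge0 x : 0 <= rnorm x.
Proof. by rewrite -ler0c -normE. Qed.

Lemma rnormD x y : rnorm (x + y) <= rnorm x + rnorm y.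
Proof. by rewrite -lecR rmorphD /= -!normE ler_normD. Qed.

Lemma rnormN x : rnorm (- x) = rnorm x.
Proof. by rewrite /rnorm normrN. Qed.

Lemma rnorm0 : rnorm 0 = 0.
Proof. by rewrite /rnorm normr0. Qed.

Lemma rnorm0_eq0 x : rnorm x = 0 -> x = 0.
Proof. by move=> x0; apply/eqP; rewrite -normr_eq0 normE x0. Qed.

Lemma rdistC x y : rnorm (x - y) = rnorm (y - x).
Proof. by rewrite -rnormN opprB. Qed.

Lemma rdistD y x z : rnorm (x - z) <= rnorm (x - y) + rnorm (y - z).
Proof. by rewrite -[x in X in X <= _](subrK y) -addrA rnormD. Qed.

Lemma normr_leE x (e : R) : (`|x| <= e%:C%C) = (rnorm x <= e).
Proof. by rewrite normE lecR. Qed.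

Lemma normr_ltE x (e : R) : (`|x| < e%:C%C) = (rnorm x < e).
Proof. by rewrite normE ltcR. Qed.

End RealNorm.

Section RealNormScalar.
Variables (R : realType).

Lemma rnormZ (V : normedModType R[i]) (a : R[i]) (x : V) :
  rnorm (a *: x) = complex.Re `|a| * rnorm x.
Proof.
by apply: complexI; rewrite rmorphM /= -!normE normrZ.
Qed.

Lemma rnormZr (V : normedModType R[i]) (a : R) (x : V) :
  rnorm (a%:C%C *: x) = `|a| * rnorm x.
Proof. by rewrite rnormZ normc_def /= expr0n /= addr0 sqrtr_sqr. Qed.

Lemma gt0c (e : R[i]) : 0 < e -> exists2 d : R, 0 < d & e = d%:C%C.
Proof.
move=> e0; exists (complex.Re e); last by rewrite RRe_real // gtr0_real.
by move: e0; rewrite ltcE /= => /andP[_].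
Qed.

Lemma cvg_rnormP T (F : set_system T) (FF : Filter F) (V : normedModType R[i])
    (f : T -> V) (l : V) :
  f @ F --> l <-> forall e : R, 0 < e -> \forall t \near F, rnorm (l - f t) <= e.
Proof.
split=> [/cvgrPdist_le fl e e0|fl].
  by near do rewrite -normr_leE; apply: fl; rewrite ltcR.
by apply/cvgrPdist_le => _ /gt0c[e e0 ->]; near do rewrite normr_leE; exact: fl.
Unshelve. all: by end_near. Qed.

Lemma ball_rnorm (V : normedModType R[i]) (x y : V) (e : R) :
  ball x e%:C%C y <-> rnorm (x - y) < e.
Proof. by rewrite -ball_normE /= normr_ltE. Qed.

Lemma cauchy_rnormP (V : normedModType R[i]) (F : set_system V) (FF : Filter F) :
  cauchy F <-> forall e : R, 0 < e -> \forall x & y \near F, rnorm (x - y) < e.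
Proof.
rewrite -cauchy_ballP; split=> [FC e e0|FC _ /gt0c[e e0 ->]].
  have e0' : 0 < e%:C%C by rewrite ltcR.
  by apply: filterS (FC _ e0') => -[x y] /= /ball_rnorm.
by apply: filterS (FC _ e0) => -[x y] /= /ball_rnorm.
Qed.

End RealNormScalar.

HB.mixin Record isHilbert (R : realType) H & CompleteNormedModule R[i] H := {
  inner : H -> H -> R[i];
  innerDl : forall x x' y, inner (x + x') y = inner x y + inner x' y;
  innerZl : forall (a : R[i]) x y, inner (a *: x) y = a * inner x y;
  inner_conj : forall x y, inner y x = ((inner x y)^*)%C;
  inner_norm : forall x, inner x x = `|x| ^+ 2
}.

#[short(type="hilbertType")]
HB.structure Definition Hilbert (R : realType) :=
  {H of CompleteNormedModule R[i] H & isHilbert R H}.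

Section HilbertTheory.
Variables (R : realType) (H : hilbertType R).
Implicit Types x y z : H.

Lemma innerDr x y y' : inner x (y + y') = inner x y + inner x y'.
Proof. by rewrite inner_conj innerDl rmorphD /= -!inner_conj. Qed.

Lemma innerZr (a : R[i]) x y : inner x (a *: y) = (a^*)%C * inner x y.
Proof. by rewrite inner_conj innerZl rmorphM /= -!inner_conj. Qed.

Definition rinner x y : R := complex.Re (inner x y).

Let ReD (a b : R[i]) : complex.Re (a + b) = complex.Re a + complex.Re b.
Proof. by case: a b => [? ?] [? ?]. Qed.

Lemma rinnerDl x x' y : rinner (x + x') y = rinner x y + rinner x' y.
Proof. by rewrite /rinner innerDl ReD. Qed.

Lemma rinnerC x y : rinner x y = rinner y x.
Proof. by rewrite /rinner inner_conj; case: inner. Qed.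

Lemma rinnerDr x y y' : rinner x (y + y') = rinner x y + rinner x y'.
Proof. by rewrite /rinner innerDr ReD. Qed.

Lemma rinnerZl (a : R) x y : rinner (a%:C%C *: x) y = a * rinner x y.
Proof. by rewrite /rinner innerZl; case: inner => b c /=; rewrite mul0r subr0. Qed.

Lemma rinnerZr (a : R) x y : rinner x (a%:C%C *: y) = a * rinner x y.
Proof. by rewrite rinnerC rinnerZl rinnerC. Qed.

Lemma rinnerNl x y : rinner (- x) y = - rinner x y.
Proof.
by apply/eqP; rewrite -addr_eq0 -rinnerDl addNr /rinner -(scale0r 0) innerZl mul0r.
Qed.

Lemma rinnerNr x y : rinner x (- y) = - rinner x y.
Proof. by rewrite rinnerC rinnerNl rinnerC. Qed.

Lemma rinnerE x : rinner x x = rnorm x ^+ 2.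
Proof. by rewrite /rinner inner_norm normE -rmorphXn. Qed.

Lemma inner_def x y : (forall z, rinner z x = rinner z y) -> x = y.
Proof.
move=> xy; apply/eqP; rewrite -subr_eq0; apply/eqP/rnorm0_eq0/eqP.
by rewrite -sqrf_eq0 -rinnerE rinnerDr rinnerNr xy subrr.
Qed.

Lemma rnormD_sqr x y :
  rnorm (x + y) ^+ 2 = rnorm x ^+ 2 + 2 * rinner x y + rnorm y ^+ 2.
Proof.
by rewrite -!rinnerE rinnerDl !rinnerDr (rinnerC y x); ring.
Qed.

Lemma rinner_le x y : rinner x y <= rnorm x * rnorm y.
Proof.
have := rnormD x y; rewrite -(ler_pXn2r (n := 2)) ?nnegrE ?addr_ge0 ?rnorm_ge0 //.
by rewrite rnormD_sqr sqrrD lerD2r lerD2l -[leRHS]mulr_natl ler_pM2l.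
Qed.

Lemma ler_norm_rinner x y : `|rinner x y| <= rnorm x * rnorm y.
Proof.
by rewrite ler_norml rinner_le andbT lerNl -rinnerNl -(rnormN x) rinner_le.
Qed.

Lemma real_riesz (phi : H -> R) (M : R) :
  (forall x y, phi (x + y) = phi x + phi y) ->
  (forall (a : R) x, phi (a%:C%C *: x) = a * phi x) ->
  (forall x, `|phi x| <= M * rnorm x) ->
  exists z, forall x, phi x = rinner x z.
Proof.
move=> phiD phiZ phiM.
pose J x := rnorm x ^+ 2 - 2 * phi x.
pose d := inf (range J).
have Jlb : has_lbound (range J).
  exists (- M ^+ 2) => _ [x _ <-]; rewrite /J.
  have := phiM x; rewrite ler_norml => /andP[_ ?].
  by have := sqr_ge0 (rnorm x - M); nra.
have Jd x : d <= J x by apply: ge_inf => //; exists x.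
have Jinf e : 0 < e -> exists x, J x < d + e.
  move=> e0; have [|_ [x _ <-] xd] := @inf_adherent _ (range J) e e0.
    by split => //; exists (J 0), 0.
  by exists x.
have par x y : rnorm (x - y) ^+ 2 <= 2 * (J x - d) + 2 * (J y - d).
  have := Jd ((2^-1)%:C%C *: (x + y)).
  rewrite /J rnormZr exprMn !phiZ phiD.
  rewrite !rnormD_sqr rinnerNr rnormN ger0_norm ?invr_ge0 ?ler0n //.
  by rewrite expr2; lra.
pose F := filter_from [set e : R | 0 < e] (fun e => [set x | J x < d + e]).
have FF : ProperFilter F.
  apply: filter_from_proper; last by move=> e /Jinf.
  apply: filter_from_filter; first by exists 1 => /=.
  move=> e f /= e0 f0; exists (Order.min e f) => /=; first by rewrite lt_min e0.
  by move=> u /= uef; split; apply: lt_le_trans uef _; rewrite lerD2l ge_min lexx ?orbT.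
have FJ e : 0 < e -> F [set x | J x < d + e] by move=> e0; exists e.
have : cauchy F.
  apply/cauchy_rnormP => e e0.
  have e4 : 0 < e ^+ 2 / 4 by rewrite divr_gt0 ?exprn_gt0.
  exists ([set x | J x < d + e ^+ 2 / 4], [set x | J x < d + e ^+ 2 / 4]).
    by split; exact: FJ.
  move=> [u v] /= [ue ve].
  rewrite -(ltr_pXn2r (n := 2)) ?nnegrE ?rnorm_ge0 ?ltW //.
  by apply: le_lt_trans (par _ _) _; lra.
move=> /cauchy_cvg /cvg_ex[z Fz]; exists z => w; rewrite rinnerC.
have Fz' : id @ F --> z by [].
have main t : 0 <= 2 * t * (rinner z w - phi w) + t ^+ 2 * rnorm w ^+ 2.
  apply/ler_addgt0Pl => e e0.
  have b0 : 0 < 2 * `|t| * rnorm w + 1.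
    by rewrite ltr_wpDl // !mulr_ge0 ?rnorm_ge0.
  pose del := (e / 2) / (2 * `|t| * rnorm w + 1).
  have del0 : 0 < del by rewrite !divr_gt0.
  have delE : del * (2 * `|t| * rnorm w + 1) = e / 2.
    by rewrite /del mulfVK // gt_eqF.
  have e20 : 0 < e / 2 by rewrite divr_gt0.
  have /filter_ex[x [Jx zx]] : F ([set x | J x < d + e / 2] `&` [set x | rnorm (z - x) <= del]).
    by apply: filterI; [exact: FJ|move/cvg_rnormP : Fz'; exact].
  have := Jd (x + t%:C%C *: w).
  move: Jx; rewrite /J /= phiD phiZ rnormD_sqr rinnerZr rnormZr exprMn real_normK ?num_real //.
  have : `|t * (rinner z w - rinner x w)| <= `|t| * del * rnorm w.
    rewrite normrM -mulrA ler_wpM2l // -rinnerNl -rinnerDl.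
    by apply: le_trans (ler_norm_rinner _ _) _; rewrite ler_wpM2r ?rnorm_ge0.
  rewrite ler_norml => /andP[h1 _].
  move: delE; rewrite mulrDr mulr1 => delE h2 h3.
  lra.
have N0 : 0 <= rnorm w ^+ 2 by exact: sqr_ge0.
have := main (- (rinner z w - phi w) / (rnorm w ^+ 2 + 1)).
set c := _ - _; set N := rnorm w ^+ 2 in N0 *.
have N1 : 0 < N + 1 by rewrite ltr_wpDl.
move=> h; have : c ^+ 2 <= 0.
  have h' : 0 <= - (c ^+ 2) * (N + 2) / (N + 1) ^+ 2.
    rewrite (le_trans h) // le_eqVlt; apply/orP; left; apply/eqP.
    by field; rewrite gt_eqF.
  rewrite -oppr_ge0; move: h'.
  by rewrite pmulr_lge0 ?invr_gt0 ?exprn_gt0 // pmulr_lge0 // ltr_wpDl.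
move=> c0; have /eqP : c ^+ 2 = 0 by apply/eqP; rewrite eq_le c0 sqr_ge0.
by rewrite sqrf_eq0 subr_eq0 => /eqP.
Qed.

Lemma riesz (phi : H -> R[i]) (M : R) :
  (forall x y, phi (x + y) = phi x + phi y) ->
  (forall (a : R[i]) x, phi (a *: x) = a * phi x) ->
  (forall x, `|complex.Re (phi x)| <= M * rnorm x) ->
  exists z, forall x, phi x = inner x z.
Proof.
move=> phiD phiZ phiM.
have [||x|z zP] := @real_riesz (fun x => complex.Re (phi x)) M.
- by move=> x y; rewrite phiD ReD.
- by move=> a x; rewrite phiZ; case: (phi x) => b c /=; rewrite mul0r subr0.
- exact: phiM.
exists z => x; have := zP x; have := zP ('i%C *: x).
rewrite phiZ /rinner innerZl; case: (phi x) (inner x z) => [a b] [c e] /=.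
by rewrite !mul0r !mul1r !sub0r => /oppr_inj -> ->.
Qed.

End HilbertTheory.

(* C*-algebras are not assumed to be unital, and the zero algebra is allowed. *)
HB.mixin Record isCstar (R : realType) A & CompleteNormedModule R[i] A := {
  cmul : A -> A -> A;
  star : A -> A;
  cmulA : associative cmul;
  cmulDl : left_distributive cmul +%R;
  cmulDr : right_distributive cmul +%R;
  cmulZl : forall (c : R[i]) a b, cmul (c *: a) b = c *: cmul a b;
  cmulZr : forall (c : R[i]) a b, cmul a (c *: b) = c *: cmul a b;
  starK : involutive star;
  starD : {morph star : a b / a + b};
  starZ : forall (c : R[i]) a, star (c *: a) = (c^*)%C *: star a;
  starM : forall a b, star (cmul a b) = cmul (star b) (star a);
  normM_le : forall a b, `|cmul a b| <= `|a| * `|b|;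
  cstar_norm : forall a, `|cmul (star a) a| = `|a| ^+ 2
}.

#[short(type="cstarType")]
HB.structure Definition Cstar (R : realType) :=
  {A of CompleteNormedModule R[i] A & isCstar R A}.

Section BoundedOperators.
Variables (R : realType) (H : hilbertType R).

Definition bounded_op : {pred H -> H} := fun f =>
  `[< (forall (a : R[i]) x y, f (a *: x + y) = a *: f x + f y) /\
      (exists M : R, forall x, rnorm (f x) <= M * rnorm x) >].

Record bop := Bop { bop_fun :> H -> H; _ : bop_fun \in bounded_op }.

HB.instance Definition _ := [isSub for bop_fun].
HB.instance Definition _ := [Choice of bop by <:].

Lemma bounded_op_submod_closed : submod_closed bounded_op.
Proof.
split.
  apply/asboolP; split; first by move=> a x y; rewrite scaler0 addr0.
  by exists 0 => x; rewrite rnorm0 mul0r.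
move=> c f g /asboolP[fl [M fM]] /asboolP[gl [N gN]].
have E z : (c *: f + g) z = c *: f z + g z by [].
apply/asboolP; split.
  move=> a x y; rewrite !E fl gl !scalerDr !scalerA.
  by rewrite (mulrC c) addrACA.
exists (complex.Re `|c| * M + N) => x; rewrite E mulrDl -mulrA.
apply: le_trans (rnormD _ _) _; rewrite lerD // rnormZ ler_wpM2l //.
by rewrite -ler0c RRe_real // ger0_real.
Qed.

HB.instance Definition _ :=
  GRing.isSubmodClosed.Build R[i] (H -> H) bounded_op bounded_op_submod_closed.
HB.instance Definition _ := [SubChoice_isSubLmodule of bop by <:].

Implicit Types S T : bop.

Lemma bopP S T : S =1 T -> S = T.
Proof. by move=> ST; apply/val_inj/funext. Qed.

Lemma bop_linear T (a : R[i]) x y : T (a *: x + y) = a *: T x + T y.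
Proof. by case: T => f /= /asboolP[]. Qed.

Lemma bop_bounded T : exists M : R, forall x, rnorm (T x) <= M * rnorm x.
Proof. by case: T => f /= /asboolP[]. Qed.

Lemma bop0 T : T 0 = 0.
Proof. by have := bop_linear T (-1) 0 0; rewrite scaler0 addr0 scaleN1r addNr. Qed.

Lemma bopDr T x y : T (x + y) = T x + T y.
Proof. by rewrite -[x]scale1r bop_linear !scale1r. Qed.

Lemma bopZr T (a : R[i]) x : T (a *: x) = a *: T x.
Proof. by rewrite -[a *: x]addr0 bop_linear bop0 !addr0. Qed.

Lemma bopDE S T x : (S + T) x = S x + T x. Proof. by []. Qed.
Lemma bopZE (a : R[i]) T x : (a *: T) x = a *: T x. Proof. by []. Qed.
Lemma bopNE T x : (- T) x = - T x. Proof. by []. Qed.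

Definition opnorm T : R :=
  sup [set rnorm (T x) | x in [set x | rnorm x <= 1]].

Lemma opnorm_has_sup T :
  has_sup [set rnorm (T x) | x in [set x | rnorm x <= 1]].
Proof.
have [M TM] := bop_bounded T; split; first by exists (rnorm (T 0)), 0; rewrite //= rnorm0.
exists `|M| => _ [x /= x1 <-]; apply: le_trans (TM x) _.
have := ler_norm M; have := rnorm_ge0 x; have := normr_ge0 M; nra.
Qed.

Lemma opnorm_ge0 T : 0 <= opnorm T.
Proof.
apply: le_trans (rnorm_ge0 (T 0)) _; apply: sup_upper_bound (opnorm_has_sup T) _ _.
by exists 0; rewrite //= rnorm0.
Qed.

Lemma opnormP T x : rnorm (T x) <= opnorm T * rnorm x.
Proof.
have [x0|x0] := eqVneq (rnorm x) 0.
  by rewrite (rnorm0_eq0 x0) bop0 !rnorm0 mulr0.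
have {}x0 : 0 < rnorm x by rewrite lt_neqAle eq_sym x0 rnorm_ge0.
rewrite -ler_pdivrMr //.
have -> : rnorm (T x) / rnorm x = rnorm (T ((rnorm x)^-1%:C%C *: x)).
  by rewrite bopZr rnormZr ger0_norm ?invr_ge0 ?ltW // mulrC.
apply: sup_upper_bound (opnorm_has_sup T) _ _.
exists ((rnorm x)^-1%:C%C *: x) => //=.
by rewrite rnormZr ger0_norm ?invr_ge0 ?(ltW x0) // mulVf // gt_eqF.
Qed.

Lemma opnorm_le T (M : R) :
  0 <= M -> (forall x, rnorm (T x) <= M * rnorm x) -> opnorm T <= M.
Proof.
move=> M0 TM; apply: ge_sup; first by case: (opnorm_has_sup T).
move=> _ [x /= x1 <-]; apply: le_trans (TM x) _.
by rewrite ler_piMr.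
Qed.

Let bnorm T : R[i] := (opnorm T)%:C%C.

Let bnormD S T : bnorm (S + T) <= bnorm S + bnorm T.
Proof.
rewrite /bnorm -rmorphD lecR; apply: opnorm_le; first by rewrite addr_ge0 ?opnorm_ge0.
move=> x; rewrite bopDE mulrDl; apply: le_trans (rnormD _ _) _.
by rewrite lerD ?opnormP.
Qed.

Let opnormZ_le (l : R[i]) T : opnorm (l *: T) <= complex.Re `|l| * opnorm T.
Proof.
have l0 : 0 <= complex.Re `|l| by rewrite -ler0c RRe_real // ger0_real.
apply: opnorm_le => [|x]; first by rewrite mulr_ge0 ?opnorm_ge0.
by rewrite bopZE rnormZ -mulrA ler_wpM2l ?opnormP.
Qed.

Let bnormZ (l : R[i]) T : bnorm (l *: T) = `|l| * bnorm T.
Proof.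
have lE : `|l| = (complex.Re `|l|)%:C%C by rewrite RRe_real // ger0_real.
rewrite lE /bnorm -rmorphM; congr (_%:C%C); apply/eqP; rewrite eq_le opnormZ_le andTb.
have [->|l0] := eqVneq l 0; first by rewrite normr0 mul0r opnorm_ge0.
have r0 : 0 < complex.Re `|l| by rewrite -ltcR -lE normr_gt0.
rewrite mulrC -ler_pdivlMr //.
rewrite -[X in opnorm X](scalerK l0 T); apply: le_trans (opnormZ_le _ _) _.
rewrite mulrC normfV lE.
by rewrite -fmorphV /=.
Qed.

Let bnorm0_eq0 T : bnorm T = 0 -> T = 0.
Proof.
move=> /complexI T0; apply: bopP => x; apply: rnorm0_eq0; apply/eqP.
by rewrite eq_le rnorm_ge0 andbT (le_trans (opnormP _ _)) // T0 mul0r.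
Qed.

HB.instance Definition _ :=
  Lmodule_isNormed.Build R[i] bop bnormD bnormZ bnorm0_eq0.

Lemma rnorm_bop T : rnorm T = opnorm T. Proof. by []. Qed.

Lemma rnorm_bop_le T x : rnorm (T x) <= rnorm T * rnorm x.
Proof. exact: opnormP. Qed.

Let bop_complete (F : set_system bop) : ProperFilter F -> cauchy F -> cvg F.
Proof.
move=> FF /cauchy_rnormP FC.
have ev_cvg x : cvg ((fun T : bop => T x) @ F).
  apply: cauchy_cvg; apply/cauchy_rnormP => e e0.
  have d0 : 0 < e / (rnorm x + 1) by rewrite divr_gt0 // ltr_wpDl ?rnorm_ge0.
  have [[A B] /= [FA FB] AB] := FC _ d0.
  exists ([set T x | T in A], [set T x | T in B]).
    by split; [apply: filterS FA|apply: filterS FB] => T ?; exists T.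
  move=> [_ _] /= [[S AS <-] [T BT <-]].
  have := AB (S, T) (conj AS BT) => /= ST.
  have := rnorm_bop_le (S - T) x; rewrite bopDE bopNE => h.
  apply: le_lt_trans h _; move: ST; rewrite ltr_pdivlMr ?ltr_wpDl ?rnorm_ge0 //.
  by rewrite mulrDr mulr1 => h; have := rnorm_ge0 (S - T); lra.
pose L x := lim ((fun T : bop => T x) @ F).
have LP x : (fun T : bop => T x) @ F --> L x by exact: ev_cvg.
have Llin (a : R[i]) x y : L (a *: x + y) = a *: L x + L y.
  apply: (@cvg_unique _ (@norm_hausdorff _ H) ((fun T : bop => T (a *: x + y)) @ F)).
    exact: LP.
  have -> : (fun T : bop => T (a *: x + y)) = (fun T : bop => a *: T x + T y).
    by apply/funext => T; rewrite bop_linear.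
  by apply: cvgD; [apply: cvgZr|]; exact: LP.
have near_le (e : R) : 0 < e ->
    \forall S \near F, forall x, rnorm (L x - (S : bop) x) <= e * rnorm x.
  move=> e0; have [[A B] /= [FA FB] AB] := FC _ e0.
  apply: filterS FA => S AS x; apply/ler_addgt0Pl => d d0.
  have /cvg_rnormP/(_ d d0) Ld := LP x.
  have [T [Td BT]] := filter_ex (filterI Ld FB).
  apply: le_trans (rdistD (T x) _ _) _; rewrite lerD //.
  have := AB (S, T) (conj AS BT) => /= /ltW ST.
  have := rnorm_bop_le (S - T) x; rewrite bopDE bopNE => h.
  by rewrite rdistC (le_trans h) // ler_wpM2r ?rnorm_ge0.
have Lb : L \in bounded_op.
  apply/asboolP; split => //.
  have [S SL] := filter_ex (near_le 1 ltr01).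
  exists (1 + rnorm S) => x; rewrite -[L x](subrK (S x)) mulrDl.
  by apply: le_trans (rnormD _ _) _; rewrite lerD ?rnorm_bop_le.
apply/cvg_ex; exists (Bop Lb).
suff : id @ F --> Bop Lb by [].
apply/cvg_rnormP => e e0; apply: filterS (near_le e e0) => S SL.
by rewrite rnorm_bop; apply: opnorm_le; rewrite ?ltW.
Qed.

HB.instance Definition _ := Uniform_isComplete.Build bop bop_complete.

Lemma comp_bounded S T : (S \o T) \in bounded_op.
Proof.
apply/asboolP; split; first by move=> a x y /=; rewrite !bop_linear.
exists (rnorm S * rnorm T) => x /=; apply: le_trans (rnorm_bop_le _ _) _.
by rewrite -mulrA ler_wpM2l ?rnorm_ge0 ?rnorm_bop_le.
Qed.

Definition bop_mul S T := Bop (comp_bounded S T).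

(* The adjoint exists by the Riesz representation theorem. *)
Lemma adjoint_ex T : {T' : bop | forall x y, inner (T x) y = inner x (T' y)}.
Proof.
apply: cid.
have /choice[f fP] : forall y, exists z, forall x, inner (T x) y = inner x z.
  move=> y; apply: (@riesz _ _ _ (rnorm T * rnorm y)).
  - by move=> x x'; rewrite bopDr innerDl.
  - by move=> a x; rewrite bopZr innerZl.
  - move=> x; apply: le_trans (ler_norm_rinner _ _) _.
    by rewrite mulrAC ler_wpM2r ?rnorm_ge0 ?rnorm_bop_le.
have fl (a : R[i]) x y : f (a *: x + y) = a *: f x + f y.
  apply: inner_def => z.
  by rewrite /rinner innerDr innerZr -!fP innerDr innerZr.
have fb : f \in bounded_op.
  apply/asboolP; split => //; exists (rnorm T) => y.
  have [y0|y0] := eqVneq (rnorm (f y)) 0; first by rewrite y0 mulr_ge0 ?rnorm_ge0.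
  have {}y0 : 0 < rnorm (f y) by rewrite lt_neqAle eq_sym y0 rnorm_ge0.
  rewrite -(ler_pM2r y0) -expr2 -rinnerE /rinner -fP.
  apply: le_trans (rinner_le _ _) _; rewrite mulrAC ler_wpM2r ?rnorm_ge0 //.
  exact: rnorm_bop_le.
by exists (Bop fb) => x y; rewrite fP.
Qed.

Definition adjoint T : bop := sval (adjoint_ex T).

Lemma adjointP T x y : inner (T x) y = inner x (adjoint T y).
Proof. by rewrite /adjoint; case: adjoint_ex. Qed.

Lemma adjointPr T x y : inner (adjoint T x) y = inner x (T y).
Proof. by rewrite inner_conj -adjointP -inner_conj. Qed.

Let bop_mulA : associative bop_mul.
Proof. by move=> S T U; apply: bopP. Qed.
Let bop_mulDl : left_distributive bop_mul +%R.
Proof. by move=> S T U; apply: bopP. Qed.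
Let bop_mulDr : right_distributive bop_mul +%R.
Proof. by move=> S T U; apply: bopP => x; exact: bopDr. Qed.
Let bop_mulZl (c : R[i]) S T : bop_mul (c *: S) T = c *: bop_mul S T.
Proof. exact: bopP. Qed.
Let bop_mulZr (c : R[i]) S T : bop_mul S (c *: T) = c *: bop_mul S T.
Proof. by apply: bopP => x; exact: bopZr. Qed.

Lemma adjoint_uniq S T : (forall x y, inner (S x) y = inner (T x) y) -> S = T.
Proof.
move=> ST; apply: bopP => x; apply: inner_def => z.
by rewrite rinnerC [RHS]rinnerC /rinner ST.
Qed.

Lemma adjointK : involutive adjoint.
Proof.
by move=> T; apply: adjoint_uniq => x y; rewrite !(adjointPr, adjointP).
Qed.
Let adjointD : {morph adjoint : S T / S + T}.
Proof.
by move=> S T; apply: adjoint_uniq => x y;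
  rewrite adjointPr !bopDE innerDr innerDl !adjointPr.
Qed.
Let adjointZ (c : R[i]) T : adjoint (c *: T) = (c^*)%C *: adjoint T.
Proof.
by apply: adjoint_uniq => x y; rewrite adjointPr !bopZE innerZr innerZl adjointPr.
Qed.
Let adjointM S T : adjoint (bop_mul S T) = bop_mul (adjoint T) (adjoint S).
Proof. by apply: adjoint_uniq => x y; rewrite !adjointPr. Qed.

Let bop_normM_le S T : `|bop_mul S T| <= `|S| * `|T|.
Proof.
rewrite !normE -rmorphM lecR rnorm_bop; apply: opnorm_le => [|x].
  by rewrite mulr_ge0 ?rnorm_ge0.
apply: le_trans (rnorm_bop_le S (T x)) _.
rewrite -[leRHS]mulrA; apply: ler_wpM2l; first exact: rnorm_ge0.
exact: rnorm_bop_le.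
Qed.

Let rnorm_adjoint_le T : rnorm T ^+ 2 <= rnorm (bop_mul (adjoint T) T).
Proof.
set N := rnorm (bop_mul _ _).
have N0 : 0 <= N by exact: rnorm_ge0.
rewrite -(sqr_sqrtr N0) ler_pXn2r ?nnegrE ?rnorm_ge0 ?sqrtr_ge0 //.
rewrite rnorm_bop; apply: opnorm_le => [|x]; first exact: sqrtr_ge0.
rewrite -(ler_pXn2r (n := 2)) ?nnegrE ?mulr_ge0 ?rnorm_ge0 ?sqrtr_ge0 //.
rewrite exprMn sqr_sqrtr // -rinnerE /rinner adjointP.
apply: le_trans (rinner_le _ _) _; rewrite mulrC expr2 mulrA ler_wpM2r ?rnorm_ge0 //.
exact: (rnorm_bop_le (bop_mul (adjoint T) T)).
Qed.

Lemma rnorm_adjoint T : rnorm (adjoint T) = rnorm T.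
Proof.
suff le U : rnorm U <= rnorm (adjoint U).
  by apply/eqP; rewrite eq_le le andbT -[X in _ <= rnorm X]adjointK le.
have [U0|U0] := eqVneq (rnorm U) 0; first by rewrite U0 rnorm_ge0.
have {}U0 : 0 < rnorm U by rewrite lt_neqAle eq_sym U0 rnorm_ge0.
rewrite -(ler_pM2r U0) -expr2; apply: le_trans (rnorm_adjoint_le _) _.
by have := bop_normM_le (adjoint U) U; rewrite !normE -rmorphM lecR.
Qed.

Let bop_cstar T : `|bop_mul (adjoint T) T| = `|T| ^+ 2.
Proof.
apply/eqP; rewrite eq_le !normE -rmorphXn !lecR rnorm_adjoint_le andbT.
by have := bop_normM_le (adjoint T) T; rewrite !normE -rmorphM lecR rnorm_adjoint.
Qed.

HB.instance Definition _ := isCstar.Build R bop bop_mulA bop_mulDl bop_mulDr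
  bop_mulZl bop_mulZr adjointK adjointD adjointZ adjointM bop_normM_le bop_cstar.

End BoundedOperators.

Section Subalgebras.
Variables (R : realType) (B : cstarType R).

Record is_csubalg (S : set B) : Prop := IsCsubalg {
  csub0 : S 0;
  csubZD : forall (c : R[i]) a b, S a -> S b -> S (c *: a + b);
  csubM : forall a b, S a -> S b -> S (cmul a b);
  csub_star : forall a, S a -> S (star a);
  csub_closed : closed S
}.

Record csubalg := Csubalg { csub_set :> set B; csubP : is_csubalg csub_set }.

HB.instance Definition _ := gen_eqMixin csubalg.
HB.instance Definition _ := gen_choiceMixin csubalg.

Lemma csubalg_inj (S T : csubalg) : csub_set S = csub_set T -> S = T.
Proof.
by case: S T => [S SP] [T TP] /= ST; case: _ / ST in TP *; rewrite (Prop_irrelevance SP TP).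
Qed.

Definition csub_pred (S : csubalg) : {pred B} := fun a => `[< csub_set S a >].

Record csub_elt (S : csubalg) :=
  CsubElt { csub_val :> B; csub_valP : csub_val \in csub_pred S }.

End Subalgebras.

Section SubalgebraCstar.
Variables (R : realType) (B : cstarType R) (S : csubalg B).
Local Notation elt := (csub_elt S).

HB.instance Definition _ := [isSub for @csub_val R B S].
HB.instance Definition _ := [Choice of elt by <:].

Lemma csub_in (a : elt) : csub_set S a.
Proof. by case: a => a /= /asboolP. Qed.

Lemma csub_submod_closed : submod_closed (csub_pred S).
Proof.
split; first by apply/asboolP; exact: csub0 (csubP S).
by move=> c a b /asboolP Sa /asboolP Sb; apply/asboolP; apply: csubZD (csubP S) _ _ _ _ _.
Qed.

HB.instance Definition _ :=
  GRing.isSubmodClosed.Build R[i] B (csub_pred S) csub_submod_closed.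
HB.instance Definition _ := [SubChoice_isSubLmodule of elt by <:].

Implicit Types a b : elt.

Let snorm a : R[i] := `|csub_val a|.

Let snormD a b : snorm (a + b) <= snorm a + snorm b.
Proof. exact: ler_normD. Qed.
Let snormZ (l : R[i]) a : snorm (l *: a) = `|l| * snorm a.
Proof. exact: normrZ. Qed.
Let snorm0_eq0 a : snorm a = 0 -> a = 0.
Proof. by move/normr0_eq0 => a0; apply: val_inj. Qed.

HB.instance Definition _ :=
  Lmodule_isNormed.Build R[i] elt snormD snormZ snorm0_eq0.

Lemma csub_rnorm a : rnorm a = rnorm (csub_val a). Proof. by []. Qed.

Let elt_complete (F : set_system elt) : ProperFilter F -> cauchy F -> cvg F.
Proof.
move=> FF /cauchy_rnormP FC.
have : cauchy (@csub_val R B S @ F).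
  apply/cauchy_rnormP => e e0; have [[P Q] /= [FP FQ] PQ] := FC e e0.
  exists ((@csub_val R B S) @` P, (@csub_val R B S) @` Q).
    by split; [apply: filterS FP|apply: filterS FQ] => a ?; exists a.
  by move=> [_ _] /= [[a Pa <-] [b Qb <-]]; exact: (PQ (a, b)).
move=> /cauchy_cvg /cvg_ex[l Fl].
have Sl : l \in csub_pred S.
  apply/asboolP; apply: (@closed_cvg _ _ F FF (@csub_val R B S) (csub_set S)) Fl => //.
    exact: csub_closed (csubP S).
  by near=> a; exact: csub_in.
apply/cvg_ex; exists (CsubElt Sl).
suff : id @ F --> CsubElt Sl by [].
by apply/cvg_rnormP => e e0; move/cvg_rnormP : Fl; exact.
Unshelve. all: by end_near. Qed.

HB.instance Definition _ := Uniform_isComplete.Build elt elt_complete.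

Let smul_in a b : cmul (csub_val a) (csub_val b) \in csub_pred S.
Proof. by apply/asboolP; apply: (csubM (csubP S)); exact: csub_in. Qed.
Let sstar_in a : star (csub_val a) \in csub_pred S.
Proof. by apply/asboolP; apply: (csub_star (csubP S)); exact: csub_in. Qed.

Definition csub_mul a b := CsubElt (smul_in a b).
Definition csub_adj a := CsubElt (sstar_in a).

Let smulA : associative csub_mul.
Proof. by move=> a b c; apply: val_inj; exact: cmulA. Qed.
Let smulDl : left_distributive csub_mul +%R.
Proof. by move=> a b c; apply: val_inj; exact: cmulDl. Qed.
Let smulDr : right_distributive csub_mul +%R.
Proof. by move=> a b c; apply: val_inj; exact: cmulDr. Qed.
Let smulZl (c : R[i]) a b : csub_mul (c *: a) b = c *: csub_mul a b.
Proof. by apply: val_inj; exact: cmulZl. Qed.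
Let smulZr (c : R[i]) a b : csub_mul a (c *: b) = c *: csub_mul a b.
Proof. by apply: val_inj; exact: cmulZr. Qed.
Let sstarK : involutive csub_adj.
Proof. by move=> a; apply: val_inj; exact: starK. Qed.
Let sstarD : {morph csub_adj : a b / a + b}.
Proof. by move=> a b; apply: val_inj; exact: starD. Qed.
Let sstarZ (c : R[i]) a : csub_adj (c *: a) = (c^*)%C *: csub_adj a.
Proof. by apply: val_inj; exact: starZ. Qed.
Let sstarM a b : csub_adj (csub_mul a b) = csub_mul (csub_adj b) (csub_adj a).
Proof. by apply: val_inj; exact: starM. Qed.
Let snormM_le a b : `|csub_mul a b| <= `|a| * `|b|.
Proof. exact: normM_le. Qed.
Let scstar a : `|csub_mul (csub_adj a) a| = `|a| ^+ 2.
Proof. exact: cstar_norm. Qed.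

HB.instance Definition _ := isCstar.Build R elt smulA smulDl smulDr
  smulZl smulZr sstarK sstarD sstarZ sstarM snormM_le scstar.

End SubalgebraCstar.

Section KadisonKastler.
Variables (R : realType) (B : cstarType R).
Implicit Types S T U : csubalg B.

Definition unit_ball S : set B := [set x | csub_set S x /\ rnorm x <= 1].

Definition hemidist S T : R :=
  sup [set inf [set rnorm (x - y) | y in unit_ball T] | x in unit_ball S].

Definition dKK S T : R := Order.max (hemidist S T) (hemidist T S).

Lemma unit_ball0 S : unit_ball S 0.
Proof. by split; [exact: csub0 (csubP S)|rewrite rnorm0 ler01]. Qed.

Let dist_has_inf x T : has_inf [set rnorm (x - y) | y in unit_ball T].
Proof.
split; first by exists (rnorm (x - 0)), 0 => //; exact: unit_ball0.
by exists 0 => _ [y _ <-]; exact: rnorm_ge0.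
Qed.

Let dist_ge0 x T : 0 <= inf [set rnorm (x - y) | y in unit_ball T].
Proof.
apply: lb_le_inf; first by case: (dist_has_inf x T).
by move=> _ [y _ <-]; exact: rnorm_ge0.
Qed.

Let dist_le x y T : unit_ball T y ->
  inf [set rnorm (x - y) | y in unit_ball T] <= rnorm (x - y).
Proof. by move=> Ty; apply: ge_inf; [case: (dist_has_inf x T)|exists y]. Qed.

Let hemi_has_sup S T :
  has_sup [set inf [set rnorm (x - y) | y in unit_ball T] | x in unit_ball S].
Proof.
split; first by eexists; exists 0 => //; exact: unit_ball0.
exists 1 => _ [x [_ x1] <-]; apply: le_trans (dist_le x (unit_ball0 T)) _.
by rewrite subr0.
Qed.

Let hemi_ge x S T : unit_ball S x ->
  inf [set rnorm (x - y) | y in unit_ball T] <= hemidist S T.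
Proof. by move=> Sx; apply: sup_upper_bound (hemi_has_sup S T) _ _; exists x. Qed.

Lemma hemidist_ge0 S T : 0 <= hemidist S T.
Proof. exact: le_trans (dist_ge0 0 T) (hemi_ge T (unit_ball0 S)). Qed.

Lemma hemidistP S T (e : R) x : hemidist S T < e -> unit_ball S x ->
  exists2 y, unit_ball T y & rnorm (x - y) < e.
Proof.
move=> STe Sx; have [_ [y Ty <-] xye] := @inf_lt _ _ e (proj1 (dist_has_inf x T))
  (le_lt_trans (hemi_ge T Sx) STe).
by exists y.
Qed.

Lemma hemidist_le S T (e : R) :
  (forall x, unit_ball S x -> exists2 y, unit_ball T y & rnorm (x - y) <= e) ->
  hemidist S T <= e.
Proof.
move=> STe; apply: ge_sup; first by case: (hemi_has_sup S T).
move=> _ [x Sx <-]; have [y Ty xye] := STe x Sx.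
exact: le_trans (dist_le x Ty) xye.
Qed.

Let hemidistD T S U : hemidist S U <= hemidist S T + hemidist T U.
Proof.
apply/ler_addgt0Pl => e e0; have e20 : 0 < e / 2 by rewrite divr_gt0.
apply: hemidist_le => x Sx.
have [y Ty xy] := hemidistP (ltr_pwDr e20 (lexx (hemidist S T))) Sx.
have [z Uz yz] := hemidistP (ltr_pwDr e20 (lexx (hemidist T U))) Ty.
exists z => //; apply: le_trans (rdistD y _ _) _; lra.
Qed.

Let hemidist_sub S T : hemidist S T = 0 -> csub_set S `<=` csub_set T.
Proof.
move=> ST0; suff ball_sub x : unit_ball S x -> csub_set T x.
  move=> x Sx.
  have n0 : 0 < rnorm x + 1 by rewrite ltr_wpDl ?rnorm_ge0.
  have : csub_set T ((rnorm x + 1)^-1%:C%C *: x).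
    apply: ball_sub; split.
      by rewrite -[_ *: _]addr0; apply: (csubZD (csubP S)) => //; exact: csub0 (csubP S).
    rewrite rnormZr ger0_norm ?invr_ge0 ?(ltW n0) // mulrC ler_pdivrMr // mul1r.
    by rewrite lerDl.
  move=> /(csubZD (csubP T) ((rnorm x + 1)%:C%C))/(_ (csub0 (csubP T))).
  rewrite addr0 scalerA -rmorphM /= mulfV ?gt_eqF // scale1r.
  exact.
move=> Sx; apply: (csub_closed (csubP T)) => P /nbhs_ballP[_ /= /gt0c[e e0 ->] eP].
have [||y [Ty _] xy] := @hemidistP S T e x; rewrite ?ST0 //.
by exists y; split => //; apply: eP; apply/ball_rnorm.
Qed.

Let dKKxx S : dKK S S = 0.
Proof.
rewrite /dKK maxxx; apply/eqP; rewrite eq_le hemidist_ge0 andbT.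
by apply: hemidist_le => x Sx; exists x; rewrite ?subrr ?rnorm0.
Qed.

Let dKK_eq0 S T : dKK S T = 0 -> S = T.
Proof.
move=> d0; have := hemidist_ge0 S T; have := hemidist_ge0 T S.
have : hemidist S T <= dKK S T by rewrite le_max lexx.
have : hemidist T S <= dKK S T by rewrite le_max lexx orbT.
rewrite d0 => TS ST TS0 ST0; apply: csubalg_inj; apply/seteqP; split.
  by apply: hemidist_sub; apply/eqP; rewrite eq_le ST ST0.
by apply: hemidist_sub; apply/eqP; rewrite eq_le TS TS0.
Qed.

Let dKKC S T : dKK S T = dKK T S. Proof. exact: maxC. Qed.

Let dKKD T S U : dKK S U <= dKK S T + dKK T U.
Proof.
rewrite ge_max; apply/andP; split.
  apply: le_trans (hemidistD T _ _) _.
  by rewrite lerD // le_max lexx.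
rewrite addrC; apply: le_trans (hemidistD T _ _) _.
by rewrite lerD // le_max lexx orbT.
Qed.

(* The space of all C*-subalgebras of B, metrized by dKK. *)
HB.instance Definition _ :=
  isMetric.Build R (csubalg B) dKKxx dKK_eq0 dKKC dKKD.

Lemma mdist_dKK S T : mdist S T = dKK S T. Proof. by []. Qed.

Lemma nbhs_dKK S (X : set (csubalg B)) :
  nbhs S X <-> exists2 e : R, 0 < e & forall T, dKK S T < e -> X T.
Proof.
split=> [/nbhs_ballP[e /= e0 eX]|[e e0 eX]].
  by exists e => // T ST; apply: eX; rewrite ballEmdist.
by apply/nbhs_ballP; exists e => //= T; rewrite ballEmdist; exact: eX.
Qed.

End KadisonKastler.


Definition csub_alg (R : realType) (B : cstarType R) (S : csubalg B) :
  cstarType R := csub_elt S.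

Section ContinuousLogic.
Variable R : realType.

(* The language has no symbol for a unit, since the structures are all
   C*-algebras, unital or not.  Variables are named by natural numbers.  The sort of a variable is recorded
   by its quantifier, and every *-polynomial maps balls into some ball, so that
   terms need no sort annotations and the inclusions B_m -> B_n are silent. *)
Inductive cterm : Type :=
| Tvar (x : nat)
| Tzero
| Tadd (s t : cterm)
| Tmul (s t : cterm)
| Tstar (s : cterm)
| Tscale (c : R[i]) (s : cterm).

Inductive cformula : Type :=
| Fdist (s t : cterm)
| Fconn (k : nat) (f : 'rV[R]_k -> R) of continuous f & ('I_k -> cformula)
| Fsup (x n : nat) (phi : cformula)
| Finf (x n : nat) (phi : cformula).

Fixpoint cterm_fv (t : cterm) : set nat :=
  match t with
  | Tvar x => [set x]
  | Tzero => set0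
  | Tadd s t | Tmul s t => cterm_fv s `|` cterm_fv t
  | Tstar s | Tscale _ s => cterm_fv s
  end.

Fixpoint cformula_fv (phi : cformula) : set nat :=
  match phi with
  | Fdist s t => cterm_fv s `|` cterm_fv t
  | Fconn k _ _ phis => [set x | exists i, cformula_fv (phis i) x]
  | Fsup x _ psi | Finf x _ psi => cformula_fv psi `\ x
  end.

Definition sentence (phi : cformula) := cformula_fv phi = set0.

Section Semantics.
Variable A : cstarType R.

(* The sort B_n(A). *)
Definition sort_ball (n : nat) : set A := [set a | rnorm a <= n%:R].

Definition update (v : nat -> A) (x : nat) (a : A) : nat -> A :=
  fun y => if y == x then a else v y.

Fixpoint cterm_val (v : nat -> A) (t : cterm) : A :=
  match t with
  | Tvar x => v x
  | Tzero => 0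
  | Tadd s t => cterm_val v s + cterm_val v t
  | Tmul s t => cmul (cterm_val v s) (cterm_val v t)
  | Tstar s => star (cterm_val v s)
  | Tscale c s => c *: cterm_val v s
  end.

Fixpoint cformula_val (v : nat -> A) (phi : cformula) : R :=
  match phi with
  | Fdist s t => rnorm (cterm_val v s - cterm_val v t)
  | Fconn k f _ phis => f (\row_i cformula_val v (phis i))
  | Fsup x n psi => sup [set cformula_val (update v x a) psi | a in sort_ball n]
  | Finf x n psi => inf [set cformula_val (update v x a) psi | a in sort_ball n]
  end.

(* The value of a sentence does not depend on the valuation. *)
Definition sentence_val (phi : cformula) : R := cformula_val (fun=> 0) phi.

End Semantics.

Definition axiomatizable (P : cstarType R -> Prop) :=
  exists T : set cformula, (forall phi, T phi -> sentence phi) /\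
    (forall A : cstarType R,
      P A <-> (forall phi, T phi -> sentence_val A phi = 0)).

End ContinuousLogic.

Section Properties.
Variables (R : realType).
Implicit Type A : cstarType R.

Definition abelian_alg A := forall a b : A, cmul a b = cmul b a.

Definition is_one A (e : A) := forall a : A, cmul e a = a /\ cmul a e = a.

Definition unital A := exists e : A, is_one e.

Definition projection A (p : A) := star p = p /\ cmul p p = p.

Definition unital_projectionless A :=
  exists e : A, is_one e /\ (forall p : A, projection p -> p = 0 \/ p = e).

Definition star_hom A (B : cstarType R) (f : A -> B) :=
  [/\ forall (c : R[i]) a b, f (c *: a + b) = c *: f a + f b,
      forall a b, f (cmul a b) = cmul (f a) (f b) &
      forall a, f (star a) = star (f a)].

(* The zero representation on a one-dimensional space is not irreducible. *)
Definition irreducible_rep A (K : hilbertType R) (pi : A -> bop K) :=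
  (exists a x, pi a x <> 0) /\
  (forall V : set K, closed V -> V 0 ->
    (forall (c : R[i]) x y, V x -> V y -> V (c *: x + y)) ->
    (forall a x, V x -> V (pi a x)) ->
    V = [set 0] \/ V = setT).

Definition dim_le (n : nat) (K : hilbertType R) :=
  exists b : 'I_n -> K, forall x, exists c : 'I_n -> R[i], x = \sum_i c i *: b i.

Definition subhomogeneous (n : nat) A :=
  forall (K : hilbertType R) (pi : A -> bop K),
    star_hom pi -> irreducible_rep pi -> dim_le n K.

Definition contains_unital_matrix (n : nat) A :=
  exists e : A, is_one e /\
  exists f : 'M[R[i]]_n -> A,
    [/\ forall (c : R[i]) X Y, f (c *: X + Y) = c *: f X + f Y,
        forall X Y, f (X *m Y) = cmul (f X) (f Y),
        forall X, f (map_mx (@conjc R) X^T) = star (f X),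
        injective f &
        exists X, f X = e].

Definition positive A (a : A) := exists c : A, a = cmul (star c) c.

Definition purely_infinite_simple A :=
  ~ (exists u : A, forall a, exists c : R[i], a = c *: u) /\
  (forall a b : A, positive a -> a <> 0 -> positive b -> b <> 0 ->
    exists x : nat -> A,
      (fun k => cmul (cmul (x k) a) (star (x k))) @ \oo --> b).

Definition infinite_alg A :=
  exists p q v : A,
    [/\ projection p /\ p <> 0, projection q /\ q <> 0, cmul p q = 0,
        cmul (star v) v = p + q & cmul v (star v) = p].

Definition finite_alg A := ~ infinite_alg A.

(* The unitization consists of the formal sums x.1 + x.2 1, acting on A by left
   multiplication; its C*-norm, for A not unital, is the norm of this action. *)
Definition unitization_mul A (x y : A * R[i]) : A * R[i] :=
  (cmul x.1 y.1 + y.2 *: x.1 + x.2 *: y.1, x.2 * y.2).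
Definition unitization_star A (x : A * R[i]) : A * R[i] :=
  (star x.1, (x.2^*)%C).
Definition unitization_one A : A * R[i] := (0, 1).
Definition unitization_norm A (x : A * R[i]) : R :=
  sup [set rnorm (cmul x.1 b + x.2 *: b) | b in [set b : A | rnorm b <= 1]].

Section Density.
Variables (U : zmodType) (mul : U -> U -> U) (st : U -> U) (one : U).
Variable nrm : U -> R.

Definition invertible (a : U) := exists b, mul a b = one /\ mul b a = one.

Definition dense_invertible :=
  forall a (eps : R), 0 < eps ->
    exists b, invertible b /\ nrm (a - b) < eps.

Definition dense_invertible_sa :=
  forall a, st a = a -> forall eps : R, 0 < eps ->
    exists b, [/\ st b = b, invertible b & nrm (a - b) < eps].

End Density.

Definition real_rank_zero A :=
  (forall e : A, is_one e ->
    dense_invertible_sa (@cmul R A) (@star R A) e (@rnorm R A)) /\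
  (~ unital A ->
    dense_invertible_sa (@unitization_mul A) (@unitization_star A)
      (unitization_one A) (@unitization_norm A)).

Definition stable_rank_one A :=
  (forall e : A, is_one e ->
    dense_invertible (@cmul R A) e (@rnorm R A)) /\
  (~ unital A ->
    dense_invertible (@unitization_mul A)
      (unitization_one A) (@unitization_norm A)).

End Properties.

(* Main.v *)
Require Import Defs.
From HB Require Import structures.
From mathcomp Require Import all_boot all_order all_algebra.
From mathcomp Require Import boolp classical_sets functions.
From mathcomp Require Import reals topology normedtype sequences.
From mathcomp Require Import fingroup perm.
From mathcomp Require Import complex.
From mathcomp Require Import ring lra.
From mathcomp Require derive.
Import Order.TTheory GRing.Theory Num.Theory.
Import numFieldNormedType.Exports.
Set Implicit Arguments.
Unset Strict Implicit.
Unset Printing Implicit Defensive.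
Local Open Scope classical_set_scope.
Local Open Scope ring_scope.

(** If two subalgebras are closer than d in [dKK], each x in one has an approximant in the other,
    with error at most d|x| and norm at most |x| ([dnear]). A set of subalgebras is therefore clopen
    as soon as one d > 0 works for all pairs: membership passes from S to T whenever the two are
    [dnear d] in both directions ([clopen_uniform]).

    For axiomatizable properties, the value of a formula is uniformly continuous in the algebra and
    the valuation together: terms are Lipschitz on bounded sets, connectives are uniformly
    continuous on compact boxes, and a sup or inf over a ball moves little when the ball does
    ([formula_nearP]). An axiomatizable class is therefore closed, and it is clopen if its
    complement is axiomatizable too.

    The eight concrete classes are handled by direct perturbation rather than by axioms. The basic
    tool is a functional calculus made from two iterations, for the square root and for the inverse
    of 1 - z ([sqrt_fix], [neumann]). It gives square roots, positive parts and polar decompositions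
    that stay in a subalgebra or in its sum with the scalars, [adj1].

    Abelian: commutators with unitaries that are uniformly small must vanish, since passing from u
    to u^2 nearly doubles them ([comm_unitary_zero]).

    Projectionless, matrix copies, finite: approximate projections, partial isometries and matrix
    units can be corrected to exact ones ([proj_near], [polar_near], [column_units_near]), and
    comparable projections at distance below 1 are equal.

    Purely infinite: a bounded x with x a x^* within 1/2 of b can be moved to the nearby algebra,
    and there it can be improved to any precision ([pis_bounded], [pis_correct]).

    Real rank zero and stable rank one: the invertibles are already dense if every element of norm
    at most 2 is within 1/64 of one ([inv_dense_gap], [inv_dense_sa_gap]), and such a fixed gap
    survives a small perturbation.

    Subhomogeneous: the Capelli polynomial in n^2 + 1 alternating variables vanishes on
    n-subhomogeneous algebras, because irreducible representations separate points
    ([irreps_separate], through extremal states and GNS). An irreducible representation of larger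
    dimension gives contractions at which its norm is at least 1/2 ([cap_lower_bound], through
    Schur, the density theorem and Kaplansky's cutoff). The polynomial is Lipschitz on contractions,
    so nearby algebras cannot differ in this respect. *)

(** * Bounded operators as a ring, and automation for identities and norms *)

Section BopRing.
Variables (R : realType) (H : hilbertType R).

Lemma bop_id_bounded : (id : H -> H) \in @bounded_op R H.
Proof. by apply/asboolP; split=> //; exists 1 => x; rewrite mul1r. Qed.

Definition bop_id : bop H := Bop bop_id_bounded.

Let bmulA : associative (@bop_mul R H). Proof. exact: cmulA. Qed.
Let bmul1 : left_id bop_id (@bop_mul R H). Proof. by move=> S; apply: bopP. Qed.
Let bmulr1 : right_id bop_id (@bop_mul R H). Proof. by move=> S; apply: bopP. Qed.
Let bmulDl : left_distributive (@bop_mul R H) +%R. Proof. exact: cmulDl. Qed.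
Let bmulDr : right_distributive (@bop_mul R H) +%R. Proof. exact: cmulDr. Qed.

HB.instance Definition _ := GRing.Zmodule_isPzRing.Build (bop H)
  bmulA bmul1 bmulr1 bmulDl bmulDr.


Implicit Types (S T : bop H) (u v : H) (a : R[i]).

Lemma bopME S T u : (S * T) u = S (T u). Proof. by []. Qed.
Lemma bop1E u : (1 : bop H) u = u. Proof. by []. Qed.
Lemma bop0E u : (0 : bop H) u = 0. Proof. by []. Qed.

Lemma bopNr T u : T (- u) = - T u.
Proof. by rewrite -scaleN1r bopZr scaleN1r. Qed.

Lemma bopZAl a S T : a *: S * T = a *: (S * T).
Proof. exact: bopP. Qed.

Lemma bopZAr a S T : S * (a *: T) = a *: (S * T).
Proof. by apply: bopP => x; exact: bopZr. Qed.

Lemma inner0l v : inner 0 v = 0.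
Proof. by rewrite -(scale0r 0) innerZl mul0r. Qed.

Lemma innerNl u v : inner (- u) v = - inner u v.
Proof. by rewrite -scaleN1r innerZl mulN1r. Qed.

Lemma inner0r v : inner v 0 = 0.
Proof. by rewrite inner_conj inner0l conjc0. Qed.

Lemma innerNr u v : inner u (- v) = - inner u v.
Proof. by rewrite inner_conj innerNl rmorphN /= -inner_conj. Qed.

Lemma starS T u v : inner (star T u) v = inner u (T v).
Proof. exact: adjointPr. Qed.

Lemma starSr T u v : inner u (star T v) = inner (T u) v.
Proof. by rewrite adjointP. Qed.

Lemma rstarS T u v : rinner (star T u) v = rinner u (T v).
Proof. by rewrite /rinner starS. Qed.

Definition bopLE := (@bopDE R H, @bopNE R H, @bopZE R H, bopME, bop1E, bop0E).
Definition bopRE := (@bopDr R H, bopNr, @bopZr R H, @bop0 R H).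
Definition innE := (@innerDl R H, innerNl, @innerZl R H, inner0l).

End BopRing.

(* Noncommutative polynomial identities between operators become commutative
   ring identities between the matrix coefficients of words in the operators. *)
Ltac bop_expand := rewrite !bopLE ?bopRE ?innE.
Ltac bop_ring := apply: adjoint_uniq => ? ?; bop_expand; ring.

Section NormalForms.
Variables (R : realType) (H : hilbertType R).
Definition nadd (S T : bop H) : bop H := S + T.
Definition nopp (S : bop H) : bop H := - S.
Definition nmul (S T : bop H) : bop H := S * T.
Definition nscale (l : R[i]) (S : bop H) : bop H := l *: S.
Definition nstar (S : bop H) : bop H := star S.
Definition none : bop H := 1.
Definition nzero : bop H := 0.
Definition nrm (S : bop H) : R := rnorm S.
End NormalForms.

(* The same operator can be written through different canonical structures of
   [bop H]; [bop_nf] makes convertible norms syntactically equal, so that they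
   can be generalized before calling [lra]. *)
Ltac bop_nf x := lazymatch x with
  | @Algebra.add _ ?a ?b => let a' := bop_nf a in let b' := bop_nf b in constr:(nadd a' b')
  | @Algebra.opp _ ?a => let a' := bop_nf a in constr:(nopp a')
  | @GRing.mul _ ?a ?b => let a' := bop_nf a in let b' := bop_nf b in constr:(nmul a' b')
  | @GRing.scale _ _ ?l ?a => let a' := bop_nf a in constr:(nscale l a')
  | @star _ _ ?a => let a' := bop_nf a in constr:(nstar a')
  | @GRing.one _ => lazymatch goal with H : hilbertType ?R |- _ => constr:(@none R H) end
  | @Algebra.zero _ => lazymatch goal with H : hilbertType ?R |- _ => constr:(@nzero R H) end
  | _ => x end.
Ltac norm_gen :=
  repeat match goal with
  | h : is_true (Order.le _ _) |- _ => revert h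
  | h : is_true (Order.lt _ _) |- _ => revert h
  end;
  repeat match goal with |- context [@rnorm ?R' ?V ?x] =>
    first [let x' := bop_nf x in change (@rnorm R' V x) with (nrm x')
          |generalize (@rnorm R' V x)] end;
  repeat match goal with |- context [nrm ?x] => generalize (nrm x) end; intros.
Ltac norm_lra := norm_gen; lra.
Ltac norm_nra := norm_gen; nra.

(** * Closed sets and convergence by a scalar majorant *)

Section Limits.
Variables (R : realType) (V : completeNormedModType R[i]).
Implicit Types (P : set V) (x y : V).

Lemma rnormB_sub x y : rnorm x - rnorm y <= rnorm (x - y).
Proof. by rewrite lerBlDr; have := rnormD (x - y) y; rewrite subrK. Qed.

Definition rclosed P :=
  forall x, (forall e : R, 0 < e -> exists2 y, P y & rnorm (x - y) <= e) -> P x.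

Lemma closed_rclosed P : closed P <-> rclosed P.
Proof.
split=> [Pc x Px|Pc x Px].
  apply: Pc => U /nbhs_ballP[_ /= /gt0c[e e0 ->] eU].
  have e20 : 0 < e / 2 by rewrite divr_gt0.
  have [y Py xy] := Px _ e20; exists y; split=> //; apply: eU; apply/ball_rnorm.
  by apply: le_lt_trans xy _; lra.
apply: Pc => e e0; have [|y [Py /ball_rnorm xy]] := Px (ball x e%:C%C).
  by apply: nbhsx_ballx; rewrite ltcR.
by exists y => //; exact: ltW.
Qed.

(** The increments of [w] telescope to at most [t (k + m) - t k]. A bounded nondecreasing [t] is
    eventually within any e of its supremum, so [w] is Cauchy. *)
Lemma cvg_majorant (w : nat -> V) (t : nat -> R) (M : R) :
  (forall k, rnorm (w k.+1 - w k) <= t k.+1 - t k) -> (forall k, t k <= M) ->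
  exists l, forall e : R, 0 < e -> exists N, forall k, (N <= k)%N -> rnorm (l - w k) <= e.
Proof.
move=> wt tM.
have wtD k m : rnorm (w (k + m)%N - w k) <= t (k + m)%N - t k.
  elim: m => [|m IH]; first by rewrite addn0 !subrr rnorm0.
  rewrite addnS; apply: le_trans (rdistD (w (k + m)%N) _ _) _.
  by have := wt (k + m)%N; lra.
have tk k m : t k <= t (k + m)%N.
  by rewrite -subr_ge0; apply: le_trans (wtD k m); exact: rnorm_ge0.
have tsup : has_sup (range t).
  by split; [exists (t 0%N), 0%N|exists M => _ [k _ <-]].
have near_sup e : 0 < e -> exists N, forall k, t k - t N <= e.
  move=> e0; have [_ [N _ <-] Ne] := sup_adherent e0 tsup.
  exists N => k; have : t k <= sup (range t).
    by apply: sup_upper_bound tsup _ _; exists k.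
  lra.
have wcauchy e : 0 < e ->
    exists N, forall k l, (N <= k)%N -> (N <= l)%N -> rnorm (w k - w l) <= e.
  move=> e0; have e20 : 0 < e / 2 by rewrite divr_gt0.
  have [N HN] := near_sup _ e20; exists N => k l /subnKC <- /subnKC <-.
  apply: le_trans (rdistD (w N) _ _) _; rewrite (rdistC (w N)).
  have := wtD N (k - N)%N; have := wtD N (l - N)%N.
  have := HN (N + (k - N))%N; have := HN (N + (l - N))%N; lra.
have wC : cauchy (w @ \oo).
  apply/cauchy_rnormP => e e0; have e20 : 0 < e / 2 by rewrite divr_gt0.
  have [N HN] := wcauchy _ e20.
  exists (w @` [set k | (N <= k)%N], w @` [set k | (N <= k)%N]).
    by split; exists N => // k /= Nk; exists k.
  by move=> [_ _] /= [[k /= Nk <-] [l /= Nl <-]]; have := HN _ _ Nk Nl; lra.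
move: wC => /cauchy_cvg /cvg_ex[l wl].
exists l => e e0; move/cvg_rnormP : wl => /(_ _ e0)[N _ HN].
by exists N => k Nk; exact: HN.
Qed.

End Limits.

(** * Operator norm and positive operators *)

Section OpNorm.
Variables (R : realType) (H : hilbertType R).
Implicit Types (S T a b c : bop H) (u v : H).

Lemma rnormM_le S T : rnorm (S * T) <= rnorm S * rnorm T.
Proof. by have := normM_le S T; rewrite !normE -rmorphM lecR. Qed.

Lemma rnorm_star S : rnorm (star S) = rnorm S.
Proof. exact: rnorm_adjoint. Qed.

Lemma rnorm_starM S : rnorm (star S * S) = rnorm S ^+ 2.
Proof. by apply: complexI; rewrite rmorphXn /= -!normE; exact: cstar_norm. Qed.

Lemma rnorm1_le : rnorm (1 : bop H) <= 1.
Proof. by rewrite rnorm_bop; apply: opnorm_le => // x; rewrite mul1r. Qed.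

Lemma rnorm_bop_leP T (M : R) : 0 <= M ->
  (forall x, rnorm (T x) <= M * rnorm x) -> rnorm T <= M.
Proof. by move=> M0 TM; rewrite rnorm_bop; exact: opnorm_le. Qed.

Lemma rnormM_leM S T (s t : R) : rnorm S <= s -> rnorm T <= t -> rnorm (S * T) <= s * t.
Proof.
by move=> Ss Tt; apply: le_trans (rnormM_le _ _) _; rewrite ler_pM ?rnorm_ge0.
Qed.

Lemma rnormB S T : rnorm (S - T) <= rnorm S + rnorm T.
Proof. by have := rnormD S (- T); rewrite rnormN. Qed.

(* The generic norm lemmas, restated so that their instances mention the
   canonical structures of [bop H] syntactically. *)
Lemma bnormD S T : rnorm (S + T) <= rnorm S + rnorm T. Proof. exact: rnormD. Qed.
Lemma bnorm_ge0 S : 0 <= rnorm S. Proof. exact: rnorm_ge0. Qed.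
Lemma bnormN S : rnorm (- S) = rnorm S. Proof. exact: rnormN. Qed.
Lemma bdistC S T : rnorm (S - T) = rnorm (T - S). Proof. exact: rdistC. Qed.
Lemma bdistD T S U : rnorm (S - U) <= rnorm (S - T) + rnorm (T - U).
Proof. exact: rdistD. Qed.
Lemma bnormZr (l : R) S : rnorm (l%:C%C *: S) = `|l| * rnorm S. Proof. exact: rnormZr. Qed.
Lemma bnormB_sub S T : rnorm S - rnorm T <= rnorm (S - T). Proof. exact: rnormB_sub. Qed.

Lemma starD_ S T : star (S + T) = star S + star T. Proof. exact: starD. Qed.
Lemma starM_ S T : star (S * T) = star T * star S. Proof. exact: starM. Qed.
Lemma starZ_ (a : R[i]) S : star (a *: S) = (a^*)%C *: star S. Proof. exact: starZ. Qed.
Lemma starZr (a : R) S : star (a%:C%C *: S) = a%:C%C *: star S.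
Proof. by rewrite starZ_ conjc_real. Qed.
Lemma star0 : star (0 : bop H) = 0.
Proof. by have := starZ_ 0 (0 : bop H); rewrite conjc0 !scale0r. Qed.
Lemma starN S : star (- S) = - star S.
Proof. by apply/eqP; rewrite -addr_eq0 -starD_ addNr star0. Qed.
Lemma starB S T : star (S - T) = star S - star T.
Proof. by rewrite starD_ starN. Qed.
Lemma star1 : star (1 : bop H) = 1.
Proof. by apply: adjoint_uniq => u v; rewrite starS. Qed.
Definition starE := (starD_, starM_, starB, starN, starZr, star0, star1, @starK R (bop H)).

Definition sa T := star T = T.
Definition psd T := sa T /\ forall u, 0 <= rinner (T u) u.

Lemma saS T u v : sa T -> rinner (T u) v = rinner u (T v).
Proof. by move=> Ts; rewrite -rstarS Ts. Qed.

Lemma psd_starM S : psd (star S * S).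
Proof.
split=> [|u]; first by rewrite /sa !starE.
by rewrite bopME rstarS rinnerE sqr_ge0.
Qed.

Lemma psd_conj S T : psd T -> psd (star S * T * S).
Proof.
move=> [Ts T0]; split=> [|u]; first by rewrite /sa !starE Ts mulrA.
by rewrite !bopME rstarS.
Qed.

Lemma psd_sqr S : sa S -> psd (S * S).
Proof. by move=> Ss; have := psd_starM S; rewrite Ss. Qed.

Lemma psdD S T : psd S -> psd T -> psd (S + T).
Proof.
move=> [Ss S0] [Ts T0]; split=> [|u]; first by rewrite /sa starE Ss Ts.
by rewrite bopDE rinnerDl addr_ge0.
Qed.

Lemma psdZ (l : R) T : 0 <= l -> psd T -> psd (l%:C%C *: T).
Proof.
move=> l0 [Ts T0]; split=> [|u]; first by rewrite /sa starE Ts.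
by rewrite bopZE rinnerZl mulr_ge0.
Qed.

Lemma psd_real (l : R) : 0 <= l -> psd (l%:C%C *: (1 : bop H)).
Proof.
move=> l0; apply: psdZ => //.
by split=> [|u]; [rewrite /sa starE|rewrite bop1E rinnerE sqr_ge0].
Qed.

(** The discriminant argument for the semi-definite form of T, evaluated at u + s v. *)
Lemma psd_cauchy T u v : psd T -> rinner (T u) v ^+ 2 <= rinner (T u) u * rinner (T v) v.
Proof.
move=> [Ts T0]; set x := rinner _ _; set y := rinner _ _; set z := rinner _ _.
have E (s : R) : rinner (T (u + s%:C%C *: v)) (u + s%:C%C *: v) = y + 2 * s * x + s ^+ 2 * z.
  rewrite bopDr bopZr !rinnerDl !rinnerDr !rinnerZr !rinnerZl.
  rewrite (rinnerC (T v) u) -(saS u v Ts) -/x -/y -/z; ring.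
have y0 : 0 <= y by exact: T0.
have z0 : 0 <= z by exact: T0.
have [z_eq0|z_neq0] := eqVneq z 0.
  have [->|x0] := eqVneq x 0; first by rewrite expr0n mulr_ge0.
  (* The form vanishes at v, so it is affine in s along this line; this s would give it the value
     -1. *)
  have := T0 (u + (- (y + 1) / (2 * x))%:C%C *: v); rewrite E z_eq0 mulr0 addr0.
  by have -> : y + 2 * (- (y + 1) / (2 * x)) * x = - 1; [by field|rewrite ler0N1].
have := T0 (u + (- x / z)%:C%C *: v); rewrite E.
have -> : y + 2 * (- x / z) * x + (- x / z) ^+ 2 * z = (y * z - x ^+ 2) / z by field.
have zp : 0 < z by rewrite lt_neqAle eq_sym z_neq0.
by rewrite pmulr_lge0 ?invr_gt0 // subr_ge0.
Qed.

(** This is [psd_cauchy] at v = T u, divided by |T u|^2. *)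
Lemma psd_norm_sqr T (M : R) u : 0 <= M -> psd T ->
  (forall u, rinner (T u) u <= M * rnorm u ^+ 2) -> 
  rnorm (T u) ^+ 2 <= M * rinner (T u) u.
Proof.
move=> M0 Tp TM; have := psd_cauchy u (T u) Tp; rewrite rinnerE.
have := TM (T u); have := proj2 Tp u; set n := rnorm (T u) ^+ 2.
set y := rinner _ _; set z := rinner _ _ => y0 zM nyz.
have [->|n0] := eqVneq n 0; first by rewrite mulr_ge0.
have np : 0 < n by rewrite lt_neqAle eq_sym n0 sqr_ge0.
by rewrite -(ler_pM2r np); nra.
Qed.

(** For a positive operator the quadratic form controls the norm; this is how operator inequalities
    become norm estimates. *)
Lemma psd_norm_le T (M : R) : 0 <= M -> psd T ->
  (forall u, rinner (T u) u <= M * rnorm u ^+ 2) -> rnorm T <= M.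
Proof.
move=> M0 Tp TM; apply: rnorm_bop_leP => // x.
rewrite -(ler_pXn2r (n := 2)) ?nnegrE ?mulr_ge0 ?rnorm_ge0 // exprMn.
apply: le_trans (psd_norm_sqr x M0 Tp TM) _.
by rewrite [M ^+ 2]expr2 -mulrA ler_wpM2l.
Qed.

Lemma rinner_op_le T u : rinner (T u) u <= rnorm T * rnorm u ^+ 2.
Proof.
apply: le_trans (rinner_le _ _) _; rewrite expr2 mulrA ler_wpM2r ?rnorm_ge0 //.
exact: rnorm_bop_le.
Qed.

(* Operators [0 <= S <= T] in the operator order. *)
Lemma psd_le_norm S T : psd S -> psd (T - S) -> rnorm S <= rnorm T.
Proof.
move=> Sp [_ TS]; apply: psd_norm_le => //; first exact: rnorm_ge0.
move=> u; apply: le_trans (rinner_op_le T u).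
by have := TS u; rewrite bopDE bopNE rinnerDl rinnerNl subr_ge0.
Qed.

Lemma psd_anti T : psd T -> psd (- T) -> T = 0.
Proof.
move=> Tp [_ Tn]; apply: rnorm0_eq0; apply/eqP; rewrite eq_le rnorm_ge0 andbT.
apply: psd_norm_le => // u; rewrite mul0r.
by have := Tn u; rewrite bopNE rinnerNl oppr_ge0.
Qed.

End OpNorm.

(** * Square roots and inverses by iteration *)

Section Calculus.
Variables (R : realType) (H : hilbertType R).
Implicit Types (S T a b c q r x y z w d : bop H) (u v : H) (A : set (bop H)).

Definition cabs (l : R[i]) : R := complex.Re `|l|.

Lemma cabsE (l : R[i]) : `|l| = (cabs l)%:C%C.
Proof. by rewrite /cabs RRe_real // ger0_real. Qed.

Lemma cabs_ge0 l : 0 <= cabs l.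
Proof. by rewrite -ler0c -cabsE. Qed.

Lemma cabs_eq0 l : cabs l = 0 -> l = 0.
Proof. by move=> l0; apply/eqP; rewrite -normr_eq0 cabsE l0. Qed.

Lemma cabsM l m : cabs (l * m) = cabs l * cabs m.
Proof. by apply: complexI; rewrite rmorphM /= -!cabsE normrM. Qed.

Lemma cabsV l : cabs l^-1 = (cabs l)^-1.
Proof. by apply: complexI; rewrite fmorphV /= -!cabsE normfV. Qed.

Lemma cabs_real (l : R) : cabs l%:C%C = `|l|.
Proof. by rewrite /cabs normc_def /= expr0n /= addr0 sqrtr_sqr. Qed.

Lemma cabsD l m : cabs (l + m) <= cabs l + cabs m.
Proof. by rewrite -lecR rmorphD /= -!cabsE ler_normD. Qed.

Lemma cabsN l : cabs (- l) = cabs l.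
Proof. by rewrite /cabs normrN. Qed.

Lemma rnormZc l (V : normedModType R[i]) (x : V) : rnorm (l *: x) = cabs l * rnorm x.
Proof. exact: rnormZ. Qed.

Lemma rnorm_scal_le l : rnorm (l *: (1 : bop H)) <= cabs l.
Proof. by rewrite rnormZc ler_piMr ?cabs_ge0 ?rnorm1_le. Qed.

Lemma ler_eps (s t C : R) : 0 <= C -> (forall e, 0 < e -> s <= t + C * e) -> s <= t.
Proof.
move=> C0 st; apply/ler_addgt0Pl => e e0.
have C1 : 0 < C + 1 by rewrite ltr_wpDl.
have := st (e / (C + 1)) (divr_gt0 e0 C1).
have : C * (e / (C + 1)) <= e by rewrite mulrA ler_pdivrMr // mulrC ler_pM2l // lerDl.
by lra.
Qed.

Lemma rclosed_lip_eq (f : bop H -> bop H) (C : R) : 0 <= C ->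
  (forall x y, rnorm (f x - f y) <= C * rnorm (x - y)) -> rclosed [set x | f x = 0].
Proof.
move=> C0 fC x fx /=; apply: rnorm0_eq0; apply/eqP; rewrite eq_le rnorm_ge0 andbT.
apply: (ler_eps C0) => e e0; have [y fy xy] := fx e e0.
rewrite add0r -[f x]subr0 -fy; apply: le_trans (fC _ _) _.
by rewrite ler_wpM2l.
Qed.

Lemma rclosed_preim (f : bop H -> bop H) (C : R) A : 0 <= C ->
  (forall x y, rnorm (f x - f y) <= C * rnorm (x - y)) ->
  rclosed A -> rclosed [set x | A (f x)].
Proof.
move=> C0 fC Ac x fx; apply: Ac => e e0.
have C1 : 0 < C + 1 by rewrite ltr_wpDl.
have [y fy xy] := fx _ (divr_gt0 e0 C1); exists (f y) => //.
apply: le_trans (fC _ _) _; apply: (@le_trans _ _ ((C + 1) * rnorm (x - y))).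
  by rewrite ler_wpM2r ?rnorm_ge0 // lerDl.
by rewrite mulrC -ler_pdivlMr.
Qed.

Lemma rclosed_sa : rclosed [set x : bop H | star x = x].
Proof.
have := @rclosed_lip_eq (fun x => star x - x) 2 (ler0n _ _).
have -> : [set x : bop H | star x - x = 0] = [set x | star x = x].
  by apply/seteqP; split=> x /= => [/subr0_eq|->] //; rewrite subrr.
apply=> x y; have -> : star x - x - (star y - y) = star (x - y) - (x - y).
  by rewrite starB; bop_ring.
by apply: le_trans (rnormB _ _) _; rewrite rnorm_star mulr_natl mulr2n.
Qed.

Lemma rclosed_comm y : rclosed [set x | y * x = x * y].
Proof.
have := @rclosed_lip_eq (fun x => y * x - x * y) (2 * rnorm y).
have -> : [set x : bop H | y * x - x * y = 0] = [set x | y * x = x * y].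
  by apply/seteqP; split=> x /= => [/subr0_eq|->] //; rewrite subrr.
apply=> [|x z]; first by rewrite mulr_ge0 ?rnorm_ge0.
have -> : y * x - x * y - (y * z - z * y) = y * (x - z) - (x - z) * y by bop_ring.
apply: le_trans (rnormB _ _) _.
by have := rnormM_le y (x - z); have := rnormM_le (x - z) y; lra.
Qed.

Lemma csD A x y : is_csubalg A -> A x -> A y -> A (x + y).
Proof. by move=> Ac Ax Ay; rewrite -[x]scale1r; apply: csubZD Ac _ _ _ _ _. Qed.
Lemma csZ A (l : R[i]) x : is_csubalg A -> A x -> A (l *: x).
Proof. by move=> Ac Ax; rewrite -[_ *: _]addr0; apply: csubZD Ac _ _ _ _ (csub0 Ac). Qed.
Lemma csN A x : is_csubalg A -> A x -> A (- x).
Proof. by move=> Ac Ax; rewrite -scaleN1r; apply: csZ. Qed.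
Lemma csB A x y : is_csubalg A -> A x -> A y -> A (x - y).
Proof. by move=> Ac Ax Ay; apply: csD => //; apply: csN. Qed.
Lemma csM A x y : is_csubalg A -> A x -> A y -> A (x * y).
Proof. by move=> Ac; exact: csubM Ac _ _. Qed.
Lemma csS A x : is_csubalg A -> A x -> A (star x).
Proof. by move=> Ac; exact: csub_star Ac _. Qed.
Lemma csC A : is_csubalg A -> rclosed A.
Proof. by move=> Ac; apply/closed_rclosed; exact: csub_closed Ac. Qed.

Lemma csT : is_csubalg [set: bop H].
Proof. by split=> //; exact: closedT. Qed.

Lemma bopZD (s t : R[i]) x : (s + t) *: x = s *: x + t *: x. Proof. exact: scalerDl. Qed.

(** The equation says (1 - w)^2 = 1 - z. It is solved by iterating y -> (z + y^2) / 2 from 0,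
    dominated by the scalar iteration for z = 1, which stays below 1. The last clause is the
    induction principle of the iteration; it places w in subalgebras, in commutants and among the
    self-adjoint elements. *)
Lemma sqrt_fix z : rnorm z <= 1 -> exists w, [/\ w = (2^-1)%:C%C *: (z + w * w),
  rnorm w <= 1 & forall A, rclosed A -> A 0 ->
    (forall y, A y -> A ((2^-1)%:C%C *: (z + y * y))) -> A w].
Proof.
move=> z1; pose F y := (2^-1)%:C%C *: (z + y * y).
pose w k := iter k F 0; pose t k := iter k (fun s : R => (1 + s ^+ 2) / 2) 0.
have t01 k : 0 <= t k <= 1.
  by elim: k => [|k /andP[t0 t1]] /=; [rewrite lexx ler01|apply/andP; split; nra].
have FB x y : F x - F y = (2^-1)%:C%C *: (x * (x - y) + (x - y) * y).
  by rewrite /F; bop_ring.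
have n2 : `|2^-1 : R| = 2^-1 by rewrite ger0_norm ?invr_ge0.
have FB_le x y (s t' r : R) : rnorm x <= s -> rnorm y <= t' -> rnorm (x - y) <= r ->
    rnorm (F x - F y) <= (s + t') * r / 2.
  move=> xs yt xyr; rewrite FB rnormZr n2 mulrC ler_wpM2r ?invr_ge0 //.
  apply: le_trans (rnormD _ _) _.
  by have := rnormM_leM xs xyr; have := rnormM_leM xyr yt; lra.
have wt k : rnorm (w k) <= t k.
  elim: k => [|k IH] /=; first by rewrite rnorm0.
  rewrite /F rnormZr n2 mulrC ler_wpM2r ?invr_ge0 //.
  apply: le_trans (rnormD _ _) _; rewrite lerD // expr2; exact: rnormM_leM.
have wS k : rnorm (w k.+1 - w k) <= t k.+1 - t k.
  elim: k => [|k IH].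
    rewrite /= /F mulr0 addr0 !subr0 rnormZr n2 expr0n /= addr0 mulrC.
    by rewrite ler_wpM2r ?invr_ge0.
  have -> : t k.+2 - t k.+1 = (t k.+1 + t k) * (t k.+1 - t k) / 2.
    by rewrite /=; field.
  exact: (FB_le (w k.+1) (w k) _ _ _ (wt _) (wt _) IH).
have [|l wl] := @cvg_majorant _ _ w t 1 wS; first by move=> k; case/andP: (t01 k).
have w1 k : rnorm (w k) <= 1 by apply: le_trans (wt k) _; case/andP: (t01 k).
have l1 : rnorm l <= 1.
  apply: (@ler_eps _ _ 1) => // e /wl[N /(_ N (leqnn _))].
  by have := rnormB_sub l (w N); have := w1 N; lra.
exists l; split=> //.
  apply/eqP; rewrite -subr_eq0; apply/eqP/rnorm0_eq0/eqP.
  rewrite eq_le rnorm_ge0 andbT; apply: (@ler_eps _ _ 2) => // e /wl[N HN].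
  apply: le_trans (rdistD (w N.+1) _ _) _.
  have := HN N.+1 (leqnSn _); have := FB_le _ _ _ _ _ (w1 N) l1 (lexx (rnorm (w N - l))).
  by have := HN N (leqnn _); rewrite (rdistC l (w N)) -/(F l) -[w N.+1]/(F (w N)); lra.
move=> A Ac A0 AF; apply: Ac => e /wl[N /(_ N (leqnn _)) HN]; exists (w N) => //.
by elim: {HN} N => //= k; exact: AF.
Qed.

(** The Neumann series, written as the iteration y -> 1 + z y so that it has the same kind of
    induction principle as [sqrt_fix]. That principle also makes the limit commute with z, which
    yields a two-sided inverse. *)
Lemma neumann z : rnorm z < 1 -> exists d, [/\ (1 - z) * d = 1, d * (1 - z) = 1 &
  forall A, rclosed A -> A 0 -> (forall y, A y -> A (1 + z * y)) -> A d].
Proof.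
move=> z1; set r := rnorm z in z1.
have r0 : 0 <= r by exact: rnorm_ge0.
have r1 : 0 < 1 - r by rewrite subr_gt0.
pose F y := 1 + z * y.
(* [t k] is minus the tail of the geometric series, so its increments are [r ^+ k]. *)
pose w k := iter k F 0; pose t k : R := - r ^+ k / (1 - r).
have FB x y : F x - F y = z * (x - y) by rewrite /F; bop_ring.
have wS k : rnorm (w k.+1 - w k) <= t k.+1 - t k.
  have -> : t k.+1 - t k = r ^+ k.
    by rewrite /t exprS; field; rewrite gt_eqF.
  elim: k => [|k IH].
    by rewrite /= /F mulr0 addr0 subr0 expr0 rnorm1_le.
  by rewrite -[w k.+2]/(F (w k.+1)) -[w k.+1 in X in _ - X]/(F (w k)) FB exprS rnormM_leM.
have [|l wl] := @cvg_majorant _ _ w t 0 wS.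
  by move=> k; rewrite /t mulNr oppr_le0 divr_ge0 ?exprn_ge0 // ltW.
have lP A : rclosed A -> A 0 -> (forall y, A y -> A (1 + z * y)) -> A l.
  move=> Ac A0 AF; apply: Ac => e /wl[N /(_ N (leqnn _)) HN]; exists (w N) => //.
  by elim: {HN} N => //= k; exact: AF.
have lF : l = 1 + z * l.
  apply/eqP; rewrite -subr_eq0; apply/eqP/rnorm0_eq0/eqP.
  rewrite eq_le rnorm_ge0 andbT; apply: (@ler_eps _ _ 2) => // e /wl[N HN].
  apply: le_trans (rdistD (w N.+1) _ _) _.
  rewrite -/(F l) -[w N.+1]/(F (w N)) FB.
  have := rnormM_leM (ltW z1) (lexx (rnorm (w N - l))); rewrite mul1r (rdistC (w N)).
  by have := HN N (leqnn _); have := HN N.+1 (leqnSn _); rewrite -[w N.+1]/(F (w N)); lra.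
have zl : z * l = l * z.
  apply: (lP [set x | z * x = x * z]) => /=; first exact: rclosed_comm.
    by rewrite mulr0 mul0r.
  by move=> y zy; rewrite mulrDr mulrDl mulr1 mul1r -mulrA -zy.
by exists l; split=> //; rewrite ?mulrBl ?mulrBr ?mul1r ?mulr1 -?zl {1}lF addrK.
Qed.

End Calculus.

Notation "l %:B" := (l%:C%C *: (1 : bop _)) (at level 1, left associativity, format "l %:B") : ring_scope.

Notation "l %:I" := (l *: (1 : bop _)) (at level 1, left associativity, format "l %:I") : ring_scope.

(** * Positive square roots, inverses and positive parts inside a subalgebra *)

Section PositiveCalculus.
Variables (R : realType) (H : hilbertType R).
Implicit Types (S T a b c q r x y z w d : bop H) (u v : H) (A : set (bop H)).

Lemma psd1 : psd (1 : bop H).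
Proof. by have := @psd_real R H 1 ler01; rewrite scale1r. Qed.

Lemma rinner_scal (l : R) u : rinner (l%:B u) u = l * rnorm u ^+ 2.
Proof. by rewrite bopZE bop1E rinnerZl rinnerE. Qed.

Lemma scal1M (l : R[i]) x : (l *: (1 : bop H)) * x = l *: x.
Proof. by rewrite bopZAl mul1r. Qed.

Lemma scalM1 (l : R[i]) x : x * (l *: (1 : bop H)) = l *: x.
Proof. by rewrite bopZAr mulr1. Qed.

(** Dividing by M makes z = 1 - q / M a positive contraction. With w from [sqrt_fix], the root is 1
    - w times the root of M. *)
Lemma psd_sqrt A q : is_csubalg A -> A 1 -> A q -> psd q ->
  exists r, [/\ psd r, A r, r * r = q & forall y, y * q = q * y -> y * r = r * y].
Proof.
move=> Ac A1 Aq [qs q0]; pose M := rnorm q + 1.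
have M0 : 0 < M by rewrite ltr_wpDl ?rnorm_ge0.
pose z : bop H := 1 - M^-1%:C%C *: q.
have MN0 : 0 <= M^-1 by rewrite invr_ge0 ltW.
have qu u : 0 <= rinner ((M^-1%:C%C *: q) u) u <= rnorm u ^+ 2.
  rewrite bopZE rinnerZl mulr_ge0 //= mulrC ler_pdivrMr // mulrC.
  by apply: le_trans (rinner_op_le q u) _; rewrite ler_wpM2r ?sqr_ge0 // lerDl.
have zs : star z = z by rewrite /z !starE qs.
have zu u : rinner (z u) u = rnorm u ^+ 2 - rinner ((M^-1%:C%C *: q) u) u.
  by rewrite /z bopDE bopNE bop1E rinnerDl rinnerNl rinnerE.
have z1 : rnorm z <= 1.
  apply: psd_norm_le => //; first by split=> // u; rewrite zu subr_ge0; case/andP: (qu u).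
  by move=> u; rewrite zu mul1r gerBl; case/andP: (qu u).
have [w [wE w1 wP]] := sqrt_fix z1.
have ws : star w = w.
  apply: (wP [set x | star x = x]) => /=; first exact: rclosed_sa.
    by rewrite star0.
  by move=> y ys; rewrite starZr starD_ zs starM_ ys.
have Aw : A w.
  apply: wP; [exact: csC|exact: csub0 Ac|move=> y Ay].
  apply: csZ => //; apply: csD => //; last exact: csM.
  by apply: csB => //; apply: csZ.
pose m := Num.sqrt M.
have mm : m * m = M by rewrite -expr2 sqr_sqrtr ?ltW.
exists (m%:C%C *: (1 - w)); split.
- apply: psdZ; first exact: sqrtr_ge0.
  split=> [|u]; first by rewrite /sa !starE ws.
  rewrite bopDE bopNE bop1E rinnerDl rinnerNl rinnerE subr_ge0.
  by apply: le_trans (rinner_op_le w u) _; rewrite ler_piMl ?sqr_ge0.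
- by apply: csZ => //; apply: csB.
- have w2 : w + w = z + w * w.
    rewrite {1 2}wE -scalerDl -rmorphD /= (_ : 2^-1 + 2^-1 = 1) ?scale1r //.
    by field.
  have -> : (m%:C%C *: (1 - w)) * (m%:C%C *: (1 - w)) =
            (m * m)%:C%C *: (1 - (w + w) + w * w) by rewrite rmorphM /=; bop_ring.
  rewrite w2 mm (_ : 1 - (z + w * w) + w * w = M^-1%:C%C *: q); last by rewrite /z; bop_ring.
  by rewrite scalerA -rmorphM /= mulfV ?gt_eqF // scale1r.
- move=> y yq; rewrite bopZAr bopZAl mulrBr mulrBl mulr1 mul1r; congr (_ *: (_ - _)).
  apply: (wP [set x | y * x = x * y]) => /=; first exact: rclosed_comm.
    by rewrite mulr0 mul0r.
  move=> x yx; rewrite bopZAr bopZAl mulrDr mulrDl /z mulrBr mulrBl mulr1 mul1r.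
  by rewrite bopZAr bopZAl yq mulrA yx -!mulrA yx.
Qed.

(** With s the root of S, the product equals s T s. *)
Lemma mul_psd S T : psd S -> psd T -> S * T = T * S -> psd (S * T).
Proof.
move=> Sp Tp ST; have [s [sp _ ss sc]] := psd_sqrt (csT H) I I Sp.
have Ts : T * s = s * T by exact: sc.
have -> : S * T = star s * T * s by rewrite (proj1 sp) -mulrA Ts mulrA ss.
exact: psd_conj.
Qed.

Lemma bounded_below_inj T (t : R) u : 0 < t ->
  (forall u, t * rnorm u <= rnorm (T u)) -> T u = 0 -> u = 0.
Proof.
move=> t0 Tt Tu; apply: rnorm0_eq0; apply/eqP; rewrite eq_le rnorm_ge0 andbT.
by have := Tt u; rewrite Tu rnorm0 pmulr_rle0.
Qed.

Lemma psd_geS c (t : R) u : psd (c - t%:B) -> t * rnorm u ^+ 2 <= rinner (c u) u.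
Proof.
by move=> [_ /(_ u)]; rewrite bopDE bopNE rinnerDl rinnerNl rinner_scal subr_ge0.
Qed.

Lemma psd_ge_norm c (t : R) u : psd (c - t%:B) -> t * rnorm u <= rnorm (c u).
Proof.
move=> ct; have [->|u0] := eqVneq (rnorm u) 0; first by rewrite mulr0 rnorm_ge0.
have {}u0 : 0 < rnorm u by rewrite lt_neqAle eq_sym u0 rnorm_ge0.
rewrite -(ler_pM2r u0); apply: le_trans (rinner_le _ _).
by rewrite -mulrA -expr2; exact: psd_geS.
Qed.

(** From c >= t, the operator 1 - c / M has norm at most 1 - t / M < 1, so a Neumann series inverts
    c / M. *)
Lemma psd_inv A c (t : R) : is_csubalg A -> A 1 -> A c -> 0 < t -> sa c ->
  psd (c - t%:B) ->
  exists d, [/\ c * d = 1, d * c = 1, A d, psd d & rnorm d <= t^-1] .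
Proof.
move=> Ac A1 Acc t0 cs ct; pose M := rnorm c + t.
have M0 : 0 < M by rewrite ltr_wpDl ?rnorm_ge0.
pose z : bop H := 1 - M^-1%:C%C *: c.
have zs : star z = z by rewrite /z !starE cs.
have zu u : rinner (z u) u = rnorm u ^+ 2 - M^-1 * rinner (c u) u.
  by rewrite /z bopDE bopNE bop1E bopZE rinnerDl rinnerNl rinnerZl rinnerE.
have cu u : rinner (c u) u <= M * rnorm u ^+ 2.
  apply: le_trans (rinner_op_le c u) _; rewrite ler_wpM2r ?sqr_ge0 //.
  by rewrite lerDl ltW.
have z1 : rnorm z <= 1 - t / M.
  apply: psd_norm_le.
  - by rewrite subr_ge0 ler_pdivrMr // mul1r lerDr rnorm_ge0.
  - split=> // u; rewrite zu subr_ge0 mulrC ler_pdivrMr // mulrC; exact: cu.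
  - move=> u; rewrite zu mulrBl mul1r lerD2l lerN2 [t / M]mulrC -mulrA.
    by apply: ler_wpM2l; [rewrite invr_ge0 ltW|exact: psd_geS].
have z1' : rnorm z < 1 by apply: le_lt_trans z1 _; rewrite ltrBlDr ltrDl divr_gt0.
have [d [zd dz dP]] := neumann z1'.
have zE : 1 - z = M^-1%:C%C *: c by rewrite /z opprB addrC subrK.
rewrite zE bopZAl -bopZAr in zd; rewrite zE bopZAr -bopZAl in dz.
set e := M^-1%:C%C *: d in zd dz.
have es : star e = e.
  have : star e * c = 1 by rewrite -{1}cs -starM_ zd star1.
  by move=> h; rewrite -[star e]mulr1 -zd mulrA h mul1r.
have eu v : rinner (e v) v = rinner (c (e v)) (e v).
  by have /(congr1 (fun x : bop H => x v)) := zd; rewrite bopME bop1E => {2}<-;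
    rewrite rinnerC.
exists e; split=> //.
- apply: csZ => //; apply: dP; [exact: csC|exact: csub0 Ac|move=> y Ay].
  by apply: csD => //; apply: csM => //; apply: csB => //; exact: csZ.
- split=> // v; rewrite eu; apply: le_trans (psd_geS _ ct).
  by rewrite mulr_ge0 ?sqr_ge0 // ltW.
- apply: rnorm_bop_leP => [|v]; first by rewrite invr_ge0 ltW.
  rewrite mulrC ler_pdivlMr // mulrC; apply: le_trans (psd_ge_norm (e v) ct) _.
  by have /(congr1 (fun x : bop H => x v)) := zd; rewrite bopME bop1E => ->.
Qed.

Lemma bounded_below_psd b (t : R) : 0 <= t -> (forall u, t * rnorm u <= rnorm (b u)) ->
  psd (star b * b - (t ^+ 2)%:B).
Proof.
move=> t0 bt; split=> [|u]; first by rewrite /sa !starE.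
rewrite bopDE bopNE rinnerDl rinnerNl rinner_scal bopME rstarS rinnerE subr_ge0.
by rewrite -exprMn ler_pXn2r ?nnegrE ?mulr_ge0 ?rnorm_ge0.
Qed.

(** Both [star b * b] and [b * star b] are bounded below, hence invertible. One gives a left inverse
    of b, the other a right inverse, and the two agree. *)
Lemma inv_bounded_below A b (t : R) : is_csubalg A -> A 1 -> A b -> 0 < t ->
  (forall u, t * rnorm u <= rnorm (b u)) ->
  (forall u, t * rnorm u <= rnorm (star b u)) ->
  exists d, [/\ b * d = 1, d * b = 1 & A d].
Proof.
move=> Ac A1 Ab t0 bt bst; have t20 : 0 < t ^+ 2 by rewrite exprn_gt0.
have [||d [_ dl Ad _ _]] := psd_inv Ac A1 _ t20 _ (bounded_below_psd (ltW t0) bt).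
- by apply: csM => //; exact: csS.
- by rewrite /sa !starE.
have := bounded_below_psd (ltW t0) bst; rewrite starK => bsp.
have [||e [er _ Ae _ _]] := psd_inv Ac A1 _ t20 _ bsp.
- by apply: csM => //; exact: csS.
- by rewrite /sa !starE.
rewrite mulrA in dl; rewrite -mulrA in er.
have de : d * star b = star b * e.
  by rewrite -[LHS]mulr1 -er mulrA dl mul1r.
exists (d * star b); split=> //; first by rewrite de.
by apply: csM => //; exact: csS.
Qed.

(** The model is c = (r - a) / 2 with r the absolute value of a, for which c^2 = r c. Positivity is
    obtained without spectral theory. *)
Lemma psd_half r c : psd r -> sa c -> r * c = c * r -> c * c = r * c -> psd c.
Proof.
move=> rp cs rc cc; split=> // u; have rs := proj1 rp.
suff: - rinner (c u) u <= 0 by rewrite oppr_le0.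
apply: (@ler_eps _ _ _ (rnorm u ^+ 2)); first exact: sqr_ge0.
move=> e e0; rewrite add0r.
have res : sa (r + e%:B) by rewrite /sa !starE rs.
have rep : psd (r + e%:B - e%:B) by rewrite addrK.
have [d [rd _ _ _ _]] := psd_inv (csT H) I I e0 res rep.
(* Write u = (r + e) v. In <c u, u> only the term e^2 <c v, v> can be negative; it is at least -e^2
   |r v| |v|, hence at least -e |u|^2. *)
have uE : u = (r + e%:B) (d u).
  by have /(congr1 (fun x : bop H => x u)) := rd; rewrite bopME bop1E.
set v := d u in uE; rewrite {}uE bopDE bopZE bop1E bopDr bopZr rnormD_sqr.
have crv : c (r v) = c (c v) by rewrite -!bopME cc rc.
have rcv : r (c v) = c (c v) by rewrite -!bopME cc.
rewrite rnormZr (gtr0_norm e0) !rinnerDl !rinnerDr !rinnerZl !rinnerZr crv.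
rewrite (_ : rinner (c (c v)) (r v) = rinner (r (c v)) (c v)); last first.
  by rewrite saS // crv rcv rinnerC.
rewrite (_ : rinner (c (c v)) v = rnorm (c v) ^+ 2); last by rewrite (saS _ _ cs) rinnerE.
rewrite (_ : rinner (c v) (r v) = rnorm (c v) ^+ 2); last first.
  by rewrite -(saS _ _ rs) rcv (saS _ _ cs) rinnerE.
have h1 : 0 <= rinner (r (c v)) (c v) by case: rp.
have h2 : 0 <= rinner (r v) v by case: rp.
have cr : rnorm (c v) <= rnorm (r v).
  have : rnorm (c v) ^+ 2 <= rnorm (c v) * rnorm (r v).
    by rewrite -[leLHS]rinnerE (saS _ _ cs) -rcv -(saS _ _ rs) rinnerC rinner_le.
  have := rnorm_ge0 (c v); have := rnorm_ge0 (r v).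
  by move: (rnorm _) (rnorm _) => x y; nra.
have h3 : - rinner (c v) v <= rnorm (r v) * rnorm v.
  rewrite -rinnerNl; apply: le_trans (rinner_le _ _) _.
  by rewrite rnormN ler_wpM2r ?rnorm_ge0.
have h4 := rnorm_ge0 v; have h5 := rnorm_ge0 (r v); have h6 := sqr_ge0 (rnorm (c v)).
rewrite exprMn; move: h1 h2 h3 h4 h5 h6.
move: (rinner _ (c v)) (rinner _ v) (rinner _ v) (rnorm (r v)) (rnorm v) (rnorm (c v)).
move=> p s q x y m p0 q0 sx x0 y0 m0.
have h7 : 0 <= (x - e * y) ^+ 2 by exact: sqr_ge0.
have h8 : 0 <= e * (x - e * y) ^+ 2 by apply: mulr_ge0; [exact: ltW|exact: sqr_ge0].
have e0' := ltW e0; have ee : 0 <= e * e by exact: mulr_ge0.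
have h9 : e * e * (- s) <= e * e * (x * y) by rewrite ler_wpM2l.
have h10 : 0 <= e * m ^+ 2 by apply: mulr_ge0.
have h11 : 0 <= e * e * q by rewrite !mulr_ge0.
have h12 : 0 <= e * e * (x * y) by rewrite !mulr_ge0.
nra.
Qed.

(** The absolute value r is the root of a^2. [psd_half] applies to half of r - a because (r - a)^2 =
    2 r (r - a). *)
Lemma abs_ex A a : is_csubalg A -> A 1 -> A a -> sa a ->
  exists r, [/\ psd r, A r, r * r = a * a, psd (r - a) &
    forall y, y * a = a * y -> y * r = r * y].
Proof.
move=> Ac A1 Aa sa_a.
have [r [rp Ar rr rc]] := psd_sqrt Ac A1 (csM Ac Aa Aa) (psd_sqr sa_a).
have ra : a * r = r * a by apply: rc; rewrite mulrA.
exists r; split=> //.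
- have h : psd ((2^-1)%:C%C *: (r - a)).
    apply: (psd_half rp).
    + by rewrite /sa !starE (proj1 rp) sa_a.
    + by rewrite bopZAr bopZAl mulrBr mulrBl ra.
    + have E : (r - a) * (r - a) = 2%:R%:C%C *: (r * (r - a)).
        rewrite (_ : (r - a) * (r - a) = r * r - r * a - a * r + a * a); last by bop_ring.
        by rewrite ra -rr rmorph_nat; bop_ring.
      rewrite bopZAr bopZAl scalerA E scalerA -!rmorphM /= bopZAr.
      by rewrite -mulrA mulVf ?pnatr_eq0 // mulr1.
  have := psdZ (ler0n _ 2) h; rewrite scalerA -rmorphM /= mulfV ?pnatr_eq0 //.
  by rewrite scale1r.
- by move=> y ya; apply: rc; rewrite mulrA ya -mulrA ya mulrA.
Qed.

(** With r the absolute value of a, the witness is the positive part (r + a) / 2, and c - a is the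
    negative part (r - a) / 2. *)
Lemma posp_ex A a : is_csubalg A -> A 1 -> A a -> sa a ->
  exists c, [/\ psd c, psd (c - a), c * (c - a) = 0, A c &
    forall y, y * a = a * y -> y * c = c * y].
Proof.
move=> Ac A1 Aa sa_a; have [r [rp Ar rr ra rc]] := abs_ex Ac A1 Aa sa_a.
have ar : a * r = r * a by exact: rc.
have rn : psd (r + a).
  have := @psd_half r ((2^-1)%:C%C *: (r + a)) rp.
  have E : (r + a) * (r + a) = 2%:R%:C%C *: (r * (r + a)).
    rewrite (_ : (r + a) * (r + a) = r * r + r * a + a * r + a * a); last by bop_ring.
    by rewrite ar -rr rmorph_nat; bop_ring.
  case=> [||| _ h].
  - by rewrite /sa !starE (proj1 rp) sa_a.
  - by rewrite bopZAr bopZAl mulrDr mulrDl ar.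
  - rewrite bopZAr bopZAl scalerA E scalerA -!rmorphM /= bopZAr.
    by rewrite -mulrA mulVf ?pnatr_eq0 // mulr1.
  split=> [|u]; first by rewrite /sa starE (proj1 rp) sa_a.
  by have := h u; rewrite bopZE rinnerZl pmulr_rge0 // invr_gt0.
have h0 : (0 : R) <= 2^-1 by rewrite invr_ge0.
have h1 : (2^-1)%:C%C *: (r + a) - a = (2^-1)%:C%C *: (r - a).
  apply: (@scalerI _ _ (2%:R : R[i])); first by rewrite pnatr_eq0.
  rewrite scalerBr !scalerA rmorphV ?unitfE ?pnatr_eq0 // rmorph_nat mulfV ?pnatr_eq0 //.
  by rewrite !scale1r; bop_ring.
exists ((2^-1)%:C%C *: (r + a)); split.
- exact: psdZ.
- by rewrite h1; exact: psdZ.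
- rewrite h1 bopZAl bopZAr mulrDl !mulrBr rr ar.
  by rewrite (_ : _ + _ = 0) ?scaler0 //; bop_ring.
- by apply: csZ => //; exact: csD.
- by move=> y ya; rewrite bopZAr bopZAl mulrDr mulrDl ya rc.
Qed.

End PositiveCalculus.

(** * Adjoining the identity operator to a subalgebra *)

Section Unitization.
Variables (R : realType) (H : hilbertType R).
Implicit Types (S T : set (bop H)) (a b c x y z w d : bop H) (u v : H).

(** The scalars are those of B(H): nothing is added when S contains the identity operator, while a
    unit of S other than the identity stays a projection different from 1. *)
Definition adj1 S : set (bop H) := [set z | exists x l, S x /\ z = x + l%:I].

Lemma adj1_sub S x : is_csubalg S -> S x -> adj1 S x.
Proof. by move=> Sc Sx; exists x, 0; rewrite scale0r addr0. Qed.

Lemma adj1_scal S (l : R[i]) : is_csubalg S -> adj1 S (l%:I).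
Proof. by move=> Sc; exists 0, l; rewrite add0r; split=> //; exact: csub0 Sc. Qed.

Lemma adj1_1 S : is_csubalg S -> adj1 S 1.
Proof. by move=> Sc; rewrite -[1]scale1r; exact: adj1_scal. Qed.

Lemma adj1_idem S : is_csubalg S -> S 1 -> adj1 S = S.
Proof.
move=> Sc S1; apply/seteqP; split=> z; last exact: adj1_sub.
by move=> [x [l [Sx ->]]]; apply: csD => //; exact: csZ.
Qed.

(** An x in S at distance below 1 from the identity has a Neumann inverse d, and the induction
    principle of the series puts d x = 1 into S. *)
Lemma dist_one_ge1 S x : is_csubalg S -> ~ S 1 -> S x -> 1 <= rnorm (1 - x).
Proof.
move=> Sc S1 Sx; case: lerP => // x1; exfalso; apply: S1.
have [d [_ dx dP]] := neumann x1.
suff : S (d * x) by move: dx; rewrite subKr => ->.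
apply: (dP [set w | S (w * x)]) => /=.
- apply: (@rclosed_preim _ _ _ (rnorm x)); [exact: rnorm_ge0| |exact: csC].
  by move=> y z; rewrite -mulrBl mulrC; exact: rnormM_le.
- by rewrite mul0r; exact: csub0 Sc.
- move=> y Syx; rewrite mulrDl mul1r mulrBl mul1r mulrBl -mulrA.
  by apply: csD => //; apply: csB => //; apply: csM.
Qed.

(** A rescaling of [dist_one_ge1]: the scalar part is a contractive functional, so limits can be
    taken in the two summands separately. *)
Lemma cabs_le_adj1 S x (l : R[i]) : is_csubalg S -> ~ S 1 -> S x ->
  cabs l <= rnorm (x + l%:I).
Proof.
move=> Sc S1 Sx; have [->|l0] := eqVneq l 0.
  by rewrite /cabs normr0 rnorm_ge0.
have -> : x + l%:I = l *: (1 - (- (l^-1 *: x))).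
  by rewrite opprK scalerDr scalerA mulfV // scale1r addrC.
rewrite rnormZc ler_peMr ?cabs_ge0 //; apply: (@dist_one_ge1 S) => //.
by apply: csN => //; exact: csZ.
Qed.

Lemma adj1_uniq S x y (l m : R[i]) : is_csubalg S -> ~ S 1 -> S x -> S y ->
  x + l%:I = y + m%:I -> x = y /\ l = m.
Proof.
move=> Sc S1 Sx Sy xy.
have lm : l = m.
  apply/eqP; rewrite -subr_eq0; apply/eqP/cabs_eq0/eqP; rewrite eq_le cabs_ge0 andbT.
  have := cabs_le_adj1 (l - m) Sc S1 (csB Sc Sx Sy).
  rewrite (_ : x - y + (l - m)%:I = 0) ?rnorm0 //.
  by rewrite scalerBl addrACA -opprD xy subrr.
by split=> //; move: xy; rewrite lm => /addIr.
Qed.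

(** If S contains 1, all of z is put into S and the scalar is 0; otherwise [cabs_le_adj1] bounds the
    scalar. *)
Lemma adj1_decomp S z : is_csubalg S -> adj1 S z ->
  exists x l, [/\ S x, z = x + l%:I & cabs l <= rnorm z].
Proof.
move=> Sc [x [l [Sx ->]]]; have [S1|S1] := pselect (S 1).
  exists (x + l%:I), 0; rewrite scale0r addr0; split=> //.
    by apply: csD => //; exact: csZ.
  by rewrite /cabs normr0 rnorm_ge0.
by exists x, l; split=> //; exact: (cabs_le_adj1 l Sc S1 Sx).
Qed.

(** The phase of the inner product is absorbed into v, which reduces to the inequality for real
    parts. *)
Lemma cabs_inner_le (v w : H) : cabs (inner v w) <= rnorm v * rnorm w.
Proof.
have [->|v0] := eqVneq (inner v w) 0.
  by rewrite /cabs normr0 mulr_ge0 ?rnorm_ge0.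
pose m := inner v w; pose f := ((cabs m)^-1%:C%C * (m^*)%C).
have c0 : 0 < cabs m.
  by rewrite lt_neqAle cabs_ge0 andbT eq_sym; apply: contra v0 => /eqP/cabs_eq0 h; apply/eqP.
have fm : f * m = (cabs m)%:C%C.
  rewrite /f -mulrA [_ * m]mulrC -sqr_normc cabsE -rmorphXn -rmorphM /=.
  by congr (_%:C%C); field; rewrite gt_eqF.
have := rinner_le (f *: v) w; rewrite rnormZc /rinner innerZl fm /=.
suff -> : cabs f = 1 by rewrite mul1r.
rewrite /f cabsM cabs_real ger0_norm ?invr_ge0 ?cabs_ge0 //.
by rewrite [cabs (m^*)%C]/cabs normcJ mulVf // gt_eqF.
Qed.

(** The coefficient of a limit L is read off at a vector u for which b u has norm 1. *)
Lemma rclosed_line b : rclosed [set l *: b | l in [set: R[i]]].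
Proof.
move=> L HL; have [h|b0] := pselect (b = 0).
  exists 0 => //; rewrite scale0r; apply/esym/rnorm0_eq0/eqP; rewrite eq_le rnorm_ge0 andbT.
  apply: (@ler_eps _ _ _ 1) => // e /HL[_ [l _ <-]].
  by rewrite h scaler0 subr0 mul1r add0r.
have [u bu] : exists u, rnorm (b u) = 1.
  have [u u0] : exists u, b u <> 0.
    apply: contrapT => /forallNP u0; apply: b0; apply: bopP => u.
    by rewrite bop0E; exact: contrapT (u0 u).
  have nu : 0 < rnorm (b u).
    by rewrite lt_neqAle rnorm_ge0 andbT eq_sym; apply/eqP => /rnorm0_eq0.
  exists ((rnorm (b u))^-1%:C%C *: u).
  by rewrite bopZr rnormZr ger0_norm ?invr_ge0 ?ltW // mulVf // gt_eqF.
exists (inner (L u) (b u)) => //; apply/eqP; rewrite -subr_eq0; apply/eqP/rnorm0_eq0/eqP.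
rewrite eq_le rnorm_ge0 andbT; apply: (@ler_eps _ _ _ (rnorm u * rnorm b + 1)).
  by rewrite addr_ge0 ?mulr_ge0 ?rnorm_ge0.
move=> e e0; have [_ [l _ <-] Le] := HL e e0.
rewrite add0r; apply: le_trans (rdistD (l *: b) _ _) _.
rewrite (rdistC _ L) -scalerBl rnormZc mulrDl mul1r; apply: lerD => //.
have : cabs (inner (L u) (b u) - l) <= e * rnorm u.
  have -> : inner (L u) (b u) - l = inner ((L - l *: b) u) (b u).
    rewrite bopDE bopNE bopZE innerDl innerNl innerZl inner_norm normE bu.
    by rewrite expr1n mulr1.
  apply: le_trans (cabs_inner_le _ _) _; rewrite bu mulr1.
  by apply: le_trans (rnorm_bop_le _ _) _; rewrite ler_wpM2r ?rnorm_ge0.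
move=> h; apply: le_trans (ler_wpM2r (rnorm_ge0 b) h) _.
by rewrite -[leLHS]mulrA [leLHS]mulrC.
Qed.

Lemma rclosed_scal : rclosed [set l *: (1 : bop H) | l in [set: R[i]]].
Proof. exact: rclosed_line. Qed.

Lemma adj1_csubalg S : is_csubalg S -> is_csubalg (adj1 S).
Proof.
move=> Sc; have [S1|S1] := pselect (S 1); first by rewrite adj1_idem.
split.
- exact: adj1_sub (csub0 Sc).
- move=> c _ _ [x [l [Sx ->]]] [y [m [Sy ->]]]; exists (c *: x + y), (c * l + m).
  split; first exact: csubZD Sc _ _ _ _ _.
  by rewrite scalerDr scalerDl scalerA addrACA.
- move=> _ _ [x [l [Sx ->]]] [y [m [Sy ->]]].
  exists (x * y + l *: y + m *: x), (l * m); split.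
    by apply: csD; [|apply: csD|]; rewrite //; [exact: csM|exact: csZ|exact: csZ].
  by rewrite -[cmul _ _]/((x + l%:I) * (y + m%:I)); bop_ring.
- move=> _ [x [l [Sx ->]]]; exists (star x), (l^*)%C; split; first exact: csS.
  by rewrite starD_ starZ_ star1.
(* A limit z is approximated at geometric speed. By [cabs_le_adj1] the parts in S then converge to
   some L in S, and z - L is a limit of scalars. *)
apply/closed_rclosed => z Hz.
have e0 k : 0 < 2^-1 ^+ k.+1 / 2 :> R by rewrite divr_gt0 // exprn_gt0 // invr_gt0.
have /choice[y yP] : forall k, exists y, adj1 S y /\ rnorm (z - y) <= 2^-1 ^+ k.+1 / 2.
  by move=> k; have [y ? ?] := Hz _ (e0 k); exists y.
have /choice[x xP] : forall k, exists x, S x /\ exists l, y k = x + l%:I.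
  by move=> k; have [[x [l [Sx yE]]] _] := yP k; exists x; split=> //; exists l.
have xd k : rnorm (x k.+1 - x k) <= 2 * 2^-1 ^+ k - 2 * 2^-1 ^+ k.+1.
  have [Sx [l yl]] := xP k; have [Sx' [l' yl']] := xP k.+1.
  have d1 : rnorm (y k.+1 - y k) <= 2^-1 ^+ k.+2 / 2 + 2^-1 ^+ k.+1 / 2.
    apply: le_trans (rdistD z _ _) _; rewrite (rdistC _ z).
    by apply: lerD; [case: (yP k.+1)|case: (yP k)].
  have yE : y k.+1 - y k = (x k.+1 - x k) + (l' - l)%:I.
    by rewrite yl yl' scalerBl opprD addrACA.
  have := cabs_le_adj1 (l' - l) Sc S1 (csB Sc Sx' Sx); rewrite -yE => d2.
  have -> : x k.+1 - x k = (y k.+1 - y k) - (l' - l)%:I by rewrite yE addrK.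
  apply: le_trans (rnormB _ _) _; have := rnorm_scal_le H (l' - l).
  have := e0 k; move: d1 d2; rewrite !exprS.
  move: (rnorm _) (rnorm _) (cabs _) (_ ^+ k) => p q r s. lra.
have [||L HL] := @cvg_majorant _ _ x (fun k => - (2 * 2^-1 ^+ k)) 0.
- by move=> k; apply: le_trans (xd k) _; rewrite opprK addrC.
- by move=> k; rewrite oppr_le0 mulr_ge0 // exprn_ge0 // invr_ge0.
have SL : S L.
  apply: (csC Sc) => e /HL[N /(_ N (leqnn _)) HN]; exists (x N) => //.
  by case: (xP N).
have [l _ lE] : [set l *: (1 : bop H) | l in [set: R[i]]] (z - L).
  apply: rclosed_scal => e e1; have e2 : 0 < e / 2 by rewrite divr_gt0.
  have [N HN] := HL _ e2.
  have [M HM] : exists M, 2^-1 ^+ M <= e / 2 :> R.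
    have /cvgrPdist_le/(_ _ e2)[M _ /(_ M (leqnn _)) HM] :
        (fun n => geometric (1 : R) 2^-1 n) @ \oo --> (0 : R).
      by apply: cvg_geometric; rewrite ger0_norm ?invr_ge0 // invf_lt1 // ltr1n.
    exists M; move: HM; rewrite /= mul1r sub0r normrN ger0_norm //.
    by rewrite exprn_ge0 // invr_ge0.
  have [_ [l yl]] := xP (maxn N M); have [_ yz] := yP (maxn N M).
  exists (l%:I); first by exists l.
  have -> : z - L - l%:I = (z - y (maxn N M)) - (L - x (maxn N M)).
    by rewrite yl; bop_ring.
  apply: le_trans (rnormB _ _) _; have := HN _ (leq_maxl N M).
  have : 2^-1 ^+ (maxn N M).+1 <= 2^-1 ^+ M :> R.
    apply: ler_wiXn2l; rewrite ?invr_ge0 // ?invf_le1 ?ler1n //.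
    by rewrite leqW // leq_maxr.
  have := e0 (maxn N M); move: yz; lra.
by exists L, l; split=> //; rewrite lE addrC subrK.
Qed.

(** When 1 is not in S, the scalar part of r^2 is the square of that of r. Square roots of elements
    of S hence stay in S. *)
Lemma adj1_sqr_in S r : is_csubalg S -> adj1 S r -> S (r * r) -> S r.
Proof.
move=> Sc [x [l [Sx ->]]]; have [S1 _|S1 Srr] := pselect (S 1).
  by apply: csD => //; exact: csZ.
have Sy : S (x * x + l *: x + l *: x).
  by apply: csD => //; [apply: csD => //; [exact: csM|exact: csZ]|exact: csZ].
have E : (x + l%:I) * (x + l%:I) + 0%:I = x * x + l *: x + l *: x + (l * l)%:I.
  by rewrite scale0r addr0; bop_ring.
have [_ /esym/eqP] := adj1_uniq Sc S1 Srr Sy E.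
by rewrite mulf_eq0 orbb => /eqP ->; rewrite scale0r addr0.
Qed.

Lemma adj1_mulr S x y : is_csubalg S -> S x -> adj1 S y -> S (x * y).
Proof.
move=> Sc Sx [z [l [Sz ->]]]; rewrite mulrDr scalM1.
by apply: csD; [|exact: csM|exact: csZ].
Qed.

Lemma adj1_mull S x y : is_csubalg S -> adj1 S x -> S y -> S (x * y).
Proof.
move=> Sc [z [l [Sz ->]]] Sy; rewrite mulrDl scal1M.
by apply: csD; [|exact: csM|exact: csZ].
Qed.

End Unitization.

(** * Uniform nearness, and the abelian case *)

Section Transfer.
Variables (R : realType) (H : hilbertType R).
Implicit Types (S T : csubalg (bop H)) (A B : set (bop H)) (a b c x y z w d u p e f : bop H).

Lemma conjci : (('i%C : R[i])^*)%C = - 'i%C.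
Proof. by apply/eqP; rewrite eq_complex /= oppr0 !eqxx. Qed.

Lemma i_neq0 : ('i%C : R[i]) != 0.
Proof. by rewrite eq_complex /= oner_eq0 andbF. Qed.

(** The homogeneous, one-sided form of [dKK]; the norm bound on the approximant comes from comparing
    unit balls. *)
Definition dnear (d : R) A B := forall x, A x ->
  exists y, [/\ B y, rnorm (x - y) <= d * rnorm x & rnorm y <= rnorm x].

Lemma dKK_dnear S T (d : R) : dKK S T < d -> dnear d S T /\ dnear d T S.
Proof.
suff h S' T' : hemidist S' T' < d -> dnear d S' T'.
  by rewrite /dKK gt_max => /andP[ST TS]; split; exact: h.
move=> ST x Sx; have [x0|x0] := eqVneq (rnorm x) 0.
  exists 0; rewrite (rnorm0_eq0 x0) subr0 rnorm0 mulr0; split=> //.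
  exact: csub0 (csubP T').
have {}x0 : 0 < rnorm x by rewrite lt_neqAle eq_sym x0 bnorm_ge0.
pose n := (rnorm x)^-1.
have n0 : 0 < n by rewrite invr_gt0.
have nx : rnorm (n%:C%C *: x) = 1 by rewrite bnormZr gtr0_norm // mulVf // gt_eqF.
have [|y [Ty y1] xy] := hemidistP (x := n%:C%C *: x) ST.
  by split; [exact: (csZ _ (csubP S'))|rewrite nx].
exists ((rnorm x)%:C%C *: y); split.
- exact: (csZ _ (csubP T')).
- have -> : x - (rnorm x)%:C%C *: y = (rnorm x)%:C%C *: (n%:C%C *: x - y).
    by rewrite scalerBr scalerA -rmorphM /= mulfV ?gt_eqF // scale1r.
  by rewrite bnormZr gtr0_norm // mulrC ler_pM2r // ltW.
- by rewrite bnormZr gtr0_norm // ler_piMr // ltW.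
Qed.

(** The hypothesis is symmetric in S and T, so the same d shows that the set and its complement are
    both open. *)
Lemma clopen_uniform (X : set (csubalg (bop H))) (d : R) : 0 < d ->
  (forall S T, dnear d S T -> dnear d T S -> X S -> X T) -> clopen X.
Proof.
move=> d0 XST.
have dC S T : dKK S T = dKK T S by exact: maxC.
split; last rewrite -openC; rewrite openE => S XS; apply/nbhs_dKK; exists d => // T.
  by move=> /dKK_dnear[ST TS]; exact: (XST S T).
by move=> /dKK_dnear[ST TS] XT; apply: XS; exact: (XST T S).
Qed.

Lemma dnear_sa (d : R) A B x : is_csubalg B -> dnear d A B -> A x -> sa x ->
  exists y, [/\ B y, sa y, rnorm (x - y) <= d * rnorm x & rnorm y <= rnorm x].
Proof.
move=> Bc AB Ax xs; have [y [By xy yx]] := AB x Ax.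
have h0 : (0 : R) <= 2^-1 by rewrite invr_ge0.
exists ((2^-1)%:C%C *: (y + star y)); split.
- by apply: csZ => //; apply: csD => //; exact: csS.
- by rewrite /sa starZr starD_ starK addrC.
- have -> : x - (2^-1)%:C%C *: (y + star y) = (2^-1)%:C%C *: ((x - y) + star (x - y)).
    apply: (@scalerI _ _ (2%:R : R[i])); first by rewrite pnatr_eq0.
    rewrite scalerBr !scalerA rmorphV ?unitfE ?pnatr_eq0 // rmorph_nat mulfV ?pnatr_eq0 //.
    by rewrite !scale1r starB xs; bop_ring.
  rewrite bnormZr ger0_norm // mulrC ler_pdivrMr // mulr_natr mulr2n.
  by apply: le_trans (bnormD _ _) _; rewrite rnorm_star lerD.
- rewrite bnormZr ger0_norm // mulrC ler_pdivrMr // mulr_natr mulr2n.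
  by apply: le_trans (bnormD _ _) _; rewrite rnorm_star lerD.
Qed.

Lemma le0_geom (x C q : R) : 0 <= q -> q < 1 -> (forall k, x <= C * q ^+ k) -> x <= 0.
Proof.
move=> q0 q1 xC; apply: (@ler_eps _ _ _ `|C|) => // e e0.
have /cvgrPdist_le/(_ _ e0)[M _ /(_ M (leqnn _)) HM] :
    (fun n => geometric (1 : R) q n) @ \oo --> (0 : R).
  by apply: cvg_geometric; rewrite ger0_norm.
apply: le_trans (xC M) _; rewrite add0r; apply: le_trans (ler_norm _) _.
by rewrite normrM ler_wpM2l //; move: HM; rewrite /= mul1r sub0r normrN.
Qed.

Definition celt S x (Sx : csub_set S x) : csub_elt S := CsubElt (asboolT Sx).

Lemma abelianP S : abelian_alg (csub_alg S) <-> (forall x y, csub_set S x -> csub_set S y -> x * y = y * x).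
Proof.
split=> [ab x y Sx Sy|ab a b].
  exact: (congr1 (@csub_val _ _ S) (ab (celt Sx) (celt Sy))).
by apply: val_inj; apply: ab; exact: csub_in.
Qed.

Definition unitary u := star u * u = 1 /\ u * star u = 1.

(** Taking s as the root of 1 - b^2 exhibits b as the average of two unitaries, so commuting with
    unitaries implies commuting with b. *)
Lemma unitary_sa A b : is_csubalg A -> A 1 -> A b -> sa b -> rnorm b <= 1 ->
  exists s, [/\ A s, unitary (b + 'i%C *: s) & unitary (b - 'i%C *: s)].
Proof.
move=> Ac A1 Ab bs b1.
have bp : psd (1 - b * b).
  split=> [|v]; first by rewrite /sa !starE bs.
  rewrite bopDE bopNE bop1E bopME rinnerDl rinnerNl (saS _ _ bs) !rinnerE subr_ge0.
  rewrite ler_pXn2r ?nnegrE ?rnorm_ge0 //; apply: le_trans (rnorm_bop_le b v) _.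
  by rewrite ler_piMl ?rnorm_ge0.
have [s [[ss _] As s2 sc]] := psd_sqrt Ac A1 (csB Ac A1 (csM Ac Ab Ab)) bp.
have bsc : b * s = s * b by apply: sc; bop_ring.
have is2 : 'i%C *: s * ('i%C *: s) = - (1 - b * b).
  by rewrite bopZAl bopZAr scalerA -expr2 sqr_i scaleN1r s2.
have iss : star ('i%C *: s) = - ('i%C *: s).
  by rewrite starZ_ ss conjci scaleNr.
have ib : b * ('i%C *: s) = ('i%C *: s) * b by rewrite bopZAr bopZAl bsc.
exists s; rewrite /unitary !starE bs iss; move: ('i%C *: s) is2 ib => t t2 tb.
have E : b * b - t * t = 1 by rewrite t2; bop_ring.
by split=> //; split; rewrite ?opprK -E mulrDl !mulrDr ?mulrN ?mulNr ?opprK tb;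
  bop_ring.
Qed.

(** For b = [a, u] one has [a, u^2] = 2 u b + [b, u], where |[b, u]| <= c |b|. So |[a, u]| is at
    most |[a, u^2]| / (2 - c), and repeated squaring of u forces it to 0. *)
Lemma comm_unitary_zero A (c : R) : is_csubalg A -> 0 <= c -> c < 1 ->
  (forall a u, A a -> adj1 A u -> unitary u -> rnorm (a * u - u * a) <= c * rnorm a) ->
  forall a u, A a -> adj1 A u -> unitary u -> a * u = u * a.
Proof.
move=> Ac c0 c1 cA a u Aa Au uu; apply/eqP; rewrite -subr_eq0; apply/eqP/rnorm0_eq0/eqP.
rewrite eq_le bnorm_ge0 andbT.
have m0 : 0 < 2 - c by norm_lra.
apply: (@le0_geom _ (c * rnorm a) (2 - c)^-1); first by rewrite invr_ge0 ltW.
  by rewrite invf_lt1 //; norm_lra.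
move=> k; elim: k u Au uu => [|k IH] u Au uu; first by rewrite expr0 mulr1 cA.
have A1 := adj1_csubalg Ac.
have uuu : unitary (u * u).
  case: uu => h1 h2; split; rewrite starM_ -mulrA.
    by rewrite (mulrA (star u) u u) h1 mul1r h1.
  by rewrite (mulrA u (star u) (star u)) h2 mul1r h2.
have := IH _ (csM A1 Au Au) uuu.
pose b := a * u - u * a.
have Ab : A b.
  apply: csB => //; [exact: adj1_mulr|exact: adj1_mull].
have := cA b u Ab Au uu; rewrite -/b.
have -> : a * (u * u) - u * u * a = (u * b + u * b) + (b * u - u * b) by rewrite /b; bop_ring.
set z := _ - u * b => zb IHu.
have ub : rnorm b <= rnorm (u * b).
  have bE : b = star u * (u * b) by rewrite mulrA (proj1 uu) mul1r.
  rewrite [in leLHS]bE.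
  apply: le_trans (rnormM_le _ _) _; rewrite ler_piMl ?bnorm_ge0 // rnorm_star.
  have := rnorm_starM u; rewrite (proj1 uu) => un.
  by have := rnorm1_le H; rewrite un; have := bnorm_ge0 u; norm_nra.
have : rnorm (u * b + u * b) <= rnorm (u * b + u * b + z) + rnorm z.
  by have := rnormB (u * b + u * b + z) z; rewrite addrK.
move: IHu; have -> : u * b + u * b = 2%:R%:C%C *: (u * b) by rewrite rmorph_nat; bop_ring.
rewrite bnormZr ger0_norm // => IHu h.
rewrite exprSr mulrA ler_pdivlMr //; norm_lra.
Qed.

Lemma abelian_dnear A B (d : R) : is_csubalg B -> 16 * d <= 1 -> dnear d B A ->
  (forall x y, A x -> A y -> x * y = y * x) -> forall x y, B x -> B y -> x * y = y * x.
Proof.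
move: A B => S T Tc d1 TS Sab.
have cu a u : T a -> adj1 T u -> unitary u -> a * u = u * a.
  (* The commutator splits into four terms of norm at most 2 d |a|; the ratio is 1/2 because 16 d <=
     1. *)
  apply: (@comm_unitary_zero T 2^-1) => //; rewrite ?invr_ge0 // ?invf_lt1 ?ltr1n //.
  move=> {}a {}u Ta Tu uu.
  have [x [l [Tx uE lu]]] := adj1_decomp Tc Tu.
  have un : rnorm u <= 1.
    have := rnorm_starM u; rewrite (proj1 uu) => un.
    by have := rnorm1_le H; rewrite un; have := bnorm_ge0 u; norm_nra.
  have xn : rnorm x <= 2.
    have -> : x = u - l%:I by rewrite uE addrK.
    by apply: le_trans (rnormB _ _) _; have := rnorm_scal_le H l; norm_lra.
  have [a' [Sa aa an]] := TS a Ta; have [x' [Sx xx xn']] := TS x Tx.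
  have -> : a * u - u * a = ((a - a') * x + a' * (x - x')) - (x * (a - a') + (x - x') * a').
    rewrite uE; transitivity (a * x - x * a - (a' * x' - x' * a')); last by bop_ring.
    by rewrite (Sab _ _ Sa Sx) subrr subr0; bop_ring.
  apply: le_trans (rnormB _ _) _.
  have := bnormD ((a - a') * x) (a' * (x - x')); have := bnormD (x * (a - a')) ((x - x') * a').
  have := rnormM_leM aa xn; have := rnormM_leM an xx.
  have := rnormM_leM xn aa; have := rnormM_leM xx an.
  have := bnorm_ge0 x; have := bnorm_ge0 a; have := bnorm_ge0 (a - a').
  have [d0|d0] := lerP 0 d; last by have := bnorm_ge0 (x - x'); norm_nra.
  by have := mulr_ge0 d0 (bnorm_ge0 a); norm_nra.
have T1 := adj1_csubalg Tc.
have cs a b : T a -> T b -> sa b -> rnorm b <= 1 -> a * b = b * a.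
  move=> Ta Tb bs b1.
  have [s [Ts us us']] := unitary_sa T1 (adj1_1 Tc) (adj1_sub Tc Tb) bs b1.
  have Tis : adj1 T ('i%C *: s) by exact: csZ.
  have := cu _ _ Ta (csD T1 (adj1_sub Tc Tb) Tis) us.
  have := cu _ _ Ta (csB T1 (adj1_sub Tc Tb) Tis) us'.
  move: ('i%C *: s) => t h1 h2; apply: (@scalerI _ _ (2%:R : R[i])).
    by rewrite pnatr_eq0.
  transitivity (a * (b + t) + a * (b - t)); first by bop_ring.
  by rewrite h1 h2; bop_ring.
have css a b : T a -> T b -> sa b -> a * b = b * a.
  move=> Ta Tb bs; have n0 : 0 < rnorm b + 1 by rewrite ltr_wpDl ?bnorm_ge0.
  have := cs a ((rnorm b + 1)^-1%:C%C *: b) Ta (csZ _ Tc Tb).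
  rewrite /sa starZr bs => /(_ erefl); rewrite bnormZr gtr0_norm ?invr_gt0 //.
  rewrite mulrC ler_pdivrMr // mul1r lerDl ler01 => /(_ isT).
  rewrite bopZAr bopZAl => /scalerI; apply.
  by rewrite fmorph_eq0 invr_eq0 gt_eqF.
move=> x y Tx Ty; have Ts := csS Tc Ty.
have h1 : x * (y + star y) = (y + star y) * x.
  by apply: css => //; [exact: csD|rewrite /sa !starE addrC].
have h2 : x * ('i%C *: (y - star y)) = 'i%C *: (y - star y) * x.
  apply: css => //; first by apply: csZ => //; exact: csB.
  by rewrite /sa starZ_ starB starK conjci scaleNr -scalerN opprB.
have {h2}h2 : x * (y - star y) = (y - star y) * x.
  by move: h2; rewrite bopZAr bopZAl => /scalerI; apply; rewrite i_neq0.
apply: (@scalerI _ _ (2%:R : R[i])); first by rewrite pnatr_eq0.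
transitivity (x * (y + star y) + x * (y - star y)); first by bop_ring.
by rewrite h1 h2; bop_ring.
Qed.

Lemma clopen_abelian :
  clopen [set S : csubalg (bop H) | abelian_alg (csub_alg S)].
Proof.
apply: (@clopen_uniform _ (16%:R)^-1); first by rewrite invr_gt0 ltr0n.
move=> S T _ TS /= /abelianP Sab; apply/abelianP.
by apply: (abelian_dnear (csubP T)) TS Sab; rewrite mulfV // pnatr_eq0.
Qed.

End Transfer.

(** * Correcting approximate projections and partial isometries *)

Section Projections.
Variables (R : realType) (H : hilbertType R).
Implicit Types (S T : csubalg (bop H)) (A B : set (bop H)) (a b c x y z w d u v p q e f : bop H).

Lemma rclosed_norm (C : R) : rclosed [set x : bop H | rnorm x <= C].
Proof.
move=> x xC /=; apply: (@ler_eps _ _ _ 1) => // e /xC[y /= yC xy].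
by have := bnormB_sub x y; norm_lra.
Qed.

(** This is the inverse square root of 1 - z, built as (1 - w)^-1 with w from [sqrt_fix]. The ball
    of radius |z| is stable under that iteration, so |w| <= |z|. *)
Lemma inv_sqrt z : sa z -> 4 * rnorm z <= 1 -> exists d, [/\ sa d,
  d * d * (1 - z) = 1, rnorm (d - 1) <= 2 * rnorm z,
  (forall A, is_csubalg A -> A 1 -> A z -> A d) &
  (forall y, y * z = z * y -> y * d = d * y)].
Proof.
move=> zs z4; have zn := bnorm_ge0 z.
have [|w [wE w1 wP]] := @sqrt_fix _ _ z; first by norm_lra.
have h0 : (0 : R) <= 2^-1 by rewrite invr_ge0.
have wz : rnorm w <= rnorm z.
  apply: (wP [set w | rnorm w <= rnorm z]) => /=; first exact: rclosed_norm.
    by rewrite rnorm0.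
  move=> y yz; rewrite bnormZr ger0_norm // mulrC ler_pdivrMr //.
  apply: le_trans (bnormD _ _) _; have := rnormM_leM yz yz; norm_nra.
have ws : star w = w.
  apply: (wP [set x | star x = x]) => /=; first exact: rclosed_sa.
    by rewrite star0.
  by move=> y ys; rewrite starZr starD_ zs starM_ ys.
have wA A : is_csubalg A -> A z -> A w.
  move=> Ac Az; apply: wP; [exact: csC|exact: csub0 Ac|move=> y Ay].
  by apply: csZ => //; apply: csD => //; exact: csM.
have wc y : y * z = z * y -> y * w = w * y.
  move=> yz; apply: (wP [set x | y * x = x * y]) => /=; first exact: rclosed_comm.
    by rewrite mulr0 mul0r.
  by move=> x yx; rewrite bopZAr bopZAl mulrDr mulrDl yz mulrA yx -!mulrA yx.
have w2 : (1 - w) * (1 - w) = 1 - z.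
  have E : w + w = z + w * w.
    rewrite {1 2}wE -scalerDl -rmorphD /= (_ : 2^-1 + 2^-1 = 1) ?scale1r //.
    by field.
  transitivity (1 - (w + w) + w * w); first by bop_ring.
  by rewrite E; bop_ring.
have [|d [wd dw dP]] := @neumann _ _ w; first by norm_lra.
have dc y : y * w = w * y -> y * d = d * y.
  move=> yw; apply: (dP [set x | y * x = x * y]) => /=; first exact: rclosed_comm.
    by rewrite mulr0 mul0r.
  by move=> x yx; rewrite mulrDr mulrDl mulr1 mul1r mulrA yw -!mulrA yx.
have ds : star d = d.
  have h : star d * (1 - w) = 1.
    by have := congr1 (@star _ _) wd; rewrite starM_ starB star1 ws.
  by rewrite -[star d]mulr1 -wd mulrA h mul1r.
have d2 : rnorm (d - 1) <= 2 * rnorm z.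
  have dE : d - 1 = w * d by rewrite -{1}wd; bop_ring.
  have dn : rnorm d <= 1 + rnorm (d - 1).
    by have := bnormD (d - 1) 1; rewrite subrK; have := rnorm1_le H; norm_lra.
  have : rnorm (d - 1) <= rnorm z * rnorm d by rewrite {1}dE; apply: rnormM_leM.
  by have := bnorm_ge0 d; have := bnorm_ge0 (d - 1); norm_nra.
exists d; split=> //.
- by rewrite -w2 mulrA -(mulrA d d) dw mulr1.
- move=> A Ac A1 Az; apply: dP; [exact: csC|exact: csub0 Ac|move=> y Ay].
  by apply: csD => //; apply: csM => //; exact: wA.
- by move=> y yz; apply: dc; exact: wc.
Qed.

Definition proj p := star p = p /\ p * p = p.

Lemma proj_norm_sqr p : proj p -> rnorm p = rnorm p ^+ 2.
Proof. by move=> [ps pp]; rewrite -rnorm_starM ps pp. Qed.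

Lemma proj_norm p : proj p -> p = 0 \/ rnorm p = 1.
Proof.
move=> /proj_norm_sqr/eqP; rewrite eq_sym -subr_eq0 expr2 -{3}[rnorm p]mulr1 -mulrBr mulf_eq0.
by case/orP => [/eqP/rnorm0_eq0|]; [left|rewrite subr_eq0 => /eqP; right].
Qed.

Lemma proj_norm_le1 p : proj p -> rnorm p <= 1.
Proof. by move=> /proj_norm[->|->] //; rewrite rnorm0. Qed.

Lemma proj_lt1 p : proj p -> rnorm p < 1 -> p = 0.
Proof. by move=> /proj_norm[//|->]; rewrite ltxx. Qed.

Lemma projB p q : proj p -> proj q -> p * q = q -> proj (p - q).
Proof.
move=> [ps pp] [qs qq] pq; have qp : q * p = q.
  by have := congr1 (@star _ _) pq; rewrite starM_ ps qs.
split; first by rewrite starB ps qs.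
by rewrite mulrBl !mulrBr pp pq qp qq subrr subr0.
Qed.

Lemma proj1B p : proj p -> proj (1 - p).
Proof.
move=> pp; apply: projB => //; last by rewrite mul1r.
by split; rewrite ?star1 ?mul1r.
Qed.

(** If 1 is not in A, the scalar part of a projection is 0 or 1, and its modulus is at most |p - b|
    < 1. *)
Lemma adj1_proj_in A p b : is_csubalg A -> adj1 A p -> proj p -> A b ->
  rnorm (p - b) < 1 -> A p.
Proof.
move=> Ac [x [l [Ax pE]]] [_ pp] Ab pb.
have [A1|A1] := pselect (A 1); first by rewrite pE; apply: csD => //; exact: csZ.
have E : (x * x + l *: x + l *: x) + (l * l)%:I = x + l%:I.
  by rewrite -pE -[RHS]pp pE; bop_ring.
have [|_ ll] := adj1_uniq Ac A1 _ Ax E.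
  by apply: csD => //; [apply: csD => //; [exact: csM|exact: csZ]|exact: csZ].
have l1 : cabs l < 1.
  apply: le_lt_trans pb; have := cabs_le_adj1 l Ac A1 (csB Ac Ax Ab).
  by rewrite pE addrAC.
have /eqP : l * (l - 1) = 0 by rewrite mulrBr mulr1 ll subrr.
rewrite mulf_eq0 subr_eq0 => /orP[/eqP l0|/eqP l1'].
  by rewrite pE l0 scale0r addr0.
by move: l1; rewrite l1' /cabs normr1 /= ltxx.
Qed.

(** The element y = 2 b - 1 has y^2 = 1 + 4 (b^2 - b), so it is almost a symmetry. Multiplying it by
    the inverse root of y^2 gives a symmetry s, and p = (1 + s) / 2. *)
Lemma proj_near A b : is_csubalg A -> A b -> sa b -> 16 * rnorm (b * b - b) <= 1 ->
  exists p, [/\ A p, proj p & rnorm (p - b) <= 8 * rnorm (b * b - b)].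
Proof.
move=> Ac Ab bs b16; set n := rnorm _ in b16 *; have n0 : 0 <= n by exact: bnorm_ge0.
have [y yE] : exists y, y = b + b - 1 by exists (b + b - 1).
have [z zE'] : exists z, z = (- 4%:R)%:C%C *: (b * b - b) by eexists.
have ys : star y = y by rewrite yE !starE bs.
have zs : star z = z by rewrite zE' !starE bs.
have zn : rnorm z = 4 * n by rewrite zE' bnormZr normrN ger0_norm.
have yy : y * y = 1 - z.
  by rewrite zE' rmorphN rmorph_nat yE; bop_ring.
have [|d [ds dd d1 dA dc]] := @inv_sqrt z zs; first by rewrite zn; norm_lra.
have A1c := adj1_csubalg Ac; have A1 := adj1_1 Ac; have Ab1 := adj1_sub Ac Ab.
have Ay : adj1 A y by rewrite yE; apply: csB => //; exact: csD.
have Ad : adj1 A d.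
  by apply: dA => //; rewrite zE'; apply: csZ => //; apply: csB => //; exact: csM.
have yd : y * d = d * y.
  have zE : z = 1 - y * y by rewrite yy subKr.
  by apply: dc; rewrite zE mulrBr mulrBl mulr1 mul1r mulrA.
pose s := y * d.
have ss : star s = s by rewrite /s starM_ ys ds yd.
have s2 : s * s = 1.
  have h : y * y * d = d * (y * y) by rewrite -mulrA yd mulrA yd mulrA.
  transitivity (y * (d * y) * d); first by rewrite /s !mulrA.
  by rewrite -yd mulrA h -mulrA h mulrA yy dd.
have h0 : (0 : R) <= 2^-1 by rewrite invr_ge0.
pose p := (2^-1)%:C%C *: (1 + s).
have pproj : proj p.
  split; first by rewrite /p starZr starD_ star1 ss.
  rewrite /p bopZAl bopZAr scalerA mulrDl !mulrDr s2 !mulr1 mul1r.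
  rewrite (_ : 1 + s + (s + 1) = 2%:R%:C%C *: (1 + s)); last by rewrite rmorph_nat; bop_ring.
  rewrite scalerA -!rmorphM /=; congr (_%:C%C *: _); by field.
have y2 : rnorm y <= 2.
  have := rnorm_starM y; rewrite ys yy => E.
  have : rnorm (1 - z) <= 2 by apply: le_trans (rnormB _ _) _; rewrite zn; have := rnorm1_le H; norm_lra.
  by rewrite E; have := bnorm_ge0 y; norm_nra.
have pb : rnorm (p - b) <= 8 * n.
  have -> : p - b = (2^-1)%:C%C *: (y * (d - 1)).
    apply: (@scalerI _ _ (2%:R : R[i])); first by rewrite pnatr_eq0.
    rewrite scalerBr !scalerA rmorphV ?unitfE ?pnatr_eq0 // rmorph_nat mulfV ?pnatr_eq0 //.
    by rewrite !scale1r /s mulrBr mulr1 {3}yE; bop_ring.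
  rewrite bnormZr ger0_norm // mulrC ler_pdivrMr //.
  apply: le_trans (rnormM_leM y2 d1) _; rewrite zn; norm_lra.
exists p; split=> //; apply: (@adj1_proj_in _ _ b) => //; last by apply: le_lt_trans pb _; norm_lra.
by apply: csZ => //; apply: csD => //; exact: csM.
Qed.

(** The witness is the polar part of w relative to the support p: w times the inverse root of 1 - z,
    where z = p - [star w * w]. Since w is only multiplied on the right, its left supports are kept,
    which later makes corrected partial isometries orthogonal. *)
Lemma polar_near A w p : is_csubalg A -> A w -> A p -> proj p -> w * p = w ->
  4 * rnorm (star w * w - p) <= 1 -> exists v, [/\ A v, star v * v = p,
    rnorm (v - w) <= 4 * rnorm (star w * w - p) & forall q, q * w = w -> q * v = v].
Proof.
move=> Ac Aw Ap [ps pp] wp n4; set n := rnorm _ in n4 *.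
have pw : p * star w = star w by have := congr1 (@star _ _) wp; rewrite starM_ ps.
pose z := - (star w * w - p).
have zs : star z = z by rewrite /z !starE ps.
have zn : rnorm z = n by rewrite bnormN.
have [|d [ds dd d1 dA dc]] := @inv_sqrt z zs; first by rewrite zn.
have pz : p * z = z * p.
  by rewrite /z mulrN mulNr mulrBr mulrBl pp mulrA pw -mulrA wp.
have pd : p * d = d * p by exact: dc.
have zp : z * p = z by rewrite /z mulNr mulrBl -mulrA wp pp.
have ddp : d * d * (star w * w) = p.
  have -> : star w * w = (1 - z) * p by rewrite mulrBl mul1r zp /z; bop_ring.
  by rewrite mulrA dd mul1r.
have zd : (star w * w) * d = d * (star w * w).
  apply: dc; rewrite /z mulrN mulNr mulrBr mulrBl; congr (- (_ - _)).
  by rewrite -mulrA wp mulrA pw.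
have w2 : rnorm w <= 2.
  have := rnorm_starM w => E.
  have : rnorm (star w * w) <= n + rnorm p.
    by have := bnormD (star w * w - p) p; rewrite subrK.
  have := proj_norm_le1 (conj ps pp).
  by rewrite E; have := bnorm_ge0 w; norm_nra.
exists (w * d); split.
- apply: adj1_mulr => //; apply: dA; [exact: adj1_csubalg|exact: adj1_1|].
  by apply: csN; [exact: adj1_csubalg|apply: adj1_sub => //; apply: csB => //; apply: csM => //; exact: csS].
- by rewrite starM_ ds mulrA -(mulrA d) -mulrA zd mulrA ddp.
- have -> : w * d - w = w * (d - 1) by bop_ring.
  apply: le_trans (rnormM_leM w2 d1) _; rewrite zn; norm_lra.
- by move=> q qw; rewrite mulrA qw.
Qed.

End Projections.

(** * Transfer of projections, units and infiniteness *)

Section ProjectionTransfer.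
Variables (R : realType) (H : hilbertType R).
Implicit Types (S T : csubalg (bop H)) (A B : set (bop H)) (a b c x y z w u v p q e f r : bop H) (d : R).

(** A self-adjoint approximant b of e has |b^2 - b| <= 3 d, and [proj_near] moves it by at most 24
    d; with |e - b| <= d this gives 25. *)
Lemma proj_transfer A B d e : is_csubalg B -> 0 <= d -> 64 * d <= 1 ->
  dnear d A B -> A e -> proj e -> exists f, [/\ B f, proj f & rnorm (e - f) <= 25 * d].
Proof.
move=> Bc d0 d64 AB Ae pe; have e1 := proj_norm_le1 pe; have [es ee] := pe.
have [b [Bb bs eb be]] := dnear_sa Bc AB Ae es.
have ebd : rnorm (e - b) <= d.
  by apply: le_trans eb _; rewrite ler_piMr.
have b1 := le_trans be e1.
have bb : rnorm (b * b - b) <= 3 * d.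
  have -> : b * b - b = (e - b) - (b * (e - b) + (e - b) * e).
    by rewrite mulrBr mulrBl ee; bop_ring.
  apply: le_trans (rnormB _ _) _; have := bnormD (b * (e - b)) ((e - b) * e).
  have := rnormM_leM b1 ebd; have := rnormM_leM ebd e1; norm_lra.
have [|f [Bf pf fb]] := proj_near Bc Bb bs; first by norm_lra.
exists f; split=> //; apply: le_trans (bdistD b _ _) _; rewrite (bdistC b); norm_lra.
Qed.

Definition unit_of A e := A e /\ forall a, A a -> e * a = a /\ a * e = a.

Lemma unit_proj A e : is_csubalg A -> unit_of A e -> proj e.
Proof.
move=> Ac [Ae eA]; have [ee _] := eA e Ae.
have [_ h] := eA _ (csS Ac Ae); split=> //.
by have := congr1 (@star _ _) h; rewrite starM_ starK h.
Qed.

Lemma unit_transfer A B d e : is_csubalg A -> is_csubalg B -> 0 <= d -> 128 * d <= 1 ->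
  dnear d A B -> dnear d B A -> unit_of A e ->
  exists f, [/\ unit_of B f, proj f & rnorm (e - f) <= 25 * d].
Proof.
move=> Ac Bc d0 d1 AB BA ue; have pe := unit_proj Ac ue.
have [||f [Bf pf ef]] := @proj_transfer A B d e Bc d0 _ AB _ pe; [norm_lra|by case: ue|].
(* The defect z = y - f y is killed by f, but it is close to some x in A with e x = x, and e is
   close to f. So |z| <= 27 d |z|, which forces z = 0. *)
have fl y : B y -> f * y = y.
  move=> By; apply/eqP; rewrite eq_sym -subr_eq0; apply/eqP; set z := y - _.
  have Bz : B z by apply: csB => //; exact: csM.
  have fz : f * z = 0 by rewrite mulrBr mulrA (proj2 pf) subrr.
  have [x [Ax zx xz]] := BA z Bz; have [ex _] := proj2 ue x Ax.
  have zE : z = (z - x) + (e - f) * x + f * (x - z).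
    by rewrite mulrBr fz mulrBl ex; bop_ring.
  have n1 : rnorm z <= rnorm (z - x) + rnorm ((e - f) * x) + rnorm (f * (x - z)).
    by rewrite {1}zE; apply: le_trans (bnormD _ _) _; rewrite lerD2r bnormD.
  have n2 := rnormM_leM ef xz.
  have := rnormM_leM (proj_norm_le1 pf) (lexx (rnorm (x - z))).
  rewrite mul1r (bdistC x) => n3; apply: rnorm0_eq0.
  by have := bnorm_ge0 z; norm_nra.
exists f; split=> //; split=> // y By; split; first exact: fl.
have := congr1 (@star _ _) (fl _ (csS Bc By)).
by rewrite starM_ starK (proj1 pf).
Qed.

Lemma csub_oneP S (e : csub_elt S) : is_one (e : csub_alg S) <-> unit_of (csub_set S) (csub_val e).
Proof.
split=> [ue|[_ ue] a]; last first.
  have [h1 h2] := ue _ (csub_in a).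
  by split; apply: val_inj; [exact: h1|exact: h2].
split=> [|a Sa]; first exact: csub_in.
have [/(congr1 (@csub_val _ _ S)) h1 /(congr1 (@csub_val _ _ S)) h2] := ue (celt Sa).
by split; [exact: h1|exact: h2].
Qed.

Lemma csub_projP S (e : csub_elt S) : projection (e : csub_alg S) <-> proj (csub_val e).
Proof.
split=> [[/(congr1 (@csub_val _ _ S)) h1 /(congr1 (@csub_val _ _ S)) h2] //|[h1 h2]].
by split; apply: val_inj; [exact: h1|exact: h2].
Qed.

Lemma unitalP S : unital (csub_alg S) <-> exists e, unit_of (csub_set S) e.
Proof.
split=> [[e /csub_oneP ue]|[e ue]]; first by exists (csub_val e).
by exists (celt (proj1 ue)); apply/csub_oneP.
Qed.

Lemma unital_projectionlessP S : unital_projectionless (csub_alg S) <->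
  exists e, unit_of (csub_set S) e /\
    forall p, csub_set S p -> proj p -> p = 0 \/ p = e.
Proof.
split=> [[e [/csub_oneP ue eP]]|[e [ue eP]]].
  exists (csub_val e); split=> // p Sp pp.
  have [|/(congr1 (@csub_val _ _ S)) h|/(congr1 (@csub_val _ _ S)) h] := eP (celt Sp).
  - exact/csub_projP.
  - by left.
  - by right.
exists (celt (proj1 ue)); split; first exact/csub_oneP.
move=> p /csub_projP pp; have [p0|pe] := eP _ (csub_in p) pp.
  by left; exact: val_inj.
by right; exact: val_inj.
Qed.

Lemma clopen_unital_projectionless :
  clopen [set S : csubalg (bop H) | unital_projectionless (csub_alg S)].
Proof.
have d0 : (0 : R) < 128%:R^-1 by rewrite invr_gt0 ltr0n.
have dE : 128 * 128%:R^-1 = 1 :> R by rewrite mulfV // pnatr_eq0.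
apply: (clopen_uniform d0); move: (_^-1) d0 dE => d d0 dE S T ST TS.
move=> /unital_projectionlessP[e [ue eP]]; apply/unital_projectionlessP.
have [|f [uf pf ef]] := unit_transfer (csubP S) (csubP T) (ltW d0) _ ST TS ue.
  by rewrite dE.
exists f; split=> // p Tp pp.
have [|q [Sq pq qp]] := proj_transfer (csubP S) (ltW d0) _ TS Tp pp; first by norm_lra.
have [q0|qe] := eP q Sq pq; [left|right].
  by apply: proj_lt1 => //; move: qp; rewrite q0 subr0; norm_lra.
have [fp _] := proj2 uf p Tp.
(* Here p lies under f, so f - p is a projection; its norm is below 1, hence it is 0. *)
have /proj_lt1 h := projB pf pp fp.
apply/eqP; rewrite eq_sym -subr_eq0; apply/eqP/h.
apply: le_lt_trans (bdistD e _ _) _; rewrite (bdistC f) (bdistC e p) -qe.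
by move: ef; rewrite -qe; norm_lra.
Qed.

Lemma star_eq0 x : star x * x = 0 -> x = 0.
Proof.
move=> h; apply: rnorm0_eq0; apply/eqP.
by rewrite -sqrf_eq0 -rnorm_starM h rnorm0.
Qed.

Lemma pisom_r v r : star v * v = r -> proj r -> v * r = v.
Proof.
move=> vv [rs rr]; apply/eqP; rewrite -subr_eq0; apply/eqP; apply: star_eq0.
transitivity (r * (star v * v) * r - r * (star v * v) - star v * v * r + star v * v).
  by rewrite starB starM_ rs; bop_ring.
by rewrite vv !rr; bop_ring.
Qed.

Lemma pisom_proj v r : star v * v = r -> proj r -> proj (v * star v).
Proof.
move=> vv pr; split; first by rewrite !starE.
by rewrite mulrA -(mulrA v) vv (pisom_r vv pr).
Qed.

Lemma pisom_norm v r : star v * v = r -> proj r -> rnorm v <= 1.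
Proof.
move=> vv pr; have := rnorm_starM v; rewrite vv.
by have := proj_norm_le1 pr; have := bnorm_ge0 v; norm_nra.
Qed.

Definition infinite_in A := exists p q v,
  [/\ A p /\ A q /\ A v, proj p /\ p <> 0, proj q /\ q <> 0, p * q = 0 &
   star v * v = p + q /\ v * star v = p].

(** The support r = p + q of v is moved to f in B, and an approximant of v is cut down to f and
    polar-corrected to v'. Then p' = v' [star v'] and f - p' are close to p and q, hence nonzero. *)
Lemma infinite_dnear A B d : is_csubalg A -> is_csubalg B -> 0 <= d -> 2048 * d <= 1 ->
  dnear d A B -> infinite_in A -> infinite_in B.
Proof.
move=> Ac Bc d0 d1 AB [p [q [v [[Ap [Aq Av]] [pp p0] [pq q0] pq0 [vv vvs]]]]].
have [ps pp'] := pp; have [qs qq'] := pq.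
have qp0 : q * p = 0 by have := congr1 (@star _ _) pq0; rewrite starM_ ps qs star0.
have pr : proj (p + q).
  by split; rewrite ?starD_ ?ps ?qs // mulrDl !mulrDr pp' qq' pq0 qp0 addr0 add0r.
set r := p + q in vv pr.
have rp : r * p = p by rewrite mulrDl pp' qp0 addr0.
have vr : v * r = v := pisom_r vv pr.
have v1 := pisom_norm vv pr; have r1 := proj_norm_le1 pr.
have rv : r * v = v.
  have svs : star (star v) * star v = p by rewrite starK.
  have := congr1 (@star _ _) (pisom_r svs pp); rewrite starM_ starK ps => pv.
  by rewrite -pv mulrA rp.
have [||f [Bf pf rf]] := @proj_transfer A B d r Bc d0 _ AB _ pr; first by norm_lra.
  exact: csD.
have f1 := proj_norm_le1 pf; have [w0 [Bw0 vw0 w0v]] := AB v Av.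
have {}vw0 : rnorm (v - w0) <= d by apply: le_trans vw0 _; rewrite ler_piMr.
have w01 := le_trans w0v v1.
(* Compressing on both sides makes f the right support needed by [polar_near] and a left support, so
   that p' lies under f. *)
pose w := f * w0 * f.
have w1 : rnorm w <= 1.
  by have := rnormM_leM (rnormM_leM f1 w01) f1; rewrite !mulr1.
have wv : rnorm (v - w) <= 51 * d.
  have -> : v - w = (r - f) * w0 * f + r * (v - w0) * f + r * v * (r - f).
    transitivity (r * v * r - w); first by rewrite rv vr.
    by rewrite /w; bop_ring.
  apply: le_trans (bnormD _ _) _; apply: le_trans (lerD (bnormD _ _) (lexx _)) _.
  have := rnormM_leM (rnormM_leM rf w01) f1.
  have := rnormM_leM (rnormM_leM r1 vw0) f1.
  have := rnormM_leM (rnormM_leM r1 v1) rf; norm_lra.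
have ww : rnorm (star w * w - f) <= 127 * d.
  have -> : star w * w - f = (r - f) - (star (v - w) * w + star v * (v - w)).
    by rewrite -vv starB; bop_ring.
  apply: le_trans (rnormB _ _) _; have := bnormD (star (v - w) * w) (star v * (v - w)).
  have svw : rnorm (star (v - w)) <= 51 * d by rewrite rnorm_star.
  have sv : rnorm (star v) <= 1 by rewrite rnorm_star.
  have := rnormM_leM svw w1; have := rnormM_leM sv wv; norm_lra.
have [|||v' [Bv' vv' v'w v'P]] := @polar_near _ _ B w f Bc _ Bf pf.
- by apply: csM => //; exact: csM.
- by rewrite /w -mulrA (proj2 pf).
- norm_lra.
have v'v : rnorm (v - v') <= 559 * d.
  apply: le_trans (bdistD w _ _) _; rewrite (bdistC w); norm_lra.
have fv' : f * v' = v' by apply: v'P; rewrite /w !mulrA (proj2 pf).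
have v'1 := pisom_norm vv' pf.
pose p' := v' * star v'.
have pp'' : proj p' := pisom_proj vv' pf.
have fp' : f * p' = p' by rewrite /p' mulrA fv'.
have pq' : proj (f - p') by exact: projB.
have p'f : p' * f = p'.
  by have := congr1 (@star _ _) fp'; rewrite starM_ (proj1 pf) (proj1 pp'').
have p'p : rnorm (p - p') <= 1118 * d.
  have -> : p - p' = (v - v') * star v + v' * star (v - v').
    by rewrite -vvs /p' starB; bop_ring.
  apply: le_trans (bnormD _ _) _.
  have svw : rnorm (star (v - v')) <= 559 * d by rewrite rnorm_star.
  have sv : rnorm (star v) <= 1 by rewrite rnorm_star.
  have := rnormM_leM v'v sv; have := rnormM_leM v'1 svw; norm_lra.
exists p', (f - p'), v'; split.
- have Bp' : B p' by apply: csM => //; exact: csS.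
  by split=> //; split=> //; exact: csB.
- split=> // h; apply: p0; apply: proj_lt1 => //.
  by move: p'p; rewrite h subr0; norm_lra.
- split=> // h; apply: q0; apply: proj_lt1 => //.
  have -> : q = (r - f) - (p - p') + (f - p') by rewrite /r; bop_ring.
  by rewrite h addr0; apply: le_lt_trans (rnormB _ _) _; norm_lra.
- by rewrite mulrBr p'f (proj2 pp'') subrr.
- by split=> //; rewrite addrC subrK.
Qed.

Lemma infiniteP S : infinite_alg (csub_alg S) <-> infinite_in (csub_set S).
Proof.
split=> [[p [q [v [[pp p0] [pq q0] pq0 vv vvs]]]]|[p [q [v [[Sp [Sq Sv]] [pp p0] [pq q0] pq0 [vv vvs]]]]]].
  exists (csub_val p), (csub_val q), (csub_val v); split.
  - by split; [|split]; exact: csub_in.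
  - by split; [exact/csub_projP|move=> h; apply: p0; exact: val_inj].
  - by split; [exact/csub_projP|move=> h; apply: q0; exact: val_inj].
  - exact: (congr1 (@csub_val _ _ S) pq0).
  - by split; [exact: (congr1 (@csub_val _ _ S) vv)|exact: (congr1 (@csub_val _ _ S) vvs)].
exists (celt Sp), (celt Sq), (celt Sv); split.
- by split; [exact/csub_projP|move=> h; apply: p0; exact: (congr1 (@csub_val _ _ S) h)].
- by split; [exact/csub_projP|move=> h; apply: q0; exact: (congr1 (@csub_val _ _ S) h)].
- exact: val_inj.
- exact: val_inj.
- exact: val_inj.
Qed.

Lemma clopen_finite : clopen [set S : csubalg (bop H) | finite_alg (csub_alg S)].
Proof.
have d0 : (0 : R) < 2048%:R^-1 by rewrite invr_gt0 ltr0n.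
apply: (clopen_uniform d0) => S T ST TS fS /infiniteP iT; apply: fS; apply/infiniteP.
apply: infinite_dnear iT; [exact: csubP|exact: csubP|exact: (ltW d0)| |exact: TS].
by rewrite mulfV // pnatr_eq0.
Qed.

End ProjectionTransfer.

(** * Perturbation of matrix units *)

Section MatrixUnits.
Variables (R : realType) (H : hilbertType R).
Implicit Types (S T : csubalg (bop H)) (A B : set (bop H)) (a b c y z w u p q e f r : bop H) (d : R).
Implicit Types (x v : nat -> bop H).

(** One column of a system of matrix units: x_k plays the part of e_k1 and p that of e_11; the
    others are the products [x i * star (x j)]. *)
Definition column_units A p x (m : nat) := [/\ A p, proj p,
  forall k, (k < m)%N -> A (x k) &
  forall k l, (k < m)%N -> (l < m)%N -> star (x k) * x l = if k == l then p else 0].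

Lemma column_unit_p A p x m k : column_units A p x m -> (k < m)%N -> x k * p = x k.
Proof.
by move=> [_ pp _ xx] km; apply: pisom_r => //; rewrite xx // eqxx.
Qed.

Lemma column_unit_norm A p x m k : column_units A p x m -> (k < m)%N -> rnorm (x k) <= 1.
Proof.
by move=> [_ pp _ xx] km; apply: (@pisom_norm _ _ _ p) => //; rewrite xx // eqxx.
Qed.

Definition range_proj x m : bop H := \sum_(k < m) x k * star (x k).

Lemma star_sum (I : finType) (F : I -> bop H) : star (\sum_i F i) = \sum_i star (F i).
Proof. by apply: (big_morph (@star _ (bop H))) => [a b|]; rewrite ?starD_ ?star0. Qed.

Lemma norm_sum_le (m : nat) (F : 'I_m -> bop H) (C : R) :
  (forall i, rnorm (F i) <= C) -> rnorm (\sum_i F i) <= m%:R * C.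
Proof.
elim: m F => [|m IH] F FC; first by rewrite big_ord0 rnorm0 mul0r.
rewrite big_ord_recr /=; apply: le_trans (bnormD _ _) _.
by rewrite -natr1 mulrDl mul1r lerD // IH.
Qed.

Lemma column_units_mul A p x m (k : 'I_m) : column_units A p x m ->
  star (x k) * range_proj x m = star (x k).
Proof.
move=> cu; rewrite /range_proj mulr_sumr (bigD1 k) //= big1 ?addr0 => [|l lk].
  have [_ pp _ xx] := cu; rewrite mulrA xx // eqxx.
  have := congr1 (@star _ _) (column_unit_p cu (ltn_ord k)).
  by rewrite starM_ (proj1 pp).
have [_ _ _ xx] := cu; rewrite mulrA xx //.
case: eqP => [kl|_]; last by rewrite mul0r.
by move: lk; rewrite -val_eqE /= -kl eqxx.
Qed.

Lemma range_proj_proj A p x m : column_units A p x m -> proj (range_proj x m).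
Proof.
move=> cu; split.
  by rewrite /range_proj star_sum; apply: eq_bigr => i _; rewrite starM_ starK.
rewrite {1}/range_proj mulr_suml; apply: eq_bigr => k _.
by rewrite -mulrA (column_units_mul k cu).
Qed.

Lemma range_proj_in A p x m : is_csubalg A -> column_units A p x m -> A (range_proj x m).
Proof.
move=> Ac [_ _ xA _]; rewrite /range_proj; elim/big_ind: _ => [|a b Aa Ab|i _].
- exact: csub0 Ac.
- exact: csD.
- by apply: csM; [| |apply: csS]; rewrite //; exact: xA.
Qed.

Lemma range_proj_near p x p1 v A B m (eps : R) : 0 <= eps ->
  column_units A p x m -> column_units B p1 v m ->
  (forall k, (k < m)%N -> rnorm (x k - v k) <= eps) ->
  rnorm (range_proj x m - range_proj v m) <= m%:R * (2 * eps).
Proof.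
move=> e0 cx cv xv; rewrite /range_proj -sumrB; apply: norm_sum_le => i.
have xi := column_unit_norm cx (ltn_ord i); have vi := column_unit_norm cv (ltn_ord i).
have di := xv i (ltn_ord i).
have -> : x i * star (x i) - v i * star (v i) =
  (x i - v i) * star (x i) + v i * star (x i - v i) by rewrite starB; bop_ring.
apply: le_trans (bnormD _ _) _.
have sd : rnorm (star (x i - v i)) <= eps by rewrite rnorm_star.
have sx : rnorm (star (x i)) <= 1 by rewrite rnorm_star.
have := rnormM_leM di sx; have := rnormM_leM vi sd; norm_lra.
Qed.

(** Induction on m. An approximant of the last unit is compressed to the complement of the ranges
    already built and to the support p1, then polar-corrected. *)
Lemma column_units_near (m : nat) (eps : R) : 0 < eps -> exists2 d : R, 0 < d &
  forall A B, is_csubalg A -> is_csubalg B -> dnear d A B ->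
  forall p x, column_units A p x m ->
  exists p1 v, [/\ column_units B p1 v m, rnorm (p - p1) <= eps &
     forall k, (k < m)%N -> rnorm (x k - v k) <= eps].
Proof.
elim: m eps => [|m IH] eps e0.
  pose d := Order.min (eps / 25) 64%:R^-1.
  have d0 : 0 < d by rewrite lt_min divr_gt0 //= invr_gt0 ltr0n.
  have d1 : d <= eps / 25 by rewrite ge_min lexx.
  have d2 : d <= 64%:R^-1 by rewrite ge_min lexx orbT.
  exists d => // A B Ac Bc AB p x [Ap pp _ _].
  have [|p1 [Bp1 pp1 pd]] := proj_transfer Bc (ltW d0) _ AB Ap pp.
    by move: d2; rewrite -[64%:R^-1]mul1r ler_pdivlMr ?ltr0n // mulrC.
  exists p1, (fun=> 0); split=> //.
  by apply: le_trans pd _; move: d1; rewrite ler_pdivlMr // mulrC.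
(* With e2 = e1 / N and eta = (4 m + 2) e2, the compression w is within eta of x_m, [star w * w] is
   within 4 eta of p1, and polar correction moves w by at most 16 eta. The total is 17 eta = e1. *)
pose N : R := 17 * (4 * m%:R + 2).
have m0 : 0 <= m%:R :> R by rewrite ler0n.
have N0 : 0 < N by rewrite /N; lra.
pose e1 := Order.min eps 1.
have e10 : 0 < e1 by rewrite lt_min e0 ltr01.
have e11 : e1 <= 1 by rewrite ge_min lexx orbT.
have e1e : e1 <= eps by rewrite ge_min lexx.
pose e2 := e1 / N.
have e20 : 0 < e2 by rewrite divr_gt0.
have e2N : e2 * N = e1 by rewrite /e2 mulfVK // gt_eqF.
have [d1 d10 Hd] := IH e2 e20.
pose d := Order.min d1 e2.
have d0 : 0 < d by rewrite lt_min d10.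
have dd1 : d <= d1 by rewrite ge_min lexx.
have de2 : d <= e2 by rewrite ge_min lexx orbT.
exists d => // A B Ac Bc AB p x cx; have [Ap pp xA xx] := cx.
have AB1 : dnear d1 A B.
  move=> y Ay; have [z [Bz yz zy]] := AB y Ay; exists z; split=> //.
  by apply: le_trans yz _; rewrite ler_wpM2r ?bnorm_ge0.
have cx' : column_units A p x m.
  by split=> // [k km|k l km lm]; [apply: xA|apply: xx]; rewrite ltnS ltnW.
have [p1 [v [cv pp1e xv]]] := Hd A B Ac Bc AB1 p x cx'.
have [Bp1 pp1 vB vv] := cv.
pose F := range_proj x m; pose G := range_proj v m.
have pG : proj (1 - G) by apply: proj1B; exact: range_proj_proj cv.
have pF : proj (1 - F) by apply: proj1B; exact: range_proj_proj cx'.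
have FG : rnorm (F - G) <= m%:R * (2 * e2) := range_proj_near (ltW e20) cx' cv xv.
have xm1 := column_unit_norm cx (ltnSn m).
have [y [By xy yx]] := AB _ (xA m (ltnSn m)).
have y1 := le_trans yx xm1.
have {}xy : rnorm (x m - y) <= e2.
  apply: le_trans xy _; apply: le_trans de2.
  by rewrite ler_piMr // ltW.
have Fx : F * x m = 0.
  rewrite mulr_suml; apply: big1 => i _.
  have im : (i < m.+1)%N by exact: leqW (ltn_ord i).
  by rewrite -mulrA (xx _ _ im (ltnSn m)) (ltn_eqF (ltn_ord i)) mulr0.
have xp : x m * p = x m := column_unit_p cx (ltnSn m).
pose w := (1 - G) * y * p1.
have G1 := proj_norm_le1 pG; have F1 := proj_norm_le1 pF.
have p11 := proj_norm_le1 pp1; have p01 := proj_norm_le1 pp.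
pose eta := (4 * m%:R + 2) * e2.
have eta0 : 0 <= eta by apply: mulr_ge0; [norm_lra|exact: ltW].
have eta17 : 17 * eta = e1 by rewrite -e2N /eta /N; ring.
have wx : rnorm (x m - w) <= eta.
  have -> : x m - w = (1 - F) * x m * (p - p1) + (1 - F) * (x m - y) * p1 -
      (F - G) * y * p1.
    rewrite -{1}xp -{1}[x m]mul1r; transitivity ((1 - F) * x m * p - w).
      by rewrite (mulrBl (x m)) Fx subr0 mul1r.
    by rewrite /w; bop_ring.
  apply: le_trans (rnormB _ _) _.
  have := bnormD ((1 - F) * x m * (p - p1)) ((1 - F) * (x m - y) * p1).
  have := rnormM_leM (rnormM_leM F1 xm1) pp1e.
  have := rnormM_leM (rnormM_leM F1 xy) p11.
  have := rnormM_leM (rnormM_leM FG y1) p11.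
  by have := mulr_ge0 m0 (ltW e20); rewrite /eta; norm_lra.
have w1 : rnorm w <= 1.
  by have := rnormM_leM (rnormM_leM G1 y1) p11; rewrite !mulr1.
have ww : rnorm (star w * w - p1) <= 4 * eta.
  have xxm : star (x m) * x m = p by rewrite xx // eqxx.
  have -> : star w * w - p1 = (p - p1) - (star (x m - w) * w + star (x m) * (x m - w)).
    by rewrite -xxm starB; bop_ring.
  apply: le_trans (rnormB _ _) _.
  have := bnormD (star (x m - w) * w) (star (x m) * (x m - w)).
  have s1 : rnorm (star (x m - w)) <= eta by rewrite rnorm_star.
  have s2 : rnorm (star (x m)) <= 1 by rewrite rnorm_star.
  have := rnormM_leM s1 w1; have := rnormM_leM s2 wx.
  have : e2 <= eta by rewrite /eta; have := mulr_ge0 m0 (ltW e20); norm_lra.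
  norm_lra.
have wp1 : w * p1 = w by rewrite /w -mulrA (proj2 pp1).
have Bw : B w.
  rewrite /w mulrBl mul1r; apply: csM => //; apply: csB => //; apply: csM => //.
  exact: range_proj_in cv.
have [|vm [Bvm vvm vmw vmP]] := polar_near Bc Bw Bp1 pp1 wp1; first by norm_lra.
have vk k : (k < m)%N -> star (v k) * vm = 0.
  move=> km; have vkw : star (v k) * w = 0.
    rewrite /w !mulrA mulrBr mulr1 (column_units_mul (Ordinal km) cv) /=.
    by rewrite subrr !mul0r.
  (* The left support 1 - v_k [star (v k)] of w is kept by [polar_near], which makes the new unit
     orthogonal to v_k. *)
  have := vmP (1 - v k * star (v k)).
  rewrite !mulrBl !mul1r -!mulrA vkw mulr0 subr0 => /(_ erefl) h.
  have := congr1 (fun z => vm - z) h; rewrite subKr subrr.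
  move=> /(congr1 (fun z => star (v k) * z)); rewrite mulr0 !mulrA vv // eqxx.
  have := congr1 (@star _ _) (column_unit_p cv km).
  by rewrite starM_ (proj1 pp1) => ->.
have [v' v'm v'k] : exists2 v', v' m = vm & forall k, (k < m)%N -> v' k = v k.
  exists (fun k => if k == m then vm else v k); first by rewrite eqxx.
  by move=> k km; rewrite (ltn_eqF km).
have cases k : (k < m.+1)%N -> k = m \/ (k < m)%N.
  by rewrite ltnS leq_eqVlt => /orP[/eqP|]; [left|right].
have e2e : e2 <= eps.
  apply: le_trans e1e; rewrite -eta17 /eta.
  by have := mulr_ge0 m0 (ltW e20); norm_lra.
exists p1, v'; split.
- split=> [//|//|k|k l] => [/cases[->|km]|/cases[->|km] /cases[->|lm]].
  + by rewrite v'm.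
  + by rewrite v'k //; exact: vB.
  + by rewrite v'm eqxx.
  + rewrite v'm v'k // eq_sym (ltn_eqF lm).
    by have := congr1 (@star _ _) (vk l lm); rewrite starM_ starK star0.
  + by rewrite v'm v'k // (ltn_eqF km) vk.
  + by rewrite !v'k //; exact: vv.
- exact: le_trans pp1e _.
- move=> k /cases[->|km]; last by rewrite v'k //; exact: le_trans (xv k km) _.
  rewrite v'm; apply: le_trans (bdistD w _ _) _; rewrite (bdistC w).
  by apply: le_trans e1e; norm_lra.
Qed.

End MatrixUnits.

(** * Matrix units and unital copies of matrix algebras *)

Section MatrixAlgebra.
Variables (R : realType) (H : hilbertType R).
Implicit Types (S T : csubalg (bop H)) (A B : set (bop H)) (p q e : bop H) (d : R).
Implicit Types (x v : nat -> bop H).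

Section MatrixMap.
Variables (A : set (bop H)) (p : bop H) (v : nat -> bop H) (n : nat).
Hypothesis cu : column_units A p v n.
Implicit Types X Y : 'M[R[i]]_n.

Definition mxmap X : bop H := \sum_(i < n) \sum_(j < n) X i j *: (v i * star (v j)).

Lemma mxmap_linear (c : R[i]) X Y : mxmap (c *: X + Y) = c *: mxmap X + mxmap Y.
Proof.
rewrite /mxmap scaler_sumr -big_split /=; apply: eq_bigr => i _.
rewrite scaler_sumr -big_split /=; apply: eq_bigr => j _.
by rewrite !mxE scalerDl scalerA.
Qed.

(** Compressing between two units recovers a matrix entry; injectivity of [mxmap] follows when p is
    nonzero. *)
Lemma mxmap_corner X (k l : 'I_n) : star (v k) * mxmap X * v l = X k l *: p.
Proof.
have [_ [ps pp] _ vv] := cu.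
rewrite /mxmap mulr_sumr (bigD1 k) //= [X in _ + X]big1 ?addr0 => [|i ik]; last first.
  rewrite mulr_sumr big1 // => j _; rewrite bopZAr mulrA vv //.
  by rewrite eq_sym (negPf (_ : val i != val k)) // mul0r scaler0.
rewrite mulr_sumr mulr_suml (bigD1 l) //= big1 ?addr0 => [|j jl]; last first.
  rewrite bopZAr bopZAl -!mulrA vv //.
  by rewrite (negPf (_ : val j != val l)) // !mulr0 scaler0.
by rewrite bopZAr bopZAl -mulrA -mulrA vv // eqxx mulrA vv // eqxx pp.
Qed.

Lemma mxmap_mul X Y : mxmap (X *m Y) = mxmap X * mxmap Y.
Proof.
have [_ _ _ vv] := cu.
rewrite /mxmap mulr_suml; apply: eq_bigr => i _; rewrite mulr_suml.
under eq_bigr => l _ do rewrite !mxE scaler_suml.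
rewrite exchange_big /=; apply: eq_bigr => j _.
rewrite bopZAl mulr_sumr [X in _ = _ *: X](bigD1 j) //= [X in _ + X]big1 ?addr0 => [|k kj]; last first.
  rewrite mulr_sumr big1 // => l _; rewrite bopZAr -mulrA (mulrA (star (v j))) vv //.
  by rewrite eq_sym (negPf (_ : val k != val j)) // mul0r mulr0 scaler0.
rewrite mulr_sumr scaler_sumr; apply: eq_bigr => l _.
rewrite bopZAr scalerA -mulrA (mulrA (star (v j))) vv // eqxx mulrA.
by rewrite (column_unit_p cu).
Qed.

Lemma mxmap_star X : mxmap (map_mx (@conjc R) X^T) = star (mxmap X).
Proof.
rewrite /mxmap star_sum exchange_big /=; apply: eq_bigr => j _.
rewrite star_sum; apply: eq_bigr => i _.
by rewrite !mxE starZ_ starM_ starK.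
Qed.

Lemma mxmap_inj : (0 < n)%N -> p <> 0 -> injective mxmap.
Proof.
move=> n0 p0 X Y XY; apply/matrixP => i j.
apply/eqP; rewrite -subr_eq0; apply/eqP; apply: contrapT => /eqP h; apply: p0.
have : (X i j - Y i j) *: p = 0 by rewrite scalerBl -!mxmap_corner XY subrr.
by move/eqP; rewrite scaler_eq0 (negPf h) => /eqP.
Qed.

Lemma mxmap1 : mxmap 1%:M = range_proj v n.
Proof.
rewrite /mxmap /range_proj; apply: eq_bigr => i _.
rewrite (bigD1 i) //= mxE eqxx scale1r big1 ?addr0 // => j ji.
by rewrite mxE eq_sym (negPf ji) scale0r.
Qed.

Lemma mxmap_in X : is_csubalg A -> A (mxmap X).
Proof.
move=> Ac; have [_ _ vA _] := cu.
rewrite /mxmap; elim/big_ind: _ => [|a b|i _]; [exact: csub0 Ac|exact: csD|].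
elim/big_ind: _ => [|a b|j _]; [exact: csub0 Ac|exact: csD|].
by apply: csZ => //; apply: csM => //; [|apply: csS => //]; exact: vA.
Qed.

End MatrixMap.

(** The algebra of matrices of size 0 is zero, so its unit is 0 and the unit of S must be 0. *)
Lemma contains_matrix0 S : contains_unital_matrix 0 (csub_alg S) <->
  forall a : bop H, csub_set S a -> a = 0.
Proof.
split=> [[e [/csub_oneP ue [f [fl _ _ _ [X fX]]]]] a Sa|S0].
  have f0 : f X = 0.
    have XE : X = (-1) *: X + X by rewrite (flatmx0 X) scaler0 addr0.
    by rewrite XE fl scaleN1r addNr.
  have [<- _] := proj2 ue a Sa.
  by rewrite -(congr1 (@csub_val _ _ S) fX) f0; exact: mul0r.
have z a b : a = b :> csub_alg S.
  by apply: val_inj; rewrite /= (S0 _ (csub_in a)) (S0 _ (csub_in b)).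
exists 0; split; first by move=> a; split; exact: z.
exists (fun=> 0); split; try by move=> *; exact: z.
  by move=> X Y _; rewrite (flatmx0 X) (flatmx0 Y).
by exists 0.
Qed.

(** The units are the images of the elementary matrices in the first column; their range projections
    add up to the image of the identity matrix. *)
Lemma contains_matrix_units S n : contains_unital_matrix n.+1 (csub_alg S) ->
  exists p x, [/\ column_units (csub_set S) p x n.+1, p <> 0 &
    unit_of (csub_set S) (range_proj x n.+1)].
Proof.
move=> [e [/csub_oneP ue [f [fl fM fS fi [X0 fX0]]]]].
pose g X := csub_val (f X).
have gl c X Y : g (c *: X + Y) = c *: g X + g Y by rewrite /g fl.
have gM X Y : g (X *m Y) = g X * g Y by rewrite /g fM.
have gS X : g (map_mx (@conjc R) X^T) = star (g X) by rewrite /g fS.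
have gin X : csub_set S (g X) by exact: csub_in.
have gi X Y : g X = g Y -> X = Y by move=> XY; apply: fi; exact: val_inj.
have g0 : g 0 = 0 by have := gl (-1) 0 0; rewrite scaler0 addr0 scaleN1r addNr.
have gD X Y : g (X + Y) = g X + g Y by rewrite -[X]scale1r gl !scale1r.
have gsum (I : finType) (F : I -> 'M[R[i]]_n.+1) : g (\sum_i F i) = \sum_i g (F i).
  exact: (big_morph g gD g0).
have dS (i j : 'I_n.+1) : map_mx (@conjc R) (delta_mx i j)^T = delta_mx j i.
  by rewrite trmx_delta; apply/matrixP => k l; rewrite !mxE; case: andP => _;
    rewrite ?conjc1 ?conjc0.
pose x k := g (delta_mx (inord k) 0); pose p := g (delta_mx 0 0).
have g1 : g 1%:M = csub_val e.
  have h : csub_val e = g X0 by rewrite /g fX0.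
  have [_ h1] := proj2 ue _ (gin 1%:M).
  by rewrite -h1 {1}h -gM mul1mx -h.
exists p, x; split.
- split; [exact: gin| |by move=> k _; exact: gin|move=> k l kn ln].
  + by split; rewrite /p -?gS ?dS // -gM mul_delta_mx.
  + rewrite /x -gS dS -gM mul_delta_mx_cond.
    have -> : (inord k == inord l :> 'I_n.+1) = (k == l).
      by rewrite -val_eqE /= !inordK.
    by case: eqP => _; rewrite ?mulr1n // mulr0n g0.
- move=> p0; have := gi (delta_mx 0 0) 0; rewrite g0 => /(_ p0)/matrixP/(_ 0 0).
  by rewrite !mxE eqxx /= => /eqP; rewrite oner_eq0.
- suff -> : range_proj x n.+1 = csub_val e by [].
  rewrite -g1 -[1%:M](_ : \sum_(i < n.+1) delta_mx i i = _); last first.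
    rewrite [RHS]matrix_sum_delta; apply: eq_bigr => i _.
    rewrite (bigD1 i) //= mxE eqxx scale1r big1 ?addr0 // => j ji.
    by rewrite mxE eq_sym (negPf ji) scale0r.
  rewrite gsum; apply: eq_bigr => i _.
  by rewrite /x inord_val -gS dS -gM mul_delta_mx.
Qed.

Lemma matrix_units_contains S n p v : column_units (csub_set S) p v n.+1 -> p <> 0 ->
  unit_of (csub_set S) (range_proj v n.+1) -> contains_unital_matrix n.+1 (csub_alg S).
Proof.
move=> cu p0 ue.
pose g X : csub_alg S := celt (mxmap_in cu X (csubP S)).
exists (celt (proj1 ue)); split; first exact/csub_oneP.
exists g; split.
- by move=> c X Y; apply: val_inj; exact: mxmap_linear.
- by move=> X Y; apply: val_inj; exact: (mxmap_mul cu).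
- by move=> X; apply: val_inj; exact: mxmap_star.
- move=> X Y /(congr1 (@csub_val _ _ S)); exact: (mxmap_inj cu).
- by exists 1%:M; apply: val_inj; exact: mxmap1.
Qed.

Lemma unit_of_uniq A e q : unit_of A e -> unit_of A q -> e = q.
Proof.
by move=> [Ae eP] [Aq qP]; have [_ <-] := qP e Ae; have [-> _] := eP q Aq.
Qed.

Lemma clopen_contains_matrix n :
  clopen [set S : csubalg (bop H) | contains_unital_matrix n (csub_alg S)].
Proof.
case: n => [|n].
  apply: (@clopen_uniform _ _ _ 2^-1); first by rewrite invr_gt0.
  move=> S T _ TS /contains_matrix0 S0; apply/contains_matrix0 => y Ty.
  have [x [Sx yx _]] := TS y Ty; move: yx; rewrite (S0 x Sx) subr0 => yx.
  by apply: rnorm0_eq0; have := bnorm_ge0 y; norm_lra.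
have m0 : 0 <= n.+1%:R :> R by rewrite ler0n.
(* Chosen so that the range projections of the two systems differ by less than 1/2. *)
pose eps : R := (4 * (n.+1%:R + 1))^-1.
have eps0 : 0 < eps by rewrite invr_gt0; lra.
have epsE : n.+1%:R * (2 * eps) + 2 * eps = 2^-1.
  by rewrite /eps; field; rewrite gt_eqF //; lra.
have [d1 d10 Hd] := @column_units_near R H n.+1 eps eps0.
pose d := Order.min d1 128%:R^-1.
have d0 : 0 < d by rewrite lt_min d10 invr_gt0 ltr0n.
have dd1 : d <= d1 by rewrite ge_min lexx.
have d2 : 128 * d <= 1.
  have : d <= 128%:R^-1 by rewrite ge_min lexx orbT.
  by rewrite -[128%:R^-1]mul1r ler_pdivlMr ?ltr0n // mulrC.
apply: (clopen_uniform d0) => S T ST TS /contains_matrix_units[p [x [cx p0 ue]]].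
have [f [uf pf ef]] := unit_transfer (csubP S) (csubP T) (ltW d0) d2 ST TS ue.
have ST1 : dnear d1 (csub_set S) (csub_set T).
  move=> y Sy; have [z [Tz yz zy]] := ST y Sy; exists z; split=> //.
  by apply: le_trans yz _; rewrite ler_wpM2r ?bnorm_ge0.
have [p1 [v [cv pp1 xv]]] := Hd _ _ (csubP S) (csubP T) ST1 p x cx.
have near := range_proj_near (ltW eps0) cx cv xv.
have eps2 : 2 * eps <= 2^-1.
  by have := mulr_ge0 m0 (ltW eps0); move: epsE; clear; lra.
have pv := range_proj_proj cv.
(* The range projection of the new units lies under the unit f at distance below 1, so it is f. *)
have fv : range_proj v n.+1 = f.
  have [fv _] := proj2 uf _ (range_proj_in (csubP T) cv).
  have /proj_lt1 h := projB pf pv fv.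
  apply/eqP; rewrite eq_sym -subr_eq0; apply/eqP/h.
  apply: le_lt_trans (bdistD (range_proj x n.+1) _ _) _; rewrite (bdistC f).
  move: epsE near ef d2 eps2 eps0; norm_gen.
  have : n.+1%:R * (2 * eps) <= 2^-1 by move: epsE eps0; clear; lra.
  by clear -ef near d2; move: (_ * (2 * eps)) near => t; lra.
apply: (matrix_units_contains cv); last by rewrite fv.
move=> p10; apply: p0; have [_ pp _ _] := cx.
by apply: proj_lt1 pp _; move: pp1; rewrite p10 subr0; norm_lra.
Qed.

End MatrixAlgebra.

(** * Uniform continuity of formulas, and axiomatizable classes *)

Section FormulaContinuity.
Variables (R : realType) (H : hilbertType R).
Implicit Types (S T : csubalg (bop H)) (t : cterm R) (phi : cformula R) (N : R).
Implicit Types (u : nat -> bop H).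

Lemma csub_cterm_val S (v : nat -> csub_elt S) t :
  csub_val (@cterm_val R (csub_alg S) v t) = @cterm_val R (bop H) (fun x => csub_val (v x)) t.
Proof.
elim: t => [x||s Es t Et|s Es t Et|s Es|c s Es] //=.
- by rewrite -Es -Et.
- by rewrite -Es -Et.
- by rewrite -Es.
- by rewrite -Es.
Qed.

Lemma term_bound t N : 0 <= N -> exists2 M, 0 <= M &
  forall u, (forall x, rnorm (u x) <= N) -> rnorm (@cterm_val R (bop H) u t) <= M.
Proof.
move=> N0; elim: t => [x||s [Ms Ms0 sM] t [Mt Mt0 tM]|s [Ms Ms0 sM] t [Mt Mt0 tM]|s [M M0 sM]|c s [M M0 sM]] /=.
- by exists N => // u uN; exact: uN.
- by exists 0 => // u _; rewrite rnorm0.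
- exists (Ms + Mt) => [|u uN]; first exact: addr_ge0.
  by apply: le_trans (bnormD _ _) _; apply: lerD; [exact: sM|exact: tM].
- exists (Ms * Mt) => [|u uN]; first exact: mulr_ge0.
  by apply: rnormM_leM; [exact: sM|exact: tM].
- by exists M => // u uN; rewrite rnorm_star; exact: sM.
- exists (cabs c * M) => [|u uN]; first by rewrite mulr_ge0 ?cabs_ge0.
  by rewrite rnormZc ler_wpM2l ?cabs_ge0 // sM.
Qed.

Lemma term_near t N : 0 <= N -> exists2 C, 0 <= C & forall u u' (d : R),
  (forall x, rnorm (u x) <= N) -> (forall x, rnorm (u' x) <= N) -> 
  (forall x, rnorm (u x - u' x) <= d) ->
  rnorm (@cterm_val R (bop H) u t - @cterm_val R (bop H) u' t) <= C * d.
Proof.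
move=> N0; elim: t => [x||s [Cs Cs0 sC] t [Ct Ct0 tC]|s [Cs Cs0 sC] t [Ct Ct0 tC]|s [C C0 sC]|c s [C C0 sC]] /=.
- by exists 1 => // u u' d _ _ uu; rewrite mul1r; exact: uu.
- by exists 0 => // u u' d _ _ uu; rewrite subrr rnorm0 mul0r.
- exists (Cs + Ct) => [|u u' d uN u'N uu]; first exact: addr_ge0.
  rewrite opprD addrACA mulrDl; apply: le_trans (bnormD _ _) _.
  by apply: lerD; [exact: sC|exact: tC].
- have [Ms Ms0 sM] := term_bound s N0; have [Mt Mt0 tM] := term_bound t N0.
  exists (Cs * Mt + Ms * Ct) => [|u u' d uN u'N uu].
    by rewrite addr_ge0 ?mulr_ge0.
  have := sC u u' d uN u'N uu; have := tC u u' d uN u'N uu.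
  have := sM u' u'N; have := tM u uN.
  move: (cterm_val u s) (cterm_val u t) (cterm_val u' s) (cterm_val u' t) => a b a' b'.
  move=> bM aM bb aa; rewrite [X in rnorm X](_ : _ = (a - a') * b + a' * (b - b')).
    apply: le_trans (bnormD _ _) _; rewrite [leRHS]mulrDl; apply: lerD.
      by apply: le_trans (rnormM_leM aa bM) _; rewrite [leRHS]mulrAC.
    by rewrite -[leRHS]mulrA; exact: rnormM_leM.
  by rewrite -[cmul a b]/(a * b) -[cmul a' b']/(a' * b'); bop_ring.
- by exists C => // u u' d uN u'N uu; rewrite -starB rnorm_star; exact: sC.
- exists (cabs c * C) => [|u u' d uN u'N uu]; first by rewrite mulr_ge0 ?cabs_ge0.
  by rewrite -scalerBr rnormZc -mulrA ler_wpM2l ?cabs_ge0 // sC.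
Qed.

Definition row_box (k : nat) (M : R) : set 'rV[R]_k := [set a | forall i, `|a ord0 i| <= M].

Lemma row_box_compact k M : compact (@row_box k M).
Proof.
have := @rV_compact R k (fun=> `[- M, M]%classic) (fun _ => @segment_compact R _ _).
congr compact; apply/seteqP; split=> a aM i; have := aM i.
  by rewrite /= in_itv /= ler_norml.
by rewrite /= in_itv /= ler_norml.
Qed.

(** Heine-Cantor through near coverings; only one of the two points is required to lie in the
    compact box. *)
Lemma row_unif_continuous k (f : 'rV[R]_k -> R) (M e : R) : continuous f -> 0 < e ->
  exists2 d : R, 0 < d & forall a b : 'rV[R]_k, row_box M a ->
    (forall i, `|a ord0 i - b ord0 i| <= d) -> `|f a - f b| <= e.
Proof.
move=> fc e0.
have /compact_near_coveringP/(_ R 0^'+ (fun d a => forall b : 'rV[R]_k,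
  (forall i, `|a ord0 i - b ord0 i| <= d) -> `|f a - f b| <= e)) := @row_box_compact k M.
case=> [a _|d /= d0 Hd]; last first.
  have d20 : 0 < d / 2 by rewrite divr_gt0.
  exists (d / 2) => // a b aM ab; apply: (Hd (d / 2)) => //=.
  by rewrite sub0r normrN gtr0_norm // ltr_pdivrMr // ltr_pMr // ltr1n.
have e20 : 0 < e / 2 by rewrite divr_gt0.
have /cvgrPdist_le/(_ _ e20)/nbhs_ballP[r /= r0 Hr] := fc a.
have r20 : 0 < r / 2 by rewrite divr_gt0.
near=> a' d => /= b a'b.
have aa' : ball a (r / 2) a' by near: a'; exact: nbhsx_ballx.
have dr : d < r / 2 by near: d; apply: nbhs_right_lt.
have h1 : `|f a - f a'| <= e / 2.
  by apply: Hr; apply: le_ball aa'; rewrite ler_pdivrMr // ler_pMr // ler1n.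
have h2 : `|f a - f b| <= e / 2.
  apply: Hr; split=> // i j; rewrite ord1 /ball /=; have [_ /(_ 0 j)] := aa'.
  rewrite /ball /= => h.
  have := a'b j; have := ler_normD (a 0 j - a' 0 j) (a' 0 j - b 0 j).
  rewrite addrA subrK; move: h dr; lra.
have := ler_normD (f a' - f a) (f a - f b); rewrite addrA subrK.
by rewrite (distrC (f a') (f a)); lra.
Unshelve. all: by end_near. Qed.

Lemma sup_near (X Y : set R) (e M : R) : X !=set0 -> Y !=set0 ->
  (forall x, X x -> x <= M) -> (forall y, Y y -> y <= M) ->
  (forall x, X x -> exists2 y, Y y & x - y <= e) ->
  sup X - sup Y <= e.
Proof.
move=> X0 Y0 XM YM XY; rewrite lerBlDr; apply: ge_sup => // x /XY[y Yy xy].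
have : y <= sup Y by apply: sup_upper_bound => //; split=> //; exists M.
by move: xy; lra.
Qed.

Lemma inf_near (X Y : set R) (e M : R) : X !=set0 -> Y !=set0 ->
  (forall x, X x -> M <= x) -> (forall y, Y y -> M <= y) ->
  (forall y, Y y -> exists2 x, X x & x - y <= e) ->
  inf X - inf Y <= e.
Proof.
move=> X0 Y0 XM YM YX; rewrite lerBlDr addrC -lerBlDr; apply: lb_le_inf => // y /YX[x Xx xy].
have : inf X <= x by apply: ge_inf => //; exists M.
by move: xy; lra.
Qed.

Lemma update_bounded S (v : nat -> csub_elt S) N (n x : nat) (a : csub_alg S) :
  (forall y, rnorm (csub_val (v y)) <= N) -> sort_ball n a -> 0 <= N ->
  forall y, rnorm (csub_val (@update R (csub_alg S) v x a y)) <= N + n%:R.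
Proof.
move=> vN an N0 y; rewrite /update; case: eqP => _.
  by apply: le_trans an _; rewrite lerDr.
by apply: le_trans (vN y) _; rewrite lerDl.
Qed.

(** The bound is uniform over all subalgebras. It supplies the compact boxes for the connectives and
    the boundedness that sup and inf need. A quantifier over the ball of radius n replaces the bound
    N on valuations by N + n. *)
Lemma formula_bound phi N : 0 <= N -> exists2 M, 0 <= M & forall S (v : nat -> csub_elt S),
  (forall x, rnorm (csub_val (v x)) <= N) -> `|@cformula_val R (csub_alg S) v phi| <= M.
Proof.
elim: phi N => [s t|k f fc phis IH|x n psi IH|x n psi IH] N N0 /=.
- have [Ms Ms0 sM] := term_bound s N0; have [Mt Mt0 tM] := term_bound t N0.
  exists (Ms + Mt) => [|S v vN]; first exact: addr_ge0.
  rewrite ger0_norm ?rnorm_ge0 //; apply: le_trans (rnormD _ _) _; rewrite rnormN.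
  apply: lerD; rewrite csub_rnorm csub_cterm_val; [exact: sM|exact: tM].
- have /choice[M MP] : forall i, exists M, 0 <= M /\ forall S (v : nat -> csub_elt S),
      (forall x, rnorm (csub_val (v x)) <= N) -> `|@cformula_val R (csub_alg S) v (phis i)| <= M.
    by move=> i; have [M M0 MP] := IH i N N0; exists M.
  pose K := \sum_i M i.
  have MK i : M i <= K.
    by rewrite /K (bigD1 i) //= lerDl sumr_ge0 // => j _; case: (MP j).
  have : compact (f @` @row_box k K).
    by apply: continuous_compact; [exact: continuous_subspaceT|exact: row_box_compact].
  move=> /compact_bounded[B [_ /(_ (`|B| + 1))]].
  rewrite ltr_pwDr ?ltr01 ?ler_norm // => /(_ isT) fB.
  exists (`|B| + 1) => [|S v vN]; first by rewrite addr_ge0.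
  apply: fB; exists (\row_i cformula_val v (phis i)) => // i; rewrite mxE.
  by apply: le_trans (MK i); case: (MP i) => _; exact.
- have [M M0 MP] := IH (N + n%:R) (addr_ge0 N0 (ler0n _ _)); exists M => // S v vN.
  set X := [set _ | _ in _].
  have XM z : X z -> `|z| <= M.
    by move=> [a an <-]; apply: MP; exact: update_bounded.
  have X0 : X !=set0 by eexists; exists 0 => //; rewrite /sort_ball /= rnorm0 ler0n.
  rewrite ler_norml; apply/andP; split.
    case: X0 => z Xz; apply: (@le_trans _ _ z).
      by have := XM z Xz; rewrite ler_norml => /andP[].
    apply: sup_upper_bound => //; split; first by exists z.
    by exists M => y /XM; rewrite ler_norml => /andP[].
  by apply: ge_sup => // y /XM; rewrite ler_norml => /andP[].
- have [M M0 MP] := IH (N + n%:R) (addr_ge0 N0 (ler0n _ _)); exists M => // S v vN.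
  set X := [set _ | _ in _].
  have XM z : X z -> `|z| <= M.
    by move=> [a an <-]; apply: MP; exact: update_bounded.
  have X0 : X !=set0 by eexists; exists 0 => //; rewrite /sort_ball /= rnorm0 ler0n.
  rewrite ler_norml; apply/andP; split.
    by apply: lb_le_inf => // y /XM; rewrite ler_norml => /andP[].
  case: X0 => z Xz; apply: (@le_trans _ _ z).
    by apply: ge_inf => //; exists (- M) => y /XM; rewrite ler_norml => /andP[].
  by have := XM z Xz; rewrite ler_norml => /andP[].
Qed.

Lemma dnear_le (d d' : R) (A B : set (bop H)) : d <= d' -> dnear d A B -> dnear d' A B.
Proof.
move=> dd AB x Ax; have [y [By xy yx]] := AB x Ax; exists y; split=> //.
by apply: le_trans xy _; rewrite ler_wpM2r ?rnorm_ge0.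
Qed.

(** Uniform over all pairs of nearby subalgebras and all valuations bounded by N, as the induction
    through quantifiers requires. *)
Definition formula_near (e d : R) phi N := forall S T,
  dnear d (csub_set S) (csub_set T) -> dnear d (csub_set T) (csub_set S) ->
  forall (v : nat -> csub_elt S) (w : nat -> csub_elt T),
  (forall x, rnorm (csub_val (v x)) <= N) -> (forall x, rnorm (csub_val (w x)) <= N) ->
  (forall x, rnorm (csub_val (v x) - csub_val (w x)) <= d) ->
  `|@cformula_val R (csub_alg S) v phi - @cformula_val R (csub_alg T) w phi| <= e.

Lemma formula_near_le e d d' phi N : d' <= d -> formula_near e d phi N -> formula_near e d' phi N.
Proof.
move=> dd Hd S T ST TS v w vN wN vw; apply: Hd => //; try exact: dnear_le dd _.
by move=> x; exact: le_trans (vw x) dd.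
Qed.

Lemma update_near S T (v : nat -> csub_elt S) (w : nat -> csub_elt T) (a : csub_elt S) (b : csub_elt T) x (d : R) :
  (forall x, rnorm (csub_val (v x) - csub_val (w x)) <= d) ->
  rnorm (csub_val a - csub_val b) <= d ->
  forall y, rnorm (csub_val (@update R (csub_alg S) v x a y) - csub_val (@update R (csub_alg T) w x b y)) <= d.
Proof. by move=> vw ab y; rewrite /update; case: eqP. Qed.

Lemma ball_near S T (d d' : R) (n : nat) (a : csub_elt S) : 
  d * (n%:R + 1) = d' -> 0 < d -> dnear d (csub_set S) (csub_set T) ->
  @sort_ball R (csub_alg S) n a ->
  exists2 b : csub_elt T, @sort_ball R (csub_alg T) n b & rnorm (csub_val a - csub_val b) <= d'.
Proof.
move=> dd d0 ST an; have [b [Tb ab ba]] := ST _ (csub_in a).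
exists (celt Tb); first exact: le_trans ba an.
apply: le_trans ab _; rewrite -dd ler_pM2l //.
by apply: le_trans an _; rewrite lerDl.
Qed.

(** Induction on the formula. A connective is uniformly continuous on a box containing the values of
    its arguments. For a quantifier, each element of a ball in one algebra is matched with an
    element of the same ball in the other, and the suprema or infima are compared. *)
Lemma formula_nearP phi N e : 0 <= N -> 0 < e -> exists2 d, 0 < d & formula_near e d phi N.
Proof.
elim: phi N e => [s t|k f fc phis IH|x n psi IH|x n psi IH] N e N0 e0.
- have [Cs Cs0 sC] := term_near s N0; have [Ct Ct0 tC] := term_near t N0.
  have C0 : 0 < Cs + Ct + 1 by rewrite ltr_wpDl // addr_ge0.
  exists (e / (Cs + Ct + 1)) => [|S T _ _ v w vN wN vw]; first exact: divr_gt0.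
  set d := e / _ in vw; have dE : d * (Cs + Ct + 1) = e by rewrite /d mulfVK // gt_eqF.
  have d0 : 0 < d by exact: divr_gt0.
  have := sC _ _ d vN wN vw; have := tC _ _ d vN wN vw.
  rewrite /= -!csub_cterm_val !csub_rnorm.
  rewrite -[csub_val (_ - _)]/(csub_val (cterm_val v s) - csub_val (cterm_val v t)).
  rewrite -[csub_val (cterm_val w s - _)]/(csub_val (cterm_val w s) - csub_val (cterm_val w t)).
  move: (csub_val (cterm_val v s)) (csub_val (cterm_val v t))
    (csub_val (cterm_val w s)) (csub_val (cterm_val w t)) => a b a' b' bb aa.
  apply: (@le_trans _ _ (rnorm ((a - b) - (a' - b')))).
    rewrite ler_norml lerNl opprB; apply/andP; split; last exact: bnormB_sub.
    by rewrite (bdistC (a - b) (a' - b')); exact: bnormB_sub.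
  have -> : a - b - (a' - b') = (a - a') - (b - b') by bop_ring.
  by apply: le_trans (rnormB _ _) _; norm_lra.
- have /choice[M MP] : forall i, exists M, 0 <= M /\ forall S (v : nat -> csub_elt S),
      (forall x, rnorm (csub_val (v x)) <= N) -> `|@cformula_val R (csub_alg S) v (phis i)| <= M.
    by move=> i; have [M M0 MP] := formula_bound (phis i) N0; exists M.
  pose K := \sum_i M i.
  have MK i : M i <= K.
    by rewrite /K (bigD1 i) //= lerDl sumr_ge0 // => j _; case: (MP j).
  have [d d0 fd] := row_unif_continuous K fc e0.
  have /choice[g gP] : forall i, exists d', 0 < d' /\ formula_near d d' (phis i) N.
    by move=> i; have [d' ? ?] := IH i N d N0 d0; exists d'.
  exists (\big[Order.min/1]_i g i).
    by elim/big_ind: _ => // [a b a0 b0|i _]; [rewrite lt_min a0|case: (gP i)].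
  move=> S T ST TS v w vN wN vw /=; apply: fd => [i|i]; rewrite !mxE.
    by apply: le_trans (MK i); case: (MP i) => _; exact.
  have gi : \big[Order.min/1]_i g i <= g i by apply: bigmin_le_cond.
  have [_ gn] := gP i.
  by apply: (formula_near_le gi gn).
- have [d d0 Hd] := IH (N + n%:R) e (addr_ge0 N0 (ler0n _ _)) e0.
  have n0 : 0 < n%:R + 1 :> R by rewrite ltr_wpDl.
  have [M M0 MP] := formula_bound psi (addr_ge0 N0 (ler0n _ n)).
  pose d' := d / (n%:R + 1); have d'E : d' * (n%:R + 1) = d by rewrite /d' mulfVK // gt_eqF.
  have d'0 : 0 < d' by exact: divr_gt0.
  have dd' : d' <= d by rewrite -d'E ler_pMr // lerDr.
  exists d' => // S T ST TS v w vN wN vw /=.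
  have vw' y := le_trans (vw y) dd'.
  have ST' := dnear_le dd' ST; have TS' := dnear_le dd' TS.
  rewrite ler_norml lerNl opprB; apply/andP; split.
    apply: (@sup_near _ _ _ M).
    + by eexists; exists 0 => //; rewrite /sort_ball /= rnorm0 ler0n.
    + by eexists; exists 0 => //; rewrite /sort_ball /= rnorm0 ler0n.
    + move=> _ [a an <-]; apply: le_trans (ler_norm _) _; apply: MP; exact: update_bounded.
    + move=> _ [a an <-]; apply: le_trans (ler_norm _) _; apply: MP; exact: update_bounded.
    + move=> _ [a an <-]; have [b bn ab] := ball_near d'E d'0 TS an.
      eexists; first by exists b.
      apply: le_trans (ler_norm _) _; rewrite distrC; apply: (Hd S T) => //.
      * exact: update_bounded.
      * exact: update_bounded.
      * by apply: update_near => //; rewrite bdistC.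
  apply: (@sup_near _ _ _ M).
  + by eexists; exists 0 => //; rewrite /sort_ball /= rnorm0 ler0n.
  + by eexists; exists 0 => //; rewrite /sort_ball /= rnorm0 ler0n.
  + move=> _ [a an <-]; apply: le_trans (ler_norm _) _; apply: MP; exact: update_bounded.
  + move=> _ [a an <-]; apply: le_trans (ler_norm _) _; apply: MP; exact: update_bounded.
  + move=> _ [a an <-]; have [b bn ab] := ball_near d'E d'0 ST an.
    eexists; first by exists b.
    apply: le_trans (ler_norm _) _; apply: (Hd S T) => //.
    * exact: update_bounded.
    * exact: update_bounded.
    * exact: update_near.
- have [d d0 Hd] := IH (N + n%:R) e (addr_ge0 N0 (ler0n _ _)) e0.
  have n0 : 0 < n%:R + 1 :> R by rewrite ltr_wpDl.
  have [M M0 MP] := formula_bound psi (addr_ge0 N0 (ler0n _ n)).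
  pose d' := d / (n%:R + 1); have d'E : d' * (n%:R + 1) = d by rewrite /d' mulfVK // gt_eqF.
  have d'0 : 0 < d' by exact: divr_gt0.
  have dd' : d' <= d by rewrite -d'E ler_pMr // lerDr.
  exists d' => // S T ST TS v w vN wN vw /=.
  have vw' y := le_trans (vw y) dd'.
  have ST' := dnear_le dd' ST; have TS' := dnear_le dd' TS.
  have lb z : `|z| <= M -> - M <= z by rewrite ler_norml => /andP[].
  rewrite ler_norml lerNl opprB; apply/andP; split.
    apply: (@inf_near _ _ _ (- M)).
    + by eexists; exists 0 => //; rewrite /sort_ball /= rnorm0 ler0n.
    + by eexists; exists 0 => //; rewrite /sort_ball /= rnorm0 ler0n.
    + move=> _ [a an <-]; apply: lb; apply: MP; exact: update_bounded.
    + move=> _ [a an <-]; apply: lb; apply: MP; exact: update_bounded.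
    + move=> _ [a an <-]; have [b bn ab] := ball_near d'E d'0 ST an.
      eexists; first by exists b.
      apply: le_trans (ler_norm _) _; rewrite distrC; apply: (Hd S T) => //.
      * exact: update_bounded.
      * exact: update_bounded.
      * exact: update_near.
  apply: (@inf_near _ _ _ (- M)).
  + by eexists; exists 0 => //; rewrite /sort_ball /= rnorm0 ler0n.
  + by eexists; exists 0 => //; rewrite /sort_ball /= rnorm0 ler0n.
  + move=> _ [a an <-]; apply: lb; apply: MP; exact: update_bounded.
  + move=> _ [a an <-]; apply: lb; apply: MP; exact: update_bounded.
  + move=> _ [a an <-]; have [b bn ab] := ball_near d'E d'0 TS an.
    eexists; first by exists b.
    apply: le_trans (ler_norm _) _; apply: (Hd S T) => //.
    * exact: update_bounded.
    * exact: update_bounded.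
    * by apply: update_near => //; rewrite bdistC.
Qed.

(** A limit S of the class is near algebras in which each axiom has value 0, so [formula_nearP]
    bounds the value at S by every e > 0. *)
Lemma axiomatizable_closed (P : cstarType R -> Prop) : axiomatizable P ->
  closed [set S : csubalg (bop H) | P (csub_alg S)].
Proof.
move=> [Th [_ ThP]] S clS; apply/ThP => phi Tphi.
apply/eqP; rewrite -normr_le0; apply/ler_addgt0Pl => e e0; rewrite addr0.
have [d d0 Hd] := formula_nearP phi (lexx 0) e0.
have [T [PT ST]] := clS (fun T => dKK S T < d) (proj2 (nbhs_dKK _ _) (ex_intro2 _ _ d d0 (fun T => id))).
have [nST nTS] := dKK_dnear ST.
have T0 : @cformula_val R (csub_alg T) (fun=> 0) phi = 0 by exact: (proj1 (ThP _) PT phi Tphi).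
have := Hd S T nST nTS (fun=> 0) (fun=> 0); rewrite T0 (subr0 (cformula_val _ phi)); apply.
- by move=> x; rewrite -csub_rnorm rnorm0.
- by move=> x; rewrite -csub_rnorm rnorm0.
- by move=> x; have := ltW d0; rewrite -(rnorm0 (bop H)) -[in X in rnorm X](subrr (0 : bop H)).
Qed.

Lemma clopen_axiomatizable (P : cstarType R -> Prop) :
  axiomatizable P -> axiomatizable (fun A => ~ P A) ->
  clopen [set S : csubalg (bop H) | P (csub_alg S)].
Proof.
move=> aP anP; split; last exact: axiomatizable_closed.
by rewrite -closedC; exact: (axiomatizable_closed anP).
Qed.

End FormulaContinuity.

(** * Purely infinite simple algebras *)

Section PurelyInfinite.
Variables (R : realType) (H : hilbertType R).
Implicit Types (S T : csubalg (bop H)) (A B : set (bop H)) (a b c k q r s t x y z w p e g : bop H) (d : R).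

Definition posin A a := exists2 c, A c & a = star c * c.

Lemma posin_in A a : is_csubalg A -> posin A a -> A a.
Proof. by move=> Ac [c Ac' ->]; apply: csM => //; exact: csS. Qed.

Lemma posin_psd A a : posin A a -> psd a.
Proof. by move=> [c _ ->]; exact: psd_starM. Qed.

Lemma psd_sqrt_in A q : is_csubalg A -> A q -> psd q ->
  exists r, [/\ psd r, A r, r * r = q & forall y, y * q = q * y -> y * r = r * y].
Proof.
move=> Ac Aq qp.
have [r [rp Ar rr rc]] := psd_sqrt (adj1_csubalg Ac) (adj1_1 Ac) (adj1_sub Ac Aq) qp.
by exists r; split=> //; apply: adj1_sqr_in => //; rewrite rr.
Qed.

Lemma psd_posin A q : is_csubalg A -> A q -> psd q -> posin A q.
Proof.
move=> Ac Aq qp; have [r [[rs _] Ar rr _]] := psd_sqrt_in Ac Aq qp.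
by exists r => //; rewrite rs.
Qed.

Lemma posp_in A a (m : R) : is_csubalg A -> A a -> psd a -> 0 < m ->
  exists c, [/\ psd c, psd (c - (a - m%:B)), c * (c - (a - m%:B)) = 0, A c &
    forall y, y * a = a * y -> y * c = c * y].
Proof.
move=> Ac Aa pa m0; have A1c := adj1_csubalg Ac; have A1 := adj1_1 Ac.
have [||c [pc pc' cc A1cc ccomm]] := @posp_ex _ _ (adj1 A) (a - m%:B) A1c A1.
- by apply: csB => //; [exact: adj1_sub|exact: adj1_scal].
- by rewrite /sa starB starZr star1 (proj1 pa).
exists c; split=> //; last first.
  by move=> y ya; apply: ccomm; rewrite mulrBr mulrBl ya scal1M scalM1.
have [An1|An1] := pselect (A 1); first by rewrite -(adj1_idem Ac An1).
have [r [[rs _] A1r rr _]] := psd_sqrt A1c A1 A1cc pc.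
have [x [l [Ax cE]]] := A1cc; have [y [n [Ay rE]]] := A1r.
have nreal : (n^*)%C = n.
  have E : star y + (n^*)%C%:I = y + n%:I.
    by rewrite -rE -[RHS]rs rE starD_ starZ_ star1.
  by have [] := adj1_uniq Ac An1 (csS Ac Ay) Ay E.
have ln : l = n * n.
  have E : x + l%:I = (y * y + n *: y + n *: y) + (n * n)%:I.
    by rewrite -cE -rr rE; bop_ring.
  have [] // := adj1_uniq Ac An1 Ax _ E.
  by apply: csD => //; [apply: csD => //; [exact: csM|exact: csZ]|exact: csZ].
have lm : l * (l + m%:C%C) = 0.
  have E : (x * x + l *: x + (l *: x - l *: a) - x * a + m%:C%C *: x) + (l * (l + m%:C%C))%:I
      = 0 + 0%:I.
    by rewrite scale0r addr0 -cc cE; bop_ring.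
  have [|//] := adj1_uniq Ac An1 _ (csub0 Ac) E.
  have Axx := csM Ac Ax Ax; have Axa := csM Ac Ax Aa.
  have Alx := csZ l Ac Ax; have Ala := csZ l Ac Aa; have Amx := csZ m%:C%C Ac Ax.
  apply: csD => //; apply: csB => //; apply: csD => //; [exact: csD|exact: csB].
suff l0 : l = 0 by rewrite cE l0 scale0r addr0.
move/eqP: lm; rewrite mulf_eq0 => /orP[/eqP //|/eqP lm].
exfalso; have : (cabs n ^+ 2)%:C%C + m%:C%C = 0 :> R[i].
  by rewrite rmorphXn /= -cabsE sqr_normc nreal -ln.
rewrite -rmorphD => /complexI h; have := sqr_ge0 (cabs n); lra.
Qed.

(** The sequence x_n is replaced by one x for each error, which makes the condition easier to
    transport. *)
Definition pis_dense A := forall a b, posin A a -> a <> 0 -> posin A b -> b <> 0 ->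
  forall e : R, 0 < e -> exists2 x, A x & rnorm (x * a * star x - b) <= e.

Lemma norm_gt0 x : x <> 0 -> 0 < rnorm x.
Proof. by move=> x0; rewrite lt_neqAle bnorm_ge0 andbT eq_sym; apply/eqP => /rnorm0_eq0. Qed.

Lemma rnorm_starMr x : rnorm (x * star x) = rnorm x ^+ 2.
Proof. by rewrite -{1}[x]starK rnorm_starM rnorm_star. Qed.

Lemma norm_le1_psd a : psd a -> rnorm a <= 1 -> psd (1 - a).
Proof.
move=> [as_ _] a1; split=> [|u]; first by rewrite /sa starB star1 as_.
rewrite bopDE bopNE bop1E rinnerDl rinnerNl rinnerE subr_ge0.
by apply: le_trans (rinner_op_le a u) _; rewrite ler_piMl ?sqr_ge0.
Qed.

(* Compressing by a function of [a] supported where [a] is close to [1] makes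
   [x * a * star x] close to [x * star x], which bounds the norm of [x]. *)
Lemma pis_bounded A a b : is_csubalg A -> pis_dense A -> posin A a -> rnorm a <= 1 ->
  7 / 8 < rnorm a -> posin A b -> rnorm b <= 1 -> b <> 0 ->
  exists x, [/\ A x, rnorm x <= 2 & rnorm (x * a * star x - b) <= 3 / 8].
Proof.
move=> Ac Ap pa a1 a7 pb b1 b0; have Aa := posin_in Ac pa; have pa' := posin_psd pa.
have m0 : (0 : R) < 7 / 8 by lra.
(* c = (a - 7/8)_+, which is nonzero because |a| > 7/8. *)
have [c [pc pc' cc Acc ccomm]] := posp_in Ac Aa pa' m0.
set m : R := 7 / 8 in m0 a7 pc' cc.
have ac : a * c = c * a by apply: ccomm.
have cca : c * a = c * c + m%:C%C *: c.
  apply/eqP; rewrite -subr_eq0 -oppr_eq0; apply/eqP; rewrite -[RHS]cc.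
  by rewrite mulrBr mulrBr scalM1; bop_ring.
have c0 : c <> 0.
  move=> c0; move: pc'; rewrite c0 sub0r opprB => pm.
  have := psd_le_norm pa' pm; rewrite bnormZr gtr0_norm // => am.
  have := rnorm1_le H; have : m * rnorm (1 : bop H) <= m * 1 by rewrite ler_pM2l // rnorm1_le.
  move=> h1 h2; suff : m < m by rewrite ltxx.
  by move: h1; rewrite mulr1; norm_lra.
(* The element b is approximated through g^2 instead of a. Then y = x g has y [star y] close to b,
   hence norm at most 2. *)
pose g := c * a.
have gs : star g = g by rewrite /g starM_ (proj1 pc) (proj1 pa') ac.
have Ag : A g by exact: csM.
have g0 : g <> 0.
  rewrite /g cca => g0; apply: c0; apply: bopP => u; rewrite bop0E; apply: rnorm0_eq0.
  have := congr1 (fun x : bop H => rinner (x u) u) g0.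
  rewrite bopDE bopZE bopME bop0E rinnerDl rinnerZl (saS _ _ (proj1 pc)) rinnerE.
  rewrite /rinner inner0l /= => h; have := proj2 pc u; rewrite /rinner => cu.
  by apply/eqP; rewrite -sqrf_eq0; apply/eqP; have := sqr_ge0 (rnorm (c u)); nra.
have gg0 : star g * g <> 0 by move/star_eq0.
have [x Ax xg] := Ap _ b (ex_intro2 _ _ g Ag erefl) gg0 pb b0 (1 / 8) ltac:(lra).
rewrite gs in xg; pose y := x * g.
have yy : y * star y = x * (g * g) * star x by rewrite /y starM_ gs !mulrA.
have yn : rnorm (y * star y) <= 9 / 8.
  have := bnormD (x * (g * g) * star x - b) b; rewrite subrK -yy.
  by move: xg b1; rewrite -yy; norm_lra.
have y2 : rnorm y <= 2.
  by have := rnorm_starMr y; have := bnorm_ge0 y; norm_nra.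
exists y; split=> //; first exact: csM.
have gag : psd (star x * 1 * x) by exact: psd_conj (psd1 H).
have p1 : psd (y * (1 - a) * star y).
  by have := psd_conj (star y) (norm_le1_psd pa' a1); rewrite starK.
(* Since g (a - m) g = a c^3 a is positive, y (1 - a) [star y] is at most (1 - m) y [star y]:
   replacing 1 by a between the factors costs little. *)
have p2 : psd ((1 - m)%:C%C *: (y * star y) - y * (1 - a) * star y).
  have E : g * (a - m%:B) * g = a * (c * c * c) * a.
    rewrite /g; transitivity (a * (c * a - m%:C%C *: c) * (c * a)).
      by rewrite -{1}ac; bop_ring.
    by rewrite {1}cca addrK; bop_ring.
  have -> : (1 - m)%:C%C *: (y * star y) - y * (1 - a) * star y =
      star (a * star x) * (star c * c * c) * (a * star x).
    transitivity (x * (g * (a - m%:B) * g) * star x).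
      by rewrite /y starM_ gs rmorphB rmorph1; bop_ring.
    by rewrite E starM_ starK (proj1 pa') (proj1 pc); bop_ring.
  by apply: psd_conj; apply: psd_conj.
have yan : rnorm (y * (1 - a) * star y) <= (1 - m) * (9 / 8).
  apply: le_trans (psd_le_norm p1 p2) _.
  rewrite bnormZr ger0_norm; last by rewrite /m; lra.
  by rewrite ler_wpM2l // /m; lra.
have -> : y * a * star y - b = (x * (g * g) * star x - b) - y * (1 - a) * star y.
  by rewrite -yy; bop_ring.
apply: le_trans (rnormB _ _) _.
by move: yan; rewrite /m; norm_lra.
Qed.

(** The bounded solution for nearby elements of A is moved to B; the errors add up to 18 d, which
    fits between 3/8 and 1/2. *)
Lemma pis_approx A B d a b : is_csubalg A -> is_csubalg B -> 0 <= d -> 256 * d <= 1 ->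
  dnear d A B -> dnear d B A -> pis_dense A -> posin B a -> rnorm a = 1 ->
  posin B b -> rnorm b = 1 ->
  exists2 x, B x & rnorm (x * a * star x - b) <= 1 / 2.
Proof.
move=> Ac Bc d0 d1 AB BA Ap.
have app q : posin B q -> rnorm q = 1 ->
    exists q', [/\ posin A q', rnorm q' <= 1 & rnorm (q - q') <= 2 * d].
  move=> [w Bw ->]; rewrite rnorm_starM => w1.
  have {}w1 : rnorm w = 1 by have := bnorm_ge0 w => w0; apply/eqP; rewrite -sqrp_eq1 // w1.
  have [w' [Aw' ww w'w]] := BA w Bw; rewrite w1 ?mulr1 in ww w'w.
  exists (star w' * w'); split; first by exists w'.
    by rewrite rnorm_starM expr_le1 // bnorm_ge0.
  have -> : star w * w - star w' * w' = star (w - w') * w + star w' * (w - w').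
    by rewrite starB; bop_ring.
  apply: le_trans (bnormD _ _) _.
  have s1 : rnorm (star (w - w')) <= d by rewrite rnorm_star.
  have s2 : rnorm (star w') <= 1 by rewrite rnorm_star.
  have w1' : rnorm w <= 1 by rewrite w1.
  have := rnormM_leM s1 w1'; have := rnormM_leM s2 ww; norm_lra.
move=> pa a1 pb b1; have [a' [pa' a'1 aa]] := app a pa a1; have [b' [pb' b'1 bb]] := app b pb b1.
have a'7 : 7 / 8 < rnorm a' by have := bnormB_sub a a'; rewrite a1; norm_lra.
have b'0 : b' <> 0.
  move=> h; suff : (1 : R) < 1 by rewrite ltxx.
  by move: bb; rewrite h subr0 b1; norm_lra.
have [x [Ax x2 xab]] := pis_bounded Ac Ap pa' a'1 a'7 pb' b'1 b'0.
have [y [By xy yx]] := AB x Ax; have y2 := le_trans yx x2.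
have {}xy : rnorm (x - y) <= 2 * d.
  by apply: le_trans xy _; rewrite mulrC ler_wpM2r.
exists y => //.
have -> : y * a * star y - b = (x * a' * star x - b') - ((x - y) * a' * star x
   + y * a' * star (x - y)) + y * (a - a') * star y - (b - b').
  by rewrite starB; bop_ring.
have sx : rnorm (star x) <= 2 by rewrite rnorm_star.
have sy : rnorm (star y) <= 2 by rewrite rnorm_star.
have sxy : rnorm (star (x - y)) <= 2 * d by rewrite rnorm_star.
apply: le_trans (rnormB _ _) _; apply: le_trans (lerD (bnormD _ _) (lexx _)) _.
apply: le_trans (lerD (lerD (rnormB _ _) (lexx _)) (lexx _)) _.
have := bnormD ((x - y) * a' * star x) (y * a' * star (x - y)).
have := rnormM_leM (rnormM_leM xy a'1) sx.
have := rnormM_leM (rnormM_leM y2 a'1) sxy.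
have := rnormM_leM (rnormM_leM y2 aa) sy.
norm_lra.
Qed.

(** With f = e / 2, D = (y + f)^-1 and P the root of D, take z = k P x. Then z a [star z] = k^2 - f
    k D k, and |k D k| <= 2 because k^2 <= 2 y. *)
Lemma pis_correct B a k y x (e : R) : is_csubalg B -> B k -> sa k -> B x -> psd y -> B y ->
  y = x * a * star x -> psd (y + y - k * k) -> 0 < e ->
  exists2 z, B z & rnorm (z * a * star z - k * k) <= e.
Proof.
move=> Bc Bk ks Bx py By yE yk e0.
have B1c := adj1_csubalg Bc; have B1 := adj1_1 Bc.
pose f := e / 2; have f0 : 0 < f by rewrite divr_gt0.
have Bf : adj1 B (y + f%:B) by apply: csD => //; [exact: adj1_sub|exact: adj1_scal].
have sf : sa (y + f%:B) by rewrite /sa !starE (proj1 py).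
have [|D [yD Dy BD pD _]] := psd_inv B1c B1 Bf f0 sf; first by rewrite addrK.
have [P [[Ps _] BP PP Pc]] := psd_sqrt B1c B1 BD pD.
have yDc : y * D = D * y.
  by have := etrans yD (esym Dy); rewrite mulrDl mulrDr scal1M scalM1 => /addIr.
have yP : y * P = P * y by exact: Pc.
have PyP : P * y * P = 1 - f%:C%C *: D.
  by rewrite -yP -mulrA PP -[X in _ = X - _]yD mulrDl scal1M addrK.
have kDk : rnorm (k * D * k) <= 2.
  have -> : k * D * k = star (P * k) * (P * k) by rewrite starM_ ks Ps -PP !mulrA.
  rewrite rnorm_starM -rnorm_starMr starM_ ks Ps.
  have -> : P * k * (k * P) = P * (k * k) * P by rewrite !mulrA.
  have p1 : psd (P * (k * k) * P) by have := psd_conj P (psd_sqr ks); rewrite Ps.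
  have p2 : psd (P * (y + y) * P - P * (k * k) * P).
    by have := psd_conj P yk; rewrite Ps mulrBr mulrBl.
  apply: le_trans (psd_le_norm p1 p2) _.
  have -> : P * (y + y) * P = 2%:R%:C%C *: (P * y * P) by rewrite rmorph_nat; bop_ring.
  rewrite bnormZr ger0_norm // -[leRHS]mulr1 ler_wpM2l //.
  apply: le_trans (rnorm1_le H); apply: psd_le_norm.
    by have := psd_conj P py; rewrite Ps.
  by rewrite PyP subKr; apply: psdZ => //; exact: ltW.
exists (k * P * x).
  by rewrite -mulrA; apply: csM => //; exact: adj1_mull.
have -> : k * P * x * a * star (k * P * x) - k * k = - (f%:C%C *: (k * D * k)).
  transitivity (k * (P * y * P) * k - k * k).
    by rewrite yE !starM_ ks Ps; bop_ring.
  by rewrite PyP; bop_ring.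
rewrite bnormN bnormZr gtr0_norm //.
by have := ler_wpM2l (ltW f0) kDk; rewrite /f; norm_lra.
Qed.

(* With [k = (s - t)_+] the difference [s - k] is [min (s, t)]. *)
Lemma truncation s k (t : R) : 0 < t -> psd s -> psd k -> psd (k - (s - t%:B)) ->
  k * (k - (s - t%:B)) = 0 -> s * k = k * s ->
  [/\ psd (s - k), psd (t%:B - (s - k)), (s - k) * k = t%:C%C *: k,
      k * (s - k) = t%:C%C *: k & rnorm (s - k) <= t].
Proof.
move=> t0 ps pk pk' kk sk.
have ks : k * s = k * k + t%:C%C *: k.
  apply/eqP; rewrite -subr_eq0 -oppr_eq0; apply/eqP; rewrite -[RHS]kk.
  by rewrite mulrBr mulrBr scalM1; bop_ring.
have [q qE] : exists q, q = s - k by eexists.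
rewrite -qE; have k'E : k - (s - t%:B) = t%:B - q by rewrite qE; bop_ring.
have qk : q * k = t%:C%C *: k by rewrite qE mulrBl sk ks addrAC subrr add0r.
have kq : k * q = t%:C%C *: k by rewrite qE mulrBr ks addrAC subrr add0r.
have pq : psd q.
  have p : psd (t%:C%C *: q).
    have -> : t%:C%C *: q = q * q + (t%:B - q) * s.
      have sE : s = q + k by rewrite qE subrK.
      transitivity (q * q + (t%:C%C *: (q + k) - (q * q + q * k))); first by rewrite qk; bop_ring.
      by rewrite sE; bop_ring.
    apply: psdD; first by apply: psd_sqr; rewrite /sa qE starB (proj1 ps) (proj1 pk).
    apply: mul_psd => //; first by rewrite -k'E.
    by rewrite mulrBl mulrBr scal1M scalM1 qE mulrBr mulrBl sk.
  split=> [|u]; first by rewrite /sa qE starB (proj1 ps) (proj1 pk).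
  by have := proj2 p u; rewrite bopZE rinnerZl pmulr_rge0.
rewrite k'E in pk'; split=> //.
apply: le_trans (psd_le_norm pq pk') _.
by rewrite bnormZr gtr0_norm // ler_piMr ?(ltW t0) ?rnorm1_le.
Qed.

(** With s the root of b and k = (s - t)_+, the element b1 = min(s, t) / t has norm 1 and acts as 1
    on k. A solution x for b1 with error 1/2 gives y = k x a1 [star x] k with 2 y >= k^2, which
    [pis_correct] sharpens to a solution for k^2; and k^2 is close to b. *)
Lemma pis_dnear A B d : is_csubalg A -> is_csubalg B -> 0 <= d -> 256 * d <= 1 ->
  dnear d A B -> dnear d B A -> pis_dense A -> pis_dense B.
Proof.
move=> Ac Bc d0 d1 AB BA Ap a b pa a0 pb b0 e e0.
have an := norm_gt0 a0; have bn := norm_gt0 b0.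
pose n := Num.sqrt (rnorm a)^-1.
have n0 : 0 < n by rewrite sqrtr_gt0 invr_gt0.
have nn : n * n = (rnorm a)^-1 by rewrite -expr2 sqr_sqrtr // invr_ge0 ltW.
pose a1 := (n * n)%:C%C *: a.
have pa1 : posin B a1.
  case: pa => c Bc' aE; exists (n%:C%C *: c); first exact: csZ.
  by rewrite starZr bopZAl bopZAr scalerA -rmorphM /a1 aE.
have a11 : rnorm a1 = 1.
  by rewrite bnormZr nn gtr0_norm ?invr_gt0 // mulVf // gt_eqF.
suff [z Bz zab] : exists2 z, B z & rnorm (z * a1 * star z - b) <= e.
  exists (n%:C%C *: z); first exact: csZ.
  rewrite (_ : _ * a * _ = z * a1 * star z) //.
  by rewrite /a1 starZr rmorphM /=; bop_ring.
have Bb := posin_in Bc pb; have pb' := posin_psd pb.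
have [s [ps Bs ss sc]] := psd_sqrt_in Bc Bb pb'.
have s0 : 0 < rnorm s.
  by apply: norm_gt0 => h; apply: b0; rewrite -ss h mulr0.
have M0 : 0 < 2 * (2 * rnorm s + 1) by rewrite mulr_gt0 // ltr_wpDl // mulr_ge0 // ltW.
(* The first bound makes k nonzero. The other two make s^2 - k^2 = k q + q s of norm at most e /
   2. *)
pose t := Order.min (Order.min (rnorm s / 2) 1) (e / (2 * (2 * rnorm s + 1))).
have t0 : 0 < t by rewrite !lt_min !divr_gt0 // ltr01.
have ts : t <= rnorm s / 2 by rewrite !ge_min lexx.
have t1 : t <= 1 by rewrite !ge_min lexx orbT.
have te : t * (2 * (2 * rnorm s + 1)) <= e.
  by rewrite -ler_pdivlMr // ge_min lexx orbT.
have [k [pk pk' kk Bk kc]] := posp_in Bc Bs ps t0.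
have sk : s * k = k * s by exact: kc.
have [pq _ qk _ qt] := truncation t0 ps pk pk' kk sk.
have [q qE] : exists q, q = s - k by eexists.
rewrite -qE in pq qk qt.
have Bq : B q by rewrite qE; exact: csB.
have kn0 : 0 < rnorm k.
  have := bnormB_sub s q; rewrite qE subKr -qE; move: qt ts; norm_lra.
pose b1 := t^-1%:C%C *: q.
have b1k : b1 * k = k.
  by rewrite /b1 bopZAl qk scalerA -rmorphM /= mulVf ?gt_eqF // scale1r.
have pb1 : psd b1 by apply: psdZ => //; rewrite invr_ge0 ltW.
have b11 : rnorm b1 = 1.
  apply/eqP; rewrite eq_le; apply/andP; split.
    by rewrite bnormZr gtr0_norm ?invr_gt0 // mulrC ler_pdivrMr // mul1r.
  by rewrite -(ler_pM2r kn0) mul1r -{1}b1k rnormM_le.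
have Bb1 : B b1 by exact: csZ.
have [x Bx xab] := pis_approx Ac Bc d0 d1 AB BA Ap pa1 a11 (psd_posin Bc Bb1 pb1) b11.
have pa1' := posin_psd pa1.
pose y := (k * x) * a1 * star (k * x).
have py : psd y by have := psd_conj (star (k * x)) pa1'; rewrite starK.
have By : B y.
  have Bkx : B (k * x) by exact: csM.
  by apply: csM; [|apply: csM|apply: csS] => //; exact: (posin_in Bc pa1).
have yk : psd (y + y - k * k).
  have -> : y + y - k * k = star k * ((x * a1 * star x - b1) + (x * a1 * star x - b1) + 1) * k.
    rewrite (proj1 pk) /y starM_ (proj1 pk).
    transitivity (k * (x * a1 * star x) * k + k * (x * a1 * star x) * k
                  - (k * (b1 * k) + k * (b1 * k)) + k * k); last by bop_ring.
    by rewrite b1k; bop_ring.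
  apply: psd_conj; set D := _ - b1.
  have Ds : star D = D.
    by rewrite /D starB !starM_ starK (proj1 pa1') (proj1 pb1) mulrA.
  have D12 : rnorm D <= 1 / 2 by exact: xab.
  clearbody D; split=> [|u]; first by rewrite /sa starD_ star1 starD_ Ds.
  rewrite (bopDE (D + D)) (bopDE D) bop1E !rinnerDl rinnerE.
  have := rinner_op_le (- D) u; rewrite bopNE rinnerNl bnormN.
  have : rnorm D * rnorm u ^+ 2 <= 1 / 2 * rnorm u ^+ 2 by rewrite ler_wpM2r ?sqr_ge0.
  by move: (rinner (D u) u) (rnorm u ^+ 2) (rnorm D * _) => p1 p2 p3; lra.
have e20 : 0 < e / 2 by rewrite divr_gt0.
have [z Bz zab] := pis_correct Bc Bk (proj1 pk) (csM Bc Bk Bx) py By erefl yk e20.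
exists z => //.
have -> : z * a1 * star z - b = (z * a1 * star z - k * k) - (k * q + q * s).
  by rewrite -ss qE; bop_ring.
apply: le_trans (rnormB _ _) _; have := bnormD (k * q) (q * s).
have kn : rnorm k <= rnorm s + 1.
  have -> : k = s - q by rewrite qE subKr.
  by apply: le_trans (rnormB _ _) _; norm_lra.
have := rnormM_leM kn qt; have := rnormM_leM qt (lexx (rnorm s)).
by move: zab te t1; norm_lra.
Qed.

Definition line_in A := exists2 u, A u & forall a, A a -> exists l : R[i], a = l *: u.

(** Every x in A is within half its norm of the line through u'. Iterating on the remainder puts x
    in the closure of the line, hence on it. *)
Lemma line_dnear A B d : is_csubalg A -> is_csubalg B -> 0 <= d -> 4 * d <= 1 ->
  dnear d A B -> dnear d B A -> line_in B -> line_in A.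
Proof.
move=> Ac Bc d0 d1 AB BA [u Bu uB]; have [u' [Au' uu u'u]] := BA u Bu.
have step x : A x -> exists l : R[i], rnorm (x - l *: u') <= 2^-1 * rnorm x.
  move=> Ax; have [y [By xy yx]] := AB x Ax; have [l yE] := uB y By; exists l.
  have -> : x - l *: u' = (x - y) + l *: (u - u') by rewrite scalerBr yE; bop_ring.
  apply: le_trans (bnormD _ _) _; rewrite rnormZc.
  have h : cabs l * rnorm (u - u') <= d * rnorm y.
    by rewrite yE rnormZc mulrCA ler_wpM2l ?cabs_ge0.
  have := ler_wpM2l d0 yx; have := bnorm_ge0 x.
  move: h xy; move: (cabs l * _) => c; norm_gen.
  by nra.
exists u' => // x Ax.
suff [l _ <-] : [set l *: u' | l in [set: R[i]]] x by exists l.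
apply: rclosed_line => e e0.
have geo n : exists l : R[i], rnorm (x - l *: u') <= 2^-1 ^+ n * rnorm x.
  elim: n => [|n [l IH]]; first by exists 0; rewrite scale0r subr0 expr0 mul1r.
  have [m Hm] := step _ (csB Ac Ax (csZ l Ac Au')).
  exists (l + m); rewrite scalerDl opprD addrA; apply: le_trans Hm _.
  by rewrite exprS -mulrA ler_wpM2l // invr_ge0.
have e1 : 0 < e / (rnorm x + 1) by rewrite divr_gt0 // ltr_wpDl ?bnorm_ge0.
have /cvgrPdist_le/(_ _ e1)[M _ /(_ M (leqnn _)) HM] :
    (fun n => geometric (1 : R) 2^-1 n) @ \oo --> (0 : R).
  by apply: cvg_geometric; rewrite ger0_norm ?invr_ge0 // invf_lt1 // ltr1n.
have [l Hl] := geo M; exists (l *: u'); first by exists l.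
apply: le_trans Hl _; move: HM; rewrite /= mul1r sub0r normrN ger0_norm; last first.
  by rewrite exprn_ge0 // invr_ge0.
rewrite ler_pdivlMr ?ltr_wpDl ?bnorm_ge0 //.
have : 0 <= 2^-1 ^+ M :> R by rewrite exprn_ge0 // invr_ge0.
by have := bnorm_ge0 x; move: (2^-1 ^+ M); norm_nra.
Qed.

Lemma csub_posP S a (Sa : csub_set S a) : posin (csub_set S) a ->
  positive (celt Sa : csub_alg S).
Proof. by move=> [c Sc aE]; exists (celt Sc); apply: val_inj. Qed.

Lemma csub_posinP S (a : csub_alg S) : positive a -> posin (csub_set S) (csub_val a).
Proof. by move=> [c ->]; exists (csub_val c) => //; exact: csub_in. Qed.

Lemma purely_infinite_simpleP S : purely_infinite_simple (csub_alg S) <->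
  ~ line_in (csub_set S) /\ pis_dense (csub_set S).
Proof.
have lineP : (exists u : csub_alg S, forall a : csub_alg S, exists c : R[i], a = c *: u) <-> line_in (csub_set S).
  split=> [[u uP]|[u Su uP]].
    exists (csub_val u) => [|a Sa]; first exact: csub_in.
    by have [c /(congr1 (@csub_val _ _ S)) cE] := uP (celt Sa); exists c.
  exists (celt Su) => a; have [c aE] := uP _ (csub_in a); exists c.
  by apply: val_inj; rewrite /= aE.
split=> [[nl den]|[nl den]]; (split; first by move/lineP).
  move=> a b pa a0 pb b0 e e0.
  have Sa := posin_in (csubP S) pa; have Sb := posin_in (csubP S) pb.
  have a0' : celt Sa <> 0 by move/(congr1 (@csub_val _ _ S)).
  have b0' : celt Sb <> 0 by move/(congr1 (@csub_val _ _ S)).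
  have [x /cvg_rnormP/(_ e e0)[N _ /(_ N (leqnn _)) xN]] :=
    den (celt Sa) (celt Sb) (csub_posP Sa pa) a0' (csub_posP Sb pb) b0'.
  by exists (csub_val (x N)); [exact: csub_in|rewrite bdistC].
move=> a b pa a0 pb b0.
have a0' : csub_val a <> 0 by move=> h; apply: a0; exact: val_inj.
have b0' : csub_val b <> 0 by move=> h; apply: b0; exact: val_inj.
have /choice[x xP] : forall k : nat, exists x : csub_alg S,
    rnorm (csub_val x * csub_val a * star (csub_val x) - csub_val b) <= k.+1%:R^-1.
  move=> k; have k0 : 0 < k.+1%:R^-1 :> R by rewrite invr_gt0 ltr0n.
  have [x Sx xab] := den _ _ (csub_posinP pa) a0' (csub_posinP pb) b0' _ k0.
  by exists (celt Sx).
exists x; apply/cvg_rnormP => e e0.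
exists (Num.bound e^-1) => // k Nk; rewrite rdistC; apply: le_trans (xP k) _.
rewrite -[leRHS]invrK lef_pV2 ?posrE ?ltr0n ?invr_gt0 //.
have ei : 0 <= e^-1 by rewrite invr_ge0 ltW.
by apply: le_trans (ltW (archi_boundP ei)) _; rewrite ler_nat leqW.
Qed.

Lemma clopen_purely_infinite :
  clopen [set S : csubalg (bop H) | purely_infinite_simple (csub_alg S)].
Proof.
have d0 : (0 : R) < 256%:R^-1 by rewrite invr_gt0 ltr0n.
have dE : 256 * 256%:R^-1 = 1 :> R by rewrite mulfV // pnatr_eq0.
apply: (clopen_uniform d0); move: (_^-1) d0 dE => d d0 dE S T ST TS.
move=> /purely_infinite_simpleP[nl den]; apply/purely_infinite_simpleP; split.
  move=> lT; apply: nl; apply: line_dnear ST TS lT; [exact: csubP|exact: csubP|exact: ltW|].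
  by move: dE; lra.
apply: pis_dnear ST TS den; [exact: csubP|exact: csubP|exact: ltW|].
by rewrite dE.
Qed.

End PurelyInfinite.

(** * Density of invertible elements under perturbation *)

Section InvertibleDensity.
Variables (R : realType) (H : hilbertType R).
Implicit Types (S T : csubalg (bop H)) (A B : set (bop H)) (a b c h k q r s t x y z w p g : bop H).

Definition inv_in A b := exists d : bop H, [/\ A d, b * d = 1 & d * b = 1].

Lemma inv_inM A b c : is_csubalg A -> inv_in A b -> inv_in A c -> inv_in A (b * c).
Proof.
move=> Ac [b' [Ab' bb' b'b]] [c' [Ac' cc' c'c]]; exists (c' * b'); split; first exact: csM.
  by rewrite mulrA -(mulrA b) cc' mulr1.
by rewrite mulrA -(mulrA c') b'b mulr1.
Qed.

Lemma inv_in_psdD A k (t : R) : is_csubalg A -> A 1 -> A k -> psd k -> 0 < t ->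
  inv_in A (k + t%:B).
Proof.
move=> Ac A1 Ak pk t0.
have [|||d [kd dk Ad _ _]] := @psd_inv _ _ A (k + t%:B) t Ac A1 _ t0.
- by apply: csD => //; exact: csZ.
- by rewrite /sa !starE (proj1 pk).
- by rewrite addrK.
by exists d.
Qed.

Lemma inv_comm x y (d : bop H) : y * d = 1 -> d * y = 1 -> x * y = y * x -> x * d = d * x.
Proof.
move=> yd dy xy; rewrite -[LHS]mul1r -dy -mulrA (mulrA y) -xy -!mulrA yd.
by rewrite mulr1.
Qed.

(* [h] and [k] are functions of [|a|] with [h = 1] on the support of [k], and
   [x = a / max(|a|, e)] is isometric on the support of [h]. *)
Lemma cutoff A a (e : R) : is_csubalg A -> A 1 -> A a -> 0 < e ->
  exists x h k, [/\ [/\ A x, A h & A k], sa h /\ psd k,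
    [/\ rnorm x <= 2, rnorm h <= 1 & rnorm (x * k - a) <= 4 * e],
    star x * x * h = h /\ h * k = k &
    sa a -> [/\ sa x, x * h = h * x & x * k = k * x]].
Proof.
move=> Ac A1 Aa e0.
have [r [pr Ar rr rc]] := psd_sqrt Ac A1 (csM Ac (csS Ac Aa) Aa) (psd_starM a).
have As (x : bop H) (l : R) : A x -> A (x - l%:B) by move=> Ax; apply: csB => //; exact: csZ.
have ssa (x : bop H) (l : R) : sa x -> sa (x - l%:B) by move=> xs; rewrite /sa !starE xs.
(* In terms of r, the absolute value of a: r1 = (r - e)_+, k = (r - 2 e)_+, m = max(r, e) with
   inverse y, n = (e - r)_+, h = min(r1, e) / e and x = a y. *)
have [r1 [pr1 pr1' rr1 Ar1 r1c]] := posp_ex Ac A1 (As _ e Ar) (ssa _ e (proj1 pr)).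
have {}r1c y : y * r = r * y -> y * r1 = r1 * y.
  by move=> yr; apply: r1c; rewrite mulrBr mulrBl yr scal1M scalM1.
have r1r : r * r1 = r1 * r by exact: r1c.
have [_ pn _ _ _] := truncation e0 pr pr1 pr1' rr1 r1r.
have [pq1 _ _ _ q1e] := truncation e0 pr pr1 pr1' rr1 r1r.
have [k [pk pk' kk Ak kc]] := posp_ex Ac A1 (As _ e Ar1) (ssa _ e (proj1 pr1)).
have {}kc y : y * r1 = r1 * y -> y * k = k * y.
  by move=> yr; apply: kc; rewrite mulrBr mulrBl yr scal1M scalM1.
have r1k : r1 * k = k * r1 by exact: kc.
have [pq2 _ q2k kq2 q2e] := truncation e0 pr1 pk pk' kk r1k.
have [m mE] : exists m, m = r1 + e%:B by eexists.
have Am : A m by rewrite mE; apply: csD => //; exact: csZ.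
have [||y [my ym Ay py yn]] := @psd_inv _ _ A m e Ac A1 Am e0.
- by rewrite mE /sa !starE (proj1 pr1).
- by rewrite mE addrK.
have mc x : x * r1 = r1 * x -> x * m = m * x.
  by move=> xr; rewrite mE mulrDr mulrDl xr scal1M scalM1.
have yc x : x * r1 = r1 * x -> x * y = y * x.
  by move=> xr; apply: (inv_comm my ym); exact: mc.
have [n nE] : exists n, n = r1 - (r - e%:B) by eexists.
rewrite -nE in pr1' rr1.
have mrn : m = r + n by rewrite mE nE; bop_ring.
have nn : rnorm n <= e.
  have -> : n = e%:B - (r - r1) by rewrite nE; bop_ring.
  have pe : psd (e%:B - (e%:B - (r - r1))) by rewrite subKr.
  apply: le_trans (psd_le_norm pn pe) _.
  by rewrite bnormZr gtr0_norm // ler_piMr ?(ltW e0) ?rnorm1_le.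
have nr1 : n * r1 = r1 * n by rewrite nE mulrBr !mulrBl mulrBr r1r scal1M scalM1.
(* k (k + e) = k r1 and n r1 = 0, while k + e is invertible. *)
have nk : n * k = 0.
  have [c [Ac' kc1 ck1]] := inv_in_psdD Ac A1 Ak pk e0.
  have rk : k * r1 = k * k + e%:C%C *: k.
    by rewrite -kq2 mulrBr addrC subrK.
  have : n * k * (k + e%:B) = 0.
    rewrite mulrDr scalM1 -mulrA -bopZAr -mulrDr -rk -r1k mulrA nr1 rr1 mul0r //.
  by move=> h; rewrite -[LHS]mulr1 -kc1 mulrA h mul0r.
have [h hE] : exists h, h = e^-1%:C%C *: (r1 - k) by eexists.
have ei : 0 < e^-1 by rewrite invr_gt0.
have hk : h * k = k.
  by rewrite hE bopZAl q2k scalerA -rmorphM /= mulVf ?gt_eqF // scale1r.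
have hn : rnorm h <= 1.
  by rewrite hE bnormZr gtr0_norm // mulrC ler_pdivrMr // mul1r.
have nh : n * h = 0 by rewrite hE bopZAr mulrBr nr1 rr1 nk subrr scaler0.
have hs : sa h by rewrite hE /sa starZr starB (proj1 pr1) (proj1 pk).
have Ah : A h by rewrite hE; apply: csZ => //; exact: csB.
have yr : y * r = r * y by symmetry; apply: yc.
have ryE : r * y = 1 - y * n.
  have yn' : n * y = y * n by apply: yc.
  by rewrite -yn' -my mrn mulrDl addrK.
have [x xE] : exists x, x = a * y by eexists.
have xx : star x * x = (r * y) * (r * y).
  rewrite xE starM_ (proj1 py); transitivity (y * (star a * a) * y); first by rewrite !mulrA.
  by rewrite -rr !mulrA yr.
have rys : star (r * y) = r * y by rewrite starM_ (proj1 py) (proj1 pr) yr.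
have ry2 : rnorm (r * y) <= 2.
  rewrite ryE; apply: le_trans (rnormB _ _) _.
  have := rnormM_leM yn nn; rewrite mulVf ?gt_eqF //; have := rnorm1_le H; norm_lra.
have x2 : rnorm x <= 2.
  have := rnorm_starM x; rewrite xx -{1}rys rnorm_starM => /eqP.
  by rewrite eqrXn2 ?bnorm_ge0 // => /eqP <-.
have ryh : r * y * h = h by rewrite ryE mulrBl mul1r -mulrA nh mulr0 subr0.
exists x, h, k; split=> //.
- by split=> //; rewrite xE; exact: csM.
- split=> //; have -> : x * k - a = x * (k - m) by rewrite mulrBr xE -(mulrA a y m) ym mulr1.
  have km : rnorm (k - m) <= 2 * e.
    have -> : k - m = - ((r1 - k) + e%:B) by rewrite mE; bop_ring.
    rewrite bnormN; apply: le_trans (bnormD _ _) _; rewrite mulr_natl mulr2n lerD //.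
    by rewrite bnormZr gtr0_norm // ler_piMr ?(ltW e0) ?rnorm1_le.
  by apply: le_trans (rnormM_leM x2 km) _; rewrite mulrA -natrM.
- by rewrite xx -mulrA ryh.
- move=> as_; have ar : a * r = r * a by apply: rc; rewrite as_ mulrA.
  have ar1 := r1c _ ar; have ay := yc _ ar1; have ak := kc _ ar1.
  have yr1 : y * r1 = r1 * y by symmetry; apply: yc.
  have yk : y * k = k * y by exact: kc.
  have ah : a * h = h * a by rewrite hE bopZAr bopZAl mulrBr mulrBl ar1 ak.
  have yh : y * h = h * y by rewrite hE bopZAr bopZAl mulrBr mulrBl yr1 yk.
  split; first by rewrite xE /sa starM_ (proj1 py) as_ ay.
    by rewrite xE -mulrA yh mulrA ah mulrA.
  by rewrite xE -mulrA yk mulrA ak mulrA.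
Qed.

(** q is the root of [star b * b], invertible because b is, and w = b q^-1. *)
Lemma polar_inv A b : is_csubalg A -> A 1 -> A b -> inv_in A b ->
  exists w q, [/\ [/\ A w, A q & unitary w], psd q, b = w * q &
     sa b -> sa w /\ w * q = q * w].
Proof.
move=> Ac A1 Ab [d [Ad bd db]].
have [q [pq Aq qq qc]] := psd_sqrt Ac A1 (csM Ac (csS Ac Ab) Ab) (psd_starM b).
have qs := proj1 pq.
have bbd : star b * b * (d * star d) = 1.
  have : star (d * b) = 1 by rewrite db star1.
  by rewrite starM_ => h; rewrite mulrA -(mulrA (star b)) bd mulr1.
have dbb : d * star d * (star b * b) = 1.
  have := congr1 (@star _ _) bbd.
  by rewrite starM_ (starM_ d) starK (starM_ (star b)) starK star1.
have qbb : q * (star b * b) = (star b * b) * q by rewrite -qq mulrA.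
have qdd : q * (d * star d) = d * star d * q by exact: inv_comm bbd dbb qbb.
have [p pE] : exists p, p = q * (d * star d) by eexists.
have qp : q * p = 1 by rewrite pE mulrA qq bbd.
have pq' : p * q = 1 by rewrite pE qdd -mulrA qq dbb.
have ps : star p = p by rewrite pE starM_ starM_ starK qs -qdd.
have Ap : A p by rewrite pE; apply: csM => //; apply: csM => //; exact: csS.
have ww : star (b * p) * (b * p) = 1.
  transitivity (p * (star b * b) * p); first by rewrite starM_ ps !mulrA.
  by rewrite -qq mulrA pq' mul1r qp.
have wz : b * p * (q * d) = 1 by rewrite -mulrA (mulrA p) pq' mul1r.
exists (b * p), q; split=> //.
- split=> //; first exact: csM.
  split=> //; suff -> : star (b * p) = q * d by [].
  by rewrite -[LHS]mulr1 -wz mulrA ww mul1r.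
- by rewrite -mulrA pq' mulr1.
- move=> bs; have bq : b * q = q * b by apply: qc; rewrite bs mulrA.
  have bp : b * p = p * b by exact: inv_comm qp pq' bq.
  split; first by rewrite /sa starM_ ps bs bp.
  by rewrite -mulrA pq' mulr1 mulrA -bq -mulrA qp mulr1.
Qed.

Lemma unitary_norm w : unitary w -> rnorm w <= 1.
Proof.
move=> [ww _]; have := rnorm_starM w; rewrite ww => h.
by have := rnorm1_le H; rewrite h; have := bnorm_ge0 w; norm_nra.
Qed.

Lemma unitary_star w : unitary w -> unitary (star w).
Proof. by move=> [h1 h2]; split; rewrite starK. Qed.

(* The unitary part of an invertible element near [x] is near [x] wherever [x]
   is isometric. *)
Lemma polar_near_isometry x h b w q (g : R) : 0 <= g -> 64 * g <= 1 ->
  rnorm x <= 2 -> rnorm h <= 1 -> star x * x * h = h -> rnorm (x - b) <= g ->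
  unitary w -> psd q -> b = w * q -> 6 * rnorm ((x - w) * h) <= 1.
Proof.
move=> g0 g1 x2 h1 xxh xb uw pq bE.
have qq : q * q = star b * b.
  rewrite bE starM_ (proj1 pq) mulrA -(mulrA q); case: uw => -> _; by rewrite mulr1.
have b3 : rnorm b <= 3.
  have := bnormB_sub b x; rewrite bdistC; move: xb x2 g1; norm_lra.
have e1 : rnorm (star x * x - star b * b) <= 5 * g.
  have -> : star x * x - star b * b = star (x - b) * x + star b * (x - b).
    by rewrite starB; bop_ring.
  apply: le_trans (bnormD _ _) _.
  have s1 : rnorm (star (x - b)) <= g by rewrite rnorm_star.
  have s2 : rnorm (star b) <= 3 by rewrite rnorm_star.
  have := rnormM_leM s1 x2; have := rnormM_leM s2 xb; norm_lra.
have sq : sa (q + 1%:R%:B) by rewrite /sa !starE (proj1 pq).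
have [|d [_ dq _ _ dn]] := psd_inv (csT H) I I ltr01 sq; first by rewrite addrK.
rewrite rmorph1 scale1r in dq; rewrite invr1 in dn.
(* (1 - q) h = (1 + q)^-1 (1 - q^2) h, and q^2 = [star b * b] is close to [star x * x], which fixes
   h. *)
have e2 : rnorm ((1 - q) * h) <= 5 * g.
  have -> : (1 - q) * h = d * ((star x * x - star b * b) * h).
    have -> : (star x * x - star b * b) * h = (q + 1) * ((1 - q) * h).
      by rewrite mulrBl xxh -qq; bop_ring.
    by rewrite [RHS]mulrA dq mul1r.
  by have := rnormM_leM dn (rnormM_leM e1 h1); rewrite mul1r mulr1.
have -> : (x - w) * h = (x - b) * h - w * ((1 - q) * h) by rewrite bE; bop_ring.
have := rnormB ((x - b) * h) (w * ((1 - q) * h)).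
have := rnormM_leM xb h1; have := rnormM_leM (unitary_norm uw) e2.
norm_lra.
Qed.

Lemma inv_near_unitary A w z : is_csubalg A -> A 1 -> A w -> unitary w -> A z ->
  rnorm (w - z) < 1 -> inv_in A z.
Proof.
move=> Ac A1 Aw uw Az wz.
have zE : z = w * (1 - star w * (w - z)).
  by rewrite mulrBr mulr1 mulrA (proj2 uw) mul1r subKr.
have sw : rnorm (star w) <= 1 by exact: unitary_norm (unitary_star uw).
have n1 : rnorm (star w * (w - z)) < 1.
  by apply: le_lt_trans wz; have := rnormM_leM sw (lexx (rnorm (w - z))); rewrite mul1r.
have [d [zd dz dP]] := neumann n1.
rewrite zE; apply: inv_inM => //.
  by exists (star w); split; [exact: csS|case: uw|case: uw].
exists d; split=> //; apply: dP; [exact: csC|exact: csub0 Ac|move=> y Ay].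
apply: csD => //; apply: csM => //; apply: csM => //; [exact: csS|exact: csB].
Qed.

Definition inv_dense A := forall a, A a -> forall e : R, 0 < e ->
  exists b, [/\ A b, inv_in A b & rnorm (a - b) < e].

Definition inv_dense_sa A := forall a, A a -> sa a -> forall e : R, 0 < e ->
  exists b, [/\ A b, sa b, inv_in A b & rnorm (a - b) < e].

(** A fixed gap suffices. Take x, h, k from [cutoff] and the unitary part w of an invertible near x.
    Since w is close to x on h, the element z = w + (x - w) h is invertible, and z k = x k. Then z
    (k + e / 8) is invertible and close to x k, hence to a. *)
Lemma inv_dense_gap A (g : R) : is_csubalg A -> A 1 -> 0 <= g -> 64 * g <= 1 ->
  (forall x, A x -> rnorm x <= 2 -> exists b, [/\ A b, inv_in A b & rnorm (x - b) <= g]) ->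
  inv_dense A.
Proof.
move=> Ac A1 g0 g1 Ag a Aa e e0; have e80 : 0 < e / 8 by rewrite divr_gt0.
have [x [h [k [[Ax Ah Ak] [hs pk] [x2 h1 xka] [xxh hk] _]]]] := cutoff Ac A1 Aa e80.
have [b [Ab ib xb]] := Ag x Ax x2.
have [w [q [[Aw Aq uw] pq bE _]]] := polar_inv Ac A1 Ab ib.
have xwh := polar_near_isometry g0 g1 x2 h1 xxh xb uw pq bE.
have [z zE] : exists z, z = w + (x - w) * h by eexists.
have Az : A z by rewrite zE; apply: csD => //; apply: csM => //; exact: csB.
have zk : z * k = x * k by rewrite zE mulrDl -mulrA hk mulrBl addrC subrK.
have wz : rnorm (w - z) < 1.
  have -> : w - z = - ((x - w) * h) by rewrite zE; bop_ring.
  by rewrite bnormN; move: xwh; norm_lra.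
have iz := inv_near_unitary Ac A1 Aw uw Az wz.
have ikt := inv_in_psdD Ac A1 Ak pk e80.
exists (z * (k + (e / 8)%:B)); split.
- by apply: csM => //; apply: csD => //; exact: csZ.
- exact: inv_inM.
- have -> : a - z * (k + (e / 8)%:B) = - (x * k - a) - (e / 8)%:C%C *: z.
    by rewrite mulrDr zk scalM1; bop_ring.
  apply: le_lt_trans (rnormB _ _) _; rewrite bnormN bnormZr gtr0_norm //.
  have z2 : rnorm z <= 2.
    have := bnormB_sub z w; rewrite bdistC; have := unitary_norm uw; move: wz; norm_lra.
  have := ler_wpM2l (ltW e80) z2; move: xka e0; norm_lra.
Qed.

(** As in [inv_dense_gap], but with the self-adjoint z = x - (1 - h) (x - w) (1 - h), which commutes
    with k. *)
Lemma inv_dense_sa_gap A (g : R) : is_csubalg A -> A 1 -> 0 <= g -> 64 * g <= 1 ->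
  (forall x, A x -> sa x -> rnorm x <= 2 ->
     exists b, [/\ A b, sa b, inv_in A b & rnorm (x - b) <= g]) ->
  inv_dense_sa A.
Proof.
move=> Ac A1 g0 g1 Ag a Aa as_ e e0; have e80 : 0 < e / 8 by rewrite divr_gt0.
have [x [h [k [[Ax Ah Ak] [hs pk] [x2 h1 xka] [xxh hk]]]]] := cutoff Ac A1 Aa e80.
move=> /(_ as_)[xs xh xk].
have [b [Ab bs ib xb]] := Ag x Ax xs x2.
have [w [q [[Aw Aq uw] pq bE /(_ bs)[ws wq]]]] := polar_inv Ac A1 Ab ib.
have xwh := polar_near_isometry g0 g1 x2 h1 xxh xb uw pq bE.
have kh : k * h = k by have := congr1 (@star _ _) hk; rewrite starM_ (proj1 pk) hs.
have [z zE] : exists z, z = w + (x - w) * h + (h * (x - w) - h * ((x - w) * h)) by eexists.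
have Axw : A (x - w) by exact: csB.
have Axwh : A ((x - w) * h) by exact: csM.
have Az : A z.
  by rewrite zE; apply: csD => //; [exact: csD|apply: csB => //; exact: csM].
have zs : star z = z.
  rewrite zE !starD_ starN !starM_ starB hs ws xs; bop_ring.
have zk : z * k = x * k.
  rewrite zE; transitivity (w * k + (x - w) * (h * k) + h * ((x - w) * k - (x - w) * (h * k))).
    by bop_ring.
  by rewrite hk subrr mulr0 addr0 mulrBl addrC subrK.
have kz : k * z = z * k.
  by have := congr1 (@star _ _) zk; rewrite !starM_ (proj1 pk) zs xs => ->; rewrite -xk zk.
have sxwh : rnorm (h * (x - w)) = rnorm ((x - w) * h).
  by rewrite -[LHS]rnorm_star starM_ starB hs xs ws.
have wz : rnorm (w - z) < 1.
  have -> : w - z = h * ((x - w) * h) - ((x - w) * h + h * (x - w)) by rewrite zE; bop_ring.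
  have := rnormB (h * ((x - w) * h)) ((x - w) * h + h * (x - w)).
  have := bnormD ((x - w) * h) (h * (x - w)); rewrite sxwh.
  have := rnormM_leM h1 (lexx (rnorm ((x - w) * h))); norm_lra.
have iz := inv_near_unitary Ac A1 Aw uw Az wz.
have ikt := inv_in_psdD Ac A1 Ak pk e80.
exists (z * (k + (e / 8)%:B)); split.
- by apply: csM => //; apply: csD => //; exact: csZ.
- by rewrite /sa starM_ !starE (proj1 pk) zs mulrDl mulrDr kz scal1M scalM1.
- exact: inv_inM.
- have -> : a - z * (k + (e / 8)%:B) = - (x * k - a) - (e / 8)%:C%C *: z.
    by rewrite mulrDr zk scalM1; bop_ring.
  apply: le_lt_trans (rnormB _ _) _; rewrite bnormN bnormZr gtr0_norm //.
  have z2 : rnorm z <= 2.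
    have := bnormB_sub z w; rewrite bdistC; have := unitary_norm uw; move: wz; norm_lra.
  have := ler_wpM2l (ltW e80) z2; move: xka e0; norm_lra.
Qed.

(* Replacing [b = w * q] by [w * (q + t)] bounds the inverse, so that
   invertibility passes to nearby algebras. *)
Lemma inv_shift B b w q (t d : R) b' : is_csubalg B -> B 1 -> 0 < t -> 0 <= d -> d < t ->
  unitary w -> psd q -> b = w * (q + t%:B) -> B b' -> rnorm (b - b') <= d ->
  inv_in B b'.
Proof.
move=> Bc B1 t0 d0 dt uw pq bE Bb' bb.
have iso v u : unitary v -> rnorm (v u) = rnorm u.
  move=> [vv _]; apply/eqP; rewrite -(@eqrXn2 _ 2) ?rnorm_ge0 // -!rinnerE.
  by rewrite -rstarS -bopME vv bop1E.
have qt u : t * rnorm u <= rnorm ((q + t%:B) u) by apply: psd_ge_norm; rewrite addrK.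
have sub u (y y' : bop H) : rnorm (y - y') <= d ->
    rnorm (y u) - d * rnorm u <= rnorm (y' u).
  move=> yy; rewrite lerBlDr.
  have h : y u = y' u + (y - y') u by rewrite bopDE bopNE addrC subrK.
  rewrite h; apply: le_trans (rnormD _ _) _; rewrite lerD2l.
  by apply: le_trans (rnorm_bop_le _ _) _; rewrite ler_wpM2r ?rnorm_ge0.
have td : 0 < t - d by rewrite subr_gt0.
have [||c [bc cb Bcc]] := @inv_bounded_below _ _ B b' (t - d) Bc B1 Bb' td.
- move=> u; apply: le_trans (sub u _ _ bb); rewrite mulrBl lerD2r.
  by rewrite bE bopME iso // qt.
- move=> u; apply: le_trans (sub u (star b) _ _); last by rewrite -starB rnorm_star.
  rewrite mulrBl lerD2r bE starM_ starD_ starZr star1 (proj1 pq) bopME.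
  by apply: le_trans (qt _); rewrite iso //; exact: unitary_star.
by exists c.
Qed.

(** Only the gap 1/64 has to be shown in B. An invertible w q of A is replaced by w (q + t) with t =
    1/256, whose lower bound t exceeds the error 3 d of passing to B. *)
Lemma inv_dense_dnear A B (d : R) : is_csubalg A -> A 1 -> is_csubalg B -> B 1 -> 0 <= d ->
  1024 * d <= 1 -> dnear d A B -> dnear d B A -> inv_dense A -> inv_dense B.
Proof.
move=> Ac A1 Bc B1 d0 d1 AB BA Ad.
have t0 : (0 : R) < 256%:R^-1 by rewrite invr_gt0 ltr0n.
have tE : 256 * 256%:R^-1 = 1 :> R by rewrite mulfV // pnatr_eq0.
have g0 : (0 : R) <= 64%:R^-1 by rewrite invr_ge0 ler0n.
have gE : 64 * 64%:R^-1 = 1 :> R by rewrite mulfV // pnatr_eq0.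
apply: (inv_dense_gap Bc B1 g0); first by rewrite gE.
move: (256%:R^-1) (64%:R^-1) t0 tE g0 gE => t g t0 tE g0 gE x Bx x2.
have [x' [Ax' xx' x'x]] := BA x Bx.
have [b [Ab ib xb]] := Ad x' Ax' t t0.
have [w [q [[Aw Aq uw] pq bE _]]] := polar_inv Ac A1 Ab ib.
have [b1 b1E] : exists b1, b1 = w * (q + t%:B) by eexists.
have bb1 : rnorm (b - b1) <= t.
  rewrite b1E bE (_ : _ - _ = - (t%:C%C *: w)); last by bop_ring.
  by rewrite bnormN bnormZr gtr0_norm // ler_piMr ?(ltW t0) ?(unitary_norm uw).
have Ab1 : A b1 by rewrite b1E; apply: csM => //; apply: csD => //; exact: csZ.
have b13 : rnorm b1 <= 3.
  have := bnormB_sub b1 b; have := bnormB_sub b x'; rewrite (bdistC b1) (bdistC b).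
  move: bb1 xb x'x x2 tE t0; norm_lra.
have [b2 [Bb2 b12 _]] := AB b1 Ab1.
have {}b12 : rnorm (b1 - b2) <= 3 * d.
  by apply: le_trans b12 _; rewrite mulrC ler_wpM2r.
exists b2; split=> //.
  apply: (inv_shift Bc B1 t0 _ _ uw pq b1E Bb2 b12); first by rewrite mulr_ge0.
  by move: tE d1; clear; lra.
have -> : x - b2 = (x - x') + (x' - b) + (b - b1) + (b1 - b2) by bop_ring.
apply: le_trans (bnormD _ _) _; apply: le_trans (lerD (bnormD _ _) (lexx _)) _.
apply: le_trans (lerD (lerD (bnormD _ _) (lexx _)) (lexx _)) _.
have h1 : rnorm (x - x') <= 2 * d by apply: le_trans xx' _; rewrite mulrC ler_wpM2r.
by move: h1 xb bb1 b12 tE gE d1; norm_lra.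
Qed.

Lemma inv_dense_sa_dnear A B (d : R) : is_csubalg A -> A 1 -> is_csubalg B -> B 1 -> 0 <= d ->
  1024 * d <= 1 -> dnear d A B -> dnear d B A -> inv_dense_sa A -> inv_dense_sa B.
Proof.
move=> Ac A1 Bc B1 d0 d1 AB BA Ad.
have t0 : (0 : R) < 256%:R^-1 by rewrite invr_gt0 ltr0n.
have tE : 256 * 256%:R^-1 = 1 :> R by rewrite mulfV // pnatr_eq0.
have g0 : (0 : R) <= 64%:R^-1 by rewrite invr_ge0 ler0n.
have gE : 64 * 64%:R^-1 = 1 :> R by rewrite mulfV // pnatr_eq0.
apply: (inv_dense_sa_gap Bc B1 g0); first by rewrite gE.
move: (256%:R^-1) (64%:R^-1) t0 tE g0 gE => t g t0 tE g0 gE x Bx xs x2.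
have [x' [Ax' xs' xx' x'x]] := dnear_sa Ac BA Bx xs.
have [b [Ab bs ib xb]] := Ad x' Ax' xs' t t0.
have [w [q [[Aw Aq uw] pq bE /(_ bs)[ws wq]]]] := polar_inv Ac A1 Ab ib.
have [b1 b1E] : exists b1, b1 = w * (q + t%:B) by eexists.
have b1s : sa b1.
  by rewrite b1E /sa starM_ !starE ws (proj1 pq) mulrDl mulrDr wq scal1M scalM1.
have bb1 : rnorm (b - b1) <= t.
  rewrite b1E bE (_ : _ - _ = - (t%:C%C *: w)); last by bop_ring.
  by rewrite bnormN bnormZr gtr0_norm // ler_piMr ?(ltW t0) ?(unitary_norm uw).
have Ab1 : A b1 by rewrite b1E; apply: csM => //; apply: csD => //; exact: csZ.
have b13 : rnorm b1 <= 3.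
  have := bnormB_sub b1 b; have := bnormB_sub b x'; rewrite (bdistC b1) (bdistC b).
  move: bb1 xb x'x x2 tE t0; norm_lra.
have [b2 [Bb2 b2s b12 _]] := dnear_sa Bc AB Ab1 b1s.
have {}b12 : rnorm (b1 - b2) <= 3 * d.
  by apply: le_trans b12 _; rewrite mulrC ler_wpM2r.
exists b2; split=> //.
  apply: (inv_shift Bc B1 t0 _ _ uw pq b1E Bb2 b12); first by rewrite mulr_ge0.
  by move: tE d1; clear; lra.
have -> : x - b2 = (x - x') + (x' - b) + (b - b1) + (b1 - b2) by bop_ring.
apply: le_trans (bnormD _ _) _; apply: le_trans (lerD (bnormD _ _) (lexx _)) _.
apply: le_trans (lerD (lerD (bnormD _ _) (lexx _)) (lexx _)) _.
have h1 : rnorm (x - x') <= 2 * d by apply: le_trans xx' _; rewrite mulrC ler_wpM2r.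
by move: h1 xb bb1 b12 tE gE d1; norm_lra.
Qed.

(** The part in A is moved with error 2 d |z| and the scalar is kept; dividing by 1 + 2 d restores
    the norm bound and costs 2 d |z| once more. *)
Lemma dnear_adj1 A B (d : R) : is_csubalg A -> is_csubalg B -> 0 <= d -> dnear d A B ->
  dnear (4 * d) (adj1 A) (adj1 B).
Proof.
move=> Ac Bc d0 AB z Az; have [x [l [Ax zE lz]]] := adj1_decomp Ac Az.
have [y [By xy yx]] := AB x Ax.
have xn : rnorm x <= 2 * rnorm z.
  have -> : x = z - l%:I by rewrite zE addrK.
  apply: le_trans (rnormB _ _) _; have := rnorm_scal_le H l; move: lz; norm_lra.
have s0 : 0 < 1 + 2 * d by lra.
pose s := (1 + 2 * d)^-1; have s1 : s * (1 + 2 * d) = 1 by rewrite mulVf // gt_eqF.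
have sp : 0 < s by rewrite invr_gt0.
have [z' z'E] : exists z', z' = y + l%:I by eexists.
have zz' : rnorm (z - z') <= 2 * d * rnorm z.
  rewrite zE z'E (_ : _ - _ = x - y); last by bop_ring.
  apply: le_trans xy _; rewrite -zE; have := ler_wpM2l d0 xn; norm_lra.
have z'n : rnorm z' <= (1 + 2 * d) * rnorm z.
  have := bnormB_sub z' z; rewrite bdistC; move: zz'; norm_lra.
exists (s%:C%C *: z'); split.
- by apply: csZ; [exact: adj1_csubalg|rewrite z'E; exists y, l].
- rewrite (_ : z - _ = (z - z') + (1 - s)%:C%C *: z'); last first.
    by rewrite rmorphB rmorph1; bop_ring.
  have sE : 1 - s = s * (2 * d) by rewrite -{1}s1; ring.
  have s2 : 0 <= s * (2 * d) by rewrite !mulr_ge0 // ltW.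
  apply: le_trans (bnormD _ _) _; rewrite bnormZr sE ger0_norm //.
  have := ler_wpM2l s2 z'n.
  rewrite (_ : s * (2 * d) * ((1 + 2 * d) * rnorm z) = s * (1 + 2 * d) * (2 * d * rnorm z)); last by ring.
  rewrite s1 mul1r.
  by move: zz'; norm_lra.
- rewrite bnormZr gtr0_norm // /s mulrC ler_pdivrMr // mulrC; exact: z'n.
Qed.

End InvertibleDensity.

(** * Real rank zero and stable rank one through [adj1] *)

Section RankProperties.
Variables (R : realType) (H : hilbertType R).
Implicit Types (S T : csubalg (bop H)) (A B : set (bop H)) (a b c x y e : bop H) (l m : R[i]).

(** Each step of f -> f + (y - y f) shrinks y - y f by the factor r, so the iteration converges to e
    with y e = y. Then y kills e b - b, so |e b - b| <= r |e b - b|, and e is a left unit; its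
    adjoint is a right unit. *)
Lemma approx_unit_unital A y (r : R) : is_csubalg A -> A y -> 0 <= r -> r < 1 ->
  (forall b, A b -> rnorm (b - y * b) <= r * rnorm b) -> exists e, unit_of A e.
Proof.
move=> Ac Ay r0 r1 yr.
pose f k := iter k (fun x => x + (y - y * x)) 0.
have Af k : A (f k).
  elim: k => [|k IH] /=; first exact: csub0 Ac.
  by apply: csD => //; apply: csB => //; exact: csM.
have fS k : f k.+1 = f k + (y - y * f k) by [].
have fSB k : f k.+1 - f k = y - y * f k by rewrite fS addrC addKr.
have res k : rnorm (y - y * f k) <= r ^+ k * rnorm y.
  elim: k => [|k IH]; first by rewrite mulr0 subr0 expr0 mul1r.
  have -> : y - y * f k.+1 = (y - y * f k) - y * (y - y * f k).
    by rewrite fS mulrDr opprD addrA.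
  apply: le_trans (yr _ _) _; first by apply: csB => //; exact: csM.
  by rewrite exprS -mulrA ler_wpM2l.
have q1 : 0 < 1 - r by rewrite subr_gt0.
pose t k : R := - (r ^+ k * rnorm y / (1 - r)).
have [||e eP] := @cvg_majorant _ _ f t 0.
- move=> k; rewrite fSB.
  apply: le_trans (res k) _; rewrite /t exprS le_eqVlt; apply/orP; left; apply/eqP.
  by field; rewrite gt_eqF.
- move=> k; rewrite oppr_le0 divr_ge0 ?(ltW q1) //.
  by rewrite mulr_ge0 ?exprn_ge0 ?bnorm_ge0.
have Ae : A e.
  by apply: (csC Ac) => h /eP[N /(_ N (leqnn _)) HN]; exists (f N).
have ye : y * e = y.
  apply/esym/eqP; rewrite -subr_eq0; apply/eqP/rnorm0_eq0/eqP; rewrite eq_le bnorm_ge0 andbT.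
  apply: (@ler_eps _ _ _ (1 + rnorm y)); first by rewrite addr_ge0 ?bnorm_ge0.
  move=> h h0; have [N HN] := eP h h0.
  have [M HM] : exists M, (N <= M)%N /\ rnorm (y - y * f M) <= h.
    have h1 : 0 < h / (rnorm y + 1) by rewrite divr_gt0 // ltr_wpDl ?bnorm_ge0.
    have /cvgrPdist_le/(_ _ h1)[M _ HM] : (fun n => geometric (1 : R) r n) @ \oo --> (0 : R).
      by apply: cvg_geometric; rewrite ger0_norm.
    exists (maxn N M); split; first exact: leq_maxl.
    apply: le_trans (res _) _; have := HM (maxn N M) (leq_maxr _ _).
    rewrite /= mul1r sub0r normrN ger0_norm ?exprn_ge0 // ler_pdivlMr ?ltr_wpDl ?bnorm_ge0 //.
    have : 0 <= r ^+ maxn N M by rewrite exprn_ge0.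
    by have := bnorm_ge0 y; move: (r ^+ _); norm_nra.
  have -> : y - y * e = (y - y * f M) - y * (e - f M) by bop_ring.
  rewrite add0r mulrDl mul1r; apply: le_trans (rnormB _ _) _; apply: lerD; first by case: HM.
  apply: rnormM_leM => //; apply: HN; by case: HM.
have le b : A b -> e * b = b.
  move=> Ab; apply/eqP; rewrite -subr_eq0; apply/eqP/rnorm0_eq0/eqP.
  rewrite eq_le bnorm_ge0 andbT.
  have := yr (e * b - b) (csB Ac (csM Ac Ae Ab) Ab).
  rewrite mulrBr mulrA ye subrr subr0 => h.
  by rewrite -(pmulr_rle0 _ q1) mulrBl mul1r subr_le0.
have re b : A b -> b * star e = b.
  by move=> Ab; have := congr1 (@star _ _) (le _ (csS Ac Ab)); rewrite starM_ starK.
have es : star e = e by rewrite -[LHS]le ?re //; exact: csS.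
by exists e; split=> // b Ab; split; [exact: le|rewrite -{1}es re].
Qed.

(** Realizes the formal unitization inside B(H); it is injective when S does not contain 1. *)
Definition adj1_val S (z : csub_alg S * R[i]) : bop H := csub_val z.1 + z.2%:I.

Lemma adj1_val_in S z : adj1 (csub_set S) (adj1_val (S := S) z).
Proof. by exists (csub_val z.1), z.2; split=> //; exact: csub_in. Qed.

Lemma adj1_valP S z : adj1 (csub_set S) z -> exists z' : csub_alg S * R[i], adj1_val z' = z.
Proof. by move=> [x [l [Sx ->]]]; exists (celt Sx, l). Qed.

Lemma adj1_val_inj S : ~ csub_set S 1 -> injective (@adj1_val S).
Proof.
move=> S1 [x l] [y m] h.
have [xy lm] := adj1_uniq (csubP S) S1 (csub_in x) (csub_in y) h.
by congr (_, _); [exact: val_inj|exact: lm].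
Qed.

Lemma adj1_valM S z z' : @adj1_val S (unitization_mul z z') = adj1_val z * adj1_val z'.
Proof.
case: z z' => [x l] [y m].
change (csub_val x * csub_val y + m *: csub_val x + l *: csub_val y + (l * m)%:I =
  (csub_val x + l%:I) * (csub_val y + m%:I)).
by bop_ring.
Qed.

Lemma adj1_valS S z : @adj1_val S (unitization_star z) = star (adj1_val z).
Proof. by rewrite /adj1_val /= starD_ starZ_ star1. Qed.

Lemma adj1_val1 S : @adj1_val S (unitization_one (csub_alg S)) = 1.
Proof. by rewrite /adj1_val /= scale1r; exact: add0r. Qed.

Lemma adj1_valB S z z' : @adj1_val S (z - z') = adj1_val z - adj1_val z'.
Proof.
case: z z' => [x l] [y m].
change (csub_val x - csub_val y + (l - m)%:I = csub_val x + l%:I - (csub_val y + m%:I)).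
by bop_ring.
Qed.

Lemma unit_one S : csub_set S 1 -> unit_of (csub_set S) 1.
Proof. by move=> S1; split=> // a _; rewrite mul1r mulr1. Qed.

Section UnitizationNorm.
Variables (S : csubalg (bop H)) (nS : ~ unital (csub_alg S)).
Let Sc := csubP S.

Let norm_set (z : csub_alg S * R[i]) :=
  [set rnorm (cmul z.1 b + z.2 *: b) | b in [set b : csub_alg S | rnorm b <= 1]].

Let cmulE (z : csub_alg S * R[i]) (b : csub_alg S) : csub_val (cmul z.1 b + z.2 *: b) = adj1_val z * csub_val b.
Proof. by rewrite /adj1_val mulrDl scal1M. Qed.

Let norm_sup (z : csub_alg S * R[i]) : has_sup (norm_set z).
Proof.
split; first by eexists; exists 0 => //=; rewrite rnorm0 ler01.
exists (rnorm (adj1_val z)) => _ [b b1 <-]; rewrite csub_rnorm cmulE.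
by have := rnormM_leM (lexx (rnorm (adj1_val z))) b1; rewrite mulr1.
Qed.

Lemma unitization_norm_le (z : csub_alg S * R[i]) : unitization_norm z <= rnorm (adj1_val z).
Proof.
apply: ge_sup; first by case: (norm_sup z).
move=> _ [b b1 <-]; rewrite csub_rnorm cmulE.
by have := rnormM_leM (lexx (rnorm (adj1_val z))) b1; rewrite mulr1.
Qed.

Let norm_ge (z : csub_alg S * R[i]) b : csub_set S b -> rnorm (adj1_val z * b) <= unitization_norm z * rnorm b.
Proof.
move=> Sb; have [b0|b0] := eqVneq (rnorm b) 0.
  by rewrite (rnorm0_eq0 b0) mulr0 rnorm0 mulr0.
have {}b0 : 0 < rnorm b by rewrite lt_neqAle eq_sym b0 bnorm_ge0.
rewrite -ler_pdivrMr //.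
have Sb' : csub_set S ((rnorm b)^-1%:C%C *: b) by exact: csZ.
have -> : rnorm (adj1_val z * b) / rnorm b = rnorm (adj1_val z * ((rnorm b)^-1%:C%C *: b)).
  by rewrite bopZAr bnormZr ger0_norm ?invr_ge0 ?ltW // mulrC.
apply: sup_upper_bound (norm_sup z) _ _; exists (celt Sb').
  change (rnorm ((rnorm b)^-1%:C%C *: b) <= 1).
  by rewrite bnormZr gtr0_norm ?invr_gt0 // mulVf // gt_eqF.
by rewrite csub_rnorm cmulE.
Qed.

Lemma nonunital_not1 : ~ csub_set S 1.
Proof. by move=> S1; apply: nS; apply/unitalP; exists 1; exact: unit_one. Qed.

(** Equivalence of the two norms is enough for density. If the scalar l exceeded the norm N of the
    action, -x / l would be an approximate left unit and S would be unital. With |l| <= N, the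
    identity |x|^2 = |x [star x]| gives |x| <= 2 N. *)
Lemma unitization_norm_ge (z : csub_alg S * R[i]) : rnorm (adj1_val z) <= 3 * unitization_norm z.
Proof.
set N := unitization_norm z.
have N0 : 0 <= N.
  apply: sup_upper_bound (norm_sup z) _ _; exists 0; first by rewrite /= rnorm0 ler01.
  have := cmulE z 0; rewrite mulr0 => h; apply/eqP.
  by rewrite -[_ == _]/(rnorm (csub_val (cmul z.1 0 + z.2 *: 0)) == 0) h rnorm0.
have NP b : csub_set S b -> rnorm (adj1_val z * b) <= N * rnorm b := @norm_ge z b.
case: z @N N0 NP => x l N N0 NP; rewrite /adj1_val /= in NP *.
have lN : cabs l <= N.
  rewrite leNgt; apply/negP => Nl; apply: nS; apply/unitalP.
  have l0 : 0 < cabs l by exact: le_lt_trans N0 Nl.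
  have ln : l != 0 by apply/eqP => h; move: l0; rewrite h /cabs normr0 ltxx.
  have Sx := csub_in x.
  apply: (@approx_unit_unital _ (- (l^-1 *: csub_val x)) (N / cabs l) Sc).
  - by apply: csN => //; exact: csZ.
  - by rewrite divr_ge0 // ltW.
  - by rewrite ltr_pdivrMr // mul1r.
  move=> b Sb; have -> : b - - (l^-1 *: csub_val x) * b = l^-1 *: ((csub_val x + l%:I) * b).
    rewrite mulrDl scal1M scalerDr scalerA mulVf // scale1r mulNr opprK bopZAl.
    by rewrite addrC.
  rewrite rnormZc cabsV [leRHS]mulrAC [leRHS]mulrC.
  by apply: ler_wpM2l; [rewrite invr_ge0 ltW|exact: NP].
have xn : rnorm (csub_val x) <= 2 * N.
  have Sxs := csS Sc (csub_in x).
  have xE : csub_val x * star (csub_val x) =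
      (csub_val x + l%:I) * star (csub_val x) - l *: star (csub_val x).
    by rewrite mulrDl scal1M addrK.
  have : rnorm ((csub_val x + l%:I) * star (csub_val x)) <= N * rnorm (star (csub_val x)).
    exact: NP _ Sxs.
  have := rnormB ((csub_val x + l%:I) * star (csub_val x)) (l *: star (csub_val x)).
  rewrite -xE rnorm_starMr rnormZc rnorm_star => h1 h2.
  have h3 := ler_wpM2r (bnorm_ge0 (csub_val x)) lN.
  have [->|x0] := eqVneq (rnorm (csub_val x)) 0; first by rewrite mulr_ge0.
  have {}x0 : 0 < rnorm (csub_val x) by rewrite lt_neqAle eq_sym x0 bnorm_ge0.
  by rewrite -(ler_pM2r x0); move: h1 h2 h3; rewrite expr2; move: (cabs l * _); norm_lra.
change (rnorm (csub_val x + l%:I) <= 3 * N).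
apply: le_trans (bnormD _ _) _; apply: (@le_trans _ _ (2 * N + N)); last by lra.
by apply: lerD => //; exact: le_trans (rnorm_scal_le H l) lN.
Qed.

Lemma unitization_invertible (z : csub_alg S * R[i]) :
  invertible (@unitization_mul R (csub_alg S)) (unitization_one (csub_alg S)) z <->
  inv_in (adj1 (csub_set S)) (adj1_val z).
Proof.
split=> [[w [zw wz]]|[d [Sd zd dz]]].
  exists (adj1_val w); split; first exact: adj1_val_in.
    by rewrite -adj1_valM zw adj1_val1.
  by rewrite -adj1_valM wz adj1_val1.
have [w wd] := adj1_valP Sd; rewrite -wd in zd dz.
exists w; split; apply: (adj1_val_inj nonunital_not1); by rewrite adj1_valM adj1_val1.
Qed.

Lemma nonunital_dense : inv_dense (adj1 (csub_set S)) <->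
  dense_invertible (@unitization_mul R (csub_alg S)) (unitization_one (csub_alg S))
    (@unitization_norm R (csub_alg S)).
Proof.
split=> [den z e e0|den a Sa e e0].
  have [b [Sb ib zb]] := den _ (adj1_val_in z) e e0.
  have [b' b'E] := adj1_valP Sb; exists b'; split.
    by apply/unitization_invertible; rewrite b'E.
  by apply: le_lt_trans (unitization_norm_le _) _; rewrite adj1_valB b'E.
have [z zE] := adj1_valP Sa; have e3 : 0 < e / 3 by rewrite divr_gt0.
have [b [/unitization_invertible ib zb]] := den z _ e3.
exists (adj1_val b); split=> //; first exact: adj1_val_in.
rewrite -zE -adj1_valB; apply: le_lt_trans (unitization_norm_ge _) _.
by move: zb; move: (unitization_norm _) => n; lra.
Qed.

Lemma nonunital_dense_sa : inv_dense_sa (adj1 (csub_set S)) <->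
  dense_invertible_sa (@unitization_mul R (csub_alg S)) (@unitization_star R (csub_alg S))
    (unitization_one (csub_alg S)) (@unitization_norm R (csub_alg S)).
Proof.
split=> [den z zs e e0|den a Sa as_ e e0].
  have zs' : sa (adj1_val z) by rewrite /sa -adj1_valS zs.
  have [b [Sb bs ib zb]] := den _ (adj1_val_in z) zs' e e0.
  have [b' b'E] := adj1_valP Sb; exists b'; split.
  - by apply: (adj1_val_inj nonunital_not1); rewrite adj1_valS b'E.
  - by apply/unitization_invertible; rewrite b'E.
  - by apply: le_lt_trans (unitization_norm_le _) _; rewrite adj1_valB b'E.
have [z zE] := adj1_valP Sa; have e3 : 0 < e / 3 by rewrite divr_gt0.
have zs : unitization_star z = z.
  by apply: (adj1_val_inj nonunital_not1); rewrite adj1_valS zE.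
have [b [bs /unitization_invertible ib zb]] := den z zs _ e3.
exists (adj1_val b); split=> //; first exact: adj1_val_in.
  by rewrite /sa -adj1_valS bs.
rewrite -zE -adj1_valB; apply: le_lt_trans (unitization_norm_ge _) _.
by move: zb; move: (unitization_norm _) => n; lra.
Qed.

End UnitizationNorm.

(** * Algebras with a unit e, possibly different from the identity operator *)

Section Unital.
Variables (S : csubalg (bop H)) (e : bop H).
Hypothesis ue : unit_of (csub_set S) e.
Let Sc := csubP S.
Let Se : csub_set S e := proj1 ue.
Let ce : csub_alg S := celt Se.
Let pe : proj e := unit_proj Sc ue.

(* [adj1 S] is the direct sum of [S] and the multiples of [1 - e]. *)
Lemma unital_split z : adj1 (csub_set S) z -> exists2 l, csub_set S (z * e) &
  [/\ z = z * e + l *: (1 - e), z * e = e * z & sa z -> l = 0 \/ sa (l *: (1 - e))].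
Proof.
move=> [x [l [Sx zE]]]; have [ex xe] := proj2 ue x Sx.
have zeE : z * e = x + l *: e by rewrite zE mulrDl xe scal1M.
exists l; first by rewrite zeE; apply: csD => //; exact: csZ.
have zd : z = z * e + l *: (1 - e) by rewrite zeE zE scalerBr; bop_ring.
have ez : z * e = e * z by rewrite zeE zE mulrDr ex scalM1.
split=> // zs; right.
have -> : l *: (1 - e) = z - z * e by rewrite {1}zd addrAC subrr add0r.
by rewrite /sa starB starM_ zs (proj1 pe) ez.
Qed.

Let e1e : e * (1 - e) = 0. Proof. by rewrite mulrBr mulr1 (proj2 pe) subrr. Qed.
Let ee1 : (1 - e) * e = 0. Proof. by rewrite mulrBl mul1r (proj2 pe) subrr. Qed.
Let e11 : (1 - e) * (1 - e) = 1 - e. Proof. exact: (proj2 (proj1B pe)). Qed.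

Lemma unital_inv_lift b l : csub_set S b -> l != 0 ->
  (exists d, [/\ csub_set S d, b * d = e & d * b = e]) ->
  inv_in (adj1 (csub_set S)) (b + l *: (1 - e)).
Proof.
move=> Sb l0 [d [Sd bd db]].
have S1c := adj1_csubalg Sc; have S11 := adj1_1 Sc.
have S1e : adj1 (csub_set S) (1 - e) by apply: csB => //; exact: adj1_sub.
have kill x : csub_set S x -> x * (1 - e) = 0 /\ (1 - e) * x = 0.
  by move=> Sx; have [ex xe] := proj2 ue x Sx; rewrite mulrBr mulrBl mulr1 mul1r xe ex subrr.
have [b1 b2] := kill b Sb; have [d1 d2] := kill d Sd.
exists (d + l^-1 *: (1 - e)); split.
- by apply: csD => //; [exact: adj1_sub|exact: csZ].
- rewrite mulrDr !mulrDl bd bopZAl d2 scaler0 addr0 bopZAr b1 scaler0 add0r.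
  by rewrite bopZAl bopZAr scalerA mulfV // scale1r e11 addrC subrK.
- rewrite mulrDr !mulrDl db bopZAl b2 scaler0 addr0 bopZAr d1 scaler0 add0r.
  by rewrite bopZAl bopZAr scalerA mulVf // scale1r e11 addrC subrK.
Qed.

Lemma unital_inv_corner z : adj1 (csub_set S) z -> inv_in (adj1 (csub_set S)) z ->
  exists d, [/\ csub_set S d, z * e * d = e & d * (z * e) = e].
Proof.
move=> Sz [w [Sw zw wz]].
have [_ Sze [_ ze _]] := unital_split Sz; have [_ Swe [_ we _]] := unital_split Sw.
exists (w * e); split=> //.
  by rewrite we mulrA -(mulrA z) (proj2 pe) -mulrA -we mulrA zw mul1r.
by rewrite ze mulrA -(mulrA w) (proj2 pe) -mulrA -ze mulrA wz mul1r.
Qed.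

Lemma csub_invertible (b : csub_alg S) : invertible (@cmul R (csub_alg S)) ce b <->
  exists d, [/\ csub_set S d, csub_val b * d = e & d * csub_val b = e].
Proof.
split=> [[d [/(congr1 (@csub_val _ _ S)) bd /(congr1 (@csub_val _ _ S)) db]]|[d [Sd bd db]]].
  by exists (csub_val d); split=> //; exact: csub_in.
by exists (celt Sd); split; exact: val_inj.
Qed.

Lemma unital_norm_le x : rnorm (x * e) <= rnorm x.
Proof. by have := rnormM_leM (lexx (rnorm x)) (proj_norm_le1 pe); rewrite mulr1. Qed.

Lemma one_minus_norm l : rnorm (l *: (1 - e)) <= cabs l.
Proof.
rewrite rnormZc ler_piMr ?cabs_ge0 //; exact: proj_norm_le1 (proj1B pe).
Qed.

(** Approximation by invertibles is carried out in the two summands separately; a zero coefficient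
    of 1 - e is moved to h / 2. *)
Lemma unital_dense : inv_dense (adj1 (csub_set S)) <->
  dense_invertible (@cmul R (csub_alg S)) ce (@rnorm R (csub_alg S)).
Proof.
split=> [den a h h0|den z Sz h h0].
  have [b [Sb ib ab]] := den _ (adj1_sub Sc (csub_in a)) h h0.
  have [_ Sbe _] := unital_split Sb; have [d dP] := unital_inv_corner Sb ib.
  exists (celt Sbe); split; first by apply/csub_invertible; exists d.
  rewrite csub_rnorm; apply: le_lt_trans ab.
  have [_ ae] := proj2 ue _ (csub_in a).
  have := unital_norm_le (csub_val a - b); rewrite mulrBl ae; exact.
have [l Sze [zE _ _]] := unital_split Sz.
have h20 : 0 < h / 2 by rewrite divr_gt0.
have [b [/csub_invertible ib ab]] := den (celt Sze) _ h20.
have [m m0 lm] : exists2 m : R[i], m != 0 & cabs (l - m) <= h / 2.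
  have [->|l0] := eqVneq l 0; last by exists l; rewrite // subrr /cabs normr0 ltW.
  exists (h / 2)%:C%C; first by rewrite fmorph_eq0 gt_eqF.
  by rewrite sub0r cabsN cabs_real gtr0_norm.
exists (csub_val b + m *: (1 - e)); split.
- apply: csD; [exact: adj1_csubalg|by apply: adj1_sub => //; exact: csub_in|].
  by apply: csZ; [exact: adj1_csubalg|apply: csB; [exact: adj1_csubalg|exact: adj1_1|exact: adj1_sub]].
- by apply: unital_inv_lift => //; exact: csub_in.
- have -> : z - (csub_val b + m *: (1 - e)) = (z * e - csub_val b) + (l - m) *: (1 - e).
    by rewrite {1}zE; bop_ring.
  apply: le_lt_trans (bnormD _ _) _.
  have := one_minus_norm (l - m); rewrite csub_rnorm in ab.
  have {}ab : rnorm (z * e - csub_val b) < h / 2 by exact: ab.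
  by move: ab lm; norm_lra.
Qed.

Lemma unital_dense_sa : inv_dense_sa (adj1 (csub_set S)) <->
  dense_invertible_sa (@cmul R (csub_alg S)) (@star R (csub_alg S)) ce (@rnorm R (csub_alg S)).
Proof.
split=> [den a as_ h h0|den z Sz zs h h0].
  have as' : sa (csub_val a) by exact: (congr1 (@csub_val _ _ S) as_).
  have [b [Sb bs ib ab]] := den _ (adj1_sub Sc (csub_in a)) as' h h0.
  have [_ Sbe [_ be _]] := unital_split Sb; have [d dP] := unital_inv_corner Sb ib.
  exists (celt Sbe); split.
  - by apply: val_inj; change (star (b * e) = b * e); rewrite starM_ bs (proj1 pe) be.
  - by apply/csub_invertible; exists d.
  - rewrite csub_rnorm; apply: le_lt_trans ab.
    have [_ ae] := proj2 ue _ (csub_in a).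
    have := unital_norm_le (csub_val a - b); rewrite mulrBl ae; exact.
have [l Sze [zE ze lsa]] := unital_split Sz.
have h20 : 0 < h / 2 by rewrite divr_gt0.
have zes : star (celt Sze : csub_alg S) = celt Sze.
  by apply: val_inj; change (star (z * e) = z * e); rewrite starM_ zs (proj1 pe) -ze.
have [b [bs /csub_invertible ib ab]] := den (celt Sze) zes _ h20.
have bs' : sa (csub_val b) by exact: (congr1 (@csub_val _ _ S) bs).
have ps : star (1 - e) = 1 - e by rewrite starB star1 (proj1 pe).
have [m [m0 lm ms]] : exists m : R[i], [/\ m != 0, cabs (l - m) <= h / 2 & sa (m *: (1 - e))].
  have [l0|l0] := eqVneq l 0; last first.
    exists l; rewrite // subrr /cabs normr0 ltW //; split=> //.
    by case: (lsa zs) => // h'; move: l0; rewrite h' eqxx.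
  exists (h / 2)%:C%C; split; first by rewrite fmorph_eq0 gt_eqF.
    by rewrite l0 sub0r cabsN cabs_real gtr0_norm.
  by rewrite /sa starZr ps.
exists (csub_val b + m *: (1 - e)); split.
- apply: csD; [exact: adj1_csubalg|by apply: adj1_sub => //; exact: csub_in|].
  by apply: csZ; [exact: adj1_csubalg|apply: csB; [exact: adj1_csubalg|exact: adj1_1|exact: adj1_sub]].
- by rewrite /sa starD_ bs' ms.
- by apply: unital_inv_lift => //; exact: csub_in.
- have -> : z - (csub_val b + m *: (1 - e)) = (z * e - csub_val b) + (l - m) *: (1 - e).
    by rewrite {1}zE; bop_ring.
  apply: le_lt_trans (bnormD _ _) _.
  have := one_minus_norm (l - m); rewrite csub_rnorm in ab.
  have {}ab : rnorm (z * e - csub_val b) < h / 2 by exact: ab.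
  by move: ab lm; norm_lra.
Qed.

End Unital.

(** One density statement in [adj1 S] covers the unital and the non-unital clause alike, so the
    comparison of S and T needs no case distinction. *)
Lemma stable_rank_oneP S : stable_rank_one (csub_alg S) <-> inv_dense (adj1 (csub_set S)).
Proof.
split=> [[un nu]|den].
  have [/unitalP[e ue]|nS] := pselect (unital (csub_alg S)).
    by apply/(unital_dense ue); apply: un; exact/csub_oneP.
  by apply/(nonunital_dense nS); exact: nu.
split=> [e /csub_oneP ue|nS]; last exact/(nonunital_dense nS).
have := proj1 (unital_dense ue) den; have -> // : celt (proj1 ue) = e.
by apply: val_inj.
Qed.

Lemma real_rank_zeroP S : real_rank_zero (csub_alg S) <-> inv_dense_sa (adj1 (csub_set S)).
Proof.
split=> [[un nu]|den].
  have [/unitalP[e ue]|nS] := pselect (unital (csub_alg S)).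
    by apply/(unital_dense_sa ue); apply: un; exact/csub_oneP.
  by apply/(nonunital_dense_sa nS); exact: nu.
split=> [e /csub_oneP ue|nS]; last exact/(nonunital_dense_sa nS).
have := proj1 (unital_dense_sa ue) den; have -> // : celt (proj1 ue) = e.
by apply: val_inj.
Qed.

Lemma clopen_stable_rank_one :
  clopen [set S : csubalg (bop H) | stable_rank_one (csub_alg S)].
Proof.
(* [inv_dense_dnear] asks for 1024, and passing to [adj1] costs a factor 4. *)
have d0 : (0 : R) < 4096%:R^-1 by rewrite invr_gt0 ltr0n.
apply: (clopen_uniform d0) => S T ST TS /stable_rank_oneP den; apply/stable_rank_oneP.
have Sc := csubP S; have Tc := csubP T.
have ST1 := dnear_adj1 Sc Tc (ltW d0) ST; have TS1 := dnear_adj1 Tc Sc (ltW d0) TS.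
apply: (inv_dense_dnear _ _ _ _ _ _ ST1 TS1) => //; try exact: adj1_csubalg; try exact: adj1_1.
  by rewrite mulr_ge0 // ltW.
by rewrite mulrA -natrM mulfV // pnatr_eq0.
Qed.

Lemma clopen_real_rank_zero :
  clopen [set S : csubalg (bop H) | real_rank_zero (csub_alg S)].
Proof.
have d0 : (0 : R) < 4096%:R^-1 by rewrite invr_gt0 ltr0n.
apply: (clopen_uniform d0) => S T ST TS /real_rank_zeroP den; apply/real_rank_zeroP.
have Sc := csubP S; have Tc := csubP T.
have ST1 := dnear_adj1 Sc Tc (ltW d0) ST; have TS1 := dnear_adj1 Tc Sc (ltW d0) TS.
apply: (inv_dense_sa_dnear _ _ _ _ _ _ ST1 TS1) => //; try exact: adj1_csubalg; try exact: adj1_1.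
  by rewrite mulr_ge0 // ltW.
by rewrite mulrA -natrM mulfV // pnatr_eq0.
Qed.

End RankProperties.

(** * The Capelli polynomial *)

Section Capelli.
Variables (R : realType).

Section Words.
Variable A : cstarType R.
Implicit Types x y : nat -> A.

(** The word y_0 x_0 y_1 x_1 ... x_(k-1) y_k. *)
Fixpoint cword x y k : A := if k is k'.+1 then cmul (cmul (cword x y k') (x k')) (y k) else y 0%N.

Lemma cword_eq x x' y k : (forall i, (i < k)%N -> x i = x' i) -> cword x y k = cword x' y k.
Proof.
elim: k => //= k IH xx; rewrite IH => [|i ik]; last by apply: xx; exact: leqW.
by rewrite xx.
Qed.

Lemma cmul0l (a : A) : cmul 0 a = 0.
Proof. by have := cmulZl 0 (0 : A) a; rewrite !scale0r. Qed.

Lemma cmul0r (a : A) : cmul a 0 = 0.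
Proof. by have := cmulZr 0 a (0 : A); rewrite !scale0r. Qed.

Lemma cword_linear x y k p (I : finType) (c : I -> R[i]) (w : I -> A) : (p < k)%N ->
  x p = \sum_i c i *: w i ->
  cword x y k = \sum_i c i *: cword (fun j => if j == p then w i else x j) y k.
Proof.
have cmul_suml (F : I -> A) b : cmul (\sum_i F i) b = \sum_i cmul (F i) b.
  by apply: (big_morph (fun a => cmul a b)) => [a a'|]; rewrite ?cmulDl ?cmul0l.
have cmul_sumr (F : I -> A) b : cmul b (\sum_i F i) = \sum_i cmul b (F i).
  by apply: (big_morph (fun a => cmul b a)) => [a a'|]; rewrite ?cmulDr ?cmul0r.
elim: k => // k IH; rewrite ltnS leq_eqVlt => /orP[/eqP pk|pk] xp /=.
  rewrite -pk xp cmul_sumr cmul_suml; apply: eq_bigr => i _.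
  rewrite cmulZr cmulZl eqxx; congr (_ *: cmul (cmul _ _) _).
  by apply: cword_eq => j jp; rewrite (ltn_eqF jp).
rewrite IH // !cmul_suml; apply: eq_bigr => i _.
by rewrite !cmulZl (gtn_eqF pk).
Qed.

(** The Capelli polynomial: alternating in the m + 1 variables x, with the m + 2 variables y as
    separators. *)
Definition cap m (x : 'I_m.+1 -> A) y : A :=
  \sum_(s : 'S_m.+1) ((-1) ^+ s : R[i]) *: cword (fun k => x (s (inord k))) y m.+1.

Lemma cap_alternate m (x : 'I_m.+1 -> A) y i j : i != j -> x i = x j -> cap x y = 0.
Proof.
move=> ij xij; pose t := tperm i j.
have xt k : x (t k) = x k by rewrite /t; case: tpermP => [->|->|].
have : cap x y = - cap x y.
  rewrite {1}/cap (reindex_inj (mulIg t)) /= /cap -sumrN; apply: eq_bigr => s _.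
  rewrite odd_permM odd_tperm ij signr_addb expr1 mulrN1 scaleNr; congr (- (_ *: _)).
  by apply: (@cword_eq _ _ y m.+1) => k _; rewrite permM xt.
move/eqP; rewrite -subr_eq0 opprK -mulr2n -scaler_nat scaler_eq0 pnatr_eq0 /=.
by move/eqP.
Qed.

(** One variable is a combination of the others; expanding in its slot leaves only terms with a
    repeated variable. *)
Lemma cap_dependent m (x : 'I_m.+1 -> A) y (c : 'I_m.+1 -> R[i]) (i0 : 'I_m.+1) :
  c i0 != 0 -> \sum_i c i *: x i = 0 -> cap x y = 0.
Proof.
move=> c0 cx; pose e i := if i == i0 then 0 else - (c i / c i0).
have x0 : x i0 = \sum_i e i *: x i.
  apply: (scalerI c0); rewrite scaler_sumr; apply/eqP.
  rewrite -subr_eq0 -[X in _ == X]cx -sumrN (bigD1 i0) //= /e eqxx scale0r scaler0 oppr0.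
  rewrite add0r [in X in _ == X](bigD1 i0) //=; apply/eqP; congr (_ + _).
  apply: eq_bigr => i ii; rewrite (negPf ii) scalerA mulrN mulrCA mulfV // mulr1.
  by rewrite scaleNr opprK.
have capE : cap x y = \sum_i e i *: cap (fun j => if j == i0 then x i else x j) y.
  rewrite /cap; under [RHS]eq_bigr => i _ do rewrite scaler_sumr.
  rewrite exchange_big; apply: eq_bigr => s _.
  have sk : s (inord (s^-1%g i0)) = i0 by rewrite inord_val permKV.
  rewrite (@cword_linear _ y m.+1 (s^-1%g i0) _ e x) ?sk // scaler_sumr.
  apply: eq_bigr => i _; rewrite !scalerA mulrC; congr (_ *: _).
  apply: (@cword_eq _ _ y m.+1) => k km; congr (if _ then _ else _).
  apply/eqP/eqP => [->|<-]; first by rewrite sk.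
  by rewrite permK inordK.
rewrite capE big1 // => i _; have [->|ii] := eqVneq i i0.
  by rewrite /e eqxx scale0r.
by rewrite (@cap_alternate _ _ y i i0) ?scaler0 // eqxx (negPf ii).
Qed.

End Words.

Lemma cword_hom (A B : cstarType R) (f : A -> B) (x y : nat -> A) k : star_hom f ->
  f (cword x y k) = cword (fun i => f (x i)) (fun i => f (y i)) k.
Proof.
move=> [_ fM _]; elim: k => //= k IH.
by rewrite !fM IH.
Qed.

Lemma cap_hom (A B : cstarType R) (f : A -> B) m (x : 'I_m.+1 -> A) (y : nat -> A) :
  star_hom f -> f (cap x y) = cap (fun i => f (x i)) (fun i => f (y i)).
Proof.
move=> fh; have [fl _ _] := fh.
have f0 : f 0 = 0 by have := fl (-1) 0 0; rewrite scaler0 addr0 scaleN1r addNr.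
have fD a b : f (a + b) = f a + f b by rewrite -[a]scale1r fl !scale1r.
have fZ c a : f (c *: a) = c *: f a by rewrite -[c *: a]addr0 fl f0 addr0.
rewrite /cap (big_morph f fD f0); apply: eq_bigr => s _.
by rewrite fZ cword_hom.
Qed.

Lemma cabs_sign (b : bool) : cabs ((-1) ^+ b : R[i]) = 1.
Proof. by case: b; rewrite ?expr1 ?expr0 ?cabsN -(@rmorph1 _ _ (real_complex R)) cabs_real normr1. Qed.

Section WordNorms.
Variable A : cstarType R.
Implicit Types x y : nat -> A.

Lemma cnormM (a b : A) (s t : R) : rnorm a <= s -> rnorm b <= t -> rnorm (cmul a b) <= s * t.
Proof.
move=> aS bt; apply: (@le_trans _ _ (rnorm a * rnorm b)).
  by have := normM_le a b; rewrite !normE -rmorphM lecR.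
by rewrite ler_pM ?rnorm_ge0.
Qed.

Lemma cword_norm x y k : (forall i, rnorm (x i) <= 1) -> (forall i, rnorm (y i) <= 1) ->
  rnorm (cword x y k) <= 1.
Proof.
move=> x1 y1; elim: k => //= k IH.
by have := cnormM (cnormM IH (x1 k)) (y1 k.+1); rewrite !mulr1.
Qed.

Lemma cword_near x y x' y' k (d : R) :
  (forall i, rnorm (x i) <= 1) -> (forall i, rnorm (y i) <= 1) ->
  (forall i, rnorm (x' i) <= 1) -> (forall i, rnorm (y' i) <= 1) ->
  (forall i, rnorm (x i - x' i) <= d) -> (forall i, rnorm (y i - y' i) <= d) ->
  rnorm (cword x y k - cword x' y' k) <= (2 * k%:R + 1) * d.
Proof.
move=> x1 y1 x1' y1' xx yy; elim: k => [|k IH] /=.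
  by rewrite mulr0 add0r mul1r.
have cmulBl (a b c : A) : cmul (a - b) c = cmul a c - cmul b c.
  by rewrite -scaleN1r cmulDl cmulZl scaleN1r.
have cmulBr (a b c : A) : cmul a (b - c) = cmul a b - cmul a c.
  by rewrite -scaleN1r cmulDr cmulZr scaleN1r.
have w1 := cword_norm k x1 y1; have w1' := cword_norm k x1' y1'.
set w := cword x y k in IH w1 *; set w' := cword x' y' k in IH w1' *.
have -> : cmul (cmul w (x k)) (y k.+1) - cmul (cmul w' (x' k)) (y' k.+1) =
   cmul (cmul (w - w') (x k)) (y k.+1) + cmul (cmul w' (x k - x' k)) (y k.+1)
   + cmul (cmul w' (x' k)) (y k.+1 - y' k.+1).
  by rewrite !(cmulBl, cmulBr) !addrA !subrK.
have h1 := cnormM (cnormM IH (x1 k)) (y1 k.+1).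
have h2 := cnormM (cnormM w1' (xx k)) (y1 k.+1).
have h3 := cnormM (cnormM w1' (x1' k)) (yy k.+1).
apply: le_trans (rnormD _ _) _; apply: le_trans (lerD (rnormD _ _) (lexx _)) _.
move: h1 h2 h3; rewrite -[k.+1%:R]natr1.
move: (rnorm _) (rnorm _) (rnorm _) (k%:R : R) => p q r s; lra.
Qed.

(** There are (m + 1)! words, each with 2 (m + 1) + 1 letters of norm at most 1. *)
Lemma cap_near m (x x' : 'I_m.+1 -> A) y y' (d : R) :
  (forall i, rnorm (x i) <= 1) -> (forall i, rnorm (y i) <= 1) ->
  (forall i, rnorm (x' i) <= 1) -> (forall i, rnorm (y' i) <= 1) ->
  (forall i, rnorm (x i - x' i) <= d) -> (forall i, rnorm (y i - y' i) <= d) ->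
  rnorm (cap x y - cap x' y') <= (m.+1)`!%:R * ((2 * m.+1%:R + 1) * d).
Proof.
move=> x1 y1 x1' y1' xx yy; rewrite /cap -sumrB -[in leRHS](card_Sn m.+1).
rewrite -sum1_card natr_sum mulr_suml.
elim/big_rec2: _ => [|s u v _ IH]; first by rewrite rnorm0.
apply: le_trans (rnormD _ _) _; apply: lerD => //; rewrite mul1r -scalerBr.
rewrite rnormZc cabs_sign mul1r.
exact: cword_near.
Qed.

End WordNorms.

End Capelli.

Section Dependence.
Variables (R : realType) (K : hilbertType R).

Lemma bop_sumE (I : Type) (r : seq I) (P : pred I) (F : I -> bop K) u :
  (\sum_(i <- r | P i) F i) u = \sum_(i <- r | P i) F i u.
Proof. by apply: (big_morph (fun T : bop K => T u)) => [S T|]; rewrite ?bopDE. Qed.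

Lemma bop_sumr (I : Type) (r : seq I) (P : pred I) (F : I -> K) (T : bop K) :
  T (\sum_(i <- r | P i) F i) = \sum_(i <- r | P i) T (F i).
Proof. by apply: (big_morph T) => [S U|]; rewrite ?bopDr ?bop0. Qed.

Lemma row_kernel (F : fieldType) p q (N : 'M[F]_(p, q)) : (q < p)%N ->
  exists2 v : 'rV[F]_p, v != 0 & v *m N = 0.
Proof.
move=> qp; have k0 : kermx N != 0.
  by rewrite -mxrank_eq0 mxrank_ker subn_eq0 -ltnNge (leq_ltn_trans (rank_leq_col N)).
have [i ri] : exists i, row i (kermx N) != 0.
  apply/existsP; apply: contra_neqT k0; rewrite negb_exists => /forallP k0.
  by apply/row_matrixP => i; rewrite row0; apply/eqP/negPn/k0.
by exists (row i (kermx N)) => //; rewrite -row_mul mulmx_ker row0.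
Qed.

(** Operators are described by n^2 coefficients on a spanning family, so n^2 + 1 of them satisfy a
    linear relation and [cap_dependent] applies. *)
Lemma cap_dim_le n (x : 'I_(n * n).+1 -> bop K) (y : nat -> bop K) :
  dim_le n K -> cap x y = 0.
Proof.
move=> [b bE].
have /choice[M ME] : forall T : bop K, exists M : 'M[R[i]]_n,
    forall j, T (b j) = \sum_k M j k *: b k.
  move=> T; have /choice[c cE] := fun j => bE (T (b j)).
  by exists (\matrix_(j, k) c j k) => j; rewrite cE; apply: eq_bigr => k _; rewrite mxE.
pose N : 'M[R[i]]_((n * n).+1, n * n) := \matrix_i mxvec (M (x i)).
have [v v0 vN] := row_kernel N (ltnSn _).
have [i0 vi0] : exists i, v 0 i != 0.
  apply/existsP; apply: contra_neqT v0; rewrite negb_exists => /forallP v0.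
  by apply/rowP => i; rewrite mxE; apply/eqP/negPn/v0.
apply: (cap_dependent y vi0); apply: bopP => u; have [d ->] := bE u.
rewrite bop_sumr big1 // => j _; rewrite bopZr bop_sumE; apply/eqP.
rewrite scaler_eq0; apply/orP; right; apply/eqP.
under eq_bigr => i _ do rewrite bopZE ME scaler_sumr.
rewrite exchange_big big1 // => k _ /=.
under eq_bigr => i _ do rewrite scalerA.
rewrite -scaler_suml; have := congr1 (fun w : 'rV__ => w 0 (mxvec_index j k)) vN.
rewrite !mxE => vN0; rewrite (_ : \sum_i _ = 0) ?scale0r // -[RHS]vN0.
by apply: eq_bigr => i _; rewrite mxE mxvecE.
Qed.

End Dependence.

(** The choice t = d / (b + 1) turns the inequality into (b + 2) d^2 <= 0. *)
Lemma quadratic_eq0 (R : realType) (b d : R) : 0 <= b ->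
  (forall t, 2 * t * d <= t ^+ 2 * b) -> d = 0.
Proof.
move=> b0 /(_ (d / (b + 1))) h; have b1 : 0 < b + 1 by lra.
have : (b + 1) ^+ 2 * (2 * (d / (b + 1)) * d) <= (b + 1) ^+ 2 * ((d / (b + 1)) ^+ 2 * b).
  by rewrite ler_pM2l ?exprn_gt0.
have -> : (b + 1) ^+ 2 * (2 * (d / (b + 1)) * d) = 2 * (b + 1) * d ^+ 2 by field; lra.
have -> : (b + 1) ^+ 2 * ((d / (b + 1)) ^+ 2 * b) = b * d ^+ 2 by field; lra.
move=> {}h; have d2 := sqr_ge0 d; apply/eqP; rewrite -sqrf_eq0 eq_le d2 andbT; nra.
Qed.

(** * Nearest points for a semi-definite real form, used for Hilbert spaces and for their finite
    powers *)

Section RealForm.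
Variables (R : realType) (V : lmodType R[i]) (q : V -> V -> R).
Hypothesis qDl : forall x y z, q (x + y) z = q x z + q y z.
Hypothesis qZl : forall (a : R) x z, q (a%:C%C *: x) z = a * q x z.
Hypothesis qC : forall x y, q x y = q y x.
Hypothesis q_ge0 : forall x, 0 <= q x x.

Let qDr x y z : q x (y + z) = q x y + q x z.
Proof. by rewrite qC qDl !(qC x). Qed.

Let qZr (a : R) x z : q x (a%:C%C *: z) = a * q x z.
Proof. by rewrite qC qZl qC. Qed.

Let qN x z : q (- x) z = - q x z.
Proof.
have -> : - x = (-1)%:C%C *: x by rewrite rmorphN1 scaleN1r.
by rewrite qZl mulN1r.
Qed.

Let qNr x z : q x (- z) = - q x z. Proof. by rewrite qC qN qC. Qed.

Lemma form_cauchy x y : q x y ^+ 2 <= q x x * q y y.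
Proof.
have pos (t : R) : 0 <= q x x + 2 * t * q x y + t ^+ 2 * q y y.
  have := q_ge0 (x + t%:C%C *: y); rewrite qDl !qDr !qZl !qZr (qC y x).
  by rewrite expr2; lra.
have [y0|y0] := eqVneq (q y y) 0; last first.
  have yp : 0 < q y y by rewrite lt_neqAle eq_sym y0 q_ge0.
  have := pos (- q x y / q y y).
  have -> : q x x + 2 * (- q x y / q y y) * q x y + (- q x y / q y y) ^+ 2 * q y y =
    (q x x * q y y - q x y ^+ 2) / q y y by field.
  by rewrite pmulr_lge0 ?invr_gt0 // subr_ge0.
have [->|xy] := eqVneq (q x y) 0; first by rewrite expr0n mulr_ge0.
have := pos (- (q x x + 1) / (2 * q x y)).
have -> : q x x + 2 * (- (q x x + 1) / (2 * q x y)) * q x y +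
   (- (q x x + 1) / (2 * q x y)) ^+ 2 * q y y = - 1 by rewrite y0; field.
by lra.
Qed.

(* The minimizing sequence for the distance to [W] is Cauchy by the parallelogram law. *)
Lemma form_proj (W : V -> Prop) : W 0 ->
  (forall (a : R) x y, W x -> W y -> W (a%:C%C *: x + y)) ->
  (forall u : nat -> V, (forall k, W (u k)) ->
     (forall j k, (j <= k)%N -> q (u k - u j) (u k - u j) <= 4^-1 ^+ j) ->
     exists2 l, W l & forall e : R, 0 < e -> exists k0, forall k, (k0 <= k)%N ->
       q (u k - l) (u k - l) <= e) ->
  forall x, exists2 y, W y & forall w, W w -> q (x - y) w = 0.
Proof.
move=> W0 Wlin Wc x.
have q0 : 0 <= 4^-1 :> R by lra.
have q1 : 4^-1 <= 1 :> R by lra.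
pose n y := q (x - y) (x - y).
pose D := [set n y | y in W].
have Dlb : has_lbound D by exists 0 => _ [y _ <-]; exact: q_ge0.
have dn y : W y -> inf D <= n y by move=> Wy; apply: ge_inf => //; exists y.
have Dinf : has_inf D by split => //; exists (n 0), 0.
set d := inf D in dn.
(* The slack is small enough for the parallelogram law to give the geometric Cauchy bound of the
   completeness hypothesis. *)
have /choice[u uP] k : exists y, W y /\ n y <= d + 16^-1 * 4^-1 ^+ k.
  have e0 : 0 < 16^-1 * 4^-1 ^+ k :> R by rewrite mulr_gt0 ?exprn_gt0 ?invr_gt0.
  have [_ [y Wy <-] yd] := inf_adherent e0 Dinf.
  by exists y; split => //; exact: ltW.
have par y z : W y -> W z -> q (y - z) (y - z) <= 2 * (n y - d) + 2 * (n z - d).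
  move=> Wy Wz.
  have := dn ((2^-1)%:C%C *: y + (2^-1)%:C%C *: z).
  have -> : (2^-1)%:C%C *: y + (2^-1)%:C%C *: z = (2^-1)%:C%C *: (y + z) by rewrite scalerDr.
  have := Wlin 2^-1 (y + z) 0.
  rewrite addr0 => h1 h2.
  have {h1 h2}: d <= n ((2^-1)%:C%C *: (y + z)).
    apply/h2/h1 => //; have := Wlin 1 _ _ Wy Wz.
    by rewrite rmorph1 scale1r.
  rewrite /n !(qDl, qDr, qN, qNr, qZl, qZr) (qC y x) (qC z x) (qC z y).
  by move: (q x x) (q x y) (q x z) (q y y) (q y z) (q z z) => ? ? ? ? ? ?; lra.
have [j k jk|l Wl lP] := Wc u (fun k => (uP k).1).
  have [Wj nj] := uP j; have [Wk nk] := uP k.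
  have kj : 4^-1 ^+ k <= 4^-1 ^+ j :> R.
    exact: ler_wiXn2l.
  have e0 : 0 <= 4^-1 ^+ j :> R by exact: exprn_ge0.
  have := par _ _ Wk Wj; lra.
(* The distance passes to the limit; the cross term is controlled by positivity of the form at e (x
   - u_k) - (u_k - l). *)
have nl : n l <= d.
  have d0 : 0 <= d by apply: lb_le_inf; [exact: Dinf.1|move=> _ [y _ <-]; exact: q_ge0].
  apply: (@ler_eps _ _ _ (d + 2)) => [|e e0]; first lra.
  have e1 : 0 < e + 1 by lra.
  have [k0 k0P] := lP (e ^+ 2 / (e + 1)) (divr_gt0 (exprn_gt0 2 e0) e1).
  rewrite -subr_le0; apply: (@le0_geom _ _ 1 4^-1); rewrite ?q0 //; first lra.
  move=> k.
  have [_ nu] := uP (k0 + k)%N; have := k0P (k0 + k)%N (leq_addr _ _).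
  have kk : 4^-1 ^+ (k0 + k) <= 4^-1 ^+ k :> R.
    by rewrite exprD ler_piMl ?exprn_ge0 ?exprn_ile1.
  have k0' : 0 <= 4^-1 ^+ k :> R by exact: exprn_ge0.
  have k1 : 4^-1 ^+ k <= 1 :> R by rewrite exprn_ile1.
  move: (4^-1 ^+ (k0 + k)) kk nu => c kk; have := q_ge0 (u (k0 + k)%N - l).
  have := q_ge0 (e%:C%C *: (x - u (k0 + k)%N) - (u (k0 + k)%N - l)).
  have {1}-> : n l = q ((x - u (k0 + k)%N) + (u (k0 + k)%N - l)) ((x - u (k0 + k)%N) + (u (k0 + k)%N - l)).
    by rewrite addrA subrK.
  rewrite /n; move: (x - u _) (u _ - l) => {uP k0P}a b.
  rewrite !(qDl, qDr, qN, qNr, qZl, qZr) (qC b a) ler_pdivlMr //.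
  move: (4^-1 ^+ k) k0' k1 kk (q a a) (q a b) (q b b) => {}k k0' k1 kk A B C h1 h2 h3 h4.
  have h5 : e * (A + B + (B + C)) <= (e + 1) * (e * A) + (e + 1) * C by nra.
  have h7 : (e + 1) * A <= (e + 1) * (d + 16^-1 * c) by rewrite ler_pM2l.
  have h8 : e * c <= e * 1 by rewrite ler_pM2l //; lra.
  have h9 : e * ((e + 1) * A + e) <= e * (d + (d + 2) * e + k) by rewrite ler_pM2l //; lra.
  have h6 : e * (A + B + (B + C)) <= e * (d + (d + 2) * e + k) by lra.
  by move: h6; rewrite ler_pM2l //; lra.
exists l => // w Ww.
have lin (t : R) : 2 * t * q (x - l) w <= t ^+ 2 * q w w.
  have := dn (t%:C%C *: w + l) (Wlin _ _ _ Ww Wl).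
  have := nl; rewrite /n.
  have -> : x - (t%:C%C *: w + l) = (x - l) - t%:C%C *: w by rewrite opprD addrCA addrC.
  move: (x - l) => m; rewrite !(qDl, qDr, qN, qNr, qZl, qZr) (qC w m) expr2.
  by move: (q m m) (q m w) (q w w) => *; lra.
exact: quadratic_eq0 (q_ge0 w) lin.
Qed.

End RealForm.

Section ComplexParts.
Variable R : realType.
Implicit Types z : R[i].

Lemma Re_add z w : complex.Re (z + w) = complex.Re z + complex.Re w.
Proof. by case: z w => [? ?] [? ?]. Qed.

Lemma Re_opp z : complex.Re (- z) = - complex.Re z.
Proof. by case: z. Qed.

Lemma Im_opp z : complex.Im (- z) = - complex.Im z.
Proof. by case: z. Qed.

Lemma Im_add z w : complex.Im (z + w) = complex.Im z + complex.Im w.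
Proof. by case: z w => [? ?] [? ?]. Qed.

Lemma cabs_sqr z : cabs z ^+ 2 = complex.Re z ^+ 2 + complex.Im z ^+ 2.
Proof. by case: z => a b; rewrite /cabs normc_def /= sqr_sqrtr // addr_ge0 ?sqr_ge0. Qed.

Lemma Re_le_cabs z : `|complex.Re z| <= cabs z.
Proof.
rewrite -(ler_pXn2r (n := 2)) ?nnegrE ?cabs_ge0 // cabs_sqr real_normK ?num_real //.
by rewrite lerDl sqr_ge0.
Qed.

Lemma Im_le_cabs z : `|complex.Im z| <= cabs z.
Proof.
rewrite -(ler_pXn2r (n := 2)) ?nnegrE ?cabs_ge0 // cabs_sqr real_normK ?num_real //.
by rewrite lerDr sqr_ge0.
Qed.

Lemma cabs_le_ReIm z : cabs z <= `|complex.Re z| + `|complex.Im z|.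
Proof.
rewrite -(ler_pXn2r (n := 2)) ?nnegrE ?cabs_ge0 ?addr_ge0 // cabs_sqr sqrrD.
rewrite !real_normK ?num_real // -addrA lerD2l lerDr.
by rewrite mulrn_wge0 // mulr_ge0.
Qed.

Lemma cabs_conj z : cabs (z^*)%C = cabs z.
Proof. by case: z => a b; rewrite /cabs !normc_def /= sqrrN. Qed.

Lemma mul_conj_cabs z : z * (z^*)%C = (cabs z ^+ 2)%:C%C.
Proof.
case: z => a b; rewrite cabs_sqr /=; apply/eqP; rewrite eq_complex /=.
by apply/andP; split; apply/eqP; ring.
Qed.

Lemma cabs_distC z w : cabs (z - w) = cabs (w - z).
Proof. by rewrite -cabsN opprB. Qed.

Lemma cabs_distD y z w : cabs (z - w) <= cabs (z - y) + cabs (y - w).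
Proof. by rewrite -[z in X in X <= _](subrK y) -addrA cabsD. Qed.

End ComplexParts.

(** * Completion of a semi-inner product space to a Hilbert space *)

Record semi_inner (R : realType) (V : lmodType R[i]) := SemiInner {
  sform :> V -> V -> R[i];
  sformDl : forall x y z, sform (x + y) z = sform x z + sform y z;
  sformZl : forall (c : R[i]) x z, sform (c *: x) z = c * sform x z;
  sformC : forall x y, sform y x = ((sform x y)^*)%C;
  sform_ge0 : forall x, 0 <= complex.Re (sform x x) }.

Section Completion.
Variables (R : realType) (V : lmodType R[i]) (s : semi_inner V).
Implicit Types (b c v w : V).

Let sDr b v w : s b (v + w) = s b v + s b w.
Proof. by rewrite sformC sformDl rmorphD /= -!sformC. Qed.

Let sZr b (l : R[i]) v : s b (l *: v) = (l^*)%C * s b v.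
Proof. by rewrite sformC sformZl rmorphM /= -sformC. Qed.

Definition snrm v := Num.sqrt (complex.Re (s v v)).

Lemma snrm_ge0 v : 0 <= snrm v. Proof. exact: sqrtr_ge0. Qed.

Lemma snrm_sqr v : snrm v ^+ 2 = complex.Re (s v v).
Proof. by rewrite sqr_sqrtr // sform_ge0. Qed.

Lemma sformE v : s v v = (snrm v ^+ 2)%:C%C.
Proof.
rewrite snrm_sqr; have := sformC s v v; case: (s v v) => x y /= [].
move=> h; have -> : y = 0 by lra.
by [].
Qed.

Lemma snrmZ (l : R[i]) v : snrm (l *: v) = cabs l * snrm v.
Proof.
apply/eqP; rewrite -(eqrXn2 (n := 2)) ?mulr_ge0 ?snrm_ge0 ?cabs_ge0 //; apply/eqP/complexI.
rewrite -sformE sformZl sZr mulrA mul_conj_cabs sformE exprMn.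
by rewrite [in RHS]rmorphM.
Qed.

Lemma sform_le b v : cabs (s b v) <= snrm b * snrm v.
Proof.
have re_le c w : complex.Re (s c w) <= snrm c * snrm w.
  apply: le_trans (ler_norm _) _.
  rewrite -(ler_pXn2r (n := 2)) ?nnegrE ?mulr_ge0 ?snrm_ge0 // real_normK ?num_real //.
  rewrite exprMn !snrm_sqr.
  apply: (@form_cauchy R V (fun x y => complex.Re (s x y))) => [x y z|a x z|x y|x].
  - by rewrite sformDl Re_add.
  - by rewrite sformZl; case: (s x z) => ? ? /=; rewrite mul0r subr0.
  - by rewrite sformC; case: (s _ _).
  - exact: sform_ge0.
have [->|s0] := eqVneq (cabs (s b v)) 0; first by rewrite mulr_ge0 ?snrm_ge0.
have s1 : 0 < cabs (s b v) by rewrite lt_neqAle eq_sym s0 cabs_ge0.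
have := re_le (((s b v)^*)%C *: b) v.
rewrite sformZl mulrC mul_conj_cabs /= snrmZ cabs_conj expr2 -mulrA.
by rewrite ler_pM2l.
Qed.

Lemma snrmD v w : snrm (v + w) <= snrm v + snrm w.
Proof.
rewrite -(ler_pXn2r (n := 2)) ?nnegrE ?addr_ge0 ?snrm_ge0 // snrm_sqr sformDl !sDr.
rewrite !Re_add -!snrm_sqr sqrrD (sformC s v w).
have := sform_le v w; have := Re_le_cabs (s v w); rewrite ler_norml => /andP[_].
case: (s v w) => x y /=; lra.
Qed.

Definition approximable : {pred V -> R[i]^o} := fun f =>
  `[< forall e : R, 0 < e -> exists b, forall v, cabs (f v - s b v) <= e * snrm v >].

(* The completion of [V] for the semi-norm, realized as the space of conjugate-linear
   functionals that are limits of the functionals [s b]. *)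
Record completion := Completion { cfun :> V -> R[i]^o; _ : cfun \in approximable }.

HB.instance Definition _ := [isSub for cfun].
HB.instance Definition _ := [Choice of completion by <:].

Lemma approximable_submod_closed : submod_closed approximable.
Proof.
split.
  apply/asboolP => e e0; exists 0 => v; rewrite (_ : s 0 v = 0).
    by rewrite subrr /cabs normr0 mulr_ge0 ?snrm_ge0 ?ltW.
  by rewrite -(scale0r (0 : V)) sformZl mul0r.
move=> l f g /asboolP fa /asboolP ga; apply/asboolP => e e0.
have l1 : 0 < cabs l + 1 by rewrite ltr_wpDl ?cabs_ge0.
have e1 : 0 < e / (cabs l + 1) by rewrite divr_gt0.
have [b bf] := fa _ (divr_gt0 e1 (ltr0Sn R 1)); have [c cg] := ga _ (divr_gt0 e0 (ltr0Sn R 1)).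
exists (l *: b + c) => v; rewrite sformDl sformZl.
have -> : (l *: f + g) v - (l * s b v + s c v) = l * (f v - s b v) + (g v - s c v).
  by rewrite mulrBr opprD addrACA.
apply: le_trans (cabsD _ _) _; rewrite cabsM; have := cg v; have := bf v.
have : cabs l * (e / (cabs l + 1) / 2) <= e / 2.
  rewrite -!mulrA mulrCA; rewrite ler_pM2l // mulrA ler_piMl ?invr_ge0 //.
  by rewrite ler_pdivrMr // mul1r lerDl.
have := snrm_ge0 v; have := cabs_ge0 l.
move: (cabs l) (cabs _) (cabs _) (snrm v) (_ / _ / 2) => p x y z t *; nra.
Qed.

HB.instance Definition _ :=
  GRing.isSubmodClosed.Build R[i] (V -> R[i]^o) approximable approximable_submod_closed.
HB.instance Definition _ := [SubChoice_isSubLmodule of completion by <:].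

Implicit Types (f g : completion).

Lemma cfunP f g : f =1 g -> f = g.
Proof. by move=> fg; apply/val_inj/funext. Qed.

Lemma cfunDE f g v : (f + g) v = f v + g v. Proof. by []. Qed.
Lemma cfunZE (l : R[i]) f v : (l *: f) v = l * f v. Proof. by []. Qed.
Lemma cfunNE f v : (- f) v = - f v. Proof. by []. Qed.

Lemma cfun_approx f (e : R) : 0 < e -> exists b, forall v, cabs (f v - s b v) <= e * snrm v.
Proof. by case: f => f /= /asboolP; exact. Qed.

Lemma cfun_linear f (l : R[i]) v w : f (l *: v + w) = (l^*)%C * f v + f w.
Proof.
apply/eqP; rewrite -subr_eq0; apply/eqP/cabs_eq0/eqP; rewrite eq_le cabs_ge0 andbT.
apply: (@ler_eps _ _ _ (snrm (l *: v + w) + cabs l * snrm v + snrm w)) => [|e e0].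
  by rewrite !addr_ge0 ?mulr_ge0 ?snrm_ge0 ?cabs_ge0.
have [b bf] := cfun_approx f e0.
have -> : f (l *: v + w) - ((l^*)%C * f v + f w) =
    (f (l *: v + w) - s b (l *: v + w)) - ((l^*)%C * (f v - s b v) + (f w - s b w)).
  by rewrite sDr sZr mulrBr; move: (f (l *: v + w)) ((l^*)%C * f v) ((l^*)%C * s b v) (f w) (s b w) => ? ? ? ? ?; ring.
apply: le_trans (cabsD _ _) _; rewrite cabsN.
apply: le_trans (lerD (lexx _) (cabsD _ _)) _; rewrite cabsM cabs_conj.
have := bf v; have := bf w; have := bf (l *: v + w); have := cabs_ge0 l.
move: (cabs l) (cabs _) (cabs _) (cabs _) (snrm _) (snrm _) (snrm _) => *; nra.
Qed.

Lemma cfun_bounded f : exists2 M : R, 0 <= M & forall v, cabs (f v) <= M * snrm v.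
Proof.
have [b bf] := cfun_approx f ltr01.
exists (1 + snrm b) => [|v]; first by rewrite addr_ge0 ?snrm_ge0.
rewrite -[f v](subrK (s b v)); apply: le_trans (cabsD _ _) _.
by rewrite mulrDl lerD ?sform_le.
Qed.

End Completion.

Section CompletionNorm.
Variables (R : realType) (V : lmodType R[i]) (s : semi_inner V).
Local Notation K := (completion s).
Implicit Types (b c v w : V) (f g : K).

Definition cnorm f : R := sup [set cabs (f v) | v in [set v | snrm s v <= 1]].

Let cfunZ f (l : R[i]) v : f (l *: v) = (l^*)%C * f v.
Proof.
have f0 : f 0 = 0.
  by have := cfun_linear f (-1) 0 0; rewrite scaler0 addr0 rmorphN1 mulN1r addNr.
by have := cfun_linear f l v 0; rewrite f0 !addr0.
Qed.

Lemma cnorm_has_sup f : has_sup [set cabs (f v) | v in [set v | snrm s v <= 1]].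
Proof.
have s0 : snrm s 0 = 0 by rewrite -(scale0r (0 : V)) snrmZ /cabs normr0 mul0r.
have [M M0 fM] := cfun_bounded f; split; first by exists (cabs (f 0)), 0; rewrite //= s0.
exists M => _ [v /= v1 <-]; apply: le_trans (fM v) _.
by rewrite ler_piMr.
Qed.

Lemma cnorm_ge0 f : 0 <= cnorm f.
Proof.
have [x [v v1 _]] := (cnorm_has_sup f).1.
apply: le_trans (cabs_ge0 (f v)) _; apply: sup_upper_bound (cnorm_has_sup f) _ _.
by exists v.
Qed.

Lemma cnormP f v : cabs (f v) <= cnorm f * snrm s v.
Proof.
have [M _ fM] := cfun_bounded f.
have [v0|v0] := eqVneq (snrm s v) 0.
  by rewrite v0 mulr0 (le_trans (fM v)) // v0 mulr0.
have {}v0 : 0 < snrm s v by rewrite lt_neqAle eq_sym v0 snrm_ge0.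
have vV : cabs ((snrm s v)^-1%:C%C) = (snrm s v)^-1.
  by rewrite cabs_real ger0_norm ?invr_ge0 ?ltW.
rewrite -ler_pdivrMr //; apply: sup_upper_bound (cnorm_has_sup f) _ _.
exists ((snrm s v)^-1%:C%C *: v); first by rewrite /= snrmZ vV mulVf // gt_eqF.
by rewrite cfunZ cabsM cabs_conj vV mulrC.
Qed.

Lemma cnorm_le f (M : R) : 0 <= M -> (forall v, cabs (f v) <= M * snrm s v) -> cnorm f <= M.
Proof.
move=> M0 fM; apply: ge_sup; first by case: (cnorm_has_sup f).
by move=> _ [v /= v1 <-]; apply: le_trans (fM v) _; rewrite ler_piMr.
Qed.

Let nrm f : R[i] := (cnorm f)%:C%C.

Let nrmD f g : nrm (f + g) <= nrm f + nrm g.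
Proof.
rewrite /nrm -rmorphD lecR; apply: cnorm_le; first by rewrite addr_ge0 ?cnorm_ge0.
move=> v; rewrite cfunDE mulrDl; apply: le_trans (cabsD _ _) _.
by rewrite lerD ?cnormP.
Qed.

Let cnormZ_le (l : R[i]) f : cnorm (l *: f) <= cabs l * cnorm f.
Proof.
apply: cnorm_le => [|v]; first by rewrite mulr_ge0 ?cnorm_ge0 ?cabs_ge0.
by rewrite cfunZE cabsM -mulrA ler_wpM2l ?cnormP ?cabs_ge0.
Qed.

Let nrmZ (l : R[i]) f : nrm (l *: f) = `|l| * nrm f.
Proof.
rewrite cabsE /nrm -rmorphM; congr (_%:C%C); apply/eqP; rewrite eq_le cnormZ_le andTb.
have [->|l0] := eqVneq l 0; first by rewrite /cabs normr0 mul0r cnorm_ge0.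
have r0 : 0 < cabs l.
  by rewrite lt_neqAle cabs_ge0 andbT eq_sym; apply: contra l0 => /eqP/cabs_eq0 ->.
rewrite mulrC -ler_pdivlMr // mulrC -cabsV.
by have := cnormZ_le l^-1 (l *: f); rewrite scalerA mulVf // scale1r.
Qed.

Let nrm_eq0 f : nrm f = 0 -> f = 0.
Proof.
move=> /complexI f0; apply: cfunP => v; apply: cabs_eq0; apply/eqP.
by rewrite eq_le cabs_ge0 andbT (le_trans (cnormP _ _)) // f0 mul0r.
Qed.

HB.instance Definition _ := Lmodule_isNormed.Build R[i] (completion s) nrmD nrmZ nrm_eq0.

Lemma rnorm_completion f : rnorm f = cnorm f. Proof. by []. Qed.

Lemma rnorm_cfun_le f v : cabs (f v) <= rnorm f * snrm s v.
Proof. exact: cnormP. Qed.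

Let cauchy_eval (F : set_system K) v (p : R[i] -> R) : ProperFilter F -> cauchy F ->
  (forall z z', `|p z - p z'| <= cabs (z - z')) -> cvg ((fun f : K => p (f v)) @ F).
Proof.
move=> FF /cauchy_rnormP FC pl; apply: cauchy_cvg; apply/cauchy_ballP => e e0.
have d0 : 0 < e / (snrm s v + 1) by rewrite divr_gt0 // ltr_wpDl ?snrm_ge0.
have [[A B] /= [FA FB] AB] := FC _ d0.
exists ([set p (f v) | f in A], [set p (f v) | f in B]).
  by split; [apply: filterS FA|apply: filterS FB] => f ?; exists f.
move=> [_ _] /= [[f Af <-] [g Bg <-]]; rewrite -ball_normE /=.
have := AB (f, g) (conj Af Bg) => /= fg.
apply: le_lt_trans (pl _ _) _; have := rnorm_cfun_le (f - g) v; rewrite cfunDE cfunNE => h.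
apply: le_lt_trans h _; move: fg; rewrite ltr_pdivlMr ?ltr_wpDl ?snrm_ge0 //.
by rewrite mulrDr mulr1 => h; have := rnorm_ge0 (f - g); lra.
Qed.

Let completion_complete (F : set_system K) : ProperFilter F -> cauchy F -> cvg F.
Proof.
move=> FF FC.
have Rel (z z' : R[i]) : `|complex.Re z - complex.Re z'| <= cabs (z - z').
  by rewrite -Re_opp -Re_add Re_le_cabs.
have Iml (z z' : R[i]) : `|complex.Im z - complex.Im z'| <= cabs (z - z').
  by rewrite -Im_opp -Im_add Im_le_cabs.
pose L v : R[i]^o := Complex (lim ((fun f : K => complex.Re (f v)) @ F))
  (lim ((fun f : K => complex.Im (f v)) @ F)).
have Llim v (e : R) : 0 < e -> \forall f \near F, cabs (L v - (f : K) v) <= e.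
  move=> e0; have e20 : 0 < e / 2 by rewrite divr_gt0.
  have /cvgrPdist_le/(_ _ e20) h1 := @cauchy_eval F v _ FF FC Rel.
  have /cvgrPdist_le/(_ _ e20) h2 := @cauchy_eval F v _ FF FC Iml.
  apply: filterS2 h1 h2 => f h1 h2; apply: le_trans (cabs_le_ReIm _) _.
  by rewrite Re_add Im_add Re_opp Im_opp /=; lra.
have near_le (e : R) : 0 < e ->
    \forall f \near F, forall v, cabs (L v - (f : K) v) <= e * snrm s v.
  move=> e0; have /cauchy_rnormP/(_ _ e0)[[A B] /= [FA FB] AB] := FC.
  apply: filterS FA => f Af v; apply/ler_addgt0Pl => d d0.
  have [g [gd Bg]] := filter_ex (filterI (Llim v d d0) FB).
  apply: le_trans (cabs_distD (g v) _ _) _; rewrite lerD //.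
  have := AB (f, g) (conj Af Bg) => /= /ltW fg.
  have := rnorm_cfun_le (f - g) v; rewrite cfunDE cfunNE => h.
  by rewrite cabs_distC (le_trans h) // ler_wpM2r ?snrm_ge0.
have La : L \in approximable s.
  apply/asboolP => e e0; have e20 : 0 < e / 2 by rewrite divr_gt0.
  have [f Lf] := filter_ex (near_le _ e20); have [b fb] := cfun_approx f e20.
  exists b => v; apply: le_trans (cabs_distD (f v) _ _) _.
  by rewrite [e in leRHS]splitr mulrDl lerD.
apply/cvg_ex; exists (Completion La).
suff : id @ F --> Completion La by [].
apply/cvg_rnormP => e e0; apply: filterS (near_le e e0) => f fL.
by rewrite rnorm_completion; apply: cnorm_le; rewrite ?ltW.
Qed.

HB.instance Definition _ := Uniform_isComplete.Build (completion s) completion_complete.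

Let emb_in b : (s b : V -> R[i]^o) \in approximable s.
Proof.
apply/asboolP => e e0; exists b => v; rewrite subrr /cabs normr0.
by rewrite mulr_ge0 ?snrm_ge0 ?ltW.
Qed.

Definition emb b : K := Completion (emb_in b).

Lemma embE b v : emb b v = s b v. Proof. by []. Qed.

Lemma emb_linear (l : R[i]) b c : emb (l *: b + c) = l *: emb b + emb c.
Proof. by apply: cfunP => v; rewrite cfunDE cfunZE !embE sformDl sformZl. Qed.

Lemma embB b c : emb (b - c) = emb b - emb c.
Proof. by rewrite -scaleN1r addrC emb_linear scaleN1r addrC. Qed.

Lemma rnorm_emb b : rnorm (emb b) = snrm s b.
Proof.
apply/eqP; rewrite eq_le rnorm_completion; apply/andP; split.
  by apply: cnorm_le => [|v]; rewrite ?snrm_ge0 ?sform_le.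
have [->|b0] := eqVneq (snrm s b) 0; first exact: cnorm_ge0.
have {}b0 : 0 < snrm s b by rewrite lt_neqAle eq_sym b0 snrm_ge0.
have := cnormP (emb b) b; rewrite embE sformE cabs_real ger0_norm ?sqr_ge0 //.
by rewrite expr2 ler_pM2r.
Qed.

Lemma emb_dense f (e : R) : 0 < e -> exists b, rnorm (f - emb b) <= e.
Proof.
move=> e0; have [b bf] := cfun_approx f e0; exists b.
by rewrite rnorm_completion; apply: cnorm_le => //; rewrite ltW.
Qed.

(* [f c] is the inner product of [f] with [emb c]. *)
Lemma cinner_ex f g : exists L : R[i],
  forall c, cabs (f c - L) <= 2 * rnorm f * rnorm (g - emb c).
Proof.
have real_ex (p : R[i] -> R) : (forall z z', `|p z - p z'| <= cabs (z - z')) ->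
    exists x : R, forall c, `|p (f c) - x| <= rnorm f * rnorm (g - emb c).
  (* The intervals of radius |f| |g - emb c| around p (f c) meet pairwise, so the supremum of their
     left ends lies in all of them. *)
  move=> pl; pose D := range (fun c => p (f c) - rnorm f * rnorm (g - emb c)).
  have Dub c : ubound D (p (f c) + rnorm f * rnorm (g - emb c)).
    move=> _ [b _ <-]; rewrite lerBlDr -addrA -mulrDr -lerBlDl.
    apply: le_trans (ler_norm _) _; apply: le_trans (pl _ _) _.
    have := rnorm_cfun_le f (b - c).
    have := cfun_linear f (-1) c b; rewrite rmorphN1 mulN1r scaleN1r.
    rewrite [- c + b]addrC [- f c + f b]addrC => ->.
    move=> h; apply: le_trans h _; rewrite ler_wpM2l ?rnorm_ge0 // -rnorm_emb embB.
    have := rdistD g (emb b) (emb c); rewrite (rdistC (emb b) g).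
    by move: (rnorm (g - emb b)) (rnorm (g - emb c)) (rnorm (_ - _)) => *; lra.
  have D0 : has_sup D by split; [exists (p (f 0) - rnorm f * rnorm (g - emb 0)), 0|exists (p (f 0) + rnorm f * rnorm (g - emb 0)); exact: Dub].
  exists (sup D) => c; rewrite ler_distlC; apply/andP; split.
    by apply: sup_upper_bound D0 _ _; exists c.
  by apply: ge_sup; [exact: D0.1|exact: Dub].
have [|x xP] := real_ex (@complex.Re R); first by move=> z z'; rewrite -Re_opp -Re_add Re_le_cabs.
have [|y yP] := real_ex (@complex.Im R); first by move=> z z'; rewrite -Im_opp -Im_add Im_le_cabs.
exists (Complex x y) => c; apply: le_trans (cabs_le_ReIm _) _.
by rewrite Re_add Im_add Re_opp Im_opp /=; have := xP c; have := yP c; lra.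
Qed.

Definition cinner f g := sval (cid (cinner_ex f g)).

Lemma cinnerP f g c : cabs (f c - cinner f g) <= 2 * rnorm f * rnorm (g - emb c).
Proof. by rewrite /cinner; case: cid => L. Qed.

(** Density of the embedded vectors pins down the value; the laws of the inner product then reduce
    to checking this estimate. *)
Lemma cinner_uniq f g (C : R) L : 0 <= C ->
  (forall c, rnorm (g - emb c) <= 1 -> cabs (f c - L) <= C * rnorm (g - emb c)) ->
  cinner f g = L.
Proof.
move=> C0 fL; apply/eqP; rewrite -subr_eq0; apply/eqP/cabs_eq0/eqP.
rewrite eq_le cabs_ge0 andbT.
apply: (@ler_eps _ _ _ (2 * rnorm f + C)) => [|e e0]; first by rewrite addr_ge0 ?mulr_ge0 ?rnorm_ge0.
have m0 : 0 < Num.min e 1 by rewrite lt_min e0 ltr01.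
have [c gc] := emb_dense g m0.
have [ce c1] : rnorm (g - emb c) <= e /\ rnorm (g - emb c) <= 1.
  by move: gc; rewrite le_min => /andP[].
apply: le_trans (cabs_distD (f c) _ _) _; rewrite add0r mulrDl cabs_distC.
apply: lerD; first by apply: le_trans (cinnerP _ _ _) _; rewrite ler_wpM2l ?mulr_ge0 ?rnorm_ge0.
by apply: le_trans (fL c c1) _; rewrite ler_wpM2l.
Qed.

Let cinnerDl f f' g : cinner (f + f') g = cinner f g + cinner f' g.
Proof.
apply: (@cinner_uniq _ _ (2 * rnorm f + 2 * rnorm f')) => [|c _].
  by rewrite addr_ge0 ?mulr_ge0 ?rnorm_ge0.
rewrite cfunDE opprD addrACA mulrDl; apply: le_trans (cabsD _ _) _.
by rewrite lerD ?cinnerP.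
Qed.

Let cinnerZl (l : R[i]) f g : cinner (l *: f) g = l * cinner f g.
Proof.
apply: (@cinner_uniq _ _ (cabs l * (2 * rnorm f))) => [|c _].
  by rewrite !mulr_ge0 ?rnorm_ge0 ?cabs_ge0.
by rewrite cfunZE -mulrBr cabsM -mulrA ler_wpM2l ?cinnerP ?cabs_ge0.
Qed.

Let cinner_conj f g : cinner g f = ((cinner f g)^*)%C.
Proof.
apply: (@cinner_uniq _ _ (rnorm g)) => [|c _]; first exact: rnorm_ge0.
have C0 : 0 <= snrm s c + rnorm (f - emb c) + 2 * rnorm f.
  by rewrite !addr_ge0 ?mulr_ge0 ?rnorm_ge0 ?snrm_ge0.
apply: (ler_eps C0) => e e0; have [d gd] := emb_dense g e0.
have h1 := rnorm_cfun_le (g - emb d) c; rewrite cfunDE cfunNE embE in h1.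
have h2 := rnorm_cfun_le (f - emb c) d; rewrite cfunDE cfunNE embE in h2.
have h3 := cinnerP f g d.
have h4 : snrm s d <= rnorm g + e.
  rewrite -rnorm_emb -[emb d](subrK g); apply: le_trans (rnormD _ _) _.
  by rewrite rdistC addrC lerD.
have {}h2 : cabs (s d c - (cinner f g)^*%C) <=
    rnorm (f - emb c) * snrm s d + 2 * rnorm f * rnorm (g - emb d).
  rewrite -cabs_conj rmorphB /= conjcK -sformC.
  apply: le_trans (cabs_distD (f d) _ _) _; rewrite lerD // cabs_distC.
  exact: h2.
apply: le_trans (cabs_distD (s d c) _ _) _; apply: le_trans (lerD h1 h2) _.
have := rnorm_ge0 (f - emb c); have := rnorm_ge0 f; have := snrm_ge0 s c.
have := rnorm_ge0 (g - emb d); have := rnorm_ge0 g.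
move: gd h4; move: (rnorm (g - emb d)) (rnorm (f - emb c)) (rnorm f) (rnorm g) (snrm s c) (snrm s d).
move=> x y p q z w xe h4 q0 x0 z0 p0 y0.
have h5 : x * z <= e * z by rewrite ler_wpM2r.
have h6 : y * w <= y * (q + e) by rewrite ler_wpM2l.
have h7 : p * x <= p * e by rewrite ler_wpM2l.
lra.
Qed.

Let cinner_norm f : cinner f f = `|f| ^+ 2.
Proof.
rewrite normE -rmorphXn /=.
apply: (@cinner_uniq _ _ (3 * rnorm f + 3)) => [|c c1].
  by rewrite addr_ge0 ?mulr_ge0 ?rnorm_ge0.
have h1 := rnorm_cfun_le (f - emb c) c; rewrite cfunDE cfunNE embE in h1.
have h2 : `|snrm s c - rnorm f| <= rnorm (f - emb c).
  rewrite -rnorm_emb ler_norml; apply/andP; split.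
    by rewrite lerNl opprB lerBlDr -{1}[f](subrK (emb c)) rnormD.
  by rewrite lerBlDr -{1}[emb c](subrK f) (rdistC f) rnormD.
apply: le_trans (cabs_distD (s c c) _ _) _; rewrite sformE -rmorphB cabs_real subr_sqr.
rewrite normrM (@ger0_norm _ (snrm s c + rnorm f)) ?addr_ge0 ?snrm_ge0 ?rnorm_ge0 //.
rewrite sformE in h1.
have := h2; rewrite ler_norml => /andP[_ h3].
have := rnorm_ge0 f; have := snrm_ge0 s c; have := rnorm_ge0 (f - emb c).
move: c1 h1 h2 h3; move: (rnorm (f - emb c)) (rnorm f) (snrm s c) => x p q.
move: (cabs _) (`|_|) => u t c1 h1 h2 h3 x0 q0 p0.
have : t * (q + p) <= x * (q + p) by rewrite ler_wpM2r // addr_ge0.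
have : x * q <= x * (p + 1) by rewrite ler_wpM2l //; lra.
lra.
Qed.

HB.instance Definition _ :=
  isHilbert.Build R (completion s) cinnerDl cinnerZl cinner_conj cinner_norm.

Lemma inner_emb f c : inner f (emb c) = f c.
Proof.
apply/eqP; rewrite -subr_eq0; apply/eqP/cabs_eq0/eqP; rewrite eq_le cabs_ge0 andbT.
by rewrite cabs_distC (le_trans (cinnerP f (emb c) c)) // subrr rnorm0 mulr0.
Qed.

End CompletionNorm.

(** * Orthogonal projections and invariant subspaces *)

Section HilbertProjection.
Variables (R : realType).

Lemma geom_cvg (V : completeNormedModType R[i]) (u : nat -> V) :
  (forall j k, (j <= k)%N -> rnorm (u k - u j) <= 2^-1 ^+ j) ->
  exists l, forall e : R, 0 < e -> exists N, forall k, (N <= k)%N -> rnorm (u k - l) <= e.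
Proof.
move=> uC; have [k|k|l lP] := @cvg_majorant R V u (fun k => - 2 * 2^-1 ^+ k) 0.
- by apply: le_trans (uC k k.+1 (leqnSn k)) _; rewrite exprS; lra.
- have : 0 <= 2^-1 ^+ k :> R by rewrite exprn_ge0 // invr_ge0.
  by lra.
exists l => e /lP[N NP]; exists N => k /NP.
by rewrite rdistC.
Qed.

Variable K : hilbertType R.
Implicit Types (x y w : K) (W : set K) (T P : bop K).

(** Testing real orthogonality against i w makes the imaginary part vanish as well. *)
Lemma inner0_rinner x W : (forall (c : R[i]) w w', W w -> W w' -> W (c *: w + w')) -> W 0 ->
  (forall w, W w -> rinner x w = 0) -> forall w, W w -> inner x w = 0.
Proof.
move=> Wl W0 xW w Ww; have := xW w Ww.
have Wi : W ('i%C *: w) by rewrite -[_ *: w]addr0; exact: Wl.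
have := xW _ Wi; rewrite /rinner innerZr conjci; case: (inner x w) => a b /=.
by move=> h ->; have -> : b = 0 by lra.
Qed.

Lemma projection_uniq W (p : K -> K) x y :
  (forall (c : R[i]) w w', W w -> W w' -> W (c *: w + w')) ->
  (forall x, W (p x)) -> (forall x w, W w -> inner (x - p x) w = 0) ->
  W y -> (forall w, W w -> inner (x - y) w = 0) -> p x = y.
Proof.
move=> Wlin WP PW Wy yP; apply/eqP; rewrite -subr_eq0; apply/eqP.
apply: rnorm0_eq0; apply/eqP; rewrite -sqrf_eq0 -rinnerE /rinner.
have Wd : W (p x - y) by rewrite addrC -scaleN1r; exact: Wlin.
have {1}-> : p x - y = (x - y) - (x - p x) by rewrite opprB [RHS]addrC addrA subrK.
by rewrite innerDl innerNl yP // PW // subrr.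
Qed.

Lemma orthogonal_projection W : closed W -> W 0 ->
  (forall (c : R[i]) w w', W w -> W w' -> W (c *: w + w')) ->
  exists P : bop K, (forall x, W (P x)) /\ (forall x w, W w -> inner (x - P x) w = 0).
Proof.
move=> Wc W0 Wl; have Wrc := (closed_rclosed W).1 Wc.
have /choice[p pP] : forall x, exists y, W y /\ forall w, W w -> inner (x - y) w = 0.
  move=> x; have [|||||u Wu uC|y Wy yP] := @form_proj R K (@rinner R K) _ _ _ _ W W0 _ _ x.
  - exact: rinnerDl.
  - exact: rinnerZl.
  - exact: rinnerC.
  - by move=> y; rewrite rinnerE sqr_ge0.
  - by move=> a; exact: Wl.
  - have [j k jk|l lP] := @geom_cvg K u.
      rewrite -(ler_pXn2r (n := 2)) ?nnegrE ?rnorm_ge0 ?exprn_ge0 ?invr_ge0 //.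
      rewrite -rinnerE; apply: le_trans (uC j k jk) _; rewrite -exprM mulnC exprM.
      by rewrite (_ : 2^-1 ^+ 2 = 4^-1 :> R) //; field.
    exists l.
      apply: Wrc => e e0; have [N NP] := lP e e0.
      by exists (u N) => //; rewrite rdistC; exact: NP.
    move=> e e0; have s0 : 0 < Num.sqrt e by rewrite sqrtr_gt0.
    have [N NP] := lP _ s0; exists N => k /NP h; rewrite rinnerE -[e]sqr_sqrtr; last exact: ltW.
    by rewrite ler_pXn2r ?nnegrE ?rnorm_ge0 ?sqrtr_ge0.
  - by exists y; split=> //; exact: inner0_rinner Wl W0 yP.
have p_uniq := projection_uniq Wl (fun x => (pP x).1) (fun x => (pP x).2).
have p_lin (c : R[i]) x y : p (c *: x + y) = c *: p x + p y.
  have [Wx xP] := pP x; have [Wy yP] := pP y; apply: p_uniq => [|w Ww]; first exact: Wl.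
  have -> : c *: x + y - (c *: p x + p y) = c *: (x - p x) + (y - p y).
    by rewrite opprD scalerBr addrACA.
  by rewrite innerDl innerZl xP // yP // mulr0 addr0.
have p_bd x : rnorm (p x) <= 1 * rnorm x.
  have [Wx xP] := pP x; rewrite mul1r -(ler_pXn2r (n := 2)) ?nnegrE ?rnorm_ge0 //.
  have {2}-> : x = (x - p x) + p x by rewrite subrK.
  by rewrite rnormD_sqr /rinner xP // mulr0 addr0 lerDr sqr_ge0.
have pb : p \in @bounded_op R K by apply/asboolP; split=> //; exists 1.
by exists (Bop pb); split=> [x|x w Ww] /=; [have [] := pP x|have [_] := pP x; exact].
Qed.

Section Projection.
Variables (W : set K) (P : bop K).
Hypothesis Wlin : forall (c : R[i]) w w', W w -> W w' -> W (c *: w + w').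
Hypothesis WP : forall x, W (P x).
Hypothesis PW : forall x w, W w -> inner (x - P x) w = 0.

Lemma projection_id x : W x -> P x = x.
Proof. by move=> Wx; apply: (projection_uniq Wlin WP PW) => // w _; rewrite subrr inner0l. Qed.

Lemma projection_sa : star P = P.
Proof.
have inP u v : inner u (P v) = inner (P u) (P v).
  by have := PW u (WP v); rewrite innerDl innerNl => /eqP; rewrite subr_eq0 => /eqP.
apply: bopP => y; apply: inner_def => x; congr complex.Re.
rewrite [LHS]inner_conj starS [RHS]inP -inner_conj [LHS]inner_conj inP.
by rewrite -inner_conj.
Qed.

(** T P x lies in W, and T (x - P x) is orthogonal to W because [star T] preserves W. *)
Lemma projection_comm T : (forall x, W x -> W (T x)) -> (forall x, W x -> W (star T x)) ->
  P * T = T * P.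
Proof.
move=> WT WT'; apply: bopP => x; rewrite !bopME; apply: (projection_uniq Wlin WP PW); first exact: WT.
move=> w Ww; rewrite -bopNr -bopDr.
by rewrite -[T]starK starS PW //; exact: WT'.
Qed.

End Projection.

End HilbertProjection.

(** * States, without assuming a unit *)

Section States.
Variables (R : realType) (A : cstarType R).
Implicit Types (x y a b c v w : A) (g : A -> R).

(** Real parts of positive functionals of norm at most 1. The Schwarz inequality encodes positivity
    and normalization without a unit, and every clause is a closed condition on the values of g. *)
Definition state g :=
  [/\ forall (l : R) x y, g (l%:C%C *: x + y) = l * g x + g y,
      forall x, g (star x) = g x,
      forall x, `|g x| <= rnorm x &
      forall x, g x ^+ 2 <= g (cmul (star x) x)].

(** Extreme among the states with value 1 at a; the element a stands in for the missing unit. *)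
Definition pure_at a g :=
  [/\ state g, g a = 1 & forall g1 g2 (t : R), 0 < t < 1 -> state g1 -> state g2 ->
    g1 a = 1 -> g2 a = 1 -> (forall x, g x = t * g1 x + (1 - t) * g2 x) -> g1 =1 g].

Section StateTheory.
Variable g : A -> R.
Hypothesis gs : state g.

Lemma stateD x y : g (x + y) = g x + g y.
Proof. by have [gl _ _ _] := gs; have := gl 1 x y; rewrite rmorph1 scale1r mul1r. Qed.

Lemma state0 : g 0 = 0.
Proof. by have := stateD 0 0; rewrite addr0; lra. Qed.

Lemma stateZ (l : R) x : g (l%:C%C *: x) = l * g x.
Proof. by have [gl _ _ _] := gs; have := gl l x 0; rewrite state0 !addr0. Qed.

Lemma stateN x : g (- x) = - g x.
Proof. by apply/eqP; rewrite -addr_eq0 -stateD addNr state0. Qed.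

(* A real-linear functional is the real part of a unique complex-linear one. *)
Definition cstate x : R[i] := Complex (g x) (- g ('i%C *: x)).

Lemma cstateD x y : cstate (x + y) = cstate x + cstate y.
Proof. by apply/eqP; rewrite eq_complex /= scalerDr !stateD opprD !eqxx. Qed.

Lemma cstateZ (l : R[i]) x : cstate (l *: x) = l * cstate x.
Proof.
have E (p q : R) y : (Complex p q) *: y = p%:C%C *: y + q%:C%C *: ('i%C *: y).
  rewrite scalerA -scalerDl; congr (_ *: _); apply/eqP; rewrite eq_complex /=.
  by apply/andP; split; apply/eqP; ring.
have ii : 'i%C *: ('i%C *: x) = - x.
  rewrite scalerA -[RHS]scaleN1r; congr (_ *: _); apply/eqP; rewrite eq_complex /=.
  by apply/andP; split; apply/eqP; ring.
case: l => p q; rewrite /cstate scalerA mulrC -scalerA (E p q x) (E p q ('i%C *: x)) ii !stateD !stateZ stateN.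
by apply/eqP; rewrite eq_complex /=; apply/andP; split; apply/eqP; ring.
Qed.

Lemma cstate_star x : cstate (star x) = ((cstate x)^*)%C.
Proof.
have [_ gst _ _] := gs; apply/eqP; rewrite eq_complex /= gst eqxx /= opprK.
have -> : 'i%C *: star x = - star ('i%C *: x) by rewrite starZ conjci scaleNr opprK.
by rewrite stateN gst opprK.
Qed.

Let fDl x y z : cstate (cmul (star z) (x + y)) =
  cstate (cmul (star z) x) + cstate (cmul (star z) y).
Proof. by rewrite cmulDr cstateD. Qed.

Let fZl (l : R[i]) x z : cstate (cmul (star z) (l *: x)) = l * cstate (cmul (star z) x).
Proof. by rewrite cmulZr cstateZ. Qed.

Let fC x y : cstate (cmul (star x) y) = ((cstate (cmul (star y) x))^*)%C.
Proof. by rewrite -cstate_star starM starK. Qed.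

Let f_ge0 x : 0 <= complex.Re (cstate (cmul (star x) x)).
Proof. by have [_ _ _ gS] := gs; apply: le_trans (gS x); exact: sqr_ge0. Qed.

Definition state_form : semi_inner A :=
  SemiInner (sform := fun b c => cstate (cmul (star c) b)) fDl fZl fC f_ge0.

Lemma state_formE b c : state_form b c = cstate (cmul (star c) b). Proof. by []. Qed.

(** At a + t w the Schwarz inequality gives (1 + t g(w))^2 <= 1 + 2 t g(a^* w) + t^2 g(w^* w), so
    the linear terms in t agree. *)
Lemma state_absorb a w : rnorm a <= 1 -> g a = 1 -> g (cmul (star a) w) = g w.
Proof.
move=> a1 ga; have [_ gst gb gS] := gs.
have gaa : g (cmul (star a) a) <= 1.
  apply: le_trans (ler_norm _) _; apply: le_trans (gb _) _.
  rewrite /rnorm cstar_norm normE -rmorphXn /= -(expr1n _ 2).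
  by rewrite ler_pXn2r ?nnegrE ?rnorm_ge0.
have gwa : g (cmul (star w) a) = g (cmul (star a) w) by rewrite -gst starM starK.
have q (t : R) : 2 * t * g w - 2 * t * g (cmul (star a) w) <= t ^+ 2 * g (cmul (star w) w).
  have := gS (a + t%:C%C *: w).
  have -> : star (a + t%:C%C *: w) = star a + t%:C%C *: star w by rewrite starD starZ conjc_real.
  rewrite !(cmulDl, cmulDr) !(cmulZl, cmulZr) !(stateD, stateZ) ga gwa.
  have := sqr_ge0 (t * g w); rewrite !expr2.
  by move: (g (cmul _ w)) (g (cmul _ w)) (g (cmul _ a)) gaa (g w) => *; lra.
have gww : 0 <= g (cmul (star w) w) by apply: le_trans (gS w); exact: sqr_ge0.
apply/eqP; rewrite eq_sym -subr_eq0; apply/eqP; apply: (quadratic_eq0 gww) => t.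
by rewrite mulrBr.
Qed.

Lemma cstate_absorb a w : rnorm a <= 1 -> g a = 1 -> cstate (cmul w a) = cstate w.
Proof.
move=> a1 ga; have -> : cmul w a = star (cmul (star a) (star w)) by rewrite starM !starK.
rewrite cstate_star -[in RHS](starK w) [in RHS]cstate_star; congr (_^*)%C.
apply/eqP; rewrite eq_complex /= state_absorb // eqxx /=.
by rewrite -cmulZr state_absorb.
Qed.

End StateTheory.

Lemma vector_state (K : hilbertType R) (pi : A -> bop K) (u : K) : star_hom pi ->
  (forall x, rnorm (pi x) <= rnorm x) -> u != 0 ->
  state (fun x => rinner (pi x u) u / rnorm u ^+ 2).
Proof.
move=> [pl pM ps] pc u0.
have {}u0 : 0 < rnorm u.
  by rewrite lt_neqAle rnorm_ge0 andbT eq_sym; apply: contra u0 => /eqP/rnorm0_eq0 ->.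
have u2 : 0 < rnorm u ^+ 2 by rewrite exprn_gt0.
split=> [l x y|x|x|x].
- by rewrite pl bopDE bopZE rinnerDl rinnerZl mulrDl mulrA.
- by rewrite ps rstarS rinnerC.
- rewrite normrM normfV (ger0_norm (sqr_ge0 (rnorm u))) ler_pdivrMr //.
  apply: le_trans (ler_norm_rinner _ _) _; rewrite expr2 mulrA ler_wpM2r ?rnorm_ge0 //.
  by apply: le_trans (rnorm_bop_le _ _) _; rewrite ler_wpM2r ?rnorm_ge0.
- rewrite pM ps bopME rstarS rinnerE expr_div_n ler_pdivrMr ?exprn_gt0 //.
  rewrite [rnorm u ^+ 2 ^+ 2]expr2 mulrA divfK ?gt_eqF // -exprMn -(@real_normK _ (rinner _ _)) ?num_real //.
  by rewrite ler_pXn2r ?nnegrE ?mulr_ge0 ?rnorm_ge0 // ler_norm_rinner.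
Qed.

End States.

Lemma rnorm_cstar (R : realType) (A : cstarType R) (a : A) : rnorm (star a) = rnorm a.
Proof.
have le (b : A) : rnorm b <= rnorm (star b).
  have [->|b0] := eqVneq (rnorm b) 0; first exact: rnorm_ge0.
  have {}b0 : 0 < rnorm b by rewrite lt_neqAle eq_sym b0 rnorm_ge0.
  rewrite -(ler_pM2r b0) -expr2; have := cnormM (lexx (rnorm (star b))) (lexx (rnorm b)).
  by rewrite [X in X <= _]/rnorm cstar_norm normE -rmorphXn.
by apply/eqP; rewrite eq_le le andbT; have := le (star a); rewrite starK.
Qed.

(** * The GNS representation of an extremal state *)

Section GNS.
Variables (R : realType) (A : cstarType R) (g : A -> R).
Implicit Types (x y a b c v w : A).
Hypothesis gs : state g.
(** Positivity of |b|^2 - [star b * b], compressed by v so that no unit occurs; it makes left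
    multiplication bounded for the GNS semi-norm. *)
Hypothesis dominated : forall b v, exists w, cmul (star w) w =
  (rnorm b ^+ 2)%:C%C *: cmul (star v) v - cmul (star v) (cmul (cmul (star b) b) v).

Local Notation s := (state_form gs).
Local Notation K := (completion s).

Lemma snrm_mul b v : snrm s (cmul b v) <= rnorm b * snrm s v.
Proof.
rewrite -(ler_pXn2r (n := 2)) ?nnegrE ?mulr_ge0 ?rnorm_ge0 ?snrm_ge0 // exprMn !snrm_sqr.
rewrite !state_formE /=.
have [w wE] := dominated b v; have [_ _ _ /(_ w)] := gs.
rewrite wE stateD // stateN // stateZ // starM -!cmulA.
by have := sqr_ge0 (g w); lra.
Qed.

Lemma rep_approximable b (f : K) : ((fun v => f (cmul (star b) v)) : A -> R[i]^o) \in approximable s.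
Proof.
apply/asboolP => e e0; have b1 : 0 < rnorm b + 1 by rewrite ltr_wpDl ?rnorm_ge0.
have [c cf] := cfun_approx f (divr_gt0 e0 b1); exists (cmul b c) => v.
have -> : s (cmul b c) v = s c (cmul (star b) v) by rewrite !state_formE starM starK cmulA.
apply: le_trans (cf _) _; rewrite -mulrA ler_pM2l // mulrC ler_pdivrMr //.
apply: le_trans (snrm_mul _ _) _; rewrite rnorm_cstar mulrC ler_wpM2l ?snrm_ge0 //.
by rewrite lerDl.
Qed.

Definition rep_fun b (f : K) : K := Completion (rep_approximable b f).

Lemma rep_funE b f v : rep_fun b f v = f (cmul (star b) v). Proof. by []. Qed.

Lemma rnorm_rep_fun b f : rnorm (rep_fun b f) <= rnorm b * rnorm f.
Proof.
rewrite rnorm_completion; apply: cnorm_le => [|v]; first by rewrite mulr_ge0 ?rnorm_ge0.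
rewrite rep_funE; apply: le_trans (rnorm_cfun_le _ _) _; rewrite -mulrA mulrCA.
rewrite ler_wpM2l ?rnorm_ge0 //; apply: le_trans (snrm_mul _ _) _.
by rewrite rnorm_cstar.
Qed.

Lemma rep_fun_bounded b : rep_fun b \in @bounded_op R K.
Proof.
apply/asboolP; split; first by move=> l f f'; apply: cfunP => v.
by exists (rnorm b) => f; exact: rnorm_rep_fun.
Qed.

Definition rep b : bop K := Bop (rep_fun_bounded b).

Lemma repE b f v : rep b f v = f (cmul (star b) v). Proof. by []. Qed.

Lemma rep_emb b c : rep b (emb s c) = emb s (cmul b c).
Proof. by apply: cfunP => v; rewrite repE !embE !state_formE starM starK cmulA. Qed.

Lemma emb_density (W : set K) : closed W -> (forall b, W (emb s b)) -> forall f, W f.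
Proof.
move=> Wc We f; apply: ((closed_rclosed W).1 Wc) => e /(emb_dense f)[b fb].
by exists (emb s b).
Qed.

Lemma bop_emb_eq (T U : bop K) : (forall b, T (emb s b) = U (emb s b)) -> T = U.
Proof.
move=> TU; apply: bopP; apply: (@emb_density [set f | T f = U f]) => //.
apply/closed_rclosed => f fP /=; apply/eqP; rewrite -subr_eq0 -bopNE -bopDE; apply/eqP.
apply: rnorm0_eq0; apply/eqP; rewrite eq_le rnorm_ge0 andbT.
apply: (@ler_eps _ _ _ (rnorm (T - U))) => [|e /fP[h hT fh]]; first exact: rnorm_ge0.
have -> : (T - U) f = (T - U) (f - h).
  by rewrite bopDr bopNr [(T - U) h]bopDE bopNE hT subrr subr0.
by apply: le_trans (rnorm_bop_le _ _) _; rewrite add0r ler_wpM2l ?rnorm_ge0.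
Qed.

Lemma rep_star_hom : star_hom rep.
Proof.
split=> [l b c|b c|b].
- apply: bopP => f; apply: cfunP => v; rewrite bopDE bopZE cfunDE cfunZE !repE starD starZ.
  by rewrite cmulDl cmulZl cfun_linear conjcK.
- by apply: bopP => f; apply: cfunP => v; rewrite bopME !repE starM cmulA.
- apply: bop_emb_eq => c; apply: (@inner_def R K) => f.
  have h : inner f (rep (star b) (emb s c)) = inner f (star (rep b) (emb s c)).
    by rewrite rep_emb inner_emb [RHS]inner_conj starS -inner_conj inner_emb repE.
  by rewrite /rinner h.
Qed.

Lemma rnorm_rep b : rnorm (rep b) <= rnorm b.
Proof. by apply: rnorm_bop_leP => [|f]; [exact: rnorm_ge0|exact: rnorm_rep_fun]. Qed.

Section Pure.
Variable a : A.
Hypothesis a1 : rnorm a <= 1.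
Hypothesis gp : pure_at a g.

Let xi := emb s a.
Let ga : g a = 1. Proof. by case: gp. Qed.

Let rep_xi b : rep b xi = emb s b.
Proof. by rewrite rep_emb; apply: cfunP => v; rewrite !embE !state_formE cmulA cstate_absorb. Qed.

Let rep_state b : rinner (rep b xi) xi = g b.
Proof. by rewrite rep_xi /rinner inner_emb embE state_formE /= state_absorb. Qed.

Let xi1 : rnorm xi ^+ 2 = 1.
Proof. by rewrite -rinnerE -ga -rep_state rep_xi. Qed.

Lemma rep_neq0 : rep a xi <> 0.
Proof. by rewrite rep_xi => h; move: xi1; rewrite /xi h rnorm0 expr0n /= => /eqP; rewrite eq_sym oner_eq0. Qed.

(** An invariant subspace splits the cyclic vector xi into eta + zeta and g into a convex
    combination of their vector states, both with value 1 at a. If both parts are nonzero,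
    extremality gives eta = t xi; projecting gives eta = t eta, so t = 1 and zeta = 0, a
    contradiction. *)
Lemma rep_irreducible : irreducible_rep rep.
Proof.
split; first by exists a, xi; exact: rep_neq0.
move=> W Wc W0 Wl WT; have [repl repM reps] := rep_star_hom.
have [P [WP PW]] := orthogonal_projection Wc W0 Wl.
have Ps := projection_sa WP PW.
have Pid := projection_id Wl WP PW.
have Pc b : P * rep b = rep b * P.
  apply: (projection_comm Wl WP PW) => f Wf; first exact: WT.
  by rewrite -reps; exact: WT.
have [eta etaD] : exists eta, eta = P xi by eexists.
have [zeta zetaD] : exists zeta, zeta = xi - eta by eexists.
have Weta : W eta by rewrite etaD.
have orth f : W f -> inner f zeta = 0.
  by move=> Wf; rewrite inner_conj zetaD etaD PW // conjc0.
have eta_zeta b : rinner (rep b eta) zeta = 0 by rewrite /rinner orth //; exact: WT.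
have zeta_eta b : rinner (rep b zeta) eta = 0.
  by rewrite rinnerC -rstarS -reps; exact: eta_zeta.
have xiE : xi = eta + zeta by rewrite zetaD addrCA subrr addr0.
have gE b : g b = rinner (rep b eta) eta + rinner (rep b zeta) zeta.
  by rewrite -rep_state xiE bopDr rinnerDl !rinnerDr eta_zeta zeta_eta addr0 add0r.
have rep_eta : rep a eta = eta by rewrite etaD -bopME -Pc bopME rep_xi.
have rep_zeta : rep a zeta = zeta by rewrite zetaD bopDr bopNr rep_eta rep_xi.
have sum1 : rnorm eta ^+ 2 + rnorm zeta ^+ 2 = 1.
  by rewrite -ga gE rep_eta rep_zeta !rinnerE.
have [e0|e0] := eqVneq eta 0.
  left; have P0 : P = 0.
    by apply: bop_emb_eq => b; rewrite -rep_xi -bopME Pc bopME -etaD e0 bop0 bop0E.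
  apply/seteqP; split=> [f Wf|f -> //] /=.
  by rewrite -(Pid f Wf) P0 bop0E.
right; have [z0|z0] := eqVneq zeta 0.
  apply/seteqP; split=> // f _; apply: (emb_density Wc) => b.
  by rewrite -rep_xi; apply: WT; rewrite xiE z0 addr0.
have n0 (f : K) : f != 0 -> 0 < rnorm f ^+ 2.
  move=> f0; rewrite exprn_gt0 // lt_neqAle rnorm_ge0 andbT eq_sym.
  by apply: contra f0 => /eqP/rnorm0_eq0 ->.
have ep := n0 _ e0; have zp := n0 _ z0.
have [t tE] : exists t, t = rnorm eta ^+ 2 by eexists.
rewrite -tE in sum1 ep.
have tz : rnorm zeta ^+ 2 = 1 - t by lra.
have g1E : (fun b => rinner (rep b eta) eta / rnorm eta ^+ 2) =1 g.
  have [_ _] := gp.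
  move=> /(_ _ (fun b => rinner (rep b zeta) zeta / rnorm zeta ^+ 2) t); apply.
  - by rewrite ep /= -subr_gt0 -tz.
  - exact: vector_state rep_star_hom rnorm_rep e0.
  - exact: vector_state rep_star_hom rnorm_rep z0.
  - by rewrite rep_eta rinnerE -tE divff // gt_eqF.
  - by rewrite rep_zeta rinnerE divff // gt_eqF.
  - move=> b; rewrite gE -tE -tz mulrC divfK ?gt_eqF //; congr (_ + _).
    by rewrite mulrC divfK ?gt_eqF.
have etaE : eta = t%:C%C *: xi.
  apply: inner_def => f; apply/eqP; rewrite -subr_eq0 -rinnerNr -rinnerDr; apply/eqP.
  rewrite rinnerC; move: f; apply: emb_density.
    apply/closed_rclosed => f fP /=; rewrite rinnerC.
    apply/eqP; rewrite -normr_le0.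
    apply: (@ler_eps _ _ _ (rnorm (eta - t%:C%C *: xi))) => [|e /fP[h hT fh]]; first exact: rnorm_ge0.
    have -> : rinner f (eta - t%:C%C *: xi) = rinner (f - h) (eta - t%:C%C *: xi).
      by rewrite (rinnerDl f) rinnerNl [rinner h _]rinnerC hT subr0.
    by apply: le_trans (ler_norm_rinner _ _) _; rewrite add0r mulrC ler_wpM2l ?rnorm_ge0.
  move=> b /=; rewrite -rep_xi rinnerDl rinnerNl rinnerZl -!rstarS -reps rep_state.
  have := g1E (star b); rewrite -tE.
  have -> : rinner (rep (star b) eta) xi = rinner (rep (star b) eta) eta.
    by rewrite xiE rinnerDr eta_zeta addr0.
  by move=> <-; rewrite mulrC divfK ?gt_eqF // subrr.
have : eta = t%:C%C *: eta by rewrite -{1}[eta](Pid _ Weta) {1}etaE bopZr -etaD.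
move/(congr1 (@rnorm R K)); rewrite rnormZr ger0_norm ?(ltW ep) // => eta_t.
have e1 : 0 < rnorm eta by rewrite lt_neqAle rnorm_ge0 andbT eq_sym; apply: contra e0 => /eqP/rnorm0_eq0 ->.
have t1 : t = 1 by apply: (mulIf (lt0r_neq0 e1)); rewrite -eta_t mul1r.
by move: zp; rewrite tz t1 subrr ltxx.
Qed.

End Pure.

End GNS.

(** * Extreme points of compact sets by Zorn's lemma *)

Section ExtremePoints.
Variables (R : realType) (I : eqType).
Local Notation E := (prod_topology (fun _ : I => R)).
Implicit Types (g f : E) (X U : set E).

Lemma eval_continuous (x : I) : continuous (fun g : E => g x).
Proof. exact: (@proj_continuous I (fun _ => R) x). Qed.

Let comb (t : R) g1 g2 : E := fun x => t * g1 x + (1 - t) * g2 x.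

(* The complement of a closed face of [X]. *)
Let coface X U := [/\ open U, X `\` U !=set0 & forall g1 g2 t, 0 < t < 1 ->
  X g1 -> X g2 -> X (comb t g1 g2) -> U g1 -> U (comb t g1 g2)].

(** By compactness, a chain of open sets that covers X has a member covering X. *)
Let coface_bigcup X (D : set (set E)) : compact X -> X !=set0 -> D `<=` coface X ->
  total_on D subset -> coface X (\bigcup_(U in D) U).
Proof.
move=> Xc X0 DX Dt; split.
- by apply: bigcup_open => U /DX[].
- have [[U0 DU0]|D0] := pselect (D !=set0); last first.
    by have [x Xx] := X0; exists x; split=> // -[U DU _]; apply: D0; exists U.
  apply: contrapT => XU.
  have XD : X `<=` \bigcup_(U in D) U.
    by move=> x Xx; apply: contrapT => nx; apply: XU; exists x.
  pose F := filter_from D (fun U => [set W | D W /\ U `<=` W]).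
  have FF : Filter F.
    apply: filter_from_filter; first by exists U0.
    move=> U W DU DW; have [UW|WU] := Dt U W DU DW.
      by exists W => // Z [DZ WZ]; split; split=> //; exact: subset_trans WZ.
    by exists U => // Z [DZ UZ]; split; split=> //; exact: subset_trans UZ.
  have nc := (compact_near_coveringP X).1 Xc.
  have [x Xx|U DU UX] := nc _ F (fun U x => U x) FF.
    have [U DU Ux] := XD x Xx; exists (U, [set W | D W /\ U `<=` W]).
      split => /=; last by exists U.
      by apply: open_nbhs_nbhs; split=> //; have [] := DX U DU.
    by move=> [y W] /= [Uy [_ UW]]; exact: UW.
  have [_ [y [Xy Uy]] _] := DX U DU.
  by apply: Uy; apply: (UX U (conj DU (@subset_refl _ U))) Xy.
- move=> g1 g2 t t01 X1 X2 X12 [U DU Ug1]; exists U => //.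
  by have [_ _ /(_ g1 g2 t)] := DX U DU; exact.
Qed.

(** The complement of a maximal coface is a minimal closed face. Adding to the coface the points
    where an evaluation is below its maximum on the face gives a coface again; so every evaluation
    is constant on the face, which is a single point. *)
Lemma extreme_point X : compact X -> X !=set0 -> exists2 f, X f &
  forall g1 g2 (t : R), 0 < t < 1 -> X g1 -> X g2 ->
    (forall x, f x = t * g1 x + (1 - t) * g2 x) -> g1 = f.
Proof.
move=> Xc X0.
have [U [UX Umax]] : exists U, coface X U /\ forall B, U `<` B -> ~ coface X B.
  by apply: Zorn_bigcup => D DX Dt; exact: coface_bigcup.
have [Uo [f [Xf Uf]] Uface] := UX.
have Fc : compact (X `\` U).
  by rewrite setDE; apply: compact_closedI => //; exact: open_closedC.
have Fconst x g : X g -> ~ U g -> g x = f x.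
  have [m mF mP] : exists2 m, m \in X `\` U & forall g, g \in X `\` U -> g x <= m x.
    apply: derive.compact_EVT_max => //; first by exists f.
    by apply: continuous_subspaceT; exact: eval_continuous.
  pose B := U `|` [set g : E | g x < m x].
  have BX : coface X B.
    split.
    - apply: openU => //.
      by apply: (open_comp (f := fun g : E => g x) (D := [set r | r < m x])) => [h _|]; [exact: eval_continuous|exact: open_lt].
    - by have [Xm Um] := set_mem mF; exists m; split=> // -[//|] /=; rewrite ltxx.
    - move=> g1 g2 t t01 X1 X2 X12 Bg1.
      have [Uc|Uc] := pselect (U (comb t g1 g2)); first by left.
      right; have Ug1 : ~ U g1 by move=> Ug; apply: Uc; exact: Uface.
      have c21 : comb (1 - t) g2 g1 = comb t g1 g2.
        by apply/funext => y; rewrite /comb subKr addrC.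
      have Ug2 : ~ U g2.
        move=> Ug; apply: Uc; rewrite -c21; apply: Uface => //; last by rewrite c21.
        by move: t01 => /andP[t0 t1]; rewrite subr_gt0 t1 ltrBlDr ltrDl.
      have g1m : g1 x < m x by case: Bg1.
      have g2m : g2 x <= m x by apply: mP; exact: mem_set.
      move: t01 => /andP[t0 t1]; rewrite /= /comb.
      have : (1 - t) * g2 x <= (1 - t) * m x by rewrite ler_pM2l // subr_gt0.
      have : t * g1 x < t * m x by rewrite ltr_pM2l.
      lra.
  have BU : B `<=` U.
    apply: contrapT => BU; apply: (Umax B) => //; split=> //; first by move=> h Uh; left.
  have Fm h : X h -> ~ U h -> h x = m x.
    move=> Xh Uh; apply/eqP; rewrite eq_le mP /=; last exact: mem_set.
    rewrite leNgt; apply/negP => hm.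
    by apply/Uh/BU; right.
  by move=> Xg Ug; rewrite !Fm.
exists f => // g1 g2 t t01 X1 X2 fE; apply/funext => x; apply: Fconst => // Ug1.
have fc : f = comb t g1 g2 by apply/funext => y; exact: fE.
by apply: Uf; rewrite fc; apply: Uface => //; rewrite -fc.
Qed.

End ExtremePoints.

Section ContinuousReal.
Variables (R : realType) (T : topologicalType).
Implicit Types f h : T -> R.

Lemma continuous_subr f h : continuous f -> continuous h -> continuous (fun g => f g - h g).
Proof. by move=> fc hc g; apply: cvgB; [exact: fc|exact: hc]. Qed.

Lemma continuous_addr f h : continuous f -> continuous h -> continuous (fun g => f g + h g).
Proof. by move=> fc hc g; apply: cvgD; [exact: fc|exact: hc]. Qed.

Lemma continuous_mulr f h : continuous f -> continuous h -> continuous (fun g => f g * h g).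
Proof. by move=> fc hc g; apply: cvgM; [exact: fc|exact: hc]. Qed.

Lemma continuous_cst (r : R) : continuous (fun _ : T => r).
Proof. by move=> g; exact: cvg_cst. Qed.

Lemma closed_ge0 f : continuous f -> closed [set g | 0 <= f g].
Proof.
move=> fc; apply: (closed_comp (f := f) (D := [set r | 0 <= r])) => [g _|]; first exact: fc.
exact: closed_ge.
Qed.

End ContinuousReal.

(** * Compactness of the state space *)

Section StateSpace.
Variables (R : realType) (A : cstarType R).
Local Notation E := (prod_topology (fun _ : A => R)).
Implicit Types (g : E) (x y a : A).

Let ev x : continuous (fun g : E => g x). Proof. exact: eval_continuous. Qed.

(** States form a closed subset of a product of segments, cut out by weak inequalities between
    evaluations. *)
Lemma state_compact : compact [set g : E | state g].
Proof.
apply: (@subclosed_compact _ _ [set g : E | forall x, `[- rnorm x, rnorm x]%classic (g x)]).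
- have -> : [set g : E | state g] =
    (\bigcap_(p in [set: R * A * A])
       ([set g | 0 <= g (p.1.1%:C%C *: p.1.2 + p.2) - (p.1.1 * g p.1.2 + g p.2)] `&`
        [set g | 0 <= (p.1.1 * g p.1.2 + g p.2) - g (p.1.1%:C%C *: p.1.2 + p.2)]))
    `&` (\bigcap_(x in [set: A])
       ([set g | 0 <= g (star x) - g x] `&` [set g | 0 <= g x - g (star x)] `&`
        [set g | 0 <= rnorm x - g x] `&` [set g | 0 <= rnorm x + g x] `&`
        [set g | 0 <= g (cmul (star x) x) - g x * g x])).
    apply/seteqP; split=> g.
      move=> [gl gst gb gS]; split=> [[[l x] y] _ /=|x _ /=].
        by rewrite gl subrr.
      rewrite gst subrr; have := gS x; rewrite expr2 -subr_ge0 => ->.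
      have := gb x; rewrite ler_norml => /andP[h1 h2]; do !split=> //.
        by rewrite subr_ge0.
      by rewrite -lerBlDl sub0r.
    move=> [g1 g2]; split=> [l x y|x|x|x].
    - have [/=] := g1 (l, x, y) I; rewrite !subr_ge0 => h1 h2.
      by apply/eqP; rewrite eq_le h1 h2.
    - have [[[[/= h1 h2] _] _] _] := g2 x I.
      by apply/eqP; rewrite eq_le -subr_ge0 h2 -subr_ge0.
    - have [[[_ /= h1] h2] _] := g2 x I.
      by rewrite ler_norml; apply/andP; split; lra.
    - by have [_ /=] := g2 x I; rewrite subr_ge0 expr2.
  apply: closedI; apply: closed_bigI => p _; repeat apply: closedI;
    apply: closed_ge0; by repeat first [exact: ev | exact: continuous_cst | apply: continuous_subr | apply: continuous_addr | apply: continuous_mulr].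
- apply: (@tychonoff A (fun _ => R) (fun x => `[- rnorm x, rnorm x]%classic)) => x.
  exact: segment_compact.
- by move=> g [_ _ gb _] x /=; rewrite in_itv /= -ler_norml.
Qed.

Lemma pure_at_ex a g : state g -> g a = 1 -> exists f : A -> R, pure_at a f.
Proof.
move=> gs ga; pose X : set E := [set g | state g] `&` [set g | 0 <= g a - 1] `&` [set g | 0 <= 1 - g a].
have XP f : X f <-> state f /\ f a = 1.
  split=> [[[fs /= h1] h2]|[fs fa]]; last by rewrite /X /= fa subrr.
  by split=> //; lra.
have Xc : compact X.
  apply: compact_closedI; first (apply: compact_closedI; first exact: state_compact);
    apply: closed_ge0; apply: continuous_subr; first [exact: continuous_cst|exact: ev].
have [|f /XP[fs fa] fP] := extreme_point Xc; first by exists g; apply/XP.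
exists f; split=> // g1 g2 t t01 s1 s2 a1 a2 fE x.
by rewrite (fP g1 g2 t) //; apply/XP.
Qed.

End StateSpace.

(** * Irreducible representations separate points *)

Section Separation.
Variables (R : realType) (H : hilbertType R) (S : csubalg (bop H)).
Local Notation A := (csub_alg S).

Lemma csub_val_star_hom : star_hom (@csub_val R (bop H) S : A -> bop H).
Proof. by split. Qed.

(** The root r of |b|^2 - [star b * b] lies in [adj1 S], in which S is an ideal; take w = r v. *)
Lemma csub_dominated (b v : A) : exists w : A, cmul (star w) w =
  (rnorm b ^+ 2)%:C%C *: cmul (star v) v - cmul (star v) (cmul (cmul (star b) b) v).
Proof.
have Sc := csubP S; have A1c := adj1_csubalg Sc.
have Sb := csub_in b; have Sv := csub_in v.
have [q qE] : exists q : bop H, q = (rnorm b ^+ 2)%:B - star (csub_val b) * csub_val b by eexists.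
have qp : psd q.
  split=> [|u]; first by rewrite /sa qE starB starM_ starK starZr star1.
  rewrite qE bopDE bopNE bopZE bop1E rinnerDl rinnerNl rinnerZl rinnerE bopME rstarS rinnerE.
  by rewrite subr_ge0 -exprMn ler_pXn2r ?nnegrE ?mulr_ge0 ?rnorm_ge0 // rnorm_bop_le.
have Aq : adj1 S q.
  rewrite qE; apply: csB => //; first exact: adj1_scal.
  by apply: csM => //; [apply: csS => //|]; exact: adj1_sub.
have [r [rp Ar rr _]] := psd_sqrt A1c (adj1_1 Sc) Aq qp.
exists (celt (adj1_mull Sc Ar Sv)); apply: val_inj.
change (star (r * csub_val v) * (r * csub_val v) = (rnorm b ^+ 2)%:C%C *: (star (csub_val v) * csub_val v)
  - star (csub_val v) * (star (csub_val b) * csub_val b * csub_val v)).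
rewrite starM_ -mulrA (mulrA (star r)) (proj1 rp) rr qE mulrBl mulrBr; congr (_ - _).
by rewrite bopZAl bopZAr mul1r.
Qed.

(** By compactness some state maximizes the value at [cmul (star z) z]. The vector states of H show
    that this maximum bounds |z v|^2 / |v|^2 for every nonzero v, hence is at least |z|^2 = 1. *)
Lemma norming_state (z : A) : rnorm z = 1 -> exists2 g : A -> R, state g & g (cmul (star z) z) = 1.
Proof.
move=> z1; pose a : A := cmul (star z) z; have [z' zE] : exists z', z' = csub_val z by eexists.
have z'1 : rnorm z' = 1 by rewrite zE.
have vs (u : H) : u != 0 -> state (fun x : A => rinner (csub_val x u) u / rnorm u ^+ 2).
  exact: (vector_state csub_val_star_hom (fun x => lexx _)).
have aE u : rinner (csub_val a u) u = rnorm (z' u) ^+ 2.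
  by rewrite zE /a (_ : csub_val (cmul (star z) z) = star (csub_val z) * csub_val z) // bopME rstarS rinnerE.
have [u u0] : exists u : H, u != 0.
  apply: contrapT => nu; have : rnorm z' <= 0.
    apply: rnorm_bop_leP => // u; have [->|u0] := eqVneq u 0; first by rewrite bop0 rnorm0 mulr0.
    by case: nu; exists u.
  by rewrite z'1 ler10.
have [m /set_mem ms mP] : exists2 m, m \in [set g : prod_topology (fun _ : A => R) | state g] &
    forall g, g \in [set g : prod_topology (fun _ : A => R) | state g] -> g a <= m a.
  apply: derive.compact_EVT_max; [|exact: state_compact|].
    by exists (fun x : A => rinner (csub_val x u) u / rnorm u ^+ 2); exact: vs.
  by apply: continuous_subspaceT; exact: (@eval_continuous R A a).
have ma : 0 <= m a by have [_ _ _ /(_ z)] := ms; apply: le_trans; exact: sqr_ge0.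
exists m => //; apply/eqP; rewrite eq_le; apply/andP; split.
  have [_ _ mb _] := ms; apply: le_trans (ler_norm _) _; apply: le_trans (mb _) _.
  by rewrite {1}/rnorm cstar_norm normE -rmorphXn /= z1 expr1n.
rewrite -(expr1n _ 2) -{1}z'1 -[leRHS]sqr_sqrtr // ler_pXn2r ?nnegrE ?rnorm_ge0 ?sqrtr_ge0 //.
apply: rnorm_bop_leP => [|v]; first exact: sqrtr_ge0.
have [->|v0] := eqVneq v 0; first by rewrite bop0 rnorm0 mulr0.
rewrite -(ler_pXn2r (n := 2)) ?nnegrE ?mulr_ge0 ?rnorm_ge0 ?sqrtr_ge0 // exprMn sqr_sqrtr //.
have v2 : 0 < rnorm v ^+ 2.
  by rewrite exprn_gt0 // lt_neqAle rnorm_ge0 andbT eq_sym; apply: contra v0 => /eqP/rnorm0_eq0 ->.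
by rewrite -ler_pdivrMr // -aE; apply: (mP (fun x : A => rinner (csub_val x v) v / rnorm v ^+ 2)); apply: mem_set; exact: vs.
Qed.

Lemma irreps_separate (z : A) : z <> 0 -> exists (K : hilbertType R) (pi : A -> bop K),
  [/\ star_hom pi, irreducible_rep pi & pi z <> 0].
Proof.
move=> z0; have nz : 0 < rnorm z.
  rewrite lt_neqAle rnorm_ge0 andbT eq_sym; apply/eqP => nz.
  by apply: z0; exact: rnorm0_eq0.
pose w : A := (rnorm z)^-1%:C%C *: z.
have w1 : rnorm w = 1 by rewrite rnormZr ger0_norm ?invr_ge0 ?(ltW nz) // mulVf // gt_eqF.
have [g gs ga] := norming_state w1.
have [f fp] := pure_at_ex gs ga; have [fs _ _] := fp.
have a1 : rnorm (cmul (star w) w) <= 1.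
  by rewrite /rnorm cstar_norm normE -rmorphXn /= w1 expr1n.
exists (completion (state_form fs)), (rep fs csub_dominated).
have hom := rep_star_hom fs csub_dominated.
split=> //; first exact: (@rep_irreducible R A f fs csub_dominated _ a1 fp).
move=> pz; have [pl pM ps] := hom.
have := @rep_neq0 _ _ _ fs csub_dominated _ a1 fp; apply.
rewrite pM bopME; suff -> : rep fs csub_dominated w = 0 by rewrite bop0E bop0.
by rewrite -[w]addr0 pl pz scaler0 add0r; have := pl (-1) 0 0; rewrite scaler0 addr0 scaleN1r addNr.
Qed.

Lemma subhomogeneous_cap n (x : 'I_(n * n).+1 -> A) (y : nat -> A) :
  subhomogeneous n A -> cap x y = 0.
Proof.
move=> Sn; apply: contrapT => /irreps_separate[K [pi [ph pirr]]]; apply.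
by rewrite (cap_hom _ _ ph); apply: cap_dim_le; exact: Sn ph pirr.
Qed.

End Separation.

(** * Contractivity of star-homomorphisms *)

Section RepContractive.
Variables (R : realType) (H : hilbertType R) (S : csubalg (bop H)) (K : hilbertType R).
Local Notation A := (csub_alg S).
Variable pi : A -> bop K.
Hypothesis ph : star_hom pi.

(** For |y| <= 1, [sqrt_fix] gives a self-adjoint w in S with 2 w = y^* y + w^2. The identity passes
    to the images Y and W, so |Y u|^2 = 2 <W u, u> - |W u|^2 <= |u|^2. *)
Lemma star_hom_contractive (x : A) : rnorm (pi x) <= rnorm x.
Proof.
have [pl pM ps] := ph; have Sc := csubP S.
have p0 : pi 0 = 0 by have := pl (-1) 0 0; rewrite scaler0 addr0 scaleN1r addNr.
have pZ c y : pi (c *: y) = c *: pi y by rewrite -[c *: y]addr0 pl p0 addr0.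
have pD y z : pi (y + z) = pi y + pi z by rewrite -[y]scale1r pl !scale1r.
have unit_case (y : A) : rnorm y <= 1 -> rnorm (pi y) <= 1.
  move=> y1; have Sy := csub_in y.
  have [z zE] : exists z, z = star (csub_val y) * csub_val y by eexists.
  have z1 : rnorm z <= 1 by rewrite zE rnorm_starM expr_le1 // rnorm_ge0.
  have [w [wE _ wA]] := sqrt_fix z1.
  have Sz : csub_set S z by rewrite zE; apply: csM => //; exact: csS.
  have Sw : csub_set S w.
    apply: wA; [exact/closed_rclosed/(csub_closed Sc)|exact: csub0 Sc|].
    by move=> v Sv; apply: csZ => //; apply: csD => //; exact: csM.
  have ws : sa w.
    apply: (wA [set v | sa v]); [exact: rclosed_sa|exact: star0|].
    by move=> v vs; rewrite /sa /= starZr starD_ starM_ vs zE starM_ starK.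
  have eqS : 2 *: celt Sw = cmul (star y) y + cmul (celt Sw) (celt Sw) :> A.
    apply: val_inj; change (2 *: w = star (csub_val y) * csub_val y + w * w).
    have two : (2 : R[i]) = (2 : R)%:C%C by rewrite rmorph_nat.
    by rewrite {1}wE scalerA two -rmorphM /= mulfV ?pnatr_eq0 // scale1r zE.
  have Ws : star (pi (celt Sw)) = pi (celt Sw).
    by rewrite -ps; congr pi; apply: val_inj; exact: ws.
  have := congr1 pi eqS; rewrite pZ pD !pM ps; move: (pi (celt Sw)) Ws => W Ws E.
  apply: rnorm_bop_leP => // u; rewrite mul1r -(ler_pXn2r (n := 2)) ?nnegrE ?rnorm_ge0 //.
  have := congr1 (fun T : bop K => rinner (T u) u) E.
  rewrite bopDE !bopME rinnerDl rstarS rinnerE -{2}Ws rstarS rinnerE bopZE.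
  have -> : (2 : R[i]) = (2 : R)%:C%C by rewrite rmorph_nat.
  rewrite rinnerZl rinnerC => h.
  have := rnormD_sqr u (- W u); rewrite rinnerNr rnormN.
  by have := sqr_ge0 (rnorm (u - W u)); lra.
have [x0|x0] := eqVneq (rnorm x) 0.
  by rewrite (rnorm0_eq0 x0) p0 !rnorm0.
have {}x0 : 0 < rnorm x by rewrite lt_neqAle eq_sym x0 rnorm_ge0.
have xV : `|(rnorm x)^-1| = (rnorm x)^-1 by rewrite ger0_norm // invr_ge0 ltW.
have := unit_case ((rnorm x)^-1%:C%C *: x); rewrite pZ !rnormZr xV mulVf ?gt_eqF //.
by move=> /(_ (lexx _)); rewrite mulrC ler_pdivrMr // mul1r.
Qed.

End RepContractive.

(** * Schur's lemma *)

Section Schur.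
Variables (R : realType) (A : cstarType R) (K : hilbertType R) (pi : A -> bop K).
Hypothesis ph : star_hom pi.
Hypothesis pirr : irreducible_rep pi.
Implicit Types (h X : bop K).

Lemma rclosed_ker X : closed [set u : K | X u = 0].
Proof.
apply/closed_rclosed => f fP /=; apply: rnorm0_eq0; apply/eqP; rewrite eq_le rnorm_ge0 andbT.
apply: (@ler_eps _ _ _ (rnorm X)) => [|e /fP[u uT fu]]; first exact: rnorm_ge0.
have -> : X f = X (f - u) by rewrite bopDr bopNr uT subr0.
by apply: le_trans (rnorm_bop_le _ _) _; rewrite add0r ler_wpM2l ?rnorm_ge0.
Qed.

Lemma commutant_ker X : (forall a, X * pi a = pi a * X) -> X = 0 \/ forall u, X u = 0 -> u = 0.
Proof.
move=> Xc; have [_ irr] := pirr.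
have [||||V0|VT] := irr [set u : K | X u = 0].
- exact: rclosed_ker.
- exact: bop0.
- by move=> c x y /= x0 y0; rewrite bop_linear x0 y0 scaler0 addr0.
- by move=> a x /= x0; rewrite -bopME Xc bopME x0 bop0.
- by right=> u Xu; have : [set u : K | X u = 0] u by []; rewrite V0.
- by left; apply: bopP => u; have : [set u : K | X u = 0] u by rewrite VT.
Qed.

(** For real l let p be the absolute value of h - l. Then p - (h - l) and p + (h - l) have product 0
    and the former commutes with pi, so irreducibility gives h >= l or h <= l. Hence the form of h
    takes one value on unit vectors. *)
Lemma schur_sa h : sa h -> (forall a, h * pi a = pi a * h) -> exists l : R, h = l%:B.
Proof.
move=> hs hc.
have dicho (l : R) : psd (h - l%:B) \/ psd (l%:B - h).
  have ls : sa (h - l%:B) by rewrite /sa starB hs starZr star1.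
  have [p [pp _ pq _ pc]] := abs_ex (csT K) I I ls.
  have hlc a : (h - l%:B) * pi a = pi a * (h - l%:B).
    by rewrite mulrBl mulrBr hc bopZAl bopZAr mul1r mulr1.
  have pca a : p * pi a = pi a * p by apply/esym/pc; rewrite hlc.
  have hp : (h - l%:B) * p = p * (h - l%:B) by apply: pc.
  have [|E|E] := @commutant_ker (p - (h - l%:B)).
  - by move=> a; rewrite mulrBl [RHS]mulrBr pca hlc.
  - by left; have <- : p = h - l%:B by apply/eqP; rewrite -subr_eq0 E.
  - right; have <- : p = l%:B - h; last by [].
    apply/eqP; rewrite -subr_eq0; apply/eqP; rewrite opprB; apply: bopP => u; apply: E.
    rewrite -bopME; have -> : (p - (h - l%:B)) * (p + (h - l%:B)) = 0.
      move: (h - l%:B) pq hp => q pq hp.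
      by rewrite mulrBl !mulrDr pq hp [q * q + _]addrC subrr.
    by [].
have [[a [u u0]] _] := pirr.
have un0 : 0 < rnorm u ^+ 2.
  rewrite exprn_gt0 // lt_neqAle rnorm_ge0 andbT eq_sym; apply/eqP => /rnorm0_eq0 E.
  by apply: u0; rewrite E bop0.
pose l := rinner (h u) u / rnorm u ^+ 2.
have lE : rinner (h u) u = l * rnorm u ^+ 2 by rewrite /l divfK // gt_eqF.
have scalE (m : R) v : rinner ((m%:B : bop K) v) v = m * rnorm v ^+ 2.
  by rewrite bopZE bop1E rinnerZl rinnerE.
have up v : rinner (h v) v <= l * rnorm v ^+ 2.
  apply: (@ler_eps _ _ _ (rnorm v ^+ 2)) => [|e e0]; first exact: sqr_ge0.
  have [[_ /(_ u)]|[_ /(_ v)]] := dicho (l + e); rewrite bopDE bopNE rinnerDl rinnerNl scalE.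
    by rewrite lE; have := mulr_gt0 e0 un0; lra.
  lra.
have lo v : l * rnorm v ^+ 2 <= rinner (h v) v.
  apply: (@ler_eps _ _ _ (rnorm v ^+ 2)) => [|e e0]; first exact: sqr_ge0.
  have [[_ /(_ v)]|[_ /(_ u)]] := dicho (l - e); rewrite bopDE bopNE rinnerDl rinnerNl scalE.
    lra.
  by rewrite lE; have := mulr_gt0 e0 un0; lra.
exists l; apply/eqP; rewrite -subr_eq0; apply/eqP.
have sl : sa (h - l%:B) by rewrite /sa starB hs starZr star1.
apply: psd_anti; split=> //.
- by move=> v; rewrite bopDE bopNE rinnerDl rinnerNl scalE; have := lo v; lra.
- by rewrite opprB /sa starB hs starZr star1.
- by move=> v; rewrite opprB bopDE bopNE rinnerDl rinnerNl scalE; have := up v; lra.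
Qed.

Lemma schur X : (forall a, X * pi a = pi a * X) -> exists l : R[i], X = l%:I.
Proof.
move=> Xc; have [_ _ ps] := ph.
have Xc' a : star X * pi a = pi a * star X.
  by have := congr1 star (Xc (star a)); rewrite !starM_ ps starK => ->.
have [||l lE] := @schur_sa (X + star X).
- by rewrite /sa starD_ starK addrC.
- by move=> a; rewrite mulrDl mulrDr Xc Xc'.
have [||m mE] := @schur_sa ('i%C *: (X - star X)).
- by rewrite /sa starZ_ conjci starB starK scaleNr -scalerN opprB.
- by move=> a; rewrite bopZAl bopZAr mulrBl mulrBr Xc Xc'.
exists ((2^-1)%:C%C * (l%:C%C - 'i%C * m%:C%C)).
have X2 : X - star X = (- ('i%C * m%:C%C)) *: (1 : bop K).
  by rewrite scaleNr -scalerA -mE scalerA -expr2 sqr_i scaleN1r opprK.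
rewrite -scalerA scalerDl -X2 -lE addrACA subrr addr0 scalerDr -scalerDl -rmorphD /=.
have -> : 2^-1 + 2^-1 = 1 :> R by lra.
by rewrite scale1r.
Qed.

End Schur.

(** * Finite powers of a Hilbert space and the density theorem *)

Section Amplification.
Variables (R : realType) (K : hilbertType R) (I : finType).
Implicit Types (u v w : I -> K) (D : set (I -> K)).

Definition ainner u v : R := \sum_k rinner (u k) (v k).

Lemma ainnerC u v : ainner u v = ainner v u.
Proof. by apply: eq_bigr => k _; exact: rinnerC. Qed.

Lemma ainnerDl u v w : ainner (u + v) w = ainner u w + ainner v w.
Proof. by rewrite /ainner -big_split; apply: eq_bigr => k _; exact: rinnerDl. Qed.

Lemma ainnerZl (a : R) u w : ainner (a%:C%C *: u) w = a * ainner u w.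
Proof. by rewrite /ainner mulr_sumr; apply: eq_bigr => k _; exact: rinnerZl. Qed.

Lemma ainnerNl u w : ainner (- u) w = - ainner u w.
Proof. by rewrite /ainner -sumrN; apply: eq_bigr => k _; exact: rinnerNl. Qed.

Lemma ainner_ge0 u : 0 <= ainner u u.
Proof. by apply: sumr_ge0 => k _; rewrite rinnerE sqr_ge0. Qed.

Lemma rnorm_ainner u k : rnorm (u k) ^+ 2 <= ainner u u.
Proof.
rewrite /ainner (bigD1 k) //= rinnerE lerDl; apply: sumr_ge0 => j _.
by rewrite rinnerE sqr_ge0.
Qed.

Lemma ainner_eq0 u : ainner u u = 0 -> u = 0.
Proof.
move=> u0; apply/funext => k; apply: rnorm0_eq0; apply/eqP.
by rewrite -sqrf_eq0 eq_le sqr_ge0 andbT -u0 rnorm_ainner.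
Qed.

Definition aclosure D u := forall e : R, 0 < e ->
  exists s, D s /\ forall k, rnorm (u k - s k) <= e.

Lemma aclosure_sub D u : D u -> aclosure D u.
Proof. by move=> Du e e0; exists u; split=> // k; rewrite subrr rnorm0 ltW. Qed.

Lemma aclosure_lin D (c : R[i]) : (forall u v, D u -> D v -> D (c *: u + v)) ->
  forall u v, aclosure D u -> aclosure D v -> aclosure D (c *: u + v).
Proof.
move=> Dl u v Du Dv e e0; have c1 : 0 < cabs c + 1 by rewrite ltr_wpDl ?cabs_ge0.
have [s [Ds us]] := Du _ (divr_gt0 e0 c1).
have [t [Dt vt]] := Dv (e / (cabs c + 1)) (divr_gt0 e0 c1).
exists (c *: s + t); split=> [|k]; first exact: Dl.
have -> : (c *: u + v) k - (c *: s + t) k = c *: (u k - s k) + (v k - t k).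
  by rewrite scalerBr opprD addrACA.
apply: le_trans (rnormD _ _) _; rewrite rnormZc.
have : cabs c * rnorm (u k - s k) <= cabs c * (e / (cabs c + 1)).
  by rewrite ler_wpM2l ?cabs_ge0.
have := vt k; have : e = (cabs c + 1) * (e / (cabs c + 1)) by rewrite mulrC divfK ?gt_eqF.
lra.
Qed.

Lemma aclosure_proj D : D 0 ->
  (forall (a : R) u v, D u -> D v -> D (a%:C%C *: u + v)) ->
  forall x, exists2 y, aclosure D y & forall w, aclosure D w -> ainner (x - y) w = 0.
Proof.
move=> D0 Dl; apply: form_proj.
- exact: ainnerDl.
- exact: ainnerZl.
- exact: ainnerC.
- exact: ainner_ge0.
- exact: aclosure_sub.
- by move=> a; apply: aclosure_lin; exact: Dl.
move=> u Du uC.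
have uC' i j k : (j <= k)%N -> rnorm (u k i - u j i) <= 2^-1 ^+ j.
  move=> jk; rewrite -(ler_pXn2r (n := 2)) ?nnegrE ?rnorm_ge0 ?exprn_ge0 ?invr_ge0 //.
  apply: le_trans (rnorm_ainner (u k - u j) i) _; apply: le_trans (uC j k jk) _.
  by rewrite -exprM mulnC exprM (_ : 2^-1 ^+ 2 = 4^-1 :> R) //; field.
have /choice[l lP] i := geom_cvg (uC' i).
have lim_le (e : R) : 0 < e -> exists N, forall k, (N <= k)%N -> forall i, rnorm (u k i - l i) <= e.
  move=> e0; have /choice[N NP] i := lP i e e0; exists (\max_i N i) => k Nk i.
  by apply: NP; apply: leq_trans Nk; exact: leq_bigmax.
exists l => [e e0|e e0].
  have e20 : 0 < e / 2 by rewrite divr_gt0.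
  have [N NP] := lim_le _ e20; have [s [Ds us]] := Du N _ e20; exists s; split=> // k.
  apply: le_trans (rdistD (u N k) _ _) _; rewrite rdistC.
  by have := NP N (leqnn N) k; have := us k; lra.
have I0 : 0 < (#|I|%:R + 1 : R) by rewrite ltr_wpDl.
have s0 : 0 < Num.sqrt (e / (#|I|%:R + 1)) by rewrite sqrtr_gt0 divr_gt0.
have [N NP] := lim_le _ s0; exists N => k Nk.
apply: (@le_trans _ _ (\sum_(i : I) (e / (#|I|%:R + 1)))).
  apply: ler_sum => i _; rewrite rinnerE -[leRHS]sqr_sqrtr; last by rewrite divr_ge0 ?ltW.
  by rewrite ler_pXn2r ?nnegrE ?rnorm_ge0 ?sqrtr_ge0 // NP.
rewrite sumr_const -[X in X <= _]mulr_natr mulrAC ler_pdivrMr // ler_pM2l //.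
by rewrite lerDl.
Qed.

End Amplification.

Section Density.
Variables (R : realType) (A : cstarType R) (K : hilbertType R) (pi : A -> bop K).
Hypothesis ph : star_hom pi.
Hypothesis pirr : irreducible_rep pi.

Lemma irreducible_nondegenerate (v : K) : (forall a, pi a v = 0) -> v = 0.
Proof.
move=> v0; have [[a [x ax]] irr] := pirr.
have [||||V0|VT] := irr [set u : K | forall a, pi a u = 0].
- have -> : [set u : K | forall a, pi a u = 0] = \bigcap_(a in [set: A]) [set u | pi a u = 0].
    by apply/seteqP; split=> u /= h; [move=> b _; exact: h|move=> b; exact: h].
  by apply: closed_bigI => b _; exact: rclosed_ker.
- by move=> b; rewrite bop0.
- by move=> c u w u0 w0 b; rewrite bop_linear u0 w0 scaler0 addr0.
- by move=> b u u0 c; have [_ pM _] := ph; have := u0 (cmul c b); rewrite pM bopME.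
- by have : [set u : K | forall a, pi a u = 0] v by []; rewrite V0.
- by have : [set u : K | forall a, pi a u = 0] x; [rewrite VT|move=> /(_ a)].
Qed.

Variable I : finType.
Implicit Types (a b u v w : I -> K).

(* The projection onto the closure of the orbit of [a] commutes with [pi], so its matrix
   entries are scalars by Schur's lemma, and it commutes with every operator. *)
Lemma density a b : (forall t, \sum_k inner (pi t (a k)) (b k) = 0) ->
  forall X : bop K, \sum_k inner (X (a k)) (b k) = 0.
Proof.
move=> ab X; have [pl pM ps] := ph.
have pi0 : pi 0 = 0 by have := pl (-1) 0 0; rewrite scaler0 addr0 scaleN1r addNr.
pose D := [set u | exists t, u = fun k => pi t (a k)].
have D0 : D 0 by exists 0; apply/funext => k; rewrite pi0 bop0E.
have Dl (c : R[i]) u v : D u -> D v -> D (c *: u + v).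
  by move=> [t ->] [t' ->]; exists (c *: t + t'); apply/funext => k; rewrite pl bopDE bopZE.
have /choice[p pP] : forall x, exists y, aclosure D y /\ forall w, aclosure D w -> ainner (x - y) w = 0.
  by move=> x; have [y] := aclosure_proj D0 (fun c => @Dl _) x; exists y.
have WB u v : aclosure D u -> aclosure D v -> aclosure D (u - v).
  by move=> Du Dv; rewrite addrC -scaleN1r; apply: aclosure_lin => //; exact: Dl.
have p_uniq x y : aclosure D y -> (forall w, aclosure D w -> ainner (x - y) w = 0) -> p x = y.
  move=> Wy yP; have [Wp pxP] := pP x; apply/eqP; rewrite -subr_eq0; apply/eqP/ainner_eq0.
  have Wd := WB _ _ Wp Wy.
  have {1}-> : p x - y = (x - y) - (x - p x) by rewrite opprB [RHS]addrC addrA subrK.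
  by rewrite ainnerDl ainnerNl yP // pxP // subrr.
have Di u : aclosure D u -> aclosure D ((('i%C)^*)%C *: u).
  move=> Du; rewrite -[_ *: u]addr0; apply: aclosure_lin => //; first exact: Dl.
  exact: aclosure_sub.
have p_lin (c : R[i]) x y : p (c *: x + y) = c *: p x + p y.
  have [Wx xP] := pP x; have [Wy yP] := pP y.
  apply: p_uniq => [|w Ww]; first by apply: aclosure_lin => //; exact: Dl.
  have -> : c *: x + y - (c *: p x + p y) = c *: (x - p x) + (y - p y).
    by rewrite opprD scalerBr addrACA.
  rewrite ainnerDl yP // addr0.
  have <- : ainner (x - p x) ((c^*)%C *: w) = ainner (c *: (x - p x)) w.
    by apply: eq_bigr => k _; rewrite /rinner innerZr innerZl conjcK.
  apply: xP; rewrite -[_ *: w]addr0; apply: aclosure_lin => //; first exact: Dl.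
  exact: aclosure_sub.
have pN x i : rnorm (p x i) ^+ 2 <= ainner x x.
  have [Wx xP] := pP x; apply: le_trans (rnorm_ainner (p x) i) _.
  have -> : ainner x x = ainner (x - p x + p x) (x - p x + p x) by rewrite subrK.
  move: (x - p x) xP => z zP; move: (p x) Wx => y Wy.
  rewrite ainnerDl (ainnerC z) (ainnerC y) !ainnerDl (ainnerC y z) (zP _ Wy).
  by rewrite addr0 add0r lerDr ainner_ge0.
pose act t u : I -> K := fun k => pi t (u k).
have Wact t u : aclosure D u -> aclosure D (act t u).
  move=> Wu e e0; have t1 : 0 < rnorm (pi t) + 1 by rewrite ltr_wpDl ?rnorm_ge0.
  have [s [[t' ->] us]] := Wu _ (divr_gt0 e0 t1).
  exists (fun k => pi (cmul t t') (a k)); split=> [|k]; first by exists (cmul t t').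
  rewrite pM bopME -bopNr -bopDr; apply: le_trans (rnorm_bop_le _ _) _.
  have := us k; rewrite ler_pdivlMr // mulrDr mulr1 mulrC.
  by have := rnorm_ge0 (u k - pi t' (a k)); lra.
have pact t u : p (act t u) = act t (p u).
  have [Wu uP] := pP u; apply: p_uniq => [|w Ww]; first exact: Wact.
  rewrite -(uP (act (star t) w)); last exact: Wact.
  apply: eq_bigr => k _; rewrite /act ps -[RHS]rinnerC rstarS rinnerC.
  by rewrite bopDr bopNr.
pose delta j x : I -> K := fun k => if k == j then x else 0.
have delta_lin j (c : R[i]) x y : delta j (c *: x + y) = c *: delta j x + delta j y.
  apply/funext => k; rewrite /delta /=; change ((if k == j then c *: x + y else 0) =
    c *: (if k == j then x else 0) + (if k == j then y else 0)).
  by case: ifP => // _; rewrite scaler0 addr0.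
have delta_norm j x : ainner (delta j x) (delta j x) = rnorm x ^+ 2.
  rewrite /ainner (bigD1 j) //= big1 => [|k kj]; first by rewrite /delta eqxx addr0 rinnerE.
  by rewrite /delta (negPf kj) rinnerE rnorm0 expr0n.
have qb i j : (fun x => p (delta j x) i) \in @bounded_op R K.
  apply/asboolP; split=> [c x y|]; first by rewrite delta_lin p_lin.
  exists 1 => x; rewrite mul1r -(ler_pXn2r (n := 2)) ?nnegrE ?rnorm_ge0 //.
  by rewrite -(delta_norm j x); exact: pN.
have /choice[c cP] : forall ij : I * I, exists c : R[i], Bop (qb ij.1 ij.2) = c *: (1 : bop K).
  move=> [i j] /=; apply: (schur ph pirr) => t; apply: bopP => x; rewrite !bopME /=.
  have -> : delta j (pi t x) = act t (delta j x).
    by apply/funext => k; rewrite /act /delta; case: ifP => // _; rewrite bop0.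
  by rewrite pact.
have pE u i : p u i = \sum_j c (i, j) *: u j.
  have pD x y : p (x + y) = p x + p y by rewrite -[x]scale1r p_lin !scale1r.
  have p0 : p 0 = 0 by have := p_lin (-1) 0 0; rewrite scaler0 addr0 scaleN1r addNr.
  have uE : u = \sum_j delta j (u j).
    apply/funext => k; rewrite fct_sumE (bigD1 k) //= /delta eqxx big1 ?addr0 // => j jk.
    by rewrite eq_sym (negPf jk).
  rewrite {1}uE (big_morph p pD p0) fct_sumE; apply: eq_bigr => j _.
  by have /(congr1 (fun T : bop K => T (u j))) := cP (i, j).
(* The family a lies in the closure of its own orbit: p fixes every [act t a], and the
   representation is nondegenerate. *)
have pa i : p a i = a i.
  apply/eqP; rewrite eq_sym -subr_eq0; apply/eqP/irreducible_nondegenerate => t.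
  have : p (act t a) = act t a.
    apply: p_uniq => [|w _]; first by apply: aclosure_sub; exists t.
    by rewrite subrr /ainner big1 // => k _; rewrite /rinner inner0l.
  by rewrite pact => /(congr1 (fun f => f i)) E; rewrite bopDr bopNr [X in _ - X]E subrr.
have XaW : aclosure D (fun k => X (a k)).
  have -> : (fun k => X (a k)) = p (fun k => X (a k)); last by have [] := pP (fun k => X (a k)).
  by apply/funext => k; rewrite pE -{1}[a k]pa pE bop_sumr; apply: eq_bigr => j _; rewrite bopZr.
apply: cabs_eq0; apply/eqP; rewrite eq_le cabs_ge0 andbT.
apply: (@ler_eps _ _ _ (\sum_k rnorm (b k))) => [|e e0].
  by apply: sumr_ge0 => k _; exact: rnorm_ge0.
have [s [[t ->] st]] := XaW e e0; rewrite add0r.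
have -> : \sum_k inner (X (a k)) (b k) = \sum_k inner (X (a k) - pi t (a k)) (b k).
  rewrite -[LHS]subr0 -[X in _ - X](ab t) -sumrB; apply: eq_bigr => k _.
  by rewrite innerDl innerNl.
rewrite mulr_suml.
elim/big_rec2: _ => [|k x y _ IH]; first by rewrite /cabs normr0.
apply: le_trans (cabsD _ _) _; rewrite lerD //.
by apply: le_trans (cabs_inner_le _ _) _; rewrite mulrC ler_wpM2l ?rnorm_ge0.
Qed.

End Density.

Section SelfAdjointDensity.
Variables (R : realType) (A : cstarType R) (K : hilbertType R) (pi : A -> bop K).
Hypothesis ph : star_hom pi.
Hypothesis pirr : irreducible_rep pi.

(* A real-linear functional vanishing on the self-adjoint elements is symmetrized to a
   complex-linear one, to which [density] applies. *)
Lemma sa_density (I : finType) (e : I -> K) (h : bop K) (eps : R) : sa h -> 0 < eps ->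
  exists t : A, star t = t /\ forall k, rnorm (h (e k) - pi t (e k)) <= eps.
Proof.
move=> hs; have [pl pM ps] := ph.
have pi0 : pi 0 = 0 by have := pl (-1) 0 0; rewrite scaler0 addr0 scaleN1r addNr.
pose D := [set u : I -> K | exists t, star t = t /\ u = fun k => pi t (e k)].
have star0' : star 0 = 0 :> A by have := starZ 0 (0 : A); rewrite scale0r conjc0 scale0r.
have starN' (y : A) : star (- y) = - star y by rewrite -scaleN1r starZ rmorphN1 scaleN1r.
have D0 : D 0 by exists 0; split=> //; apply/funext => k; rewrite pi0 bop0E.
have Dl (c : R) u v : D u -> D v -> D (c%:C%C *: u + v).
  move=> [t [ts ->]] [t' [ts' ->]]; exists (c%:C%C *: t + t'); split.
    by rewrite starD starZ ts ts' conjc_real.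
  by apply/funext => k; rewrite pl bopDE bopZE.
pose x k := h (e k); have [y Dy yP] := aclosure_proj D0 Dl x.
pose b := x - y.
(* Doubling the index set: for self-adjoint T the pairing becomes z(T) plus its conjugate, twice a
   real pairing that vanishes on [pi t] for self-adjoint t. By linearity it vanishes on all
   [pi t]. *)
pose a2 (i : I + I) := match i with inl k => e k | inr k => b k end.
pose b2 (i : I + I) := match i with inl k => b k | inr k => e k end.
pose z (T : bop K) := \sum_k inner (T (e k)) (b k).
have Re_z T : complex.Re (z T) = ainner (fun k => T (e k)) b.
  rewrite /z (big_morph (@complex.Re R) (@Re_add R) (erefl : complex.Re 0 = 0)).
  by apply: eq_bigr.
have Fz T : sa T -> \sum_i inner (T (a2 i)) (b2 i) = z T + ((z T)^*)%C.
  move=> Ts; rewrite big_sumType /=; congr (_ + _); rewrite /z rmorph_sum.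
  by apply: eq_bigr => k _; rewrite -{1}Ts starS inner_conj.
have addJ (c : R[i]) : c + (c^*)%C = (2 * complex.Re c)%:C%C.
  by case: c => p q; apply/eqP; rewrite eq_complex /=; apply/andP; split; apply/eqP; ring.
have Fsa t : star t = t -> \sum_i inner (pi t (a2 i)) (b2 i) = 0.
  move=> ts; rewrite Fz; last by rewrite /sa -ps ts.
  rewrite addJ Re_z ainnerC yP ?mulr0 //.
  by apply: aclosure_sub; exists t.
have F0 t : \sum_i inner (pi t (a2 i)) (b2 i) = 0.
  pose t1 := t + star t; pose t2 := 'i%C *: (t - star t).
  have t1s : star t1 = t1 by rewrite starD starK addrC.
  have t2s : star t2 = t2.
    rewrite starZ conjci scaleNr -scalerN; congr (_ *: _).
    by rewrite starD starN' starK opprD opprK addrC.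
  have tE : t = (2^-1)%:C%C *: t1 + (- ((2^-1)%:C%C * 'i%C)) *: t2.
    rewrite scalerA mulNr -mulrA -expr2 sqr_i mulrN1 opprK -scalerDr.
    rewrite addrACA subrr addr0 scalerDr -scalerDl -rmorphD /=.
    have -> : 2^-1 + 2^-1 = 1 :> R by lra.
    by rewrite scale1r.
  rewrite tE pl; under eq_bigr => i _ do rewrite bopDE bopZE innerDl innerZl.
  rewrite big_split /= -mulr_sumr Fsa // mulr0 add0r.
  have -> : pi (- ((2^-1)%:C%C * 'i%C) *: t2) = - ((2^-1)%:C%C * 'i%C) *: pi t2.
    by rewrite -[X in pi X]addr0 pl pi0 addr0.
  under eq_bigr => i _ do rewrite bopZE innerZl.
  by rewrite -mulr_sumr Fsa // mulr0.
have := density ph pirr F0 h; rewrite Fz // addJ Re_z => /complexI/eqP.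
rewrite mulf_eq0 pnatr_eq0 /= => /eqP hb.
have b0 : b = 0.
  apply: ainner_eq0; have -> : ainner b b = ainner x b - ainner b y.
    by rewrite (ainnerC b y) -ainnerNl -ainnerDl.
  by rewrite hb yP // subrr.
have xy : x = y by apply/eqP; rewrite -subr_eq0 -/b b0.
move=> eps0; have [s [[t [ts ->]] xt]] := Dy eps eps0; exists t; split=> // k.
by have := xt k; rewrite -xy.
Qed.

End SelfAdjointDensity.

(** * Kaplansky's cutoff *)

Section Kaplansky.
Variables (R : realType) (H : hilbertType R).

(* [w = 2t (1 + t^2)^-1], the Cayley-type cutoff in Kaplansky's density theorem. *)
Lemma kaplansky (S : csubalg (bop H)) (t : csub_alg S) : star t = t ->
  exists w : csub_alg S, rnorm w <= 1 /\ 2 *: t = w + cmul t (cmul t w).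
Proof.
move=> ts; have Sc := csubP S; have A1c := adj1_csubalg Sc.
have [T TE] : exists T, T = csub_val t by eexists.
have ST : csub_set S T by rewrite TE; exact: csub_in.
have Ts : sa T by rewrite TE; exact: (congr1 (@csub_val _ _ S) ts).
have [c cE] : exists c, c = 1 + T * T by eexists.
have cs : sa c by rewrite /sa cE starD_ starM_ Ts star1.
have cp : psd (c - 1%:B) by rewrite cE scale1r addrC addKr; exact: psd_sqr.
have Ac : adj1 S c.
  by rewrite cE; apply: csD => //; [exact: adj1_1|apply: csM => //; exact: adj1_sub].
have [d [cd dc Ad _ _]] := psd_inv A1c (adj1_1 Sc) Ac ltr01 cs cp.
have cT : c * T = T * c by rewrite cE mulrDl mulrDr mul1r mulr1 mulrA.
have dT : d * T = T * d.
  have : d * T * (c * d) = d * (c * T) * d by rewrite cT !mulrA.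
  by rewrite cd mulr1 mulrA dc mul1r.
have [w wE] : exists w, w = 2 *: (d * T) by eexists.
have Sw : csub_set S w by rewrite wE; apply: csZ => //; exact: adj1_mull.
have cw : 2 *: T = w + T * (T * w).
  have -> : w + T * (T * w) = c * w by rewrite cE mulrDl mul1r mulrA.
  by rewrite wE bopZAr !mulrA cd mul1r.
exists (celt Sw); split; last first.
  by apply: val_inj; change (2 *: csub_val t = w + csub_val t * (csub_val t * w)); rewrite -TE.
rewrite csub_rnorm /=; apply: rnorm_bop_leP => // u; rewrite mul1r.
have [v vE] : exists v, v = d u by eexists.
have -> : w u = 2%:C%C *: T v by rewrite wE bopZE bopME -bopME dT bopME vE rmorph_nat.
have -> : u = v + T (T v).
  have : (c * d) u = v + T (T v) by rewrite cE mulrDl mul1r bopDE -mulrA !bopME vE.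
  by rewrite cd bop1E.
(* |v + T^2 v|^2 = |v|^2 + 2 |T v|^2 + |T^2 v|^2 >= 4 |T v|^2, because |T v|^2 = <v, T^2 v>. *)
rewrite -(ler_pXn2r (n := 2)) ?nnegrE ?rnorm_ge0 // rnormZr exprMn rnormD_sqr -(saS _ _ Ts) rinnerE.
have h : rnorm (T v) ^+ 2 <= rnorm v * rnorm (T (T v)).
  by rewrite -rinnerE saS // rinner_le.
have := sqr_ge0 (rnorm v - rnorm (T (T v))); rewrite (ger0_norm (ler0n R 2)).
by move: h; rewrite !expr2; lra.
Qed.

Lemma kaplansky_near (tau W : bop H) (v f g : H) (e : R) : sa tau ->
  2 *: tau = W + tau * (tau * W) -> rnorm (f - tau v) <= e -> rnorm (f - tau g) <= e ->
  rnorm (g - tau f) <= e -> rnorm (W v - f) <= 4 * e.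
Proof.
move=> ts WE h1 h2 h3; pose y := W v - f.
have yE : y + tau (tau y) = (- (2 *: (f - tau v)) + (f - tau g)) + tau (g - tau f).
  have := congr1 (fun T : bop H => T v) WE; rewrite bopZE bopDE !bopME => Wv.
  have -> : tau (tau y) = 2 *: tau v - W v - tau (tau f).
    by rewrite /y !bopDr !bopNr Wv [W v + _]addrC addrK.
  rewrite bopDr bopNr scalerBr [2 *: f]scaler_nat mulr2n /y.
  move: (W v) (2 *: tau v) (tau (tau f)) (tau g) => p q r s.
  rewrite addrC addrACA subrK opprB -[RHS]addrA (addrA (f - s)) subrK opprD.
  by rewrite !addrA subrK addrAC.
have : rnorm y ^+ 2 + rnorm (tau y) ^+ 2 = rinner (- (2 *: (f - tau v)) + (f - tau g)) y +
    rinner (g - tau f) (tau y).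
  rewrite -!rinnerE -(saS (tau y) y ts) -(saS (g - tau f) y ts) -!rinnerDl.
  by rewrite -yE.
have n1 : rnorm (- (2 *: (f - tau v)) + (f - tau g)) <= 3 * e.
  apply: le_trans (rnormD _ _) _; rewrite rnormN.
  have -> : (2 : R[i]) = (2 : R)%:C%C by rewrite rmorph_nat.
  by rewrite rnormZr ger0_norm //; lra.
have := le_trans (rinner_le (- (2 *: (f - tau v)) + (f - tau g)) y) (ler_wpM2r (rnorm_ge0 y) n1).
have := le_trans (rinner_le (g - tau f) (tau y)) (ler_wpM2r (rnorm_ge0 (tau y)) h3).
have e0 := le_trans (rnorm_ge0 _) h3.
have := rnorm_ge0 y; have := rnorm_ge0 (tau y).
rewrite -/y; move: (rnorm y) (rnorm (tau y)) (rinner _ _) (rinner _ _) => Y Z p q Z0 Y0 hq hp E.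
rewrite leNgt; apply/negP => Y4.
have : 0 < Y ^+ 2 - 3 * e * Y - 4 * e ^+ 2 by nra.
have : 0 <= (Z - e / 2) ^+ 2 by exact: sqr_ge0.
nra.
Qed.

End Kaplansky.

(** * Contractive approximation of matrix units and of words in them *)

Section RankOne.
Variables (R : realType) (K : hilbertType R).
Implicit Types x y u : K.

Lemma ket_bounded x y : (fun u => inner u y *: x) \in @bounded_op R K.
Proof.
apply/asboolP; split=> [c u v|]; first by rewrite innerDl innerZl scalerDl scalerA.
exists (rnorm y * rnorm x) => u; rewrite rnormZc [leRHS]mulrAC ler_wpM2r ?rnorm_ge0 //.
by rewrite [leRHS]mulrC cabs_inner_le.
Qed.

Definition ket x y : bop K := Bop (ket_bounded x y).

Lemma ketE x y u : ket x y u = inner u y *: x. Proof. by []. Qed.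

Lemma star_ket x y : star (ket x y) = ket y x.
Proof.
apply: bopP => u; apply: inner_def => v; congr complex.Re.
by rewrite inner_conj starS -inner_conj !ketE innerZl innerZr -inner_conj mulrC.
Qed.

End RankOne.

Section MatrixUnitApproximation.
Variables (R : realType) (H : hilbertType R) (S : csubalg (bop H)).
Local Notation A := (csub_alg S).
Variables (K : hilbertType R) (pi : A -> bop K) (I : finType) (e : I -> K).
Hypothesis ph : star_hom pi.
Hypothesis pirr : irreducible_rep pi.
Hypothesis e_ortho : forall i j, inner (e i) (e j) = (i == j)%:R.

Lemma ket_basis i j k : ket (e i) (e j) (e k) = if k == j then e i else 0.
Proof. by rewrite ketE e_ortho; case: eqP => _; rewrite ?scale1r ?scale0r. Qed.

(** The self-adjoint substitute for e_ij, as required by [sa_density]. On the basis h^3 = h, so the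
    cutoff nearly preserves it. *)
Let h i j : bop K := if i == j then ket (e i) (e i) else ket (e i) (e j) + ket (e j) (e i).

Let hE i j k : h i j (e k) = if k == j then e i else if k == i then e j else 0.
Proof.
rewrite /h; have [->|ij] := eqVneq i j.
  by rewrite ket_basis; case: eqP.
rewrite bopDE !ket_basis; have [->|kj] := eqVneq k j.
  by rewrite eq_sym (negPf ij) addr0.
by rewrite add0r.
Qed.

Let h_near i j (eps : R) : 0 < eps -> exists w : A, rnorm w <= 1 /\
  forall k, rnorm (pi w (e k) - h i j (e k)) <= eps.
Proof.
move=> eps0; have e40 : 0 < eps / 4 by rewrite divr_gt0.
have hs : sa (h i j).
  by rewrite /h /sa; case: eqP => _; rewrite ?starD_ !star_ket // addrC.
have [t [ts tP]] := sa_density ph pirr e hs e40.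
have [w [w1 wE]] := kaplansky ts; exists w; split=> // k.
have [pl pM ps] := ph.
have p0 : pi 0 = 0 by have := pl (-1) 0 0; rewrite scaler0 addr0 scaleN1r addNr.
have pE : 2 *: pi t = pi w + pi t * (pi t * pi w).
  have pZ c y : pi (c *: y) = c *: pi y by rewrite -[c *: y]addr0 pl p0 addr0.
  have pD y z : pi (y + z) = pi y + pi z by rewrite -[y]scale1r pl !scale1r.
  by rewrite -pZ wE pD !pM.
have ts' : sa (pi t) by rewrite /sa -ps ts.
have -> : eps = 4 * (eps / 4) by rewrite mulrC divfK ?pnatr_eq0.
have tP0 : rnorm (h i j 0 - pi t 0) <= eps / 4 by rewrite !bop0 subrr rnorm0 ltW.
have tPh l : rnorm (h i j (h i j (e l)) - pi t (h i j (e l))) <= eps / 4.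
  by rewrite [h i j (e l)]hE; do 2?[case: ifP => _].
have h3 : h i j (h i j (h i j (e k))) = h i j (e k).
  have hj : h i j (e j) = e i by rewrite hE eqxx.
  have hi : h i j (e i) = e j.
    by rewrite hE; have [->|_] := eqVneq i j; rewrite ?eqxx.
  rewrite [h i j (e k)]hE; case: ifP => _; first by rewrite hi hj.
  by case: ifP => _; [rewrite hj hi|rewrite !bop0].
apply: (@kaplansky_near _ _ (pi t) (pi w) (e k) (h i j (e k)) (h i j (h i j (e k)))) => //.
rewrite -{1}h3 [h i j (e k)]hE; case: ifP => _; first exact: tPh.
by case: ifP => _; [exact: tPh|rewrite !bop0 subrr rnorm0 ltW].
Qed.

(** e_ij is the product of e_ii with the self-adjoint operator attached to i and j. *)
Lemma matrix_unit_near i j (eps : R) : 0 < eps -> exists w : A, rnorm w <= 1 /\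
  forall k, rnorm (pi w (e k) - ket (e i) (e j) (e k)) <= eps.
Proof.
move=> eps0; have e20 : 0 < eps / 2 by rewrite divr_gt0.
have [u [u1 uP]] := h_near i i e20; have [v [v1 vP]] := h_near i j e20.
exists (cmul u v); split=> [|k]; first by have := cnormM u1 v1; rewrite mulr1.
have [pl pM ps] := ph; rewrite pM bopME; apply: le_trans (rdistD (pi u (h i j (e k))) _ _) _.
rewrite [eps in leRHS]splitr; apply: lerD.
  rewrite -bopNr -bopDr; apply: le_trans (rnorm_bop_le _ _) _.
  have pu1 : rnorm (pi u) <= 1 by apply: le_trans (star_hom_contractive ph u) u1.
  by apply: le_trans (ler_wpM2r (rnorm_ge0 _) pu1) _; rewrite mul1r.
have -> : ket (e i) (e j) (e k) = h i i (h i j (e k)).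
  rewrite ket_basis hE; have [_|kj] := eqVneq k j; first by rewrite hE eqxx.
  have [ki|ki] := eqVneq k i; last by rewrite bop0.
  by rewrite hE; case: eqP => // ji; case/negP: kj; apply/eqP; congruence.
rewrite hE; do 2?[case: ifP => _] => //.
by rewrite !bop0 subrr rnorm0 ltW.
Qed.

End MatrixUnitApproximation.

Section WordApproximation.
Variables (R : realType) (K : hilbertType R) (I : finType) (e : I -> K).
Hypothesis e_ortho : forall i j, inner (e i) (e j) = (i == j)%:R.
Variables (X Y : nat -> bop K) (p q : nat -> I * I) (eps : R).
Hypothesis X1 : forall k, rnorm (X k) <= 1.
Hypothesis Y1 : forall k, rnorm (Y k) <= 1.
Hypothesis X_near : forall k j, rnorm (X k (e j) - ket (e (p k).1) (e (p k).2) (e j)) <= eps.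
Hypothesis Y_near : forall k j, rnorm (Y k (e j) - ket (e (q k).1) (e (q k).2) (e j)) <= eps.

Let P k := ket (e (p k).1) (e (p k).2).
Let Q k := ket (e (q k).1) (e (q k).2).

(** Closeness is known only on the vectors e_j. This suffices because a matrix unit sends each e_j
    to some e_i or to 0. *)
Lemma cword_units k j : rnorm (cword X Y k (e j) - cword P Q k (e j)) <= (2 * k%:R + 1) * eps.
Proof.
have eps0 : 0 <= eps by apply: le_trans (rnorm_ge0 _) (X_near 0%N j).
elim: k j => [|k IH] j; first by rewrite mulr0 add0r mul1r; exact: Y_near.
change (rnorm ((cword X Y k * X k * Y k.+1) (e j) - (cword P Q k * P k * Q k.+1) (e j)) <=
  (2 * k.+1%:R + 1) * eps).
rewrite !bopME; have W1 := cword_norm k X1 Y1.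
have contr (T : bop K) u (d : R) : rnorm T <= 1 -> rnorm u <= d -> rnorm (T u) <= d.
  move=> T1 ud; apply: le_trans (rnorm_bop_le _ _) _.
  by apply: le_trans (ler_wpM2r (rnorm_ge0 _) T1) _; rewrite mul1r.
apply: le_trans (rdistD (cword X Y k (X k (Q k.+1 (e j)))) _ _) _.
have h1 : rnorm (cword X Y k (X k (Y k.+1 (e j))) - cword X Y k (X k (Q k.+1 (e j)))) <= eps.
  by rewrite -bopNr -bopDr; apply: (contr) => //; rewrite -bopNr -bopDr; apply: (contr).
have h2 : rnorm (cword X Y k (X k (Q k.+1 (e j))) - cword X Y k (P k (Q k.+1 (e j)))) <= eps.
  rewrite -bopNr -bopDr; apply: (contr) => //.
  by rewrite ket_basis //; case: ifP => _; rewrite ?bop0 ?subrr ?rnorm0.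
have h3 : rnorm (cword X Y k (P k (Q k.+1 (e j))) - cword P Q k (P k (Q k.+1 (e j)))) <= (2 * k%:R + 1) * eps.
  have z0 : 0 <= (2 * k%:R + 1) * eps by rewrite mulr_ge0 // addr_ge0 ?mulr_ge0.
  have Pe i : rnorm (cword X Y k (P k (e i)) - cword P Q k (P k (e i))) <= (2 * k%:R + 1) * eps.
    by rewrite ket_basis //; case: ifP => _; rewrite ?bop0 ?subrr ?rnorm0.
  by rewrite [Q k.+1 (e j)]ket_basis //; case: ifP => _ //; rewrite !bop0 subrr rnorm0.
have := le_trans (rdistD (cword X Y k (P k (Q k.+1 (e j)))) _ _) (lerD h2 h3).
by move: h1; rewrite -[k.+1%:R]natr1; move: (rnorm _) (rnorm _) => *; lra.
Qed.

End WordApproximation.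

Section OrthonormalFamily.
Variables (R : realType) (K : hilbertType R).

Lemma orthonormal_family n : ~ dim_le n K ->
  exists e : 'I_n.+1 -> K, forall i j, inner (e i) (e j) = (i == j)%:R.
Proof.
move=> nK; suff [e eP] : exists e : nat -> K, forall i j, (i < n.+1)%N -> (j < n.+1)%N ->
    inner (e i) (e j) = (i == j)%:R.
  by exists (fun i => e i) => i j; exact: eP.
have: (n.+1 <= n.+1)%N by []; move: {1 3 4}n.+1.
elim=> [_|k IH kn]; first by exists (fun _ => 0).
have [e eP] := IH (ltnW kn).
have [x xP] : exists x, forall c : 'I_k -> R[i], x <> \sum_i c i *: e i.
  apply: contrapT => nx; apply: nK; exists (fun i => e i) => x.
  have [c ->] : exists c : 'I_k -> R[i], x = \sum_i c i *: e i.
    by apply: contrapT => nc; apply: nx; exists x => c xc; apply: nc; exists c.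
  (* Coefficients are padded with zeros, since [dim_le n] asks for a family of exactly n vectors. *)
  pose F (i : nat) := oapp c 0 (insub i).
  exists (fun i => F i); transitivity (\sum_(i < k) F i *: e i).
    by apply: eq_bigr => i _; rewrite /F valK.
  rewrite (big_ord_widen _ (fun i => F i *: e i) (kn : (k <= n)%N)) big_mkcond.
  apply: eq_bigr => i _; case: ifP => // ik.
  by rewrite /F insubF // scale0r.
pose v := x - \sum_(i < k) inner x (e i) *: e i.
have v0 : 0 < rnorm v.
  rewrite lt_neqAle rnorm_ge0 andbT eq_sym; apply/eqP => /rnorm0_eq0/eqP.
  by rewrite subr_eq0 => /eqP; exact: xP.
have vN : rnorm ((rnorm v)^-1%:C%C *: v) = 1.
  by rewrite rnormZr ger0_norm ?invr_ge0 ?(ltW v0) // mulVf // gt_eqF.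
have ve i : (i < k)%N -> inner v (e i) = 0.
  move=> ik; rewrite /v innerDl innerNl.
  rewrite (big_morph (fun u => inner u (e i)) (fun a b => innerDl a b (e i)) (inner0l _)).
  rewrite (bigD1 (Ordinal ik)) //= innerZl eP // eqxx mulr1 big1 ?addr0 ?subrr // => j ji.
  rewrite innerZl eP //; have /negPf -> : (j : nat) != i; last by rewrite mulr0.
  by apply: contra ji => /eqP ji; apply/eqP/val_inj.
exists (fun i => if i == k then (rnorm v)^-1%:C%C *: v else e i) => i j.
have lt_k l : l != k -> (l < k.+1)%N -> (l < k)%N by move=> lk; rewrite ltnS ltn_neqAle lk.
have [->|ik] := eqVneq i k; have [->|jk] := eqVneq j k => /= hi hj.
- by rewrite inner_norm normE vN rmorph1 expr1n.
- by rewrite innerZl ve ?lt_k // mulr0.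
- by rewrite innerZr inner_conj ve ?lt_k // conjc0 mulr0 (negPf ik).
- by rewrite eP ?lt_k.
Qed.

End OrthonormalFamily.

(** * A nonzero value of the Capelli polynomial on matrix units *)

Section CapelliUnits.
Variables (R : realType) (K : hilbertType R) (n m : nat) (e : 'I_n.+1 -> K).
Hypothesis e_ortho : forall i j, inner (e i) (e j) = (i == j)%:R.
Variable f : 'I_m.+1 -> 'I_n.+1 * 'I_n.+1.
Hypothesis f_inj : injective f.

(* The staircase: the [y k] are matrix units linking the consecutive [f k], so that among
   all the words of the Capelli polynomial only the one for the identity survives. *)
Definition stair_col k : 'I_n.+1 := if (k <= m)%N then (f (inord k)).1 else ord0.

Definition stair k : 'I_n.+1 * 'I_n.+1 :=
  (if k is k'.+1 then (f (inord k')).2 else ord0, stair_col k).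

Let unit (ij : 'I_n.+1 * 'I_n.+1) : bop K := ket (e ij.1) (e ij.2).

(** A letter matches the separators on both sides only when s fixes its index, because f is
    injective. Hence a word does not kill e_j only if s fixes every index read. *)
Lemma cword_stair (s : 'S_m.+1) k j : (k <= m.+1)%N ->
  cword (fun l => unit (f (s (inord l)))) (fun l => unit (stair l)) k (e j) =
  if (j == stair_col k) && [forall i : 'I_m.+1, (i < k)%N ==> (s i == i)] then e ord0 else 0.
Proof.
elim: k j => [|k IH] j km.
  have -> : cword (fun l => unit (f (s (inord l)))) (fun l => unit (stair l)) 0 (e j) =
      if j == stair_col 0 then e ord0 else 0 by exact: (ket_basis e_ortho).
  have -> : [forall i : 'I_m.+1, (i < 0)%N ==> (s i == i)].
    by apply/forallP.
  by rewrite andbT.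
change ((cword (fun l => unit (f (s (inord l)))) (fun l => unit (stair l)) k *
  unit (f (s (inord k))) * unit (stair k.+1)) (e j) = if (j == stair_col k.+1) &&
  [forall i : 'I_m.+1, (i < k.+1)%N ==> (s i == i)] then e ord0 else 0).
have Qe : unit (stair k.+1) (e j) = if j == stair_col k.+1 then e (f (inord k)).2 else 0.
  exact: (ket_basis e_ortho).
have Pe i : unit (f (s (inord k))) (e i) =
    if i == (f (s (inord k))).2 then e (f (s (inord k))).1 else 0.
  exact: (ket_basis e_ortho).
rewrite !bopME Qe; case: ifP => _; last by rewrite !bop0.
rewrite Pe.
have allS : [forall i : 'I_m.+1, (i < k.+1)%N ==> (s i == i)] =
    (s (inord k) == inord k) && [forall i : 'I_m.+1, (i < k)%N ==> (s i == i)].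
  apply/forallP/andP => [h|[h1 /forallP h2] i].
    split; first by have := h (inord k); rewrite inordK // ltnSn.
    by apply/forallP => i; apply/implyP => ik; have := h i; rewrite (leqW ik).
  apply/implyP; rewrite ltnS leq_eqVlt => /orP[/eqP ik|ik]; last by have := h2 i; rewrite ik.
  by have <- : inord k = i by apply: val_inj; rewrite /= inordK.
have fE : (s (inord k) == inord k) = ((f (inord k)).2 == (f (s (inord k))).2) &&
    ((f (s (inord k))).1 == (f (inord k)).1).
  rewrite -(inj_eq f_inj); case: (f (s (inord k))) => a b; case: (f (inord k)) => c d /=.
  by rewrite xpair_eqE andbC eq_sym.
rewrite allS fE; case: eqP => _ /=; last by rewrite bop0.
by rewrite IH 1?ltnW // {1}/stair_col -ltnS km.
Qed.

Lemma cap_stair : cap (fun i => unit (f i)) (fun l => unit (stair l)) (e ord0) = e ord0.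
Proof.
pose w (s : 'S_m.+1) := cword (fun l => unit (f (s (inord l)))) (fun l => unit (stair l)) m.+1.
have [t tE] : exists t, t = fun s : 'S_m.+1 => ((-1) ^+ s *: w s) (e ord0) by eexists.
transitivity (\sum_s t s); first by rewrite tE; exact: bop_sumE.
have t1 : t 1%g = e ord0.
  rewrite tE bopZE odd_perm1 expr0 scale1r /w cword_stair // {1}/stair_col ltnn eqxx.
  have -> // : [forall i : 'I_m.+1, (i < m.+1)%N ==> ((1%g : 'S_m.+1) i == i)].
  by apply/forallP => i; rewrite perm1 eqxx implybT.
rewrite (bigD1 1%g) //= t1 big1 ?addr0 // => s s1.
rewrite tE bopZE /w cword_stair //; case: ifP => [/andP[_ /forallP si]|_]; last by rewrite scaler0.
case/eqP: s1; apply/permP => i; rewrite perm1; apply/eqP.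
by have := si i; rewrite ltn_ord.
Qed.

End CapelliUnits.

(** * Subhomogeneous algebras *)

Section Subhomogeneous.
Variables (R : realType) (H : hilbertType R).
Implicit Types S T : csubalg (bop H).

(** Since n^2 + 1 <= (n + 1)^2, dimension n + 1 has enough matrix units for all the variables. *)
Lemma pair_injection n : exists f : 'I_(n * n).+1 -> 'I_n.+1 * 'I_n.+1, injective f.
Proof.
have h (i : 'I_(n * n).+1) : (i < size (enum {: 'I_n.+1 * 'I_n.+1}))%N.
  rewrite -cardE card_prod !card_ord; apply: leq_trans (ltn_ord i) _.
  by rewrite mulSn mulnS addSn ltnS addnA leq_addl.
exists (fun i => nth (ord0, ord0) (enum {: 'I_n.+1 * 'I_n.+1}) i) => i j /eqP.
by rewrite nth_uniq ?enum_uniq // => /eqP/val_inj.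
Qed.

(** With exact matrix units the polynomial fixes the unit vector [e ord0]. Contractive approximants
    change this value by at most 1/2, and pi is contractive. *)
Lemma cap_lower_bound S n (K : hilbertType R) (pi : csub_alg S -> bop K) :
  star_hom pi -> irreducible_rep pi -> ~ dim_le n K ->
  exists (x : 'I_(n * n).+1 -> csub_alg S) (y : nat -> csub_alg S),
    [/\ forall i, rnorm (x i) <= 1, forall k, rnorm (y k) <= 1 & 2^-1 <= rnorm (cap x y)].
Proof.
move=> ph pirr /orthonormal_family[e e_ortho]; have [f f_inj] := pair_injection n.
set m := (n * n)%N in f f_inj *; pose c : R := (m.+1)`!%:R * (2 * m.+1%:R + 1).
have c0 : 0 < c by rewrite mulr_gt0 ?ltr0n ?fact_gt0 // ltr_wpDl // mulr_ge0.
(* c counts the letters over all words of the polynomial, so errors of 1 / (2 c) add up to at most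
   1/2. *)
have eps0 : 0 < 2^-1 / c by rewrite divr_gt0 // invr_gt0.
have near ij := matrix_unit_near ph pirr e_ortho ij.1 ij.2 eps0.
have /choice[x xP] := fun i => near (f i).
have /choice[y yP] := fun k => near (stair f k).
exists x, y; split=> [i|k|]; [exact: (xP i).1|exact: (yP k).1|].
have pc (a : csub_alg S) : rnorm a <= 1 -> rnorm (pi a) <= 1.
  by move=> a1; apply: le_trans (star_hom_contractive ph a) a1.
pose unit (ij : 'I_n.+1 * 'I_n.+1) : bop K := ket (e ij.1) (e ij.2).
have e1 : rnorm (e ord0) = 1.
  by apply/eqP; rewrite -sqrp_eq1 ?rnorm_ge0 // -rinnerE /rinner e_ortho eqxx.
have close : rnorm (cap (fun i => pi (x i)) (fun k => pi (y k)) (e ord0) -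
    cap (fun i => unit (f i)) (fun k => unit (stair f k)) (e ord0)) <= 2^-1.
  have -> : 2^-1 = (m.+1)`!%:R * ((2 * m.+1%:R + 1) * (2^-1 / c)).
    by rewrite mulrA -/c mulrCA divff ?mulr1 // gt_eqF.
  rewrite /cap !bop_sumE -sumrB -[in leRHS](card_Sn m.+1) -sum1_card natr_sum mulr_suml.
  elim/big_rec2: _ => [|s u v _ IH]; first by rewrite rnorm0.
  apply: le_trans (rnormD _ _) _; apply: lerD => //; rewrite mul1r !bopZE -scalerBr.
  rewrite rnormZc cabs_sign mul1r.
  apply: (@cword_units R K _ e e_ortho (fun k => pi (x (s (inord k)))) (fun k => pi (y k))
    (fun k => f (s (inord k))) (stair f)) => [k|k|k j|k j].
  - exact: pc (xP _).1.
  - exact: pc (yP _).1.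
  - exact: (xP _).2.
  - exact: (yP _).2.
rewrite (cap_stair e_ortho f_inj) -(cap_hom _ _ ph) in close.
apply: le_trans (star_hom_contractive ph (cap x y)).
have := rnorm_bop_le (pi (cap x y)) (e ord0); rewrite e1 mulr1.
have := rdistD (pi (cap x y) (e ord0)) (e ord0) 0; rewrite !subr0 e1 rdistC.
by move: close (rnorm (pi _)) => close N; lra.
Qed.

Lemma clopen_subhomogeneous n : clopen [set S : csubalg (bop H) | subhomogeneous n (csub_alg S)].
Proof.
pose m := (n * n)%N; pose c : R := (m.+1)`!%:R * (2 * m.+1%:R + 1).
have c0 : 0 < c by rewrite mulr_gt0 ?ltr0n ?fact_gt0 // ltr_wpDl // mulr_ge0.
(* Errors of 1 / (4 c) move the polynomial by at most 1/4, too little to get from 0 to 1/2. *)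
have d0 : 0 < 4^-1 / c by rewrite divr_gt0 // invr_gt0.
apply: (clopen_uniform d0) => S T _ TS /= Sn K pi ph pirr; apply: contrapT => nK.
have [x [y [x1 y1 xy]]] := cap_lower_bound ph pirr nK.
have near (a : csub_alg T) : exists b : csub_alg S, rnorm a <= 1 ->
    rnorm b <= 1 /\ rnorm (csub_val a - csub_val b) <= 4^-1 / c.
  have [b [Sb ab b1]] := TS _ (csub_in a); exists (celt Sb) => a1.
  split; first exact: le_trans b1 a1.
  by apply: le_trans ab _; rewrite ler_piMr // ltW.
have /choice[x' x'P] := fun i => near (x i).
have /choice[y' y'P] := fun k => near (y k).
have := @cap_near R (bop H) m (fun i => csub_val (x i)) (fun i => csub_val (x' i))
  (fun k => csub_val (y k)) (fun k => csub_val (y' k)) (4^-1 / c).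
rewrite -!(cap_hom _ _ (@csub_val_star_hom R H _)) (subhomogeneous_cap x' y' Sn) subr0.
have -> : (m.+1)`!%:R * ((2 * m.+1%:R + 1) * (4^-1 / c)) = 4^-1.
  by rewrite mulrA -/c mulrCA divff ?mulr1 // gt_eqF.
move=> h; have := le_trans xy (h x1 y1 (fun i => (x'P i (x1 i)).1) (fun k => (y'P k (y1 k)).1)
  (fun i => (x'P i (x1 i)).2) (fun k => (y'P k (y1 k)).2)).
by rewrite lef_pV2 ?posrE // ler_nat.
Qed.

End Subhomogeneous.

Theorem corollary5p15p2 (R : realType) (H : hilbertType R) :
  (forall P : cstarType R -> Prop,
     axiomatizable P -> axiomatizable (fun A => ~ P A) ->
     clopen [set S : csubalg (bop H) | P (csub_alg S)]) /\
  clopen [set S : csubalg (bop H) | abelian_alg (csub_alg S)] /\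
  (forall n : nat,
     clopen [set S : csubalg (bop H) | subhomogeneous n (csub_alg S)]) /\
  clopen [set S : csubalg (bop H) | unital_projectionless (csub_alg S)] /\
  (forall n : nat,
     clopen [set S : csubalg (bop H) | contains_unital_matrix n (csub_alg S)]) /\
  clopen [set S : csubalg (bop H) | purely_infinite_simple (csub_alg S)] /\
  clopen [set S : csubalg (bop H) | finite_alg (csub_alg S)] /\
  clopen [set S : csubalg (bop H) | real_rank_zero (csub_alg S)] /\
  clopen [set S : csubalg (bop H) | stable_rank_one (csub_alg S)].
Proof.
split; first exact: clopen_axiomatizable.
split; first exact: clopen_abelian.
split; first exact: clopen_subhomogeneous.
split; first exact: clopen_unital_projectionless.
split; first exact: clopen_contains_matrix.
split; first exact: clopen_purely_infinite.
split; first exact: clopen_finite.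
split; [exact: clopen_real_rank_zero|exact: clopen_stable_rank_one].
Qed.
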